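(* Let $d=r=1$ and assume (A1) together with continuity of $F$ and $G$ on $\mathbb{R}\times\mathcal{P}_1(\mathbb{R})$. Let $(\rho_n,h_n,\varepsilon_n)$ be a sequence of positive numbers tending to $0$, with $N_nh_n=T$ for integers $N_n$, such that $\rho_n=O(h_n)$ and $h_n=o(\varepsilon_n^2)$. For each $n$ let $m^n\in C([0,T];\mathcal{P}_1(\mathbb{R}))$ be a solution of the discrete problem $(MFG)^{\varepsilon_n}_{\rho_n,h_n}$, i.e. $m^{\varepsilon_n}_{\rho_n,h_n}[m^n]=m^n$. Then the sequence $(m^n)$ has at least one limit point in $C([0,T];\mathcal{P}_1(\mathbb{R}))$. Every such limit point $\bar m$ is a solution of the mean field game system (MFG) defined in the context, and, along a subsequence converging to $\bar m$ in $C([0,T];\mathcal{P}_1(\mathbb{R}))$, the densities of $m^n$ converge to (the density of) $\bar m$ weakly-$*$ in $L^\infty(\mathbb{R}\times[0,T])$. In particular, if (MFG) has a unique solution $m$, then $m^n\to m$ in $C([0,T];\mathcal{P}_1(\mathbb{R}))$ and weakly-$*$ in $L^\infty(\mathbb{R}\times[0,T])$.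
   Context: $\mathcal{P}_1(\mathbb{R}^d)$ is the set of Borel probability measures on $\mathbb{R}^d$ with finite first moment, with the 1-Wasserstein distance $d_1(\mu_1,\mu_2)=\inf_\gamma\int|x-y|\,d\gamma(x,y)$ (infimum over couplings $\gamma$ of $\mu_1,\mu_2$); $C([0,T];\mathcal{P}_1)$ carries the uniform distance $\sup_t d_1$. Assumption (A1): (i) $F,G:\mathbb{R}^d\times\mathcal{P}_1(\mathbb{R}^d)\to\mathbb{R}$ are uniformly bounded, and $F(\cdot,m),G(\cdot,m)\in C^2$ with $\sup_m\big(\|F(\cdot,m)\|_{C^2}+\|G(\cdot,m)\|_{C^2}\big)<\infty$, where $\|\phi\|_{C^2}=\sup_{x,|\alpha|\le2}|D^\alpha\phi(x)|$; (ii) $\sigma:[0,T]\to\mathbb{R}^{d\times r}$ has continuous columns $\sigma_1,\dots,\sigma_r$; (iii) $m_0$ is a probability measure on $\mathbb{R}^d$, absolutely continuous with essentially bounded, compactly supported density (also denoted $m_0$). Grid: for $\rho,h>0$ and an integer $N$ with $Nh=T$, set $x_i=i\rho$ ($i\in\mathbb{Z}^d$) and $t_k=kh$. In dimension one, $\beta_i$ is the piecewise affine hat function with $\beta_i(x_j)=\delta_{ij}$ (in general, the barycentric coordinate relative to $x_i$ of a fixed regular triangulation with vertices on the grid), and $I[f](x)=\sum_i f_i\beta_i(x)$ for bounded $f=(f_i)$. Discrete HJB: for $\mu\in C([0,T];\mathcal{P}_1)$, set $v_{i,N}=G(x_i,\mu(T))$ and, for $k=N-1,\dots,0$, $v_{i,k}=\inf_{\alpha\in\mathbb{R}^d}\Big[\frac{1}{2r}\sum_{\ell=1}^r\big(I[v_{\cdot,k+1}](x_i-h\alpha+\sqrt{hr}\sigma_\ell(t_k))+I[v_{\cdot,k+1}](x_i-h\alpha-\sqrt{hr}\sigma_\ell(t_k))\big)+\tfrac12h|\alpha|^2+hF(x_i,\mu(t_k))\Big]$.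 Set $v_{\rho,h}[\mu](x,t)=I[v_{\cdot,[t/h]}](x)$, where $[\cdot]$ is the integer part. Fix $\phi\in C_c^\infty(\mathbb{R}^d)$ with $\phi\ge0$, $\int\phi=1$, let $\phi_\varepsilon(x)=\varepsilon^{-d}\phi(x/\varepsilon)$, and set $v^\varepsilon_{\rho,h}[\mu](\cdot,t)=\phi_\varepsilon*v_{\rho,h}[\mu](\cdot,t)$. Discrete Fokker–Planck: let $E_i=\prod_{j=1}^d[x_i^j-\rho/2,x_i^j+\rho/2]$ and $\Phi^{\varepsilon,\ell,\pm}_{i,k}[\mu]=x_i-hDv^\varepsilon_{\rho,h}[\mu](x_i,t_k)\pm\sqrt{rh}\,\sigma_\ell(t_k)$. Set $m_{i,0}=\int_{E_i}m_0(x)\,dx$ and $m_{i,k+1}[\mu]=\frac{1}{2r}\sum_{j}\sum_{\ell=1}^r\big[\beta_i(\Phi^{\varepsilon,\ell,+}_{j,k}[\mu])+\beta_i(\Phi^{\varepsilon,\ell,-}_{j,k}[\mu])\big]m_{j,k}[\mu]$. Define $m^\varepsilon_{\rho,h}[\mu]\in C([0,T];\mathcal{P}_1)$ by letting $m^\varepsilon_{\rho,h}[\mu](t_k)$ have density $\rho^{-d}\sum_i m_{i,k}[\mu]\mathbb{1}_{E_i}$ and $m^\varepsilon_{\rho,h}[\mu](t)=\frac{t_{k+1}-t}{h}m^\varepsilon_{\rho,h}[\mu](t_k)+\frac{t-t_k}{h}m^\varepsilon_{\rho,h}[\mu](t_{k+1})$ for $t\in[t_k,t_{k+1}]$. The discrete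 problem $(MFG)^\varepsilon_{\rho,h}$ is: find $\mu\in C([0,T];\mathcal{P}_1)$ with $m^\varepsilon_{\rho,h}[\mu]=\mu$. Continuous problem: for $\mu\in C([0,T];\mathcal{P}_1)$, $v[\mu]$ denotes the unique viscosity solution (equivalently, the value function of the associated stochastic control problem) of $-\partial_tv-\frac12\mathrm{tr}(\sigma\sigma^\top D^2v)+\frac12|Dv|^2=F(x,\mu(t))$ on $\mathbb{R}^d\times(0,T)$, $v(x,T)=G(x,\mu(T))$; it is Lipschitz in $x$. A solution of (MFG) (here $d=r=1$) is $\bar m\in C([0,T];\mathcal{P}_1(\mathbb{R}))$ such that for all $\varphi\in C_c^\infty(\mathbb{R})$ and $t\in[0,T]$: $\int\varphi\,d\bar m(t)=\int\varphi\,dm_0+\int_0^t\int_{\mathbb{R}}\big[\tfrac12\sigma(s)^2\varphi''(x)-\varphi'(x)\,\partial_xv[\bar m](x,s)\big]\,d\bar m(s)(x)\,ds$. *)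

(* Defs.v *)
From HB Require Import structures.
From mathcomp Require Import all_boot all_order all_algebra.
From mathcomp Require Import all_classical all_reals all_analysis.
Import Order.TTheory GRing.Theory Num.Theory.
Import numFieldNormedType.Exports.
Set Implicit Arguments. Unset Strict Implicit. Unset Printing Implicit Defensive.
Local Open Scope classical_set_scope.
Local Open Scope ring_scope.

Section Defs.
Context {R : realType}.

Local Notation leb := (@lebesgue_measure R).

Definition P1 (mu : probability R R) : Prop :=
  (\int[mu]_x (`|x|%:E) < +oo)%E.

Definition is_coupling (mu nu : probability R R)
    (g : probability (R * R)%type R) : Prop :=
  (forall A : set R, measurable A -> g (A `*` setT) = mu A) /\
  (forall A : set R, measurable A -> g (setT `*` A) = nu A).

Definition W1 (mu nu : probability R R) : \bar R :=
  ereal_inf [set (\int[g]_z (`|z.1 - z.2|%:E))%E | g in is_coupling mu nu].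

(** mu : [0,T] -> P_1 is an element of C([0,T]; P_1) (values outside
    [0,T] are irrelevant) *)
Definition is_curve (T : R) (mu : R -> probability R R) : Prop :=
  (forall t, 0 <= t <= T -> P1 (mu t)) /\
  (forall t, 0 <= t <= T -> forall e : R, 0 < e ->
     exists2 d : R, 0 < d &
       forall s, 0 <= s <= T -> `|s - t| < d -> (W1 (mu s) (mu t) < e%:E)%E).

Definition curve_cvg (T : R) (mn : nat -> R -> probability R R)
    (mu : R -> probability R R) : Prop :=
  forall e : R, 0 < e ->
    \forall n \near \oo, forall t, 0 <= t <= T ->
      (W1 (mn n t) (mu t) < e%:E)%E.

Definition same_curve (T : R) (mu nu : R -> probability R R) : Prop :=
  forall t, 0 <= t <= T -> forall A : set R, measurable A -> mu t A = nu t A.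

Fixpoint nderiv (n : nat) (f : R -> R) : R -> R :=
  match n with
  | 0 => f
  | n'.+1 => derive1 (nderiv n' f)
  end.

Definition smooth (f : R -> R) : Prop :=
  forall (n : nat) (x : R), derivable (nderiv n f) x 1.

Definition compact_support (f : R -> R) : Prop :=
  exists K : R, forall x, K < `|x| -> f x = 0.

Definition test_fun (f : R -> R) : Prop := smooth f /\ compact_support f.

Definition C2_bounded (f : R -> R) (C : R) : Prop :=
  (forall x, derivable f x 1) /\
  (forall x, derivable (derive1 f) x 1) /\
  continuous (derive1 (derive1 f)) /\
  (forall x, `|f x| <= C /\ `|derive1 f x| <= C /\
             `|derive1 (derive1 f) x| <= C).

Definition cont_RP1 (F : R -> probability R R -> R) : Prop :=
  forall x m, P1 m -> forall e : R, 0 < e ->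
    exists2 d : R, 0 < d &
      forall y m', P1 m' -> `|y - x| < d -> (W1 m' m < d%:E)%E ->
        `|F y m' - F x m| < e.

Definition xnode (rho : R) (i : int) : R := i%:~R * rho.

Definition beta (rho : R) (i : int) (x : R) : R :=
  Num.max 0 (1 - `|x / rho - i%:~R|).

(** I[f](x) = sum_i f_i beta_i(x); only the two indices floor(x/rho) and
    floor(x/rho)+1 can give a nonzero beta_i(x), so the sum reduces to
    these two terms. *)
Definition interp (rho : R) (f : int -> R) (x : R) : R :=
  let j := Num.floor (x / rho) in
  f j * beta rho j x + f (j + 1) * beta rho (j + 1) x.

Definition hjb_step (rho h : R) (sigk : R) (Fk : int -> R) (w : int -> R)
    : int -> R :=
  fun i => inf [set 2^-1 * (interp rho w (xnode rho i - h * a + Num.sqrt h * sigk)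
                           + interp rho w (xnode rho i - h * a - Num.sqrt h * sigk))
                    + 2^-1 * h * a ^+ 2 + h * Fk i | a in [set: R]].

Section Scheme.
Variables (rho h eps : R) (N : nat) (sigma : R -> R)
          (F G : R -> probability R R -> R) (phi : R -> R) (m0 : R -> R)
          (mu : R -> probability R R).

Definition tk (k : nat) : R := k%:R * h.

(** vback j = v_{., N - j} *)
Fixpoint vback (j : nat) : int -> R :=
  match j with
  | 0 => fun i => G (xnode rho i) (mu (tk N))
  | j'.+1 => hjb_step rho h (sigma (tk (N - j'.+1)))
                      (fun i => F (xnode rho i) (mu (tk (N - j'.+1))))
                      (vback j')
  end.

Definition vgrid (k : nat) : int -> R := vback (N - k).

Definition mollifier (x : R) : R := eps^-1 * phi (x / eps).

Definition veps (k : nat) (x : R) : R :=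
  fine (\int[leb]_y ((mollifier (x - y) * interp rho (vgrid k) y)%:E))%E.

Definition Dveps (k : nat) (x : R) : R := derive1 (veps k) x.

Definition Phi_plus (j : int) (k : nat) : R :=
  xnode rho j - h * Dveps k (xnode rho j) + Num.sqrt h * sigma (tk k).
Definition Phi_minus (j : int) (k : nat) : R :=
  xnode rho j - h * Dveps k (xnode rho j) - Num.sqrt h * sigma (tk k).

Definition cell (i : int) : set R :=
  `[xnode rho i - rho / 2, xnode rho i + rho / 2]%classic.

(** m_{i,k}[mu] (nonnegative; the series over j is a sum of nonnegative
    terms, taken in \bar R) *)
Fixpoint mgrid (k : nat) : int -> \bar R :=
  match k with
  | 0 => fun i => (\int[leb]_(x in cell i) (m0 x)%:E)%E
  | k'.+1 => fun i =>
      (\esum_(j in [set: int])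
         ((2^-1 * (beta rho i (Phi_plus j k') + beta rho i (Phi_minus j k')))%:E
            * mgrid k' j))%E
  end.

(** density of m^eps_{rho,h}[mu](t): piecewise constant in x
    (rho^-1 sum_i m_{i,k} 1_{E_i}, the cells being taken half-open, which
    only changes the density on a null set) and affine in t on each
    [t_k, t_{k+1}] *)
Definition mdens (x t : R) : R :=
  let k := `|Num.floor (t / h)|%N in
  let theta := t / h - k%:R in
  let i := Num.floor (x / rho + 2^-1) in
  rho^-1 * ((1 - theta) * fine (mgrid k i) + theta * fine (mgrid k.+1 i)).

End Scheme.

Definition discrete_mfg_solution (T rho h eps : R) (N : nat) (sigma : R -> R)
    (F G : R -> probability R R -> R) (phi m0 : R -> R)
    (mu : R -> probability R R) : Prop :=
  forall t, 0 <= t <= T -> forall A : set R, measurable A ->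
    mu t A = (\int[leb]_(x in A)
                (mdens rho h eps N sigma F G phi m0 mu x t)%:E)%E.

Definition dt (f : R -> R -> R) (x t : R) : R := derive1 (f x) t.
Definition dx (f : R -> R -> R) (x t : R) : R := derive1 (fun y => f y t) x.
Definition dxx (f : R -> R -> R) (x t : R) : R := derive1 (fun y => dx f y t) x.

Definition C21 (f : R -> R -> R) : Prop :=
  (forall x t, derivable (f x) t 1) /\
  (forall x t, derivable (fun y => f y t) x 1) /\
  (forall x t, derivable (fun y => dx f y t) x 1) /\
  continuous (fun z : R * R => f z.1 z.2) /\
  continuous (fun z : R * R => dt f z.1 z.2) /\
  continuous (fun z : R * R => dx f z.1 z.2) /\
  continuous (fun z : R * R => dxx f z.1 z.2).

(** v is a (continuous) viscosity solution of
    -v_t - 1/2 sigma^2 v_xx + 1/2 |v_x|^2 = F(x, m(t)) on R x (0,T),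
    v(x,T) = G(x, m(T)). *)
Definition viscosity_solution (T : R) (sigma : R -> R)
    (F G : R -> probability R R -> R) (m : R -> probability R R)
    (v : R -> R -> R) : Prop :=
  (forall x, v x T = G x (m T)) /\
  (forall x t, 0 <= t <= T -> forall e : R, 0 < e ->
     exists2 d : R, 0 < d & forall y s, 0 <= s <= T ->
       `|y - x| < d -> `|s - t| < d -> `|v y s - v x t| < e) /\
  (forall (p : R -> R -> R) x0 t0, 0 < t0 < T -> C21 p ->
     (exists2 d : R, 0 < d & forall y s, `|y - x0| < d -> `|s - t0| < d ->
        v y s - p y s <= v x0 t0 - p x0 t0) ->
     - dt p x0 t0 - 2^-1 * sigma t0 ^+ 2 * dxx p x0 t0
       + 2^-1 * dx p x0 t0 ^+ 2 <= F x0 (m t0)) /\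
  (forall (p : R -> R -> R) x0 t0, 0 < t0 < T -> C21 p ->
     (exists2 d : R, 0 < d & forall y s, `|y - x0| < d -> `|s - t0| < d ->
        v x0 t0 - p x0 t0 <= v y s - p y s) ->
     F x0 (m t0) <=
     - dt p x0 t0 - 2^-1 * sigma t0 ^+ 2 * dxx p x0 t0
       + 2^-1 * dx p x0 t0 ^+ 2).

(** v = v[m]: the bounded viscosity solution, Lipschitz in x (unique in
    this class by the comparison principle) *)
Definition value_fun (T : R) (sigma : R -> R)
    (F G : R -> probability R R -> R) (m : R -> probability R R)
    (v : R -> R -> R) : Prop :=
  viscosity_solution T sigma F G m v /\
  (exists C : R, forall x t, 0 <= t <= T -> `|v x t| <= C) /\
  (exists L : R, forall x y t, 0 <= t <= T -> `|v x t - v y t| <= L * `|x - y|).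

Definition mfg_solution (T : R) (sigma : R -> R)
    (F G : R -> probability R R -> R) (m0 : R -> R)
    (mbar : R -> probability R R) : Prop :=
  is_curve T mbar /\
  exists v : R -> R -> R, value_fun T sigma F G mbar v /\
    forall p : R -> R, test_fun p -> forall t, 0 <= t <= T ->
      (\int[mbar t]_x (p x)%:E
       = \int[leb]_x (p x * m0 x)%:E
         + \int[leb]_(s in `[0%R, t]%classic)
             \int[mbar s]_x ((2^-1 * sigma s ^+ 2 * nderiv 2 p x
                              - derive1 p x * dx v x s)%:E))%E.

Definition weak_star_cvg (T : R) (fn : nat -> R -> R -> R)
    (mbar : R -> probability R R) : Prop :=
  exists fbar : R -> R -> R,
    measurable_fun setT (fun z : R * R => fbar z.1 z.2) /\
    (exists C : R, forall x t, `|fbar x t| <= C) /\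
    {ae leb, forall t, 0 <= t <= T -> forall A : set R, measurable A ->
       mbar t A = (\int[leb]_(x in A) (fbar x t)%:E)%E} /\
    forall g : R * R -> R,
      (leb \x leb)%E.-integrable (setT `*` `[0%R, T]%classic) (fun z => (g z)%:E) ->
      (fun k => \int[(leb \x leb)%E]_(z in setT `*` `[0%R, T]%classic)
                   ((fn k z.1 z.2 * g z)%:E))%E
      @ \oo --> (\int[(leb \x leb)%E]_(z in setT `*` `[0%R, T]%classic)
                   ((fbar z.1 z.2 * g z)%:E))%E.

End Defs.

(* Main.v *)
Require Import Defs.
From HB Require Import structures.
From mathcomp Require Import all_boot all_order all_algebra.
From mathcomp Require Import all_classical all_reals all_analysis measurable_realfun.
From mathcomp Require Import zify ring lra.
Import Order.TTheory GRing.Theory Num.Theory.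
Import numFieldNormedType.Exports.
Local Open Scope classical_set_scope.
Local Open Scope ring_scope.
Set Implicit Arguments. Unset Strict Implicit. Unset Printing Implicit Defensive.

(** The discrete value functions are bounded, Lipschitz and semiconcave, uniformly
    in the parameters, because the scheme is monotone and commutes with constants
    and grid translations.  Semiconcavity makes the discrete flow
    [x - h Dv(x) +- sqrt h sigma] expand distances between nodes by a factor at
    least [1 - C h], so the discrete densities stay bounded; a second moment bound
    and one-step Taylor expansions then make the distribution functions of the
    [m^n] equicontinuous in [(x, t)] with uniform tails.  Since [W1] is the [L^1]
    distance of distribution functions, Arzela-Ascoli gives limit points, and the
    bounded densities converge weakly-*.

    Along a further subsequence the discrete value functions converge locally
    uniformly to a viscosity solution [v] (monotonicity and consistency of the
    scheme), and by semiconcavity their mollified gradients converge to [dx v] at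
    every point of differentiability, hence almost everywhere.  Products of bounded
    almost everywhere convergent functions with weakly-* convergent densities pass
    to the limit, which turns the discrete Fokker-Planck equation into the
    continuous one. *)

(** * The semi-Lagrangian step for the Hamilton-Jacobi-Bellman equation *)

(** All estimates on the scheme are uniform in the measure argument, so the coupling of the two
    equations enters them only through the constants of [mfg_data]. The delicate term is the product
    of gradient and density: gradients converge only where the limit value function is
    differentiable, densities only weakly. The bound on the densities resolves this, since it makes
    Lebesgue-null sets null for every limit measure. It rests on sums of hats: if the images of
    neighbouring nodes are at least [s rho] apart with [s = 1 - h L], a node receives at most
    [1 + 4 (1 - s)] times the largest previous mass, and [(1 + 4 h L)^k <= exp (4 L T)]. Mollified
    derivatives are compared only at points a whole number of meshes apart, because semiconcavity is
    known only on the grid. Interpolation costs [O(rho^2)] at each of the [T / h] steps; with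
    [rho = O(h)] the total is [O(rho)]. Time regularity comes from the symmetry of the noise: the
    terms of order [sqrt h] cancel, so one step moves the mean of a smooth function by [O(h)]. *)

Lemma intS_ind (P : int -> Prop) (i : int) :
  P i -> (forall j : int, i <= j -> P j -> P (j + 1)) -> forall j : int, i <= j -> P j.
Proof.
move=> Pi IH j ij; have -> : j = i + (`|j - i|%N : int) by rewrite gez0_abs ?subr_ge0// subrKC.
elim: `|j - i|%N => [|n IHn]; first by rewrite addr0.
have -> : i + n.+1%:Z = i + n%:Z + 1 by rewrite -[in LHS]addn1 PoszD addrA.
by apply: IH => //; rewrite lerDl.
Qed.

Section Interpolation.
Context {R : realType}.
Variable rho : R.
Hypothesis rho_gt0 : 0 < rho.

Lemma xnodeD1 i : xnode rho (i + 1) = xnode rho i + rho.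
Proof. by rewrite /xnode intrD mulrDl mul1r. Qed.

Lemma xnodeB1 i : xnode rho (i - 1) = xnode rho i - rho.
Proof. by rewrite /xnode intrB mulrBl mul1r. Qed.

Definition cfrac (x : R) : R := x / rho - (Num.floor (x / rho))%:~R.

Lemma cfrac_itv x : 0 <= cfrac x < 1.
Proof.
have := floor_itv (x / rho); rewrite /cfrac intrD => /andP[]; lra.
Qed.

Lemma cfracE x : x = xnode rho (Num.floor (x / rho)) + cfrac x * rho.
Proof. by rewrite /xnode /cfrac -mulrDl addrC subrK divfK// gt_eqF. Qed.

Lemma interpE (f : int -> R) x : interp rho f x =
  (1 - cfrac x) * f (Num.floor (x / rho)) + cfrac x * f (Num.floor (x / rho) + 1).
Proof.
have := cfrac_itv x; rewrite /interp /beta intrD -/(cfrac x).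
rewrite opprD addrA -/(cfrac x) => /andP[h0 h1].
rewrite ger0_norm// (_ : `|cfrac x - 1| = 1 - cfrac x); last by rewrite distrC ger0_norm// subr_ge0 ltW.
rewrite !max_r; lra.
Qed.

Lemma interp_node (f : int -> R) i : interp rho f (xnode rho i) = f i.
Proof.
have E : Num.floor (xnode rho i / rho) = i.
  by rewrite /xnode mulfK ?gt_eqF// intrKfloor.
have F : cfrac (xnode rho i) = 0 by rewrite /cfrac E /xnode mulfK ?gt_eqF// subrr.
by rewrite interpE F E subr0 mul1r mul0r addr0.
Qed.

(** Only the two nodes of the cell of [x] carry weight, and both lie within [rho] of [x]. The local
    form lets a contact argument compare grid functions near one point only. *)
Lemma interp_le_local (f g : int -> R) x :
  (forall i, `|xnode rho i - x| <= rho -> f i <= g i) -> interp rho f x <= interp rho g x.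
Proof.
move=> fg; rewrite !interpE; have := cfrac_itv x; have := cfracE x.
set j := Num.floor _ => xE /andP[h0 h1].
have hr : 0 <= cfrac x * rho by rewrite mulr_ge0 // ltW.
have hr2 : cfrac x * rho <= rho by rewrite ger_pMl // ltW.
apply: lerD; apply: ler_wpM2l => //; try lra.
  apply: fg; rewrite ler_norml; lra.
by apply: fg; rewrite xnodeD1 ler_norml; lra.
Qed.

Lemma interp_le (f g : int -> R) x :
  (forall i, f i <= g i) -> interp rho f x <= interp rho g x.
Proof. by move=> fg; apply: interp_le_local. Qed.

Lemma interpZD (a b : R) (f g : int -> R) x :
  interp rho (fun i => a * f i + b * g i) x = a * interp rho f x + b * interp rho g x.
Proof. by rewrite !interpE; ring. Qed.

Lemma interp_cst (c : R) x : interp rho (fun=> c) x = c.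
Proof. by rewrite interpE; ring. Qed.

Lemma interpDc (f : int -> R) c x : interp rho (fun i => f i + c) x = interp rho f x + c.
Proof. by rewrite !interpE; ring. Qed.

Lemma interp_xnode x : interp rho (xnode rho) x = x.
Proof. rewrite interpE xnodeD1 {5}(cfracE x); ring. Qed.

(** Interpolation is the mean of a two-point law with barycentre [x]; the excess over [(x - c)^2] is
    the variance [t (1 - t) rho^2] of that law. *)
Lemma interp_sqr (x c : R) :
  (x - c) ^+ 2 <= interp rho (fun i => (xnode rho i - c) ^+ 2) x <= (x - c) ^+ 2 + rho ^+ 2.
Proof.
rewrite interpE xnodeD1; have := cfrac_itv x; have := cfracE x.
set j := Num.floor _; set t := cfrac x; set X := xnode rho j => -> /andP[h0 h1].
have -> : (1 - t) * (X - c) ^+ 2 + t * (X + rho - c) ^+ 2 =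
  (X + t * rho - c) ^+ 2 + t * (1 - t) * rho ^+ 2 by ring.
have : 0 <= t * (1 - t) * rho ^+ 2 by rewrite mulr_ge0 ?sqr_ge0// mulr_ge0// subr_ge0 ltW.
have : t * (1 - t) * rho ^+ 2 <= rho ^+ 2 by rewrite ger_pMl ?exprn_gt0//; nra.
by move=> *; apply/andP; split; lra.
Qed.

Lemma interp_shift (f : int -> R) x :
  interp rho (fun i => f (i + 1)) x = interp rho f (x + rho).
Proof.
have E : Num.floor ((x + rho) / rho) = Num.floor (x / rho) + 1.
  by rewrite mulrDl divff ?gt_eqF// -[1 in LHS]/(1%:~R) floorDrz// intrKfloor.
have F : cfrac (x + rho) = cfrac x.
  rewrite /cfrac E intrD mulrDl divff ?gt_eqF//; ring.
by rewrite !interpE E F.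
Qed.

Lemma nonincr_int (f : int -> R) : (forall i, f (i + 1) <= f i) ->
  forall i j : int, i <= j -> f j <= f i.
Proof.
by move=> fd i; apply: (@intS_ind (fun j => f j <= f i)) => // j _; apply: le_trans.
Qed.

Lemma interp_nonincr (f : int -> R) : (forall i, f (i + 1) <= f i) ->
  forall x y, x <= y -> interp rho f y <= interp rho f x.
Proof.
move=> fd x y xy; have fdd := nonincr_int fd.
have jj : Num.floor (x / rho) <= Num.floor (y / rho).
  by apply: le_floor; rewrite ler_pM2r ?invr_gt0.
rewrite !interpE; have := cfrac_itv x; have := cfrac_itv y.
have := cfracE y; have := cfracE x.
set j := Num.floor _ in jj *; set k := Num.floor _ in jj *.
set s := cfrac x; set t := cfrac y => xE yE /andP[t0 t1] /andP[s0 s1].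
move: jj; rewrite le_eqVlt => /predU1P[jk|jk].
  have : s <= t.
    have : s * rho <= t * rho by move: xy; rewrite xE yE jk lerD2l.
    by rewrite ler_pM2r.
  rewrite -jk; have := fd j; nra.
have := fdd (j + 1) k; rewrite lezD1 => /(_ jk) a1.
have := fd j; have := fd k; nra.
Qed.

(** Subtracting [M] times the identity, which interpolation reproduces exactly, leaves a
    nonincreasing grid function. *)
Lemma interp_onesided (f : int -> R) M : (forall i, f (i + 1) - f i <= M * rho) ->
  forall x y, x <= y -> interp rho f y - interp rho f x <= M * (y - x).
Proof.
move=> fM x y xy.
have : interp rho (fun i => 1 * f i + (- M) * xnode rho i) y <=
       interp rho (fun i => 1 * f i + (- M) * xnode rho i) x.
  apply: interp_nonincr => // i; rewrite xnodeD1; have := fM i; lra.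
by rewrite !interpZD !interp_xnode; lra.
Qed.

Lemma interp_lip (f : int -> R) M : (forall i, `|f (i + 1) - f i| <= M * rho) ->
  forall x y, `|interp rho f y - interp rho f x| <= M * `|y - x|.
Proof.
move=> fM.
have key : forall x y, x <= y -> `|interp rho f y - interp rho f x| <= M * (y - x).
  move=> x y xy; rewrite ler_norml; apply/andP; split.
    have : interp rho (fun i => (-1) * f i + 0 * 0) y - interp rho (fun i => (-1) * f i + 0 * 0) x <= M * (y - x).
      apply: interp_onesided => // i; have := fM i; rewrite ler_norml => /andP[]; lra.
    by rewrite !(interpZD (-1) 0 f (fun=> 0)) interp_cst; lra.
  apply: interp_onesided => // i; have := fM i; rewrite ler_norml => /andP[]; lra.
move=> x y; have [xy|/ltW yx] := leP x y.
  by rewrite (@ger0_norm _ (y - x)) ?subr_ge0// key.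
by rewrite distrC (distrC y) (@ger0_norm _ (x - y)) ?subr_ge0// key.
Qed.

Lemma interp_bnd (f : int -> R) M : (forall i, `|f i| <= M) ->
  forall x, `|interp rho f x| <= M.
Proof.
move=> fM x; rewrite ler_norml -{1}(interp_cst (- M) x) -{2}(interp_cst M x).
by apply/andP; split; apply: interp_le => i; have := fM i; rewrite ler_norml => /andP[].
Qed.

(* The second difference of [f] controls the first difference of
   [f (_ + 1) - f], whose interpolant is [I[f](. + rho) - I[f]]. *)
Lemma interp_semiconcave (f : int -> R) M :
  (forall i, f (i + 1) + f (i - 1) - 2 * f i <= M * rho ^+ 2) ->
  forall x y, x <= y ->
  interp rho f (y + rho) - interp rho f y - (interp rho f (x + rho) - interp rho f x)
     <= M * rho * (y - x).
Proof.
move=> fM x y xy.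
have : interp rho (fun i => 1 * f (i + 1) + (-1) * f i) y -
  interp rho (fun i => 1 * f (i + 1) + (-1) * f i) x <= M * rho * (y - x).
  apply: interp_onesided => // i; have := fM (i + 1); rewrite addrK; lra.
by rewrite !(interpZD 1 (-1) (fun i => f (i + 1)) f) !interp_shift; lra.
Qed.

End Interpolation.

Section HJBStep.
Context {R : realType}.
Variables (rho h : R).
Hypotheses (rho_gt0 : 0 < rho) (h_gt0 : 0 < h).

(** Expectation of the interpolant after one symmetric random walk step of size [sqrt h * s], the
    binomial substitute for a Brownian increment over a time [h]. *)
Definition havg (s : R) (w : int -> R) (x : R) : R :=
  2^-1 * (interp rho w (x + Num.sqrt h * s) + interp rho w (x - Num.sqrt h * s)).

Definition hcost (s : R) (f w : int -> R) (i : int) (a : R) : R :=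
  havg s w (xnode rho i - h * a) + 2^-1 * h * a ^+ 2 + h * f i.

Lemma havg_le s (w w' : int -> R) x : (forall i, w i <= w' i) -> havg s w x <= havg s w' x.
Proof. by move=> ww; rewrite /havg; have := interp_le rho_gt0 (x + Num.sqrt h * s) ww;
  have := interp_le rho_gt0 (x - Num.sqrt h * s) ww; lra. Qed.

Lemma havgZD s a b (v w : int -> R) x :
  havg s (fun i => a * v i + b * w i) x = a * havg s v x + b * havg s w x.
Proof. by rewrite /havg !interpZD//; ring. Qed.

Lemma havgZ s a (w : int -> R) x : havg s (fun i => a * w i) x = a * havg s w x.
Proof.
rewrite -[RHS]addr0 -(mul0r (havg s w x)) -havgZD; congr havg.
by apply/funext => i; rewrite mul0r addr0.
Qed.

Lemma havgDc s (w : int -> R) c x : havg s (fun i => w i + c) x = havg s w x + c.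
Proof. by rewrite /havg !interpDc//; lra. Qed.

Lemma havg_bnd s (w : int -> R) B x : (forall i, `|w i| <= B) -> `|havg s w x| <= B.
Proof.
move=> wB; have := interp_bnd rho_gt0 wB (x + Num.sqrt h * s).
have := interp_bnd rho_gt0 wB (x - Num.sqrt h * s).
rewrite !ler_norml /havg => /andP[? ?] /andP[? ?]; apply/andP; split; lra.
Qed.

Lemma havg_shift s (w : int -> R) x : havg s (fun i => w (i + 1)) x = havg s w (x + rho).
Proof.
rewrite /havg !interp_shift//; congr (_ * (interp _ _ _ + interp _ _ _)); ring.
Qed.

Lemma havg_lip s (w : int -> R) M : (forall i, `|w (i + 1) - w i| <= M * rho) ->
  forall x y, `|havg s w y - havg s w x| <= M * `|y - x|.
Proof.
move=> wM x y.
have := interp_lip rho_gt0 wM (x + Num.sqrt h * s) (y + Num.sqrt h * s).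
have := interp_lip rho_gt0 wM (x - Num.sqrt h * s) (y - Num.sqrt h * s).
have -> : y + Num.sqrt h * s - (x + Num.sqrt h * s) = y - x by ring.
have -> : y - Num.sqrt h * s - (x - Num.sqrt h * s) = y - x by ring.
rewrite !ler_norml /havg => /andP[? ?] /andP[? ?]; apply/andP; split; lra.
Qed.

Lemma hjb_stepE s f w i : hjb_step rho h s f w i = inf [set hcost s f w i a | a in [set: R]].
Proof. by []. Qed.

Section Bounded.
Variables (s : R) (w : int -> R) (B : R).
Hypothesis wB : forall i, `|w i| <= B.

(** The lower bound is what makes [inf] a true infimum over the controls; on a set that is not
    bounded below it would take a default value. *)
Lemma hcost_lb f i a : - B + h * f i <= hcost s f w i a.
Proof.
have := havg_bnd s (xnode rho i - h * a) wB; rewrite /hcost ler_norml => /andP[? _].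
have : 0 <= 2^-1 * h * a ^+ 2 by rewrite mulr_ge0 ?sqr_ge0// mulr_ge0 ?invr_ge0// ltW.
lra.
Qed.

Lemma hjb_le f i a : hjb_step rho h s f w i <= hcost s f w i a.
Proof.
rewrite hjb_stepE; apply: ge_inf; last by exists a.
by exists (- B + h * f i) => _ [b _ <-]; exact: hcost_lb.
Qed.

Lemma hjb_ge f i c : (forall a, c <= hcost s f w i a) -> c <= hjb_step rho h s f w i.
Proof.
move=> H; rewrite hjb_stepE; apply: lb_le_inf; first by exists (hcost s f w i 0), 0.
by move=> _ [a _ <-].
Qed.

Lemma hjb_approx f i e : 0 < e -> exists a, hcost s f w i a < hjb_step rho h s f w i + e.
Proof.
move=> e0; rewrite hjb_stepE.
have [|_ [a _ <-] ?] := @inf_adherent _ [set hcost s f w i a | a in [set: R]] e e0.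
  split; first by exists (hcost s f w i 0), 0.
  by exists (- B + h * f i) => _ [b _ <-]; exact: hcost_lb.
by exists a.
Qed.

Lemma hjb_bnd f C i : (forall i, `|f i| <= C) -> `|hjb_step rho h s f w i| <= B + h * C.
Proof.
move=> fC; have := fC i; rewrite !ler_norml => /andP[f1 f2].
have f1' : h * - C <= h * f i by rewrite ler_pM2l.
have f2' : h * f i <= h * C by rewrite ler_pM2l.
apply/andP; split.
  by apply: hjb_ge => a; have := hcost_lb f i a; lra.
apply: le_trans (hjb_le f i 0) _; rewrite /hcost mulr0 subr0.
have := havg_bnd s (xnode rho i) wB; rewrite ler_norml => /andP[_ ?]; lra.
Qed.

(** A control tried at node [i] is also admissible at node [i + 1], where it leads to the same foot
    point shifted by one mesh. The two costs then differ by an average of one-mesh differences of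
    [w] and [f]. *)
Lemma hjb_shift_le f D E i :
  (forall i, w (i + 1) - w i <= D) -> (forall i, f (i + 1) - f i <= E) ->
  hjb_step rho h s f w (i + 1) - hjb_step rho h s f w i <= D + h * E.
Proof.
move=> wD fE; rewrite lerBlDr -lerBlDl; apply: hjb_ge => a.
have := hjb_le f (i + 1) a; rewrite /hcost xnodeD1 (addrAC _ rho) -havg_shift.
have : havg s (fun i => w (i + 1)) (xnode rho i - h * a) <= havg s (fun i => w i + D) (xnode rho i - h * a).
  by apply: havg_le => j; have := wD j; lra.
rewrite havgDc.
have : h * f (i + 1) <= h * (f i + E) by rewrite ler_pM2l//; have := fE i; lra.
lra.
Qed.

Lemma hjb_shift_ge f D E i :
  (forall i, w i - w (i + 1) <= D) -> (forall i, f i - f (i + 1) <= E) ->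
  hjb_step rho h s f w i - hjb_step rho h s f w (i + 1) <= D + h * E.
Proof.
move=> wD fE; rewrite lerBlDr -lerBlDl; apply: hjb_ge => a.
have := hjb_le f i a; rewrite /hcost xnodeD1 (addrAC _ rho) -havg_shift.
have : havg s (fun i => w i) (xnode rho i - h * a) <= havg s (fun i => w (i + 1) + D) (xnode rho i - h * a).
  by apply: havg_le => j; have := wD j; lra.
rewrite havgDc.
have : h * f i <= h * (f (i + 1) + E) by rewrite ler_pM2l//; have := fE i; lra.
lra.
Qed.

(** Any control at the middle node competes at both neighbours. An infimum therefore preserves upper
    bounds on second differences, whereas lower bounds would need the optimal controls at [i - 1]
    and [i + 1] to be related. *)
Lemma hjb_semiconcave f D E i :
  (forall i, w (i + 1) + w (i - 1) - 2 * w i <= D) ->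
  (forall i, f (i + 1) + f (i - 1) - 2 * f i <= E) ->
  hjb_step rho h s f w (i + 1) + hjb_step rho h s f w (i - 1)
    - 2 * hjb_step rho h s f w i <= D + h * E.
Proof.
move=> wD fE.
suff : 2^-1 * (hjb_step rho h s f w (i + 1) + hjb_step rho h s f w (i - 1) - (D + h * E))
  <= hjb_step rho h s f w i by lra.
apply: hjb_ge => a.
have := hjb_le f (i + 1) a; have := hjb_le f (i - 1) a.
rewrite /hcost xnodeD1 xnodeB1 (addrAC _ rho) (addrAC _ (- rho)) -havg_shift.
set x := xnode rho i - h * a.
have -> : havg s w (x - rho) = havg s (fun i => w (i - 1)) x.
  rewrite -[x in RHS](subrK rho) -havg_shift; congr havg.
  by apply/funext => j; rewrite addrK.
have : havg s (fun i => 1 * w (i + 1) + 1 * w (i - 1)) x <= havg s (fun i => 2 * w i + D) x.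
  by apply: havg_le => j; have := wD j; lra.
rewrite havgZD havgDc havgZ.
have : h * (f (i + 1) + f (i - 1)) <= h * (2 * f i + E) by rewrite ler_pM2l//; have := fE i; lra.
lra.
Qed.

Lemma hjb_le_avg f i : hjb_step rho h s f w i <= havg s w (xnode rho i) + h * f i.
Proof. by apply: le_trans (hjb_le f i 0) _; rewrite /hcost mulr0 subr0; lra. Qed.

Section Lip.
Variable L : R.
Hypothesis wL : forall i, `|w (i + 1) - w i| <= L * rho.

Lemma L_ge0 : 0 <= L.
Proof. by have := le_trans (normr_ge0 _) (wL 0); rewrite pmulr_lge0. Qed.

Lemma havg_lip_ge i a : havg s w (xnode rho i) - L * h * `|a| <= havg s w (xnode rho i - h * a).
Proof.
have := havg_lip s wL (xnode rho i - h * a) (xnode rho i).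
rewrite opprB subrKC normrM gtr0_norm// ler_norml => /andP[_]; lra.
Qed.

(** Moving by [h a] gains at most [L h |a|], and the running cost [h a^2 / 2] compensates this up to
    [h L^2]. *)
Lemma hjb_ge_avg f i : havg s w (xnode rho i) - h * (L ^+ 2) + h * f i <= hjb_step rho h s f w i.
Proof.
apply: hjb_ge => a; rewrite /hcost; have := havg_lip_ge i a.
have : 0 <= h * (2^-1 * (`|a| - L) ^+ 2 + 2^-1 * L ^+ 2).
  apply: mulr_ge0; first exact: ltW.
  by apply: addr_ge0; apply: mulr_ge0; rewrite ?sqr_ge0.
rewrite -[a ^+ 2]real_normK ?num_real//; lra.
Qed.

(** Beyond [2 L] the cost [a^2 / 2] exceeds the possible gain [L |a|], so the control [0] does at
    least as well. Bounded near-optimal controls keep the foot points close to the node in the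
    supersolution test. *)
Lemma hjb_approx_bnd f i e : 0 < e ->
  exists2 a, `|a| <= 2 * L & hcost s f w i a < hjb_step rho h s f w i + e.
Proof.
move=> e0; have [a ha] := hjb_approx f i e0.
have [|aL] := leP `|a| (2 * L); first by exists a.
exists 0; first by rewrite normr0 mulr_ge0// L_ge0.
apply: le_lt_trans ha; rewrite /hcost mulr0 subr0; have := havg_lip_ge i a.
have : 0 <= h * (2^-1 * `|a| * (`|a| - 2 * L)).
  apply: mulr_ge0; first exact: ltW.
  by apply: mulr_ge0; [rewrite mulr_ge0|rewrite subr_ge0 ltW].
rewrite -[a ^+ 2]real_normK ?num_real//; lra.
Qed.

End Lip.
End Bounded.
End HJBStep.

(** * Iteration of the step: bounds uniform in the mesh and in the measure *)

Section HJBIter.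
Context {R : realType}.
Variables (rho h : R) (N : nat) (T : R) (s : nat -> R) (f : nat -> int -> R) (w : nat -> int -> R) (C : R).
Hypotheses (rho_gt0 : 0 < rho) (h_gt0 : 0 < h) (NhT : N%:R * h = T).
Hypothesis wS : forall k, (k < N)%N -> w k = hjb_step rho h (s k) (f k) (w k.+1).
Hypothesis fB : forall k, (k < N)%N -> forall i, `|f k i| <= C.
Hypothesis fL : forall k, (k < N)%N -> forall i, `|f k (i + 1) - f k i| <= C * rho.
Hypothesis fD : forall k, (k < N)%N -> forall i, f k (i + 1) + f k (i - 1) - 2 * f k i <= C * rho ^+ 2.
Hypothesis wB : forall i, `|w N i| <= C.
Hypothesis wL : forall i, `|w N (i + 1) - w N i| <= C * rho.
Hypothesis wD : forall i, w N (i + 1) + w N (i - 1) - 2 * w N i <= C * rho ^+ 2.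

Let ind (P : nat -> Prop) : P N -> (forall k, (k < N)%N -> P k.+1 -> P k) ->
  forall k, (k <= N)%N -> P k.
Proof.
move=> PN IH k kN; rewrite -(subKn kN); elim: (N - k)%N (leq_subr k N) => [|j IHj] jN.
  by rewrite subn0.
apply: IH; first by rewrite ltn_subrL/= (leq_trans _ jN).
by rewrite -subSn// subSS; apply: IHj; exact: ltnW.
Qed.

Lemma C_ge0 : 0 <= C. Proof. exact: le_trans (wB 0). Qed.

Let stepE (k : nat) : (k < N)%N -> ((N - k)%:R = (N - k.+1)%:R + 1 :> R)%R.
Proof. by move=> kN; rewrite natr1 -subSn. Qed.

Let le_final X Y k : 0 <= X -> (k <= N)%N -> Y <= X * (1 + (N - k)%:R * h) -> Y <= X * (1 + T).
Proof.
move=> X0 kN /le_trans; apply; rewrite ler_wpM2l// lerD2l -NhT ler_pM2r// ler_nat.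
exact: leq_subr.
Qed.

(** Each backward step adds [h C], the contribution of the running cost; hence a growth linear in
    the remaining time [(N - k) h], which is at most [T]. The Lipschitz and semiconcavity bounds
    below accumulate in the same way. *)
Lemma hjb_iter_bnd0 k : (k <= N)%N -> forall i, `|w k i| <= C * (1 + (N - k)%:R * h).
Proof.
move: k; apply: ind => [i|k kN IH i]; first by rewrite subnn mul0r addr0 mulr1.
have := hjb_bnd rho_gt0 h_gt0 (s k) IH i (fB kN); rewrite -wS// (stepE kN); lra.
Qed.

Lemma hjb_iter_bnd k : (k <= N)%N -> forall i, `|w k i| <= C * (1 + T).
Proof. by move=> kN i; apply: le_final (hjb_iter_bnd0 kN i) => //; exact: C_ge0. Qed.

Lemma hjb_iter_lip0 k : (k <= N)%N -> forall i, `|w k (i + 1) - w k i| <= C * rho * (1 + (N - k)%:R * h).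
Proof.
move: k; apply: ind => [i|k kN IH i]; first by rewrite subnn mul0r addr0 mulr1.
have wb := hjb_iter_bnd kN.
rewrite ler_norml wS// (stepE kN); apply/andP; split.
  have := @hjb_shift_ge _ rho h rho_gt0 h_gt0 (s k) _ _ wb (f k) (C * rho * (1 + (N - k.+1)%:R * h)) (C * rho) i.
  move=> H; have {}H := H _ _; suff : hjb_step rho h (s k) (f k) (w k.+1) i -
     hjb_step rho h (s k) (f k) (w k.+1) (i + 1) <=
     C * rho * (1 + (N - k.+1)%:R * h) + h * (C * rho) by lra.
  by apply: H => j; [have := IH j|have := fL kN j]; rewrite ler_norml => /andP[]; lra.
suff : hjb_step rho h (s k) (f k) (w k.+1) (i + 1) - hjb_step rho h (s k) (f k) (w k.+1) i <=
     C * rho * (1 + (N - k.+1)%:R * h) + h * (C * rho) by lra.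
by apply: (hjb_shift_le rho_gt0 h_gt0 (s k) wb) => j;
  [have := IH j|have := fL kN j]; rewrite ler_norml => /andP[]; lra.
Qed.

Lemma hjb_iter_lip k : (k <= N)%N -> forall i, `|w k (i + 1) - w k i| <= C * (1 + T) * rho.
Proof.
move=> kN i; rewrite mulrAC; apply: le_final (hjb_iter_lip0 kN i) => //.
by rewrite mulr_ge0 ?C_ge0// ltW.
Qed.

Lemma hjb_iter_semiconcave0 k : (k <= N)%N ->
  forall i, w k (i + 1) + w k (i - 1) - 2 * w k i <= C * rho ^+ 2 * (1 + (N - k)%:R * h).
Proof.
move: k; apply: ind => [i|k kN IH i]; first by rewrite subnn mul0r addr0 mulr1.
have wb := hjb_iter_bnd kN.
rewrite wS// (stepE kN).
have := hjb_semiconcave rho_gt0 h_gt0 (s k) wb i IH (fD kN); lra.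
Qed.

Lemma hjb_iter_semiconcave k : (k <= N)%N ->
  forall i, w k (i + 1) + w k (i - 1) - 2 * w k i <= C * (1 + T) * rho ^+ 2.
Proof.
move=> kN i; rewrite mulrAC; apply: le_final (hjb_iter_semiconcave0 kN i) => //.
by rewrite mulr_ge0 ?C_ge0// exprn_ge0// ltW.
Qed.

Lemma hjb_iter_avg k : (k < N)%N -> forall i,
  `|w k i - havg rho h (s k) (w k.+1) (xnode rho i)| <= h * (C + (C * (1 + T)) ^+ 2).
Proof.
move=> kN i; have wb := hjb_iter_bnd kN; have wl := hjb_iter_lip kN.
have := hjb_le_avg rho_gt0 h_gt0 (s k) wb (f k) i.
have := hjb_ge_avg rho_gt0 h_gt0 (s k) wl (f k) i.
rewrite -wS// => H1 H2; have := fB kN i; rewrite ler_norml => /andP[f1 f2].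
have f1' : h * - C <= h * f k i by rewrite ler_pM2l.
have f2' : h * f k i <= h * C by rewrite ler_pM2l.
have : 0 <= h * (C * (1 + T)) ^+ 2 by rewrite mulr_ge0 ?sqr_ge0// ltW.
by rewrite ler_norml => ?; apply/andP; split; lra.
Qed.

(* A Lipschitz function lies below its value at a node plus a parabola
   [A (x - x_i)^2 + L^2 / (4 A)]; the averages [havg] raise that parabola by
   at most [A (h S^2 + rho^2)] per step. *)
Lemma hjb_iter_time (S A : R) (K : R) : (forall k, (k < N)%N -> `|s k| <= S) -> 0 < A ->
  K = C + (C * (1 + T)) ^+ 2 ->
  forall k m, (k <= m)%N -> (m <= N)%N -> forall i,
  `|w k i - w m i| <= (C * (1 + T)) ^+ 2 / A + (m - k)%:R * (h * K + A * (h * S ^+ 2 + rho ^+ 2)).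
Proof.
move=> sS A0 KE k m km mN i0; set L := C * (1 + T); set E := h * K + _.
have hs0 x : (Num.sqrt h * x) ^+ 2 = h * x ^+ 2 by rewrite exprMn sqr_sqrtr// ltW.
have avq k' : (k' < N)%N -> forall i c, havg rho h (s k') (fun j => A * (xnode rho j - xnode rho i0) ^+ 2 + c) (xnode rho i)
    <= A * (xnode rho i - xnode rho i0) ^+ 2 + A * (h * S ^+ 2 + rho ^+ 2) + c.
  move=> k'N i c; rewrite havgDc// lerD2r -mulrDr.
  rewrite havgZ// ler_pM2l// /havg.
  have /andP[_] := interp_sqr rho_gt0 (xnode rho i + Num.sqrt h * s k') (xnode rho i0).
  have /andP[_] := interp_sqr rho_gt0 (xnode rho i - Num.sqrt h * s k') (xnode rho i0).
  set y := xnode rho i - xnode rho i0.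
  have -> : xnode rho i + Num.sqrt h * s k' - xnode rho i0 = y + Num.sqrt h * s k' by rewrite /y; ring.
  have -> : xnode rho i - Num.sqrt h * s k' - xnode rho i0 = y - Num.sqrt h * s k' by rewrite /y; ring.
  have := hs0 (s k').
  have : h * s k' ^+ 2 <= h * S ^+ 2.
    by rewrite ler_pM2l// -[s k' ^+ 2]real_normK ?num_real// lerXn2r ?nnegrE// ?sS// (le_trans _ (sS _ k'N)).
  lra.
have L0 : 0 <= L by apply: mulr_ge0; [exact: C_ge0|rewrite -NhT addr_ge0// mulr_ge0// ltW].
have lipw j : `|w m j - w m i0| <= L * `|xnode rho j - xnode rho i0|.
  have := interp_lip rho_gt0 (hjb_iter_lip mN) (xnode rho i0) (xnode rho j).
  by rewrite !interp_node.
(* Completing the square gives [2 L |y| <= A y^2 + L^2 / A], which is stronger than needed: the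
   constant is not optimised. *)
have par j : `|w m j - w m i0| <= A * (xnode rho j - xnode rho i0) ^+ 2 + L ^+ 2 / A.
  apply: le_trans (lipw j) _; set y := xnode rho j - _.
  have : 0 <= A * (`|y| - L / A) ^+ 2 by rewrite mulr_ge0 ?sqr_ge0 ?ltW.
  rewrite -[y ^+ 2]real_normK ?num_real//.
  have -> : A * (`|y| - L / A) ^+ 2 = A * `|y| ^+ 2 - 2 * L * `|y| + L ^+ 2 / A by field; rewrite gt_eqF.
  have : 0 <= L * `|y| by rewrite mulr_ge0.
  lra.
(* The bound is propagated backward from level [m] with the vertex of the parabola fixed at the node
   [i0]. It is evaluated at that node only at the end, where the parabola vanishes. *)
have claim : forall d, (d <= m - k)%N -> forall j, `|w (m - d)%N j - w m i0| <=
    A * (xnode rho j - xnode rho i0) ^+ 2 + (L ^+ 2 / A + d%:R * E).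
  elim=> [_ j|d IH dm j]; first by rewrite subn0 mul0r addr0.
  have kN : (m - d.+1 < N)%N by lia.
  have dS : (m - d)%N = (m - d.+1).+1 by lia.
  have {}IH := IH (ltnW dm); rewrite dS in IH.
  set k' := (m - d.+1)%N in kN IH *.
  have := hjb_iter_avg kN j; rewrite -KE.
  have := avq k' kN j (L ^+ 2 / A + d%:R * E + w m i0).
  have : havg rho h (s k') (w k'.+1) (xnode rho j) <=
    havg rho h (s k') (fun j => A * (xnode rho j - xnode rho i0) ^+ 2 + (L ^+ 2 / A + d%:R * E + w m i0)) (xnode rho j).
    by apply: havg_le => // l; have := IH l; rewrite ler_norml => /andP[]; lra.
  have := avq k' kN j (L ^+ 2 / A + d%:R * E - w m i0).
  have : havg rho h (s k') (fun j => (-1) * w k'.+1 j) (xnode rho j) <=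
    havg rho h (s k') (fun j => A * (xnode rho j - xnode rho i0) ^+ 2 + (L ^+ 2 / A + d%:R * E - w m i0)) (xnode rho j).
    by apply: havg_le => // l; have := IH l; rewrite ler_norml => /andP[]; lra.
  rewrite havgZ//.
  rewrite -natr1 !ler_norml (mulrDl d%:R) mul1r => ? ? ? ? /andP[? ?].
  by apply/andP; split; rewrite {2}/E; lra.
have := claim (m - k)%N (leqnn _) i0; rewrite subKn// subrr expr0n/= mulr0 add0r.
by [].
Qed.

End HJBIter.

(** * Mean value and Taylor estimates *)

Section Calculus.
Context {R : realType}.
Implicit Types (f p : R -> R).

Lemma derivable_cont f x : derivable f x 1 -> {for x, continuous f}.
Proof. by move=> /derivable1_diffP; exact: differentiable_continuous. Qed.

(** No order between [a] and [b] is imposed. The intermediate point is located only by its distance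
    to [a], which is all that the Taylor bounds use. *)
Lemma mean_value f a b : (forall x, derivable f x 1) ->
  exists2 c, `|c - a| <= `|b - a| & f b - f a = (derive1 f) c * (b - a).
Proof.
move=> df.
have key : forall a b, a <= b -> exists2 c, c \in `[a, b] & f b - f a = (derive1 f) c * (b - a).
  move=> {a b} a b ab; apply: MVT_segment => //.
    by move=> x _; apply: DeriveDef => //; rewrite derive1E.
  apply: continuous_subspaceT => x; exact: derivable_cont.
have [ab|/ltW ba] := leP a b.
  have [c + ->] := key _ _ ab; rewrite in_itv/= => /andP[ac cb]; exists c => //.
  by rewrite !ger0_norm ?subr_ge0// lerD2r.
have [c + E] := key _ _ ba; rewrite in_itv/= => /andP[bc ca]; exists c.
  by rewrite !ler0_norm ?subr_le0// lerN2 lerD2r.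
by rewrite -opprB E; ring.
Qed.

Lemma derive_le_lip f C : (forall x, derivable f x 1) -> (forall x, `|(derive1 f) x| <= C) ->
  forall x y, `|f y - f x| <= C * `|y - x|.
Proof.
move=> df fC x y; have [c _ ->] := mean_value x y df.
by rewrite normrM ler_wpM2r.
Qed.

(** Mean value theorem for [f], then for its derivative; this yields [C] in place of the sharp
    [C / 2]. *)
Lemma taylor2 f C : (forall x, derivable f x 1) -> (forall x, derivable (derive1 f) x 1) ->
  (forall x, `|(derive1 (derive1 f)) x| <= C) ->
  forall a b, `|f b - f a - (derive1 f) a * (b - a)| <= C * (b - a) ^+ 2.
Proof.
move=> df d2f fC a b; have [c ca ->] := mean_value a b df.
rewrite -mulrBl normrM -[(b - a) ^+ 2]real_normK ?num_real// expr2 mulrA ler_wpM2r//.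
apply: le_trans (derive_le_lip d2f fC a c) _; apply: ler_wpM2l => //.
exact: le_trans (fC 0).
Qed.

Lemma taylor3 f C : (forall x, derivable f x 1) -> (forall x, derivable (derive1 f) x 1) ->
  (forall x, derivable (derive1 (derive1 f)) x 1) ->
  (forall x, `|(derive1 (derive1 (derive1 f))) x| <= C) ->
  forall a b, `|f b - f a - (derive1 f) a * (b - a) - 2^-1 * (derive1 (derive1 f)) a * (b - a) ^+ 2| <= C * `|b - a| ^+ 3.
Proof.
move=> df d2f d3f fC a b.
pose g x := f x - (derive1 f) a * (x - a) - 2^-1 * (derive1 (derive1 f)) a * (x - a) ^+ 2.
have dg (x : R) : is_derive x 1 g ((derive1 f) x - (derive1 f) a - (derive1 (derive1 f)) a * (x - a)).
  have := df x => /derivableP dfx.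
  apply: is_derive_eq; by rewrite -derive1E /GRing.scale/=; field.
have [c ca E] := @mean_value g a b (fun x => @ex_derive _ _ _ _ _ _ _ (dg x)).
have -> : f b - f a - (derive1 f) a * (b - a) - 2^-1 * (derive1 (derive1 f)) a * (b - a) ^+ 2 = g b - g a.
  by rewrite /g; ring.
rewrite E derive1E (@derive_val _ _ _ _ _ _ _ (dg c)) normrM exprSr mulrA ler_wpM2r//.
apply: le_trans (taylor2 d2f d3f fC a c) _; apply: ler_wpM2l; first exact: le_trans (fC 0).
by rewrite -[(c - a) ^+ 2]real_normK ?num_real// lerXn2r ?nnegrE.
Qed.

Lemma second_diff_le f C r : (forall x, derivable f x 1) -> (forall x, derivable (derive1 f) x 1) ->
  (forall x, `|(derive1 (derive1 f)) x| <= C) -> forall x, f (x + r) + f (x - r) - 2 * f x <= 2 * C * r ^+ 2.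
Proof.
move=> df d2f fC x.
have := taylor2 df d2f fC x (x + r); have := taylor2 df d2f fC x (x - r).
have -> : x + r - x = r by ring. have -> : x - r - x = - r by ring.
rewrite sqrrN !ler_norml => /andP[_ ?] /andP[_ ?]; lra.
Qed.

Lemma derivable_quot f x (s : nat -> R) : derivable f x 1 ->
  (forall n, s n != 0) -> s @ \oo --> 0 ->
  (f (x + s n) - f x) / s n @[n --> \oo] --> (derive1 f) x.
Proof.
move=> df s0 sc.
have : (fun h => h^-1 *: (f (h + x) - f x)) @ 0^' --> (derive1 f) x.
  move: df; rewrite /derivable /derive1.
  by under eq_fun do rewrite [_%:A]mulr1.
move=> /cvgr_dnbhsP /(_ s (conj s0 sc)); apply: cvg_trans; apply: near_eq_cvg.
by apply: nearW => n; rewrite /GRing.scale/= mulrC (addrC x).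
Qed.

Lemma nderiv_support p K n : (forall x, K < `|x| -> p x = 0) ->
  forall x, K < `|x| -> nderiv n p x = 0.
Proof.
move=> pK; elim: n => //= n IH x Kx.
rewrite derive1E (@near_eq_derive _ _ _ _ (cst 0)) ?derive_cst ?oner_neq0//.
have : \forall y \near x, K < `|y|.
  have cn : {for x, continuous (fun y : R => `|y|)} by exact: norm_continuous.
  exact: cvgr_gt cn _ Kx.
by apply: filterS => y /IH.
Qed.

Lemma cont_support_bounded f K : continuous f -> (forall x, K < `|x| -> f x = 0) ->
  exists C, forall x, `|f x| <= C.
Proof.
move=> cf fK.
have [M [_ HM]] : bounded_set (f @` `[- K, K]).
  by apply: compact_bounded; apply: continuous_compact; [exact: continuous_subspaceT|exact: segment_compact].
exists (Num.max (M + 1) 0) => x; have [Kx|xK] := ltP K `|x|.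
  by rewrite fK// normr0 le_max lexx orbT.
rewrite le_max HM ?ltrDl//; exists x => //=.
by rewrite in_itv/= -ler_norml.
Qed.

Lemma test_fun_bounded p n : test_fun p -> exists C, forall x, `|nderiv n p x| <= C.
Proof.
move=> [sp [K pK]]; apply: (@cont_support_bounded _ K).
  by move=> x; apply: derivable_cont; exact: sp.
exact: nderiv_support.
Qed.

Lemma cvg_ub (u : nat -> R) (l c : R) : u @ \oo --> l -> (\forall n \near \oo, u n <= c) -> l <= c.
Proof.
move=> ul uc; have := cvg_lim (@Rhausdorff R) ul => <-.
by apply: limr_le => //; apply/cvg_ex; exists l.
Qed.

Lemma cvg_lb (u : nat -> R) (l c : R) : u @ \oo --> l -> (\forall n \near \oo, c <= u n) -> c <= l.
Proof.
move=> ul uc; have := cvg_lim (@Rhausdorff R) ul => <-.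
by apply: limr_ge => //; apply/cvg_ex; exists l.
Qed.

End Calculus.

(** * Mollified derivatives of grid functions *)

Section InterpSlopes.
Context {R : realType}.
Variable rho : R.
Hypothesis rho_gt0 : 0 < rho.

Lemma interp_cell (f : int -> R) j (t : R) : 0 <= t <= 1 ->
  interp rho f (xnode rho j + t * rho) = (1 - t) * f j + t * f (j + 1).
Proof.
move=> /andP[t0]; rewrite le_eqVlt => /predU1P[->|t1].
  by rewrite mul1r -xnodeD1 interp_node//; ring.
have E : (xnode rho j + t * rho) / rho = j%:~R + t.
  by rewrite /xnode -mulrDl mulfK// gt_eqF.
have F : Num.floor ((xnode rho j + t * rho) / rho) = j.
  by apply: floor_def; rewrite E intrD; apply/andP; split; lra.
by rewrite interpE F /cfrac F E (addrC _ t) addrK.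
Qed.

Variables (f : int -> R) (M : R).
Hypothesis M0 : 0 <= M.
Hypothesis fM : forall i, f (i + 1) + f (i - 1) - 2 * f i <= M * rho ^+ 2.

Lemma interp_slope_right z (s : R) : 0 <= s <= rho ->
  s * (interp rho f (z + rho) - interp rho f z) <=
  rho * (interp rho f (z + s) - interp rho f z) + M * rho ^+ 2 * s.
Proof.
move=> /andP[s0 sr]; rewrite (cfracE rho_gt0 z); have /andP[t0 t1'] := cfrac_itv rho z.
have {t1'} t1 := ltW t1'.
set j := Num.floor _; set t := cfrac rho z in t0 t1 *.
pose u := s / rho; have sE : s = u * rho by rewrite /u divfK// gt_eqF.
have u0 : 0 <= u by rewrite /u divr_ge0// ltW.
have u1 : u <= 1 by rewrite /u ler_pdivrMr// mul1r.
have := fM (j + 1); rewrite addrK => c; have r0 := ltW rho_gt0.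
have Mr0 : 0 <= M * rho ^+ 2 by rewrite mulr_ge0// sqr_ge0.
have -> : xnode rho j + t * rho + rho = xnode rho (j + 1) + t * rho by rewrite xnodeD1; ring.
rewrite !interp_cell ?t0//.
have [tu|tu] := leP (t + u) 1.
  have -> : xnode rho j + t * rho + s = xnode rho j + (t + u) * rho by rewrite sE; ring.
  rewrite interp_cell; last by apply/andP; split; [exact: addr_ge0|].
  rewrite sE.
  have : 0 <= u * rho * t * (M * rho ^+ 2 - (f (j + 1 + 1) + f j - 2 * f (j + 1))).
    by repeat first [done | apply: mulr_ge0]; rewrite subr_ge0.
  have : 0 <= u * rho * (1 - t) * (M * rho ^+ 2).
    by repeat first [done | apply: mulr_ge0]; rewrite subr_ge0.
  lra.
have -> : xnode rho j + t * rho + s = xnode rho (j + 1) + (t + u - 1) * rho by rewrite sE xnodeD1; ring.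
rewrite interp_cell ?sE; last by lra.
have : 0 <= rho * (1 - t) * (1 - u) * (M * rho ^+ 2 - (f (j + 1 + 1) + f j - 2 * f (j + 1))).
  by repeat first [done | apply: mulr_ge0]; rewrite subr_ge0.
have : 0 <= rho * (u - (1 - t)) * (M * rho ^+ 2).
  by repeat first [done | apply: mulr_ge0]; lra.
have : 0 <= rho * (1 - t) * u * (M * rho ^+ 2).
  by repeat first [done | apply: mulr_ge0]; rewrite subr_ge0.
lra.
Qed.

Lemma interp_slope_left z (s : R) : 0 <= s <= rho ->
  rho * (interp rho f z - interp rho f (z - s)) <=
  s * (interp rho f z - interp rho f (z - rho)) + M * rho ^+ 2 * s.
Proof.
move=> /andP[s0 sr]; rewrite (cfracE rho_gt0 z); have /andP[t0 t1'] := cfrac_itv rho z.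
have {t1'} t1 := ltW t1'.
set j := Num.floor _; set t := cfrac rho z in t0 t1 *.
pose u := s / rho; have sE : s = u * rho by rewrite /u divfK// gt_eqF.
have u0 : 0 <= u by rewrite /u divr_ge0// ltW.
have u1 : u <= 1 by rewrite /u ler_pdivrMr// mul1r.
have := fM j => c; have r0 := ltW rho_gt0.
have Mr0 : 0 <= M * rho ^+ 2 by rewrite mulr_ge0// sqr_ge0.
have -> : xnode rho j + t * rho - rho = xnode rho (j - 1) + t * rho by rewrite xnodeB1; ring.
rewrite !interp_cell ?t0// subrK.
have [tu|tu] := leP u t.
  have -> : xnode rho j + t * rho - s = xnode rho j + (t - u) * rho by rewrite sE; ring.
  rewrite interp_cell; last by lra.
  rewrite sE.
  have : 0 <= u * rho * (1 - t) * (M * rho ^+ 2 - (f (j + 1) + f (j - 1) - 2 * f j)).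
    by repeat first [done | apply: mulr_ge0]; rewrite subr_ge0.
  have : 0 <= u * rho * t * (M * rho ^+ 2).
    by repeat first [done | apply: mulr_ge0].
  lra.
have -> : xnode rho j + t * rho - s = xnode rho (j - 1) + (1 + t - u) * rho by rewrite sE xnodeB1; ring.
rewrite interp_cell ?sE; last by lra.
rewrite subrK.
have : 0 <= rho * t * (1 - u) * (M * rho ^+ 2 - (f (j + 1) + f (j - 1) - 2 * f j)).
  by repeat first [done | apply: mulr_ge0]; rewrite subr_ge0.
have : 0 <= rho * (u - t) * (M * rho ^+ 2).
  by repeat first [done | apply: mulr_ge0]; lra.
have : 0 <= rho * t * u * (M * rho ^+ 2).
  by repeat first [done | apply: mulr_ge0]; rewrite subr_ge0.
lra.
Qed.

End InterpSlopes.

Section Mollifier.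
Context {R : realType}.
Local Notation leb := (@lebesgue_measure R).
Variables (phi : R -> R) (K eps : R).
Hypotheses (sphi : smooth phi) (phiK : forall x, K < `|x| -> phi x = 0).
Hypotheses (phi_ge0 : forall x, 0 <= phi x) (phi1 : (\int[leb]_x (phi x)%:E = 1)%E).
Hypotheses (K0 : 0 < K) (eps_gt0 : 0 < eps).

Local Notation B := `[- K, K]%classic.

Lemma integral_support (f : R -> R) (a b : R) :
  (forall x, ~~ (a <= x <= b) -> f x = 0) ->
  (\int[leb]_x (f x)%:E = \int[leb]_(x in `[a, b]) (f x)%:E)%E.
Proof.
move=> fab; rewrite [RHS]integral_mkcond; apply: eq_integral => x _.
rewrite patchE; case: ifPn => //; rewrite notin_setE/= in_itv/= => /negP xab.
by rewrite fab.
Qed.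

Lemma phi_cont : continuous phi.
Proof. by move=> x; apply: derivable_cont; exact: (@sphi 0%N x). Qed.

(** Average against the unscaled kernel. After the substitution [y = x - eps u] the mollification is
    an average of translates of [I] over a fixed compact interval, so inequalities between
    increments of [I] pass to it pointwise in [u]. *)
Definition pavg (g : R -> R) : R := (\int[leb]_(u in B) (phi u * g u))%R.

Lemma itv_cont_integrable (f : R -> R) (a b : R) : continuous f -> leb.-integrable `[a, b] (EFin \o f).
Proof.
move=> cf; apply: continuous_compact_integrable; first exact: segment_compact.
exact: continuous_subspaceT.
Qed.

Lemma pavg_integrable g : continuous g -> leb.-integrable B (EFin \o (fun u => phi u * g u)).
Proof.
move=> cg; apply: itv_cont_integrable => x; apply: cvgM; [exact: phi_cont|exact: cg].
Qed.

Lemma pavg_cst (c : R) : pavg (fun=> c) = c.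
Proof.
rewrite /pavg.
have H : leb.-integrable B (EFin \o phi) by apply: itv_cont_integrable; exact: phi_cont.
rewrite RintegralZr//.
rewrite /Rintegral -integral_support ?phi1 ?mul1r// => x; rewrite -ler_norml -ltNge; exact: phiK.
Qed.

Lemma pavg_le g1 g2 : continuous g1 -> continuous g2 -> (forall u, `|u| <= K -> g1 u <= g2 u) ->
  pavg g1 <= pavg g2.
Proof.
move=> c1 c2 g12; apply: le_Rintegral => //; try exact: pavg_integrable.
by move=> u; rewrite /= in_itv/= -ler_norml => uK; rewrite ler_wpM2l// g12.
Qed.

Lemma pavgB (g1 g2 : R -> R) : continuous g1 -> continuous g2 ->
  pavg (fun u => g1 u - g2 u) = pavg g1 - pavg g2.
Proof.
move=> c1 c2; rewrite /pavg -RintegralB//; try exact: pavg_integrable.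
by apply: eq_Rintegral => u _; rewrite mulrBr.
Qed.

Lemma pavgZ c (g : R -> R) : continuous g -> pavg (fun u => c * g u) = c * pavg g.
Proof.
move=> cg; rewrite /pavg -RintegralZl//; last exact: pavg_integrable.
by apply: eq_Rintegral => u _; rewrite mulrCA.
Qed.

Lemma pavg_le_cst (c : R) (g : R -> R) : continuous g -> (forall u, `|u| <= K -> g u <= c) -> pavg g <= c.
Proof.
move=> cg gc; rewrite -(pavg_cst c); apply: pavg_le => // u; exact: cvg_cst.
Qed.

Lemma pavg_ge_cst (c : R) (g : R -> R) : continuous g -> (forall u, `|u| <= K -> c <= g u) -> c <= pavg g.
Proof.
move=> cg gc; rewrite -(pavg_cst c); apply: pavg_le => // u; exact: cvg_cst.
Qed.

Lemma pavg_lin_le (a b c : R) (g1 g2 : R -> R) : continuous g1 -> continuous g2 ->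
  (forall u, `|u| <= K -> a * g1 u - b * g2 u <= c) -> a * pavg g1 - b * pavg g2 <= c.
Proof.
move=> k1 k2 gc.
have k1' : continuous (fun u => a * g1 u) by move=> u; apply: cvgM; [exact: cvg_cst|exact: k1].
have k2' : continuous (fun u => b * g2 u) by move=> u; apply: cvgM; [exact: cvg_cst|exact: k2].
rewrite -!pavgZ// -pavgB//; apply: pavg_le_cst => // u; apply: cvgB; [exact: k1'|exact: k2'].
Qed.

Variable I : R -> R.
Hypothesis cI : continuous I.

Definition mollify (x : R) : R :=
  fine (\int[leb]_y ((mollifier eps phi (x - y) * I y)%:E))%E.

Lemma mollifier_cont x : continuous (fun y => mollifier eps phi (x - y) * I y).
Proof.
move=> y; apply: cvgM; last exact: cI.
rewrite /mollifier; apply: cvgM; first exact: cvg_cst.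
apply: (@cvg_comp _ _ _ (fun y => (x - y) / eps) phi); last exact: phi_cont.
by apply: cvgM; [apply: cvgB; [exact: cvg_cst|exact: cvg_id]|exact: cvg_cst].
Qed.

Lemma mollifier_supp x y : ~~ (x - K * eps <= y <= x + K * eps) -> mollifier eps phi (x - y) = 0.
Proof.
move=> H; rewrite /mollifier phiK ?mulr0// normrM (@gtr0_norm _ eps^-1) ?invr_gt0//.
rewrite ltr_pdivlMr// ltNge; apply: contra H.
by rewrite ler_norml => /andP[? ?]; apply/andP; split; lra.
Qed.

Lemma mollifyE x : mollify x = pavg (fun u => I (x - eps * u)).
Proof.
rewrite /mollify /pavg /Rintegral; congr fine.
rewrite (@integral_support _ (x - K * eps) (x + K * eps)); last first.
  by move=> y H; rewrite mollifier_supp// mul0r.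
pose F u := x - eps * u.
have dF (u : R) : is_derive u 1 F (- eps).
  by rewrite /F; apply: is_derive_eq; rewrite /GRing.scale/=; ring.
have F' : derive1 F = cst (- eps).
  by apply/funext => u; rewrite derive1E derive_val.
have cF : continuous F.
  by move=> u; apply: derivable_cont; exact: (@ex_derive _ _ _ _ _ _ _ (dF u)).
have -> : x - K * eps = F K by rewrite /F mulrC.
have -> : x + K * eps = F (- K) by rewrite /F; ring.
rewrite (@integration_by_substitution_decreasing _ F).
- apply: eq_integral => u _; congr EFin; rewrite F' /mollifier.
  have E : (x - F u) / eps = u by rewrite /F opprB subrKC mulrC mulKf// gt_eqF.
  rewrite [LHS](_ : _ = eps^-1 * phi ((x - F u) / eps) * I (F u) * - (- eps))//.
  by rewrite E /F; field; rewrite gt_eqF.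
- by apply: (@le_trans _ _ 0); rewrite ?oppr_le0 ltW.
- by move=> u v _ _ uv; rewrite /F ltrD2l ltrN2 ltr_pM2l.
- by rewrite F' => u _; exact: cvg_cst.
- by rewrite F'; exact: is_cvg_cst.
- by rewrite F'; exact: is_cvg_cst.
- split.
  + by move=> u _; exact: (@ex_derive _ _ _ _ _ _ _ (dF u)).
  + by apply: cvg_at_right_filter; exact: cF.
  + by apply: cvg_at_left_filter; exact: cF.
- by apply: continuous_subspaceT; exact: mollifier_cont.
Qed.

Lemma mollify_derivable x : derivable mollify x 1.
Proof.
(* One interval that contains the supports of all kernels centred within distance [1] of [x]:
   differentiation under the integral sign needs a domain that does not move. The derivative falls
   on the kernel, since [I] is only continuous. *)
pose a := x - 1 - K * eps; pose b := x + 1 + K * eps.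
have cM y : continuous (fun x => mollifier eps phi (x - y) * I y).
  move=> z; apply: cvgM; last exact: cvg_cst.
  rewrite /mollifier; apply: cvgM; first exact: cvg_cst.
  apply: (@cvg_comp _ _ _ (fun x => (x - y) / eps) phi); last exact: phi_cont.
  by apply: cvgM; [apply: cvgB; [exact: cvg_id|exact: cvg_cst]|exact: cvg_cst].
have [C HC] : exists C, forall x, `|derive1 phi x| <= C.
  by apply: (@test_fun_bounded _ phi 1); split => //; exists K.
have dM (y z : R) : is_derive z 1 (fun x => mollifier eps phi (x - y) * I y)
    (eps^-1 * (derive1 phi ((z - y) / eps) * eps^-1) * I y).
  have d1 : is_derive ((z - y) / eps) 1 phi (derive1 phi ((z - y) / eps)).
    by apply: DeriveDef; [exact: (@sphi 0%N ((z - y) / eps))|rewrite derive1E].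
  have d2 : is_derive z 1 (fun z => (z - y) / eps) eps^-1.
    by apply: is_derive_eq; rewrite /GRing.scale/=; ring.
  have d3 := @is_derive1_comp R phi (fun z => (z - y) / eps) z _ _ d1 d2.
  rewrite /mollifier.
  rewrite (_ : (fun x => _) = (fun x => (eps^-1 * I y) * (phi \o (fun z => (z - y) / eps)) x)); last first.
    by apply/funext => t /=; ring.
  apply: is_derive_eq; rewrite /GRing.scale/=; ring.
have near1 : \forall z \near x, `|z - x| < 1.
  apply: filterS (near_ball x _ ltr01) => z; by rewrite /ball/= distrC.
suff : derivable (fun x => (\int[leb]_(y in `[a, b]) (mollifier eps phi (x - y) * I y))%R) x 1.
  apply: near_eq_derivable; apply: filterS near1 => z; rewrite ltr_norml => /andP[z1 z2].
  rewrite /mollify /Rintegral; congr fine; rewrite -integral_support// => y yab.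
  rewrite mollifier_supp ?mul0r//; apply: contra yab => /andP[? ?].
  by rewrite /a /b; apply/andP; split; lra.
have [CI HI] : exists C, forall y, y \in `[a, b] -> `|I y| <= C.
  have [M [_ HM]] : bounded_set (I @` `[a, b]).
    by apply: compact_bounded; apply: continuous_compact; [exact: continuous_subspaceT|exact: segment_compact].
  by exists (M + 1) => y yab; apply: HM; rewrite ?ltrDl//; exists y.
have C0 : 0 <= C by exact: le_trans (HC 0).
have CI0 : 0 <= CI.
  apply: le_trans (normr_ge0 _) (HI x _); rewrite in_itv/= /a /b.
  have : 0 < K * eps by rewrite mulr_gt0. by move=> ?; apply/andP; split; lra.
apply: (@derivable_under_integral _ _ _ leb (fun x y => mollifier eps phi (x - y) * I y) _ _ x (x - 1) (x + 1) _ _ _ (fun=> eps^-1 * (C * eps^-1) * CI)).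
- exact: measurable_itv.
- by rewrite /= in_itv/=; apply/andP; split; lra.
- by move=> z _; apply: itv_cont_integrable; exact: mollifier_cont.
- by move=> z y _ _; exact: (@ex_derive _ _ _ _ _ _ _ (dM y z)).
- by move=> y; rewrite !mulr_ge0// invr_ge0 ltW.
- by apply: itv_cont_integrable => z; exact: cvg_cst.
- move=> z y _ yab; rewrite partial1of2E (@derive_val _ _ _ _ _ _ _ (dM y z)).
  rewrite !normrM !(@gtr0_norm _ eps^-1) ?invr_gt0//.
  apply: ler_pM; rewrite ?mulr_ge0 ?invr_ge0 ?(ltW eps_gt0)//; last exact: HI.
  by rewrite ler_pM2l ?invr_gt0// ler_pM2r ?invr_gt0.
Qed.

Section Slopes.
Variables (rho : R) (w : int -> R) (L M : R).
Hypotheses (rho_gt0 : 0 < rho) (M0 : 0 <= M).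
Hypothesis IE : I = interp rho w.
Hypothesis wL : forall i, `|w (i + 1) - w i| <= L * rho.
Hypothesis wM : forall i, w (i + 1) + w (i - 1) - 2 * w i <= M * rho ^+ 2.

Let c1 (x : R) : continuous (fun u => I (x - eps * u)).
Proof.
move=> u; apply: (@cvg_comp _ _ _ (fun u => x - eps * u) I); last exact: cI.
by apply: cvgB; [exact: cvg_cst|apply: cvgM; [exact: cvg_cst|exact: cvg_id]].
Qed.

Let c2 (x y : R) : continuous (fun u => I (x - eps * u) - I (y - eps * u)).
Proof. by move=> u; apply: cvgB; exact: c1. Qed.

Let c3 (a x y : R) : continuous (fun u => a * (I (x - eps * u) - I (y - eps * u))).
Proof. by move=> u; apply: cvgM; [exact: cvg_cst|exact: c2]. Qed.

Let cc (a : R) : continuous (fun u : R => a).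
Proof. by move=> u; exact: cvg_cst. Qed.

Lemma mollifyB x y : mollify x - mollify y = pavg (fun u => I (x - eps * u) - I (y - eps * u)).
Proof. by rewrite !mollifyE pavgB. Qed.

Lemma mollify_dist x : `|mollify x - I x| <= L * (K * eps).
Proof.
have L0 : 0 <= L by have := le_trans (normr_ge0 _) (wL 0); rewrite pmulr_lge0.
have b u : `|u| <= K -> `|I (x - eps * u) - I x| <= L * (K * eps).
  move=> uK; rewrite IE; apply: le_trans (interp_lip rho_gt0 wL _ _) _.
  have -> : x - eps * u - x = - (eps * u) by ring.
  rewrite ler_wpM2l// normrN normrM gtr0_norm// mulrC ler_pM2r//.
rewrite mollifyE ler_norml; apply/andP; split.
  rewrite lerBrDr; apply: pavg_ge_cst => // u /b; rewrite ler_norml => /andP[]; lra.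
rewrite lerBlDr; apply: pavg_le_cst => // u /b; rewrite ler_norml => /andP[]; lra.
Qed.

(** Increments that tend to [0] without exceeding [rho], the range in which secants of the
    interpolant have been compared. *)
Let s n : R := rho / n.+1%:R.

Let s_gt0 n : 0 < s n. Proof. by rewrite divr_gt0. Qed.

Let s_neq0 n : s n != 0. Proof. by rewrite gt_eqF. Qed.

Let s_le n : s n <= rho.
Proof. by rewrite /s ler_pdivrMr// ler_peMr ?ler1n// ltW. Qed.

Let s_cvg : s @ \oo --> 0.
Proof. by rewrite -(mulr0 rho); apply: cvgM; [exact: cvg_cst|exact: cvg_harmonic]. Qed.

Let Ds_cvg : (fun n => - s n) @ \oo --> 0.
Proof. by rewrite -oppr0; apply: cvgN; exact: s_cvg. Qed.

Let quot x := derivable_quot (@mollify_derivable x) s_neq0 s_cvg.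

Let quotN x : (mollify x - mollify (x - s n)) / s n @[n --> \oo] --> derive1 mollify x.
Proof.
have : forall n, - s n != 0 by move=> n; rewrite oppr_eq0.
move=> /(derivable_quot (@mollify_derivable x))/(_ Ds_cvg).
apply: cvg_trans; apply: near_eq_cvg; apply: nearW => n.
by rewrite invrN mulrN -mulNr opprB.
Qed.

Lemma mollify_deriv_bnd x : `|derive1 mollify x| <= L.
Proof.
have L0 : 0 <= L by have := le_trans (normr_ge0 _) (wL 0); rewrite pmulr_lge0.
have b n u : `|I (x + s n - eps * u) - I (x - eps * u)| <= L * s n.
  rewrite IE; apply: le_trans (interp_lip rho_gt0 wL _ _) _.
  by have -> : x + s n - eps * u - (x - eps * u) = s n; [ring|rewrite gtr0_norm].
rewrite ler_norml; apply/andP; split.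
  apply: (cvg_lb (@quot x)); apply: nearW => n; rewrite /= ler_pdivlMr// mulNr mollifyB.
  by apply: pavg_ge_cst => // u _; have := b n u; rewrite ler_norml => /andP[].
apply: (cvg_ub (@quot x)); apply: nearW => n; rewrite /= ler_pdivrMr// mollifyB.
by apply: pavg_le_cst => // u _; have := b n u; rewrite ler_norml => /andP[].
Qed.

(** This is what makes the map [x - h Dv(x)] almost expansive on the nodes. The difference quotients
    at [x + rho] and [x] are compared through the increments of [I (. + rho) - I], which discrete
    semiconcavity controls. *)
Lemma mollify_deriv_shift x : derive1 mollify (x + rho) - derive1 mollify x <= M * rho.
Proof.
have q := cvgB (@quot (x + rho)) (@quot x).
apply: (cvg_ub (q _)); apply: nearW => n; rewrite /= !fctE -mulrBl ler_pdivrMr// !mollifyB -pavgB//.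
apply: pavg_le_cst; first by move=> u; apply: cvgB; exact: c2.
move=> u _; have := interp_semiconcave rho_gt0 wM (x := x - eps * u) (y := x + s n - eps * u).
rewrite -IE => /(_ _); have -> : x + s n - eps * u - (x - eps * u) = s n by ring.
have -> : x + s n - eps * u + rho = x + rho + s n - eps * u by ring.
have -> : x - eps * u + rho = x + rho - eps * u by ring.
suff xx : x - eps * u <= x + s n - eps * u by move=> /(_ xx); lra.
by rewrite lerD2r lerDl ltW.
Qed.

Lemma mollify_slope_right x :
  mollify (x + rho) - mollify x <= rho * derive1 mollify x + M * rho ^+ 2.
Proof.
have q := cvgM (@cvg_cst _ rho _ \oo _) (@quot x).
rewrite -lerBlDr.
apply: (cvg_lb (q _ _)); apply: nearW => n; rewrite /= ?fctE (mulrA rho) ler_pdivlMr//.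
rewrite mulrBl lerBlDr mulrC -lerBlDl !mollifyB.
apply: pavg_lin_le => //.
move=> u _; have := @interp_slope_right _ rho rho_gt0 w M M0 wM (x - eps * u) (s n).
rewrite s_le ltW//= -IE => /(_ isT).
have -> : x - eps * u + rho = x + rho - eps * u by ring.
have -> : x - eps * u + s n = x + s n - eps * u by ring.
lra.
Qed.

Lemma mollify_slope_left x :
  rho * derive1 mollify x - M * rho ^+ 2 <= mollify x - mollify (x - rho).
Proof.
have q := cvgM (@cvg_cst _ rho _ \oo _) (@quotN x).
rewrite lerBlDr.
apply: (cvg_ub (q _ _)); apply: nearW => n; rewrite /= ?fctE (mulrA rho) ler_pdivrMr//.
rewrite mulrDl (mulrC _ (s n)) -lerBlDl !mollifyB.
apply: pavg_lin_le => //.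
move=> u _; have := @interp_slope_left _ rho rho_gt0 w M M0 wM (x - eps * u) (s n).
rewrite s_le ltW//= -IE => /(_ isT).
have -> : x - eps * u - rho = x - rho - eps * u by ring.
have -> : x - eps * u - s n = x - s n - eps * u by ring.
lra.
Qed.

Lemma mollify_deriv_shiftn x m : derive1 mollify (x + m%:R * rho) - derive1 mollify x <= M * (m%:R * rho).
Proof.
elim: m => [|m IH]; first by rewrite !mul0r addr0 subrr mulr0.
have := mollify_deriv_shift (x + m%:R * rho); rewrite -natr1 (mulrDl m%:R) mul1r addrA.
by move: IH; set D1 := derive1 _ x; set D2 := derive1 _ _; set D3 := derive1 _ _; lra.
Qed.

(** Telescoping of [m] one-mesh bounds: the derivative at [x + l rho] exceeds the one at [x] by at
    most [M l rho], and the sum of these excesses is within [M (m rho)^2]. The last term pays for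
    replacing the mollification by [I] at both ends. *)
Lemma mollify_secant_right x m :
  I (x + m%:R * rho) - I x <= m%:R * rho * derive1 mollify x + M * (m%:R * rho) ^+ 2 + 2 * L * (K * eps).
Proof.
suff : mollify (x + m%:R * rho) - mollify x <= m%:R * rho * derive1 mollify x + M * (m%:R * rho) ^+ 2.
  have := mollify_dist (x + m%:R * rho); have := mollify_dist x.
  set A := mollify _; set B1 := mollify _; set A2 := I _; set B2 := I _; set D := derive1 _ _.
  rewrite !ler_norml => /andP[? ?] /andP[? ?]; lra.
elim: m => [|m IH]; first by rewrite !mul0r addr0 subrr expr0n/= mulr0 addr0.
have := mollify_slope_right (x + m%:R * rho); have := mollify_deriv_shiftn x m.
rewrite -natr1 (mulrDl m%:R) mul1r addrA; set D := derive1 _ _ => D1.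
have : rho * D <= rho * (derive1 mollify x + M * (m%:R * rho)) by rewrite ler_pM2l//; lra.
have : 0 <= M * (m%:R * rho ^+ 2) by rewrite mulr_ge0// mulr_ge0// sqr_ge0.
move: IH; set D1' := derive1 _ _; set A := mollify _; set A2 := mollify _; set A3 := mollify _; lra.
Qed.

Lemma mollify_secant_left x m :
  m%:R * rho * derive1 mollify x - M * (m%:R * rho) ^+ 2 - 2 * L * (K * eps) <= I x - I (x - m%:R * rho).
Proof.
suff : m%:R * rho * derive1 mollify x - M * (m%:R * rho) ^+ 2 <= mollify x - mollify (x - m%:R * rho).
  have := mollify_dist (x - m%:R * rho); have := mollify_dist x.
  set A := mollify _; set B1 := mollify _; set A2 := I _; set B2 := I _; set D := derive1 _ _.
  rewrite !ler_norml => /andP[? ?] /andP[? ?]; lra.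
elim: m => [|m IH]; first by rewrite !mul0r subr0 subrr expr0n/= mulr0 subrr.
have := mollify_slope_left (x - m%:R * rho); have := mollify_deriv_shiftn (x - m%:R * rho) m.
rewrite subrK -natr1 (mulrDl m%:R) mul1r opprD addrA; set D := derive1 _ (_ - _) => D1.
have : rho * (derive1 mollify x - M * (m%:R * rho)) <= rho * D by rewrite ler_pM2l//; lra.
have : 0 <= M * (m%:R * rho ^+ 2) by rewrite mulr_ge0// mulr_ge0// sqr_ge0.
move: IH; set D1' := derive1 _ _; set A := mollify _; set A2 := mollify _; set A3 := mollify _; lra.
Qed.

End Slopes.
End Mollifier.

Lemma interp_continuous (R : realType) (rho : R) (w : int -> R) L : 0 < rho ->
  (forall i, `|w (i + 1) - w i| <= L * rho) -> continuous (interp rho w).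
Proof.
move=> r0 wL x; apply/cvgrPdist_lt => e e0.
have L0 : 0 <= L by have := le_trans (normr_ge0 _) (wL 0); rewrite pmulr_lge0.
have d0 : 0 < e / (L + 1) by rewrite divr_gt0// ltr_wpDl.
apply: filterS (near_ball x _ d0) => y; rewrite /ball/= => xy.
apply: le_lt_trans (interp_lip r0 wL _ _) _.
have : (L + 1) * `|x - y| < e by rewrite mulrC -ltr_pdivlMr// ltr_wpDl.
by have := normr_ge0 (x - y); lra.
Qed.

(** * Distribution functions and the Wasserstein distance *)

Section DensityIntegral.
Context {R : realType}.
Local Notation leb := (@lebesgue_measure R).
Variables (mu : probability R R) (f : R -> R).
Hypotheses (mf : measurable_fun setT f) (f0 : forall x, 0 <= f x).
Hypothesis muE : forall A : set R, measurable A -> mu A = (\int[leb]_(x in A) (f x)%:E)%E.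

Import HBNNSimple.
Local Open Scope ereal_scope.

Let density_nnsfun (g : {nnsfun R >-> R}) :
  \int[mu]_x (g x)%:E = \int[leb]_x ((g x)%:E * (f x)%:E).
Proof.
have mfE : measurable_fun [set: R] (fun x => (f x)%:E) by exact/measurable_EFinP.
under [LHS]eq_integral do rewrite fimfunE -fsumEFin//.
rewrite [LHS]ge0_integral_fsum//; last 2 first.
  - by move=> r; exact/measurable_EFinP/measurableT_comp.
  - by move=> n x _; rewrite EFinM nnfun_muleindic_ge0.
under [RHS]eq_integral.
  move=> x xD; rewrite fimfunE -fsumEFin// muleC ge0_mule_fsumr; last first.
    by move=> r; rewrite EFinM nnfun_muleindic_ge0.
  over.
rewrite [RHS]ge0_integral_fsum//; last 2 first.
  - move=> r; apply: emeasurable_funM => //.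
    apply/measurable_EFinP; apply: measurable_funM => //.
    exact: (measurable_indic (measurable_funPTI g (measurable_set1 r))).
  - move=> n x _; rewrite EFinM mule_ge0//; first by rewrite lee_fin.
    by rewrite nnfun_muleindic_ge0.
apply: eq_fsbigr => r _; rewrite integralZl_indic_nnsfun//= integral_indic// setIT.
transitivity (r%:E * \int[leb]_(x in g @^-1` [set r]) (f x)%:E).
  by congr (_ * _); exact: muE.
rewrite [in LHS]integral_mkcond.
have [r0|r0] := ltP r 0%R.
  rewrite (_ : g @^-1` [set r] = set0); last first.
    by apply/seteqP; split => x //= gxr; move: r0; rewrite -gxr ltNge fun_ge0.
  rewrite patch_set0 integral0 mule0 integral0_eq// => x _.
  by rewrite indicE in_set0 mulr0 mule0.
have mr : measurable_fun [set: R] ((fun x => (f x)%:E) \_ (g @^-1` [set r])).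
  apply: (iffLR (measurable_restrictT _ _)); last exact: measurable_funTS.
  exact: measurable_funPTI.
rewrite -ge0_integralZl//; last first.
  by move=> x _; apply: erestrict_ge0 => y _; rewrite lee_fin.
apply: eq_integral => x _; rewrite patchE indicE; case: ifPn => _.
  by rewrite mulr1 muleC.
by rewrite mulr0 !mule0.
Qed.

(** The hypothesis on sets is the case of indicators; simple functions and monotone convergence give
    the rest. [discrete_mfg_solution] provides the density in exactly this set form. *)
Lemma ge0_integral_density (g : R -> \bar R) : measurable_fun [set: R] g -> (forall x, 0 <= g x) ->
  \int[mu]_x g x = \int[leb]_x (g x * (f x)%:E).
Proof.
move=> mg g0; have mfE : measurable_fun [set: R] (fun x => (f x)%:E) by exact/measurable_EFinP.
pose g_ := nnsfun_approx measurableT mg.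
have mgf n : measurable_fun setT (fun x => (g_ n x)%:E * (f x)%:E).
  by apply: emeasurable_funM => //; exact/measurable_EFinP/measurable_funTS.
transitivity (lim (\int[mu]_x (g_ n x)%:E @[n --> \oo])).
  rewrite -monotone_convergence//=.
  - apply: eq_integral => ? /[!inE] xD; apply/esym/cvg_lim => //=.
    exact: cvg_nnsfun_approx.
  - by move=> n; exact/measurable_EFinP/measurable_funTS.
  - by move=> n ? _; rewrite lee_fin.
  - by move=> ? _ ? ? mn; rewrite lee_fin; exact/lefP/nd_nnsfun_approx.
transitivity (lim (\int[leb]_x ((g_ n x)%:E * (f x)%:E) @[n --> \oo])).
  by apply: congr_lim; apply/funext => n; exact: density_nnsfun.
rewrite -monotone_convergence//=.
- apply: eq_integral => x _; apply/cvg_lim => //=; rewrite muleC.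
  under eq_fun do rewrite muleC; apply: cvgeZl => //.
  exact: cvg_nnsfun_approx.
- by move=> n x _; rewrite mule_ge0// lee_fin.
- move=> x _ a b ab; apply: lee_wpmul2r; rewrite lee_fin//.
  by have /lefP/(_ x) := nd_nnsfun_approx measurableT mg ab.
Qed.

End DensityIntegral.

(** * Distribution functions on the line *)

Section CDF.
Context {R : realType}.
Local Notation leb := (@lebesgue_measure R).

Definition cdfR (mu : probability R R) (x : R) : R := fine (mu `]-oo, x]%classic).

Lemma cdfRE (mu : probability R R) x : mu `]-oo, x]%classic = (cdfR mu x)%:E.
Proof. by rewrite /cdfR fineK// fin_num_measure. Qed.

Lemma cdfR_ge0 mu x : 0 <= cdfR mu x. Proof. by rewrite fine_ge0. Qed.

Lemma cdfR_le1 mu x : cdfR mu x <= 1.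
Proof. by rewrite -lee_fin -cdfRE probability_le1. Qed.

Lemma cdfR_nd mu : {homo cdfR mu : x y / x <= y}.
Proof.
move=> x y xy; rewrite -lee_fin -!cdfRE le_measure ?inE//.
by apply: subset_itvl; rewrite bnd_simp.
Qed.

(** [mu] is the law of the identity seen as a random variable, which gives access to the limits and
    the right continuity of its distribution function. *)
Let idTR : R -> R := idfun.
#[local] HB.instance Definition _ :=
  @isMeasurableFun.Build _ _ _ _ idTR (@measurable_id _ _ setT).

Lemma cdfR_rc mu : right_continuous (cdfR mu).
Proof.
move=> x; apply: fine_cvg; rewrite -cdfRE.
exact: (@cdf_right_continuous _ _ _ mu (idTR : {RV mu >-> R}) x).
Qed.

Lemma cdfRy mu : cdfR mu @ +oo --> (1 : R).
Proof. exact/fine_cvg/(@cvg_cdfy1 _ _ _ mu (idTR : {RV mu >-> R})). Qed.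

Lemma cdfRNy mu : cdfR mu @ -oo --> (0 : R).
Proof. exact/fine_cvg/(@cvg_cdfNy0 _ _ _ mu (idTR : {RV mu >-> R})). Qed.

Lemma measurable_cdfR mu : measurable_fun setT (cdfR mu).
Proof. by apply: nondecreasing_measurable => // x y; exact: cdfR_nd. Qed.

Section of_cdf.
Variable F : R -> R.
Hypotheses (Fnd : {homo F : x y / x <= y}) (Frc : right_continuous F).
Hypotheses (Fy : F @ +oo --> (1 : R)) (FNy : F @ -oo --> (0 : R)).

Let FF := F.
#[local] HB.instance Definition _ := isCumulative.Build R _ R FF Fnd Frc.
#[local] HB.instance Definition _ := isCumulativeBounded.Build R 0 1 FF FNy Fy.

(* The library puts Stieltjes measures on [measurableTypeR R], an alias of
   [R] carrying another measure display. *)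
Let lsR (A : set R) : \bar R := lebesgue_stieltjes_measure FF A.

Let lsR0 : lsR set0 = 0%E. Proof. exact: measure0. Qed.
Let lsR_ge0 A : (0 <= lsR A)%E. Proof. exact: measure_ge0. Qed.
Let lsR_additive : semi_sigma_additive lsR.
Proof. exact: (@measure_semi_sigma_additive _ _ _ (lebesgue_stieltjes_measure FF)). Qed.
#[local] HB.instance Definition _ := isMeasure.Build _ R R lsR lsR0 lsR_ge0 lsR_additive.
Let lsR1 : lsR setT = 1%E.
Proof. exact: (@probability_setT _ _ _ (lebesgue_stieltjes_measure (FF : cumulativeBounded (0:R) (1:R)))). Qed.
#[local] HB.instance Definition _ := Measure_isProbability.Build _ _ _ lsR lsR1.

Lemma probability_of_cdf : exists mu : probability R R, forall x, cdfR mu x = F x.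
Proof.
exists lsR => x.
have := cdf_lebesgue_stieltjes_id (FF : cumulativeBounded (0:R) (1:R)) x.
by rewrite /cdfR => H; rewrite -[F x]/(fine (FF x)%:E) -H.
Qed.

End of_cdf.
End CDF.

Section CdfUnique.
Context {R : realType}.

Lemma cdfR_itv (mu : probability R R) (a b : R) : a <= b ->
  mu `]a, b]%classic = (cdfR mu b - cdfR mu a)%:E.
Proof.
move=> ab; have -> : `]a, b]%classic = `]-oo, b] `\` `]-oo, a] :> set R.
  by rewrite -[RHS]setCK setCD setCitvl setUC -[LHS]setCK setCitv.
rewrite measureD//; last by rewrite -ge0_fin_numE// fin_num_measure.
have -> : `]-oo, b] `&` `]-oo, a] = `]-oo, a]%classic :> set R.
  by rewrite setIidr//; apply: subset_itvl; rewrite bnd_simp.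
by rewrite EFinB -!cdfRE.
Qed.

Lemma cdfR_inj (mu nu : probability R R) : (forall x, cdfR mu x = cdfR nu x) ->
  forall A : set R, measurable A -> mu A = nu A.
Proof.
move=> FG A mA.
apply: (@measure_unique _ R R (@ocitv R) (fun n => `]- n%:R, n%:R]%classic)) => //.
- exact: ocitvI.
- by move=> n; exact: is_ocitv.
- exact: (@bigcup_itvT R false false).
- move=> B [[a b] _ <-] /=; have [ab|ba] := leP a b; first by rewrite !cdfR_itv// !FG.
  by rewrite set_itv_ge ?measure0// bnd_simp -leNgt ltW.
- by move=> k; rewrite -ge0_fin_numE// fin_num_measure.
Qed.

End CdfUnique.

(** * The Wasserstein distance as the [L^1] distance of distribution functions *)

Section W1cdf.
Context {R : realType}.
Local Notation leb := (@lebesgue_measure R).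

Definition W1cdf (mu nu : probability R R) : \bar R :=
  (\int[leb]_x `|cdfR mu x - cdfR nu x|%:E)%E.

Lemma measurable_cdfRB (mu nu : probability R R) :
  measurable_fun setT (fun x => `|cdfR mu x - cdfR nu x|).
Proof.
by apply: measurableT_comp => //; apply: measurable_funB; exact: measurable_cdfR.
Qed.

Lemma W1cdf_sym mu nu : W1cdf mu nu = W1cdf nu mu.
Proof. by apply: eq_integral => x _; rewrite distrC. Qed.

Lemma W1cdf_triangle mu nu la : (W1cdf mu la <= W1cdf mu nu + W1cdf nu la)%E.
Proof.
rewrite /W1cdf -ge0_integralD//; try by apply/measurable_EFinP; exact: measurable_cdfRB.
apply: ge0_le_integral => //; try by apply/measurable_EFinP; exact: measurable_cdfRB.
- by apply: emeasurable_funD; apply/measurable_EFinP; exact: measurable_cdfRB.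
- by move=> x _; rewrite -EFinD lee_fin ler_distD.
Qed.

(** Triples [(x, (a, b))] such that [x] separates [a] from [b]. For fixed [(a, b)] the section has
    length [|a - b|]; for fixed [x] it is the event that exactly one of [a <= x] and [b <= x]
    holds. *)
Let SD : set (R * (R * R)) := [set p | (p.2.1 <= p.1) && (p.1 < p.2.2) || (p.2.2 <= p.1) && (p.1 < p.2.1)].

Let mSD : measurable SD.
Proof.
have m1 : measurable_fun setT (fun p : R * (R * R) => p.1) by exact: measurable_fst.
have m2 : measurable_fun setT (fun p : R * (R * R) => p.2.1).
  by apply: measurableT_comp => //; exact: measurable_snd.
have m3 : measurable_fun setT (fun p : R * (R * R) => p.2.2).
  by apply: measurableT_comp => //; exact: measurable_snd.
rewrite -[SD]setTI.
have -> : SD = (fun p : R * (R * R) => (p.2.1 <= p.1) && (p.1 < p.2.2) || (p.2.2 <= p.1) && (p.1 < p.2.1)) @^-1` [set true].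
  by apply/seteqP; split.
have mb : measurable_fun setT (fun p : R * (R * R) => (p.2.1 <= p.1) && (p.1 < p.2.2) || (p.2.2 <= p.1) && (p.1 < p.2.1)).
  apply: measurable_or; apply: measurable_and.
  - exact: measurable_fun_ler.
  - exact: measurable_fun_ltr.
  - exact: measurable_fun_ler.
  - exact: measurable_fun_ltr.
exact: mb.
Qed.

(** Tonelli on the separating set: one order of integration gives the transport cost, the other the
    probability of being separated by [x]. *)
Lemma coupling_cost (g : probability (R * R)%type R) :
  (\int[g]_z (`|z.1 - z.2|%:E) = \int[leb]_x (g [set z | SD (x, z)]))%E.
Proof.
have mI : measurable_fun setT (fun p : R * (R * R) => ((\1_SD p)%:E : \bar R)).
  by apply/measurable_EFinP; exact: measurable_indic.
have := @fubini_tonelli _ _ _ _ R leb g (fun p : R * (R * R) => (\1_SD p)%:E) mI.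
move=> /(_ _); rewrite /=.
move=> H; transitivity (\int[g]_z \int[leb]_x (\1_SD (x, z))%:E)%E; last first.
  rewrite -H; last by move=> p; rewrite lee_fin.
  apply: eq_integral => x _.
  have -> : [set z | SD (x, z)] = xsection SD x.
    by apply/seteqP; split => z; rewrite /xsection/= inE.
  rewrite -[LHS]/(\int[g]_z (\1_SD (x, z))%:E)%E.
  rewrite -[xsection SD x in RHS](setIT) -integral_indic//; last exact: measurable_xsection.
  apply: eq_integral => z _; congr EFin; rewrite !indicE.
  by rewrite mem_xsection.
apply: eq_integral => z _.
have -> : (\int[leb]_x (\1_SD (x, z))%:E = leb (ysection SD z))%E.
  rewrite -[RHS]/(leb (ysection SD z)) -(setIT (ysection _ _)) -integral_indic//; last exact: measurable_ysection.
  by apply: eq_integral => x _; congr EFin; rewrite !indicE mem_ysection.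
have [zz|zz] := leP z.1 z.2.
  have -> : ysection SD z = `[z.1, z.2[%classic.
    apply/seteqP; split => x; rewrite /ysection/= inE/= in_itv/=.
      move=> /orP[//|/andP[a b]]; lra.
    by move=> h; rewrite /SD/= h.
  rewrite lebesgue_measure_itv/= lte_fin; have [lt|ge] := ltP z.1 z.2.
    by rewrite distrC ger0_norm ?subr_ge0// EFinB.
  have -> : z.1 = z.2 by apply/eqP; rewrite eq_le zz.
  by rewrite subrr normr0.
have -> : ysection SD z = `[z.2, z.1[%classic.
  apply/seteqP; split => x; rewrite /ysection/= inE/= in_itv/=.
    move=> /orP[/andP[a b]|//]; lra.
  by move=> h; rewrite /SD/= h orbT.
by rewrite lebesgue_measure_itv/= lte_fin zz gtr0_norm ?subr_gt0// EFinB.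
Qed.

Let mSDx x : measurable [set z | SD (x, z)].
Proof.
have -> : [set z | SD (x, z)] = xsection SD x.
  by apply/seteqP; split => z; rewrite /xsection/= inE.
exact: measurable_xsection.
Qed.

Let mSDg (g : probability (R * R)%type R) : measurable_fun [set: R] (fun x => g [set z | SD (x, z)]).
Proof.
have -> : (fun x => g [set z | SD (x, z)]) = g \o xsection SD.
  apply/funext => x /=; congr (g _).
  by apply/seteqP; split => z; rewrite /xsection/= inE.
exact: measurable_fun_xsection.
Qed.

(** For any coupling, the distribution functions at [x] are the probabilities of two events that
    differ only on the section of [SD] at [x]. *)
Lemma W1cdf_le_W1 mu nu : (W1cdf mu nu <= W1 mu nu)%E.
Proof.
apply: le_ereal_inf_tmp => _ [g [gm gn] <-].
rewrite coupling_cost; apply: ge0_le_integral => //.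
- by apply/measurable_EFinP; exact: measurable_cdfRB.
- exact: mSDg.
move=> x _.
have mL : measurable (`]-oo, x]%classic `*` [set: R]) by exact: measurableX.
have mR : measurable ([set: R] `*` `]-oo, x]%classic) by exact: measurableX.
have EL : (cdfR mu x)%:E = g (`]-oo, x]%classic `*` setT) by rewrite -cdfRE gm.
have ER : (cdfR nu x)%:E = g (setT `*` `]-oo, x]%classic) by rewrite -cdfRE gn.
have f1 : ((cdfR mu x)%:E <= (cdfR nu x)%:E + g [set z | SD (x, z)])%E.
  rewrite EL ER; apply: le_trans (measureU2 _ _ _) => //.
  apply: le_measure; rewrite ?inE//; first exact: measurableU.
  move=> [a b] /= [+ _]; rewrite !in_itv/= => ax.
  by have [bx|xb] := leP b x; [left|right; rewrite /SD/= ax xb].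
have f2 : ((cdfR nu x)%:E <= (cdfR mu x)%:E + g [set z | SD (x, z)])%E.
  rewrite EL ER; apply: le_trans (measureU2 _ _ _) => //.
  apply: le_measure; rewrite ?inE//; first exact: measurableU.
  move=> [a b] /= [_ +]; rewrite !in_itv/= => bx.
  by have [ax|xa] := leP a x; [left|right; rewrite /SD/= bx xa orbT].
move: f1 f2; have gf : g [set z | SD (x, z)] \is a fin_num by rewrite fin_num_measure.
rewrite -(fineK gf) -!EFinD !lee_fin ler_norml => ? ?; apply/andP; split; lra.
Qed.

Section Quantile.
Variable mu : probability R R.

Let S (u : R) : set R := [set x | u <= cdfR mu x].

(** Generalised inverse of the distribution function. It is set to [0] outside []0, 1[], where the
    infimum could run over an empty set or one that is not bounded below. *)
Definition quantile : R -> R := (fun u => inf (S u)) \_ `]0, 1[%classic.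

(** Right continuity puts the infimum into the set itself, which turns the definition into an
    equivalence. *)
Lemma quantileP u x : 0 < u < 1 -> (quantile u <= x) = (u <= cdfR mu x).
Proof.
move=> /andP[u0 u1]; rewrite /quantile patchE mem_set/=; last by rewrite in_itv/= u0 u1.
have [y Sy] : S u !=set0.
  have /cvgr_gt/(_ _ u1) := @cdfRy R mu.
  by move=> [M [_ HM]]; exists (M + 1); apply: ltW; apply: HM; rewrite ltrDl.
have [l Sl] : exists l, forall x, S u x -> l <= x.
  have /cvgr_lt/(_ _ u0) := @cdfRNy R mu.
  move=> [M [_ HM]]; exists (M - 1) => z Sz; rewrite leNgt; apply/negP => zM.
  have : cdfR mu z < u by apply: HM; rewrite (lt_le_trans zM)// gerBl.
  by rewrite ltNge Sz.
have hS : has_inf (S u) by split; [exists y|exists l].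
have inS : S u (inf (S u)).
  rewrite /S/= leNgt; apply/negP => lt.
  have /cvgr_lt/(_ _ lt) := @cdfR_rc R mu (inf (S u)).
  move=> [e /= e0 He].
  have [z Sz zlt] := inf_adherent e0 hS.
  have zge : inf (S u) <= z by apply: ge_inf => //; exists l.
  have : cdfR mu z < u.
    have [->//|zi] := eqVneq z (inf (S u)).
    apply: He; last by rewrite /= lt_neqAle eq_sym zi.
    by rewrite /= distrC ger0_norm ?subr_ge0// ltrBlDl.
  by rewrite ltNge Sz.
apply/idP/idP => [ix|ux].
  exact: le_trans inS (cdfR_nd _ ix).
by apply: ge_inf => //; exists l.
Qed.

Lemma measurable_quantile : measurable_fun [set: R] quantile.
Proof.
apply: (iffLR (measurable_restrictT _ _)); first exact: measurable_itv.
have m01 : measurable (`]0, 1[%classic : set R) by exact: measurable_itv.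
apply: (measurability (@RGenOInfty.G R)) => [|/= _ [_] [r] -> <-].
  exact: RGenOInfty.measurableE.
have -> : `]0, 1[ `&` (fun u => inf (S u)) @^-1` `]r, +oo[ = `]0, 1[%classic `&` `]cdfR mu r, +oo[%classic.
  apply/seteqP; split => u /= []; rewrite !in_itv/= !andbT => u01.
    move=> h; split => //; rewrite ltNge -quantileP// /quantile patchE mem_set/= ?in_itv//.
    by rewrite -ltNge.
  move=> h; split => //; move: h; rewrite ltNge -quantileP// /quantile patchE mem_set/= ?in_itv//.
  by rewrite -ltNge.
exact: measurableI.
Qed.

End Quantile.

Let clamp (x : R) : R := Num.max 0 (Num.min 1 x).

Lemma uniform01 : exists U : probability R R, forall x, cdfR U x = clamp x.
Proof.
have nd : {homo clamp : x y / x <= y}.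
  move=> x y xy; rewrite /clamp; apply: le_max2 => //; exact: le_min2.
have cc : continuous clamp.
  move=> x; apply: continuous_max; first exact: cvg_cst.
  by apply: continuous_min; [exact: cvg_cst|exact: cvg_id].
apply: probability_of_cdf => //.
- by move=> x; apply: cvg_at_right_filter; exact: cc.
- apply: cvg_near_cst; exists 1; split => // x /ltW x1.
  by rewrite /clamp min_l ?max_r.
- apply: cvg_near_cst; exists 0; split => // x /ltW x0.
  by rewrite /clamp max_l// ge_min x0 orbT.
Qed.

Section QuantileCoupling.
Variables (U : probability R R) (mu nu : probability R R).
Hypothesis UE : forall x, cdfR U x = clamp x.

Let QQ (u : R) : R * R := (quantile mu u, quantile nu u).
Let mQQ : measurable_fun [set: R] QQ.
Proof. by apply: measurable_fun_pair; exact: measurable_quantile. Qed.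
#[local] HB.instance Definition _ := isMeasurableFun.Build _ _ _ _ QQ mQQ.

Let g : probability (R * R)%type R := distribution U QQ.

Let N : set R := ~` `]0, 1[%classic.

Let mN : measurable N. Proof. by apply: measurableC; exact: measurable_itv. Qed.

Let Uitv (a b : R) : 0 <= a -> a <= b -> b <= 1 -> U `]a, b]%classic = (b - a)%:E.
Proof.
move=> a0 ab b1; rewrite cdfR_itv// !UE /clamp !min_r ?max_r//.
- exact: le_trans ab.
- exact: le_trans ab b1.
Qed.

Let UN : U N = 0%E.
Proof.
apply/eqP; rewrite eq_le measure_ge0 andbT; apply/lee_addgt0Pr => e e0; rewrite add0e.
pose d := Num.min e 1; have d0 : 0 < d by rewrite lt_min e0 ltr01.
have de : d <= e by rewrite ge_min lexx.
have d1 : d <= 1 by rewrite ge_min lexx orbT.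
(* The interval stops at [1 - d] in order to be disjoint from [N], the complement of the open unit
   interval; it already carries mass [1 - d]. *)
have : (U N + U `]0%R, (1 - d)%R]%classic <= 1)%E.
  rewrite -measureU//.
  - by apply: probability_le1; exact: measurableU.
  - apply/seteqP; split => x //= []; rewrite /N/= !in_itv/= => h /andP[x0 x1]; apply: h.
    by rewrite x0/=; lra.
rewrite Uitv//; [|lra|lra].
have UNf : U N \is a fin_num by rewrite fin_num_measure.
rewrite -(fineK UNf) -EFinD !lee_fin; lra.
Qed.

Let notN u : ~ N u -> 0 < u < 1.
Proof. by rewrite /N/= => /contrapT; rewrite in_itv. Qed.

Let cdf01 (la : probability R R) x : 0 <= cdfR la x <= 1.
Proof. by rewrite cdfR_ge0 cdfR_le1. Qed.

Let law (la : probability R R) x : U (quantile la @^-1` `]-oo, x]%classic) = (cdfR la x)%:E.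
Proof.
have mq : measurable (quantile la @^-1` `]-oo, x]%classic).
  by rewrite -[X in measurable X]setTI; apply: measurable_quantile.
have UF : U `]-oo, cdfR la x]%classic = (cdfR la x)%:E.
  by rewrite cdfRE UE /clamp min_r ?cdfR_le1// max_r// cdfR_ge0.
apply/eqP; rewrite eq_le; apply/andP; split.
  rewrite -UF -[leRHS]adde0 -UN; apply: le_trans (measureU2 _ _ _) => //.
  apply: le_measure; rewrite ?inE//; first exact: measurableU.
  move=> u /=; rewrite in_itv/= => qu; have [|/notN u01] := pselect (N u); first by right.
  by left; rewrite /= in_itv/= -quantileP.
rewrite -UF -[leRHS]adde0 -UN; apply: le_trans (measureU2 _ _ _) => //.
apply: le_measure; rewrite ?inE//; first exact: measurableU.
move=> u /=; rewrite in_itv/= => qu; have [|/notN u01] := pselect (N u); first by right.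
by left; rewrite /= in_itv/= quantileP.
Qed.

Let marg (la : probability R R) (mla : measurable_fun [set: R] (quantile la)) (A : set R) :
  measurable A -> U (quantile la @^-1` A) = la A.
Proof.
pose q := quantile la.
have mq : @isMeasurableFun _ _ R R q by constructor.
pose qq : {mfun R >-> R} := HB.pack q mq.
move=> mA; apply: (@cdfR_inj R (distribution U qq) la) => // x.
by rewrite /cdfR -[RHS]/(fine (cdfR la x)%:E) -law.
Qed.

(** Comonotone coupling: both measures are images of one uniform variable [u] under their quantiles.
    By [quantileP], [x] can separate the two quantiles only for [u] between the two values of the
    distribution functions at [x], an interval whose length is their distance. *)
Lemma W1_le_W1cdf : (W1 mu nu <= W1cdf mu nu)%E.
Proof.
apply: (@le_trans _ _ (\int[g]_z `|z.1 - z.2|%:E)%E).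
  apply: ereal_inf_lbound; exists g => //; split => A mA.
    rewrite -[LHS]/(U (QQ @^-1` _)).
    have -> : QQ @^-1` (A `*` setT) = quantile mu @^-1` A by apply/seteqP; split => u //= [].
    by apply: marg => //; exact: measurable_quantile.
  rewrite -[LHS]/(U (QQ @^-1` _)).
  have -> : QQ @^-1` (setT `*` A) = quantile nu @^-1` A by apply/seteqP; split => u //= [].
  by apply: marg => //; exact: measurable_quantile.
rewrite coupling_cost; apply: ge0_le_integral => //.
- exact: mSDg.
- by apply/measurable_EFinP; exact: measurable_cdfRB.
move=> x _; set a := cdfR mu x; set b := cdfR nu x.
have /andP[a0 a1] := cdf01 mu x; have /andP[b0 b1] := cdf01 nu x.
pose m := Num.min a b; pose M := Num.max a b.
have mM : `|a - b| = M - m.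
  rewrite /M /m; have [ab|ba] := leP a b; first by rewrite distrC ger0_norm ?subr_ge0.
  by rewrite gtr0_norm ?subr_gt0.
have m0 : 0 <= m by rewrite le_min a0.
have M1 : M <= 1 by rewrite ge_max a1.
have mleM : m <= M by rewrite ge_min le_max lexx.
rewrite mM -Uitv// -[leRHS]adde0 -UN; apply: le_trans (measureU2 _ _ _) => //.
rewrite -[leLHS]/(U (QQ @^-1` [set z | SD (x, z)])).
apply: le_measure; rewrite ?inE//.
- by rewrite -[X in measurable X]setTI; apply: mQQ => //; exact: mSDx.
- exact: measurableU.
move=> u /=; rewrite /SD/= => qu; have [|/notN u01] := pselect (N u); first by right.
left; rewrite /= in_itv/=; move: qu.
rewrite !ltNge !quantileP// -!ltNge -/a -/b => /orP[/andP[h1 h2]|/andP[h1 h2]].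
  by rewrite gt_min h2 orbT le_max h1.
by rewrite gt_min h2 le_max h1 orbT.
Qed.

End QuantileCoupling.

Lemma W1E (mu nu : probability R R) : W1 mu nu = W1cdf mu nu.
Proof.
apply/eqP; rewrite eq_le W1cdf_le_W1 andbT; have [U UE] := uniform01.
exact: W1_le_W1cdf UE.
Qed.

Lemma W1_triangle (mu nu la : probability R R) : (W1 mu la <= W1 mu nu + W1 nu la)%E.
Proof. by rewrite !W1E W1cdf_triangle. Qed.

Lemma W1_sym (mu nu : probability R R) : W1 mu nu = W1 nu mu.
Proof. by rewrite !W1E W1cdf_sym. Qed.

End W1cdf.

(** * Compactness and weak convergence *)

Section Subsequences.
Context {R : realType}.

Lemma homo_ltn_id (s : nat -> nat) : {homo s : a b / (a < b)%N} -> forall n, (n <= s n)%N.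
Proof. by move=> hs; elim=> // n IH; apply: leq_ltn_trans IH (hs _ _ _). Qed.

Lemma cauchy_lim (u : nat -> R) :
  (forall e, 0 < e -> exists N, forall n m, (N <= n)%N -> (N <= m)%N -> `|u n - u m| <= e) ->
  exists l : R, u @ \oo --> l.
Proof.
move=> H; apply/cvg_ex; apply/cauchy_cvgP; apply: cauchy_exP => e e0.
have e20 : 0 < e / 2 by rewrite divr_gt0.
have [N HN] := H _ e20; exists (u N); exists N => // n /= Nn.
rewrite /ball/=; apply: le_lt_trans (HN N n (leqnn _) Nn) _; lra.
Qed.

Lemma cvg_dist_le (u : nat -> R) (l : R) e : u @ \oo --> l -> 0 < e ->
  \forall n \near \oo, `|u n - l| <= e.
Proof.
move=> /cvgrPdist_le ul e0; have := ul _ e0.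
by apply: filterS => n; rewrite distrC.
Qed.

(* Limits along an ultrafilter finer than [\oo] exist for all the (bounded)
   coordinates at once; a subsequence is then read off the ultrafilter. *)
Lemma bounded_subsequence (f : nat -> nat -> R) (C : R) : (forall n i, `|f n i| <= C) ->
  exists2 s : nat -> nat, {homo s : a b / (a < b)%N} &
    forall i, exists l : R, f (s k) i @[k --> \oo] --> l.
Proof.
move=> fC; have [U [UU sU]] := ultraFilterLemma (eventually_filter : ProperFilter \oo).
have lim i : exists l : R, (fun n => f n i) @ U --> l.
  have [|l [_ cl]] := @segment_compact R (- C) C ((fun n => f n i) @ U).
  - have : U [set n | `[- C, C]%classic (f n i)] by apply: filterE => n; rewrite /= in_itv/= -ler_norml.
    by [].
  exists l => V nV; have [//|nU] := in_ultra_setVsetC ((fun n => f n i) @^-1` V) UU.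
  by have [y []] := cl (~` V) V nU nV.
have /choice[l hl] := lim.
have good k m : exists n, (m < n)%N /\ forall i, (i < k)%N -> `|f n i - l i| < k%:R^-1 + k.+1%:R^-1.
  have : U [set n | (m < n)%N /\ forall i, (i < k)%N -> `|f n i - l i| < k%:R^-1 + k.+1%:R^-1].
    apply: filterI; first by apply: sU; exists m.+1.
    have e0 : 0 < k%:R^-1 + k.+1%:R^-1 :> R by rewrite ltr_wpDl// ?invr_ge0// invr_gt0.
    elim: {1}k => [|j IH]; first by apply: filterE => n i.
    have hj : U [set n | `|f n j - l j| < k%:R^-1 + k.+1%:R^-1].
      have /cvgrPdist_lt/(_ _ e0) := hl j.
      by apply: filterS => n; rewrite /= distrC.
    apply: filterS2 IH hj => n h1 h2 i; rewrite ltnS leq_eqVlt => /predU1P[->//|]; exact: h1.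
  by move=> /filter_ex.
have /choice[G hG] : forall km : nat * nat, exists n, (km.2 < n)%N /\ forall i, (i < km.1)%N -> `|f n i - l i| < km.1%:R^-1 + km.1.+1%:R^-1.
  by move=> [k m]; exact: good.
pose s := fix s k := match k with O => G (0, 0)%N | k'.+1 => G (k'.+1, s k')%N end.
have sS k : (s k < s k.+1)%N by have [] := hG (k.+1, s k).
exists s.
  move=> a b; elim: b => // b IH; rewrite ltnS leq_eqVlt => /predU1P[->//|ab].
  exact: ltn_trans (IH ab) (sS b).
move=> i; exists (l i); apply/cvgrPdist_lt => e e0.
have e20 : 0 < e / 2 by rewrite divr_gt0.
have := @cvg_harmonic R => /cvgrPdist_lt/(_ _ e20)[M _ HM].
exists (maxn M.+1 i.+1) => // k /=; rewrite geq_max => /andP[Mk ik].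
case: k Mk ik => // k Mk ik; have [_ /(_ i ik)] := hG (k.+1, s k).
rewrite distrC => h; apply: lt_trans h _ => /=.
have := HM k Mk; have := HM k.+1 (ltnW Mk).
rewrite /= !sub0r !normrN !gtr0_norm ?invr_gt0//.
by move: (k.+1%:R^-1) (k.+2%:R^-1) => a b; lra.
Qed.

Lemma dist4_le (p q a b e : R) : 0 < e -> `|p - a| <= e / 4 -> `|q - b| <= e / 4 ->
  `|a - b| <= e / 4 -> `|p - q| <= e.
Proof. rewrite !ler_norml => e0 /andP[? ?] /andP[? ?] /andP[? ?]; apply/andP; split; lra. Qed.

Lemma dist_floor_le (x u v c : R) : x + c <= u + v -> u <= x + c -> `|x - (u - c)| <= v.
Proof. rewrite ler_norml => ? ?; apply/andP; split; lra. Qed.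

Lemma floor_nat (y : R) : 0 <= y -> exists i : nat, i%:R <= y < i%:R + 1.
Proof.
move=> y0; exists (Num.truncn y); have := Num.Theory.truncn_itv y0.
by rewrite -natr1.
Qed.

(** The modulus of continuity is required only from some rank on. This admits functions that jump in
    time on the scale of the mesh, such as discrete value functions held constant on each time
    cell. *)
Lemma arzela_ascoli (T C : R) (f : nat -> R -> R -> R) : 0 <= T ->
  (forall n x t, 0 <= t <= T -> `|f n x t| <= C) ->
  (forall e : R, 0 < e -> exists (d : R) (N0 : nat), 0 < d /\ forall n (x y s t : R), (N0 <= n)%N ->
     0 <= s <= T -> 0 <= t <= T -> `|x - y| < d -> `|s - t| < d -> `|f n x s - f n y t| <= e) ->
  exists2 s : nat -> nat, {homo s : a b / (a < b)%N} & exists g : R -> R -> R,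
    forall K e : R, 0 < e -> exists n0 : nat, forall n (x t : R), (n0 <= n)%N -> `|x| <= K -> 0 <= t <= T ->
      `|f (s n) x t - g x t| <= e.
Proof.
move=> T0 fC fE.
pose clip (t : R) := Num.min T (Num.max 0 t).
have clipP t : 0 <= clip t <= T by rewrite /clip ge_min lexx le_min T0 le_max lexx.
have clip_id t : 0 <= t <= T -> clip t = t.
  by move=> /andP[t0 tT]; rewrite /clip max_r// min_r.
(* A countable dense family of points, of mesh [1 / (m + 1)]. The shift by [Ix] reaches negative
   abscissas, and [clip] keeps the times in [[0, T]] so that the uniform bound applies to every
   index. *)
pose pt (q : nat * nat * nat * nat) : R * R := let: (m, Ix, i, j) := q in
  ((i%:R - Ix%:R) / m.+1%:R, clip (j%:R / m.+1%:R)).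
pose F n (c : nat) : R := if unpickle c is Some q then f n (pt q).1 (pt q).2 else 0.
have C0 : 0 <= C by apply: le_trans (fC 0%N 0 0 _); rewrite ?lexx ?T0.
have [n c|s hs hl] := @bounded_subsequence F C.
  rewrite /F; case: unpickle => [[[[m Ix] i] j]|]; last by rewrite normr0.
  by apply: fC; exact: clipP.
have {}hl q : exists l : R, f (s k) (pt q).1 (pt q).2 @[k --> \oo] --> l.
  by have := hl (pickle q); rewrite /F pickleK.
exists s => //.
have cau K e : 0 < e -> exists n0, forall n n' x t, (n0 <= n)%N -> (n0 <= n')%N ->
    `|x| <= K -> 0 <= t <= T -> `|f (s n) x t - f (s n') x t| <= e.
  move=> e0; have e40 : 0 < e / 4 by rewrite divr_gt0.
  have [d [N0 [d0 Hd]]] := fE _ e40.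
  have := @cvg_harmonic R => /cvgrPdist_lt/(_ _ d0)[m _ /(_ m (leqnn _))].
  rewrite /= sub0r normrN gtr0_norm ?invr_gt0// => md.
  have [Kb hKb] : exists Kb : nat, `|K| < Kb%:R.
    by exists (Num.truncn `|K|).+1; rewrite Num.Theory.truncnS_gt.
  have [Tb hTb] : exists Tb : nat, T < Tb%:R.
    by exists (Num.truncn T).+1; rewrite Num.Theory.truncnS_gt.
  pose Ix := (Kb * m.+1)%N; pose J := (Tb * m.+1)%N.
  (* Only finitely many grid points are needed to approximate the box, so one rank serves all of
     them. *)
  have : \forall n \near \oo, forall ij : 'I_(2 * Ix).+1 * 'I_J.+1,
    forall n', (n <= n')%N -> `|f (s n) (pt (m, Ix, val ij.1, val ij.2)).1 (pt (m, Ix, val ij.1, val ij.2)).2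
      - f (s n') (pt (m, Ix, val ij.1, val ij.2)).1 (pt (m, Ix, val ij.1, val ij.2)).2| <= e / 4.
    apply: filter_forall => ij; have [l /cvg_dist_le hl'] := hl (m, Ix, val ij.1, val ij.2).
    have e80 : 0 < e / 8 by rewrite divr_gt0.
    have [n1 _ H1] := hl' _ e80; exists n1 => // n /= nn1 n' nn'.
    have := H1 n nn1; have := H1 n' (leq_trans nn1 nn'); rewrite /=.
    set a := f _ _ _; set b := f _ _ _; rewrite !ler_norml => /andP[? ?] /andP[? ?].
    by apply/andP; split; lra.
  move=> [n1 _ H1]; exists (maxn n1 N0) => n n' x t.
  wlog nn' : n n' / (n <= n')%N.
    move=> W h1 h2 xK tT; have [nn'|/ltnW n'n] := leqP n n'; first exact: W.
    by rewrite distrC; exact: W.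
  rewrite !geq_max => /andP[nn1 nN0] /andP[n'n1 n'N0] xK tT.
  have xK' : `|x| < Kb%:R by apply: le_lt_trans (le_trans xK (ler_norm _)) hKb.
  have m0 : 0 < m.+1%:R :> R by [].
  have [i /andP[i1 i2]] : exists i : nat, i%:R <= (x + Kb%:R) * m.+1%:R < i%:R + 1.
    by apply: floor_nat; rewrite mulr_ge0//; move: xK'; rewrite ltr_norml => /andP[]; lra.
  have [j /andP[j1 j2]] : exists j : nat, j%:R <= t * m.+1%:R < j%:R + 1.
    by apply: floor_nat; rewrite mulr_ge0//; case/andP: tT.
  have iI : (i < (2 * Ix).+1)%N.
    rewrite ltnS -(@ler_nat R); apply: le_trans i1 _.
    rewrite /Ix !natrM mulrA ler_pM2r//; move: xK'; rewrite ltr_norml => /andP[]; lra.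
  have jJ : (j < J.+1)%N.
    rewrite ltnS -(@ler_nat R); apply: le_trans j1 _.
    rewrite /J natrM ler_pM2r// ltW//; apply: le_lt_trans hTb; by case/andP: tT.
  have jt : j%:R / m.+1%:R <= t by rewrite ler_pdivrMr.
  have cj : clip (j%:R / m.+1%:R) = j%:R / m.+1%:R.
    by apply: clip_id; rewrite divr_ge0//=; apply: le_trans jt _; case/andP: tT.
  have := H1 n nn1 (Ordinal iI, Ordinal jJ) n' nn'; rewrite [pt _]/= cj.
  set a := (i%:R - Ix%:R) / m.+1%:R; set b := j%:R / m.+1%:R in jt *.
  have xa : `|x - a| < d.
    apply: le_lt_trans md; have -> : a = i%:R / m.+1%:R - Kb%:R.
      by rewrite /a /Ix natrM mulrBl mulfK.
    have : i%:R / m.+1%:R <= x + Kb%:R by rewrite ler_pdivrMr.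
    have : x + Kb%:R <= i%:R / m.+1%:R + m.+1%:R^-1.
      have : x + Kb%:R <= (i%:R + 1) / m.+1%:R by rewrite ler_pdivlMr// ltW.
      by rewrite mulrDl mul1r.
    exact: dist_floor_le.
  have tb : `|t - b| < d.
    apply: le_lt_trans md.
    have : t <= b + m.+1%:R^-1.
      have : t <= (j%:R + 1) / m.+1%:R by rewrite ler_pdivlMr// ltW.
      by rewrite mulrDl mul1r.
    by move=> h; rewrite -[b]subr0; apply: dist_floor_le; rewrite ?addr0.
  have bT : 0 <= b <= T by have := clipP (j%:R / m.+1%:R); rewrite cj.
  have h1 := Hd (s n) x a t b (leq_trans nN0 (homo_ltn_id hs n)) tT bT xa tb.
  have h2 := Hd (s n') x a t b (leq_trans n'N0 (homo_ltn_id hs n')) tT bT xa tb.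
  by move=> h3; exact: dist4_le h1 h2 h3.
have limx x t : exists l : R, 0 <= t <= T -> f (s k) x t @[k --> \oo] --> l.
  have [tT|ntT] := pselect (0 <= t <= T); last by exists 0.
  have [|l hl'] := @cauchy_lim (fun k => f (s k) x t); last by exists l.
  move=> e e0; have [n0 Hn0] := cau `|x| e e0.
  by exists n0 => n m h1 h2; apply: Hn0.
have /choice[g hg] : forall xt : R * R, exists l : R, 0 <= xt.2 <= T -> f (s k) xt.1 xt.2 @[k --> \oo] --> l.
  by move=> [x t]; exact: limx.
exists (fun x t => g (x, t)) => K e e0; have [n0 Hn0] := cau K e e0.
exists n0 => n x t nn0 xK tT.
have hgx := hg (x, t) tT.
have c1 : (fun k => `|f (s n) x t - f (s k) x t|) @ \oo --> `|f (s n) x t - g (x, t)|.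
  by apply: cvg_norm; apply: cvgB; [exact: cvg_cst|exact: hgx].
by apply: (cvg_ub c1); exists n0 => // k /= kn0; apply: Hn0.
Qed.

End Subsequences.

(** * Densities of measures with a Lipschitz distribution function *)

Section Dominated.
Context {R : realType}.
Local Notation leb := (@lebesgue_measure R).

Section one.
Variables (mu : probability R R) (C : R).
Hypothesis C0 : 0 < C.
Hypothesis muC : forall x y, x <= y -> cdfR mu y - cdfR mu x <= C * (y - x).

(** Lebesgue measure is an infimum over covers by half-open intervals, and on such an interval the
    claim is the Lipschitz bound. *)
Lemma dominated_le (A : set R) : measurable A -> (mu A <= C%:E * leb A)%E.
Proof.
move=> mA; rewrite -lee_pdivrMl//; apply: le_ereal_inf_tmp => _ [B [mB AB] <-].
have mB' i : measurable (B i : set R) by case: (mB i) => -[a b] _ <-; exact: measurable_itv.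
rewrite lee_pdivrMl//; apply: (@le_trans _ _ (\sum_(k <oo) mu (B k))%E).
  by apply: measure_sigma_subadditive.
rewrite -nneseriesZl//; apply: lee_nneseries => // i _.
case: (mB i) => -[a b] _ <- /=; have [ab|ba] := leP a b; last first.
  by rewrite set_itv_ge ?measure0 ?wlength0 ?mule0// bnd_simp -leNgt ltW.
by rewrite wlength_itv_bnd// -EFinM cdfR_itv// lee_fin muC.
Qed.

(* The library's Lebesgue measure lives on [measurableTypeR]. *)
Let nu (A : set (measurableTypeR R)) : \bar R := mu A.
Let nu0 : nu set0 = 0%E. Proof. exact: measure0. Qed.
Let nu_ge0 A : (0 <= nu A)%E. Proof. exact: measure_ge0. Qed.
Let nu_additive : semi_sigma_additive nu.
Proof. exact: (@measure_semi_sigma_additive _ _ _ mu). Qed.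
#[local] HB.instance Definition _ := isMeasure.Build _ (measurableTypeR R) R nu nu0 nu_ge0 nu_additive.
Let nu1 : nu setT = 1%E. Proof. exact: probability_setT. Qed.
#[local] HB.instance Definition _ := Measure_isProbability.Build _ _ _ nu nu1.

(* A bounded version of the derivative of [F] that is measurable jointly in
   [x] and in a parameter of [F]. *)
Definition quot_density (F : R -> R) (x : R) : R :=
  Num.max 0 (Num.min C (fine (limn_esup (fun n => (n.+1%:R * (F (x + n.+1%:R^-1) - F x))%:E)))).

Lemma measurable_quot_density d (T : measurableType d) (F : T -> R -> R) (g : T -> R) :
  (forall c, measurable_fun [set: T] (fun z => F z (g z + c))) ->
  measurable_fun [set: T] (fun z => quot_density (F z) (g z)).
Proof.
move=> mF; apply: measurable_maxr => //; apply: measurable_minr => //.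
apply: (measurableT_comp (fine_measurable measurableT)).
apply: measurable_fun_limn_esup => n; apply/measurable_EFinP.
apply: measurable_funM => //; apply: measurable_funB => //.
by have := mF 0; under eq_fun do rewrite addr0.
Qed.

Lemma quot_density_bnd F x : 0 <= quot_density F x <= C.
Proof. by rewrite /quot_density le_max lexx/= ge_max (ltW C0) ge_min lexx. Qed.

(** Radon-Nikodym gives the density, and Lebesgue differentiation identifies it almost everywhere
    with the derivative of the distribution function. The third clause is also the source of the
    almost everywhere differentiability of Lipschitz functions. *)
Lemma lip_cdf_density : exists f : R -> R, [/\ leb.-integrable setT (EFin \o f),
  forall B : set R, measurable B -> mu B = (\int[leb]_(x in B) (f x)%:E)%E &
  {ae leb, forall x, derivable (cdfR mu) x 1 /\ derive1 (cdfR mu) x = f x}].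
Proof.
have dom : nu `<< leb.
  apply/null_content_dominatesP => B mB B0; apply/eqP; rewrite eq_le measure_ge0 andbT.
  by apply: le_trans (dominated_le mB) _; rewrite B0 mule0.
pose f := fine \o (Radon_Nikodym (charge_of_finite_measure nu) leb).
have dom' : charge_of_finite_measure nu `<< leb by [].
have fE x : (f x)%:E = (Radon_Nikodym (charge_of_finite_measure nu) leb) x.
  by rewrite /f/= fineK// Radon_Nikodym_fin_num.
have fi : leb.-integrable setT (EFin \o f).
  rewrite (_ : EFin \o f = Radon_Nikodym (charge_of_finite_measure nu) leb); last exact/funext.
  exact: Radon_Nikodym_integrable.
have muE (B : set R) : measurable B -> mu B = (\int[leb]_(x in B) (f x)%:E)%E.
  move=> mB; rewrite -[LHS]/(charge_of_finite_measure nu B).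
  rewrite (Radon_Nikodym_integral dom')//.
  by apply: eq_integral => x _; rewrite fE.
exists f; split => //.
have fi' (B : set R) : measurable B -> leb.-integrable B (EFin \o f).
  by move=> mB; apply: (integrableS measurableT).
have FE y : cdfR mu y = (\int[leb]_(x in `]-oo, y]) f x)%R.
  by rewrite /cdfR muE.
have loc : locally_integrable setT f by apply: open_integrable_locally => //; exact: openT.
have H := @FTC1Ny R f (fun y => fi' `]-oo, y]%classic (measurable_itv _)) loc.
by have -> : cdfR mu = (fun y => (\int[leb]_(x in `]-oo, y]) f x)%R) by apply/funext.
Qed.

Lemma quot_density_derive (F : R -> R) x : derivable F x 1 -> 0 <= derive1 F x <= C ->
  quot_density F x = derive1 F x.
Proof.
move=> dF /andP[fx0 fxC].
have s0 : forall n, n.+1%:R^-1 != 0 :> R by move=> n; rewrite invr_eq0.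
have q := @derivable_quot R F x (fun n => n.+1%:R^-1) dF s0 cvg_harmonic.
have q' : (fun n => (n.+1%:R * (F (x + n.+1%:R^-1) - F x))%:E) @ \oo --> (derive1 F x)%:E.
  apply: cvg_EFin; first by apply: nearW.
  apply: cvg_trans q; apply: near_eq_cvg; apply: nearW => n /=.
  by rewrite invrK mulrC.
rewrite /quot_density is_cvg_limn_esupE; last by apply/cvg_ex; exists (derive1 F x)%:E.
rewrite (_ : limn _ = (derive1 F x)%:E); last exact: cvg_lim q'.
by rewrite /= min_r// max_r.
Qed.

Lemma lip_derive_bnd (F : R -> R) x : {homo F : x y / x <= y} ->
  (forall x y, x <= y -> F y - F x <= C * (y - x)) -> derivable F x 1 -> 0 <= derive1 F x <= C.
Proof.
move=> Fnd FC dF; have s0 : forall n, n.+1%:R^-1 != 0 :> R by move=> n; rewrite invr_eq0.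
have q := @derivable_quot R F x (fun n => n.+1%:R^-1) dF s0 cvg_harmonic.
apply/andP; split.
  apply: (cvg_lb q); apply: nearW => n; rewrite invrK mulr_ge0// subr_ge0.
  by apply: Fnd; rewrite lerDl.
apply: (cvg_ub q); apply: nearW => n; rewrite ler_pdivrMr ?invr_gt0//.
by apply: le_trans (FC _ _ _) _; rewrite ?lerDl// addrAC subrr add0r.
Qed.

Lemma quot_densityE A : measurable A ->
  mu A = (\int[leb]_(x in A) (quot_density (cdfR mu) x)%:E)%E.
Proof.
have [f [fi muE H]] := lip_cdf_density; move=> mA; rewrite muE//.
have mf : measurable_fun A (EFin \o f) by case/integrableP : fi => mf _; exact: measurable_funTS.
apply: ae_eq_integral => //.
  apply: measurable_funTS; apply/measurable_EFinP.
  apply: (@measurable_quot_density _ R (fun _ => cdfR mu) id) => c.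
  apply: measurableT_comp; first exact: measurable_cdfR.
  by apply: measurable_funD.
move: H; apply: filterS; first exact: (ae_filter_ringOfSetsType leb).
move=> x [dF Fx] _; congr EFin; rewrite quot_density_derive//.
by apply: lip_derive_bnd => //; exact: cdfR_nd.
Qed.

End one.
End Dominated.

Section Heine.
Context {R : realType}.

Lemma heine (g : R -> R) (a b e : R) : continuous g -> 0 < e ->
  exists2 d : R, 0 < d & forall x y, x \in `[a, b] -> `|x - y| < d -> `|g x - g y| <= e.
Proof.
move=> cg e0; have /compact_near_coveringP nc := @segment_compact R a b.
have e20 : 0 < e / 2 by rewrite divr_gt0.
have := nc R (0^'+) (fun d x => forall y, `|x - y| < d -> `|g x - g y| <= e).
have H : forall x, `[a, b]%classic x -> \forall x' \near x & d \near 0^'+, forall y, `|x' - y| < d -> `|g x' - g y| <= e.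
  move=> x _; have /cvgrPdist_lt/(_ _ e20)/nbhs_ballP[r /= r0 Hr] := cg x.
  have r20 : 0 < r / 2 by rewrite divr_gt0.
  exists (ball x (r / 2), [set d : R | d < r / 2]); first split.
  - exact: nbhsx_ballx.
  - exact: nbhs_right_lt.
  - move=> [x' d] [/= xx' dr] y yd.
    have h1 : `|g x - g x'| < e / 2 by apply: Hr; apply: le_ball xx'; lra.
    have h2 : `|g x - g y| < e / 2.
      apply: Hr; rewrite /ball/=; move: xx'; rewrite /ball/= => xx'.
      have -> : x - y = (x - x') + (x' - y) by ring.
      by apply: le_lt_trans (ler_normD _ _) _; lra.
    have -> : g x' - g y = (g x - g y) - (g x - g x') by ring.
    by apply: le_trans (ler_normB _ _) _; lra.
move=> /(_ _ H) [d /= d0 Hd]; exists (d / 2); first by rewrite divr_gt0.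
move=> x y xab xy; apply: (Hd (d / 2) _ _ x) => //=.
- by rewrite sub0r normrN gtr0_norm ?divr_gt0//; lra.
- by rewrite divr_gt0.
Qed.

End Heine.

(** * Weak convergence of uniformly bounded densities *)

Section WeakStar.
Context {R : realType}.
Local Notation leb := (@lebesgue_measure R).

Definition bdens (C : R) (f : R -> R) := measurable_fun setT f /\ forall x, 0 <= f x <= C.

Variables (C : R) (fn : nat -> R -> R) (f : R -> R).
Hypotheses (bfn : forall n, bdens C (fn n)) (bf : bdens C f).
Hypothesis fn_f : forall a b : R, a <= b ->
  (\int[leb]_(x in `]a, b]) fn n x)%R @[n --> \oo] --> (\int[leb]_(x in `]a, b]) f x)%R.

Let C0 : 0 <= C. Proof. by have [_ /(_ 0) /andP[]] := bf; exact: le_trans. Qed.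

Lemma mul_bdens_integrable (D : set R) (g h : R -> R) : measurable D -> bdens C h ->
  leb.-integrable D (EFin \o g) -> leb.-integrable D (EFin \o (fun x => g x * h x)).
Proof.
move=> mD [mh hC] ig; apply: (@integrableMl _ _ _ leb D mD (EFin \o g) h) => //.
  exact: measurable_funTS.
exists C; split; first exact: num_real.
move=> M CM x _ /=; have /andP[h0 hx] := hC x.
by rewrite ger0_norm// (le_trans hx)// ltW.
Qed.

Lemma Rintegral_norm_le (D : set R) (g : R -> R) B : measurable D -> (leb D < +oo)%E ->
  leb.-integrable D (EFin \o g) -> (forall x, D x -> `|g x| <= B) ->
  `|(\int[leb]_(x in D) g x)%R| <= B * fine (leb D).
Proof.
move=> mD Dfin ig gB; apply: (le_trans (@le_normr_Rintegral _ _ _ leb D g mD ig)).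
rewrite -Rintegral_cst//; apply: le_Rintegral => //.
  rewrite (_ : EFin \o _ = abse \o (EFin \o g)); last exact/funext.
  exact: integrable_abse.
by apply: measurable_bounded_integrable => //; exact: bounded_cst.
Qed.

Lemma itv_integrable (g : R -> R) (a b : R) : continuous g -> leb.-integrable `]a, b] (EFin \o g).
Proof.
move=> cg; apply: (@integrableS _ _ _ leb `[a, b]%classic) => //.
  by apply: subset_itvr; rewrite bnd_simp.
apply: continuous_compact_integrable; first exact: segment_compact.
exact: continuous_subspaceT.
Qed.

Let fine_itv (a b : R) : a <= b -> fine (leb `]a, b]%classic) = b - a.
Proof.
move=> ab; rewrite lebesgue_measure_itv/= lte_fin.
by case: ltgtP ab => // [->]; rewrite subrr.
Qed.

Let itv_fin (a b : R) : (leb `]a, b]%classic < +oo)%E.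
Proof. by rewrite lebesgue_measure_itv/=; case: ifP => _; rewrite ?ltry// -EFinB ltry. Qed.

Lemma riemann_bound (h g : R -> R) (K w e : R) (M : nat) : bdens C h -> continuous g -> 0 <= w ->
  (forall i x, (i < M)%N -> K + i%:R * w < x <= K + i.+1%:R * w -> `|g x - g (K + i%:R * w)| <= e) ->
  forall m, (m <= M)%N ->
  `|(\int[leb]_(x in `]K, K + m%:R * w]) (g x * h x))%R -
    \sum_(i < m) g (K + i%:R * w) * (\int[leb]_(x in `]K + i%:R * w, K + i.+1%:R * w]) h x)%R|
    <= e * C * (m%:R * w).
Proof.
move=> bh cg w0 He; elim=> [_|m IH mM].
  by rewrite mul0r addr0 set_itvoc0 Rintegral_set0 big_ord0 subrr normr0 mulr0.
pose a := K + m%:R * w; pose b := K + m.+1%:R * w.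
have ab : a <= b by rewrite lerD2l ler_wpM2r// ler_nat.
have Ka : K <= a by rewrite lerDl mulr_ge0.
have igh (x y : R) : leb.-integrable `]x, y] (EFin \o (fun x => g x * h x)).
  by apply: mul_bdens_integrable => //; exact: itv_integrable.
have ih (x y : R) : leb.-integrable `]x, y] (EFin \o h).
  have := @mul_bdens_integrable `]x, y]%classic (fun=> 1) h (measurable_itv _) bh.
  rewrite (_ : EFin \o (fun x => 1 * h x) = EFin \o h); last by apply/funext => z /=; rewrite mul1r.
  by apply; apply: itv_integrable => z; exact: cvg_cst.
have E1 : (\int[leb]_(x in `]K, b]) (g x * h x))%R = (\int[leb]_(x in `]K, a]) (g x * h x))%R +
   (\int[leb]_(x in `]a, b]) (g x * h x))%R.
  have := @Rintegral_itvB R (fun x => g x * h x) (BRight K) (BRight b) a (igh K b).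
  by rewrite !bnd_simp => /(_ Ka ab) <-; rewrite subrKC.
rewrite big_ord_recr/= E1 -/a -/b.
set S := \sum_(i < m) _; set I1 := (\int[leb]_(x in `]K, a]) _)%R.
set I2 := (\int[leb]_(x in `]a, b]) _)%R; set I3 := (\int[leb]_(x in `]a, b]) _)%R.
have E2 : I2 - g a * I3 = (\int[leb]_(x in `]a, b]) ((g x - g a) * h x))%R.
  rewrite /I2 /I3 -RintegralZl// -RintegralB//; last first.
    apply: mul_bdens_integrable => //; apply: itv_integrable => z; exact: cvg_cst.
  by apply: eq_Rintegral => x _; rewrite mulrBl.
have B2 : `|I2 - g a * I3| <= e * C * w.
  have -> : e * C * w = e * C * fine (leb `]a, b]%classic).
    by rewrite fine_itv// /a /b -natr1; congr (_ * _); ring.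
  rewrite E2; apply: Rintegral_norm_le => //.
    apply: mul_bdens_integrable => //; apply: itv_integrable => z.
    by apply: cvgB; [exact: cg|exact: cvg_cst].
  move=> x; rewrite /= in_itv/= => xab; have [_ /(_ x) /andP[h0 hC]] := bh.
  by rewrite normrM (ger0_norm h0); apply: ler_pM => //; exact: He.
have -> : I1 + I2 - (S + g a * I3) = (I1 - S) + (I2 - g a * I3) by ring.
apply: le_trans (ler_normD _ _) _.
have := IH (ltnW mM); rewrite -/a -/I1 -/S -natr1 => H.
have -> : e * C * ((m%:R + 1) * w) = e * C * (m%:R * w) + e * C * w by ring.
exact: lerD.
Qed.

Lemma cvg_eps (u : nat -> R) (l : R) : (forall e, 0 < e -> \forall n \near \oo, `|u n - l| <= e) ->
  u @ \oo --> l.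
Proof.
by move=> H; apply/cvgrPdist_le => e e0; apply: filterS (H e e0) => n; rewrite distrC.
Qed.

Lemma cvg_big_ord m (u : 'I_m -> nat -> R) (l : 'I_m -> R) :
  (forall i, u i @ \oo --> l i) -> \sum_(i < m) u i n @[n --> \oo] --> \sum_(i < m) l i.
Proof.
elim: m u l => [|m IH] u l ul.
  by rewrite big_ord0; under eq_fun do rewrite big_ord0; exact: cvg_cst.
rewrite big_ord_recr; under eq_fun do rewrite big_ord_recr.
by apply: cvgD; [apply: IH => i; exact: ul|exact: ul].
Qed.

Lemma weak_continuous (g : R -> R) (K : R) : continuous g -> 0 <= K ->
  (\int[leb]_(x in `](- K), K]) (g x * fn n x))%R @[n --> \oo] -->
  (\int[leb]_(x in `](- K), K]) (g x * f x))%R.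
Proof.
move=> cg K0; apply: cvg_eps => e e0.
(* Makes the error [2 K C e'] of a Riemann sum at most [e / 4]; the summands [1] only avoid dividing
   by zero. *)
pose e' := e / (4 * (C + 1) * (2 * K + 1)).
have C1 : 0 < C + 1 by rewrite ltr_wpDl.
have K1 : 0 < 2 * K + 1 by rewrite ltr_wpDl// mulr_ge0.
have e'0 : 0 < e' by rewrite divr_gt0// !mulr_gt0.
have [d d0 Hd] := heine (- K) K cg e'0.
have [M hM] : exists M : nat, 2 * K / d < M.+1%:R.
  by exists (Num.truncn (2 * K / d)); rewrite Num.Theory.truncnS_gt.
pose w := 2 * K / M.+1%:R.
have w0 : 0 <= w by rewrite divr_ge0// mulr_ge0.
have wd : w < d by rewrite /w ltr_pdivrMr// (mulrC d) -ltr_pdivrMr.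
have wM : - K + M.+1%:R * w = K by rewrite /w; field; rewrite gt_eqF// -natr1 addrC.
have He i x : (i < M.+1)%N -> - K + i%:R * w < x <= - K + i.+1%:R * w -> `|g x - g (- K + i%:R * w)| <= e'.
  move=> iM /andP[x1 x2]; apply: Hd.
    have i0 : 0 <= i%:R * w by rewrite mulr_ge0.
    have iw : i.+1%:R * w <= M.+1%:R * w by rewrite ler_wpM2r// ler_nat.
    by rewrite in_itv/=; apply/andP; split; lra.
  rewrite ger0_norm; last by rewrite subr_ge0 ltW.
  move: x2; rewrite -natr1 mulrDl mul1r; lra.
pose S (h : R -> R) := \sum_(i < M.+1) g (- K + i%:R * w) * (\int[leb]_(x in `](- K + i%:R * w)%R, (- K + i.+1%:R * w)%R]) h x)%R.
have Sb h : bdens C h -> `|(\int[leb]_(x in `](- K), K]) (g x * h x))%R - S h| <= e / 4.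
  move=> bh; have := riemann_bound bh cg w0 He (leqnn M.+1); rewrite wM => /le_trans; apply.
  have -> : M.+1%:R * w = 2 * K by lra.
  have : e' * (4 * (C + 1) * (2 * K + 1)) = e by rewrite /e' divfK// gt_eqF// !mulr_gt0.
  have : 0 <= e' * K by rewrite mulr_ge0// ltW.
  have : 0 <= e' * C by rewrite mulr_ge0// ltW.
  nra.
have Sc : S (fn n) @[n --> \oo] --> S f.
  apply: cvg_big_ord => i; apply: cvgM; first exact: cvg_cst.
  by apply: fn_f; rewrite lerD2l ler_wpM2r// ler_nat.
have e40 : 0 < e / 4 by rewrite divr_gt0.
have := cvg_dist_le Sc e40; apply: filterS => n Sn.
have := Sb _ (bfn n); have := Sb _ bf; move: Sn.
set a := S _; set b := S _; set c := (Rintegral _ _ _); set c' := (Rintegral _ _ _).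
by rewrite !ler_norml => /andP[? ?] /andP[? ?] /andP[? ?]; apply/andP; split; lra.
Qed.

(* Approximation in [L^1] preserves weak-star convergence, the densities being bounded. *)
Lemma weak_closure (D : set R) (g : R -> R) : measurable D -> leb.-integrable D (EFin \o g) ->
  (forall e : R, 0 < e -> exists h : R -> R, [/\ leb.-integrable D (EFin \o h),
    (\int[leb]_(x in D) `|g x - h x|)%R <= e &
    (\int[leb]_(x in D) (h x * fn n x))%R @[n --> \oo] --> (\int[leb]_(x in D) (h x * f x))%R]) ->
  (\int[leb]_(x in D) (g x * fn n x))%R @[n --> \oo] --> (\int[leb]_(x in D) (g x * f x))%R.
Proof.
move=> mD ig H; apply: cvg_eps => e e0.
have C1 : 0 < C + 1 by rewrite ltr_wpDl.
have e40 : 0 < e / 4 by rewrite divr_gt0.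
have [h [ih gh hc]] := H (e / 4 / (C + 1)) (divr_gt0 e40 C1).
have igh : leb.-integrable D (EFin \o (fun x => g x - h x)).
  rewrite (_ : EFin \o _ = (EFin \o g) \- (EFin \o h))%E; last by apply/funext => x /=; rewrite EFinB.
  exact: integrableB.
have inorm : leb.-integrable D (EFin \o (fun x => `|g x - h x|)).
  rewrite (_ : EFin \o _ = abse \o (EFin \o (fun x => g x - h x))); last exact/funext.
  exact: integrable_abse.
have bd k : bdens C k -> `|(\int[leb]_(x in D) (g x * k x))%R - (\int[leb]_(x in D) (h x * k x))%R| <= e / 4.
  move=> bk; rewrite -RintegralB//; try exact: mul_bdens_integrable.
  have iP := mul_bdens_integrable mD bk igh.
  have -> : (\int[leb]_(x in D) (g x * k x - h x * k x))%R = (\int[leb]_(x in D) ((g x - h x) * k x))%R.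
    by apply: eq_Rintegral => x _; rewrite mulrBl.
  apply: (le_trans (@le_normr_Rintegral _ _ _ leb D _ mD iP)).
  apply: (@le_trans _ _ (\int[leb]_(x in D) (C * `|g x - h x|))%R).
    apply: le_Rintegral => //.
    - rewrite (_ : EFin \o _ = abse \o (EFin \o (fun x => (g x - h x) * k x))); last exact/funext.
      exact: integrable_abse.
    - by under [X in _.-integrable _ X]eq_fun do rewrite /= EFinM; exact: integrableZl.
    - move=> x _; have [_ /(_ x) /andP[k0 kC]] := bk.
      by rewrite normrM (ger0_norm k0) mulrC ler_wpM2r.
  rewrite RintegralZl//; apply: (@le_trans _ _ ((C + 1) * (e / 4 / (C + 1)))); last first.
    by rewrite mulrC divfK// gt_eqF.
  apply: ler_pM => //; last by lra.
  by apply: Rintegral_ge0.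
have := cvg_dist_le hc e40; apply: filterS => n hn.
have := bd _ (bfn n); have := bd _ bf; move: hn.
set a := (Rintegral _ _ _); set b := (Rintegral _ _ _); set c := (Rintegral _ _ _); set c' := (Rintegral _ _ _).
by rewrite !ler_norml => /andP[? ?] /andP[? ?] /andP[? ?]; apply/andP; split; lra.
Qed.

Lemma weak_itv (g : R -> R) (K : R) : 0 <= K -> leb.-integrable `](- K), K] (EFin \o g) ->
  (\int[leb]_(x in `](- K), K]) (g x * fn n x))%R @[n --> \oo] -->
  (\int[leb]_(x in `](- K), K]) (g x * f x))%R.
Proof.
move=> K0 ig; apply: weak_closure => // e e0.
have [h_ [ch ih]] := @approximation_continuous_integrable R `](- K), K]%classic g (measurable_itv _) (itv_fin _ _) ig.
move=> /fine_cvgP[_ /(@cvg_dist_le R)] /(_ e e0) [n _ /(_ n (leqnn _))] /= hn.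
exists (h_ n); split => //; last exact: weak_continuous.
by move: hn; rewrite subr0; apply: le_trans (ler_norm _).
Qed.

(** Truncation to []-k, k]] converges in [L^1] by dominated convergence, which reduces the line to
    bounded intervals; there continuous functions are dense and are handled by Riemann sums. *)
Lemma weak_integrable (g : R -> R) : leb.-integrable setT (EFin \o g) ->
  (\int[leb]_x (g x * fn n x))%R @[n --> \oo] --> (\int[leb]_x (g x * f x))%R.
Proof.
move=> ig; apply: weak_closure => // e e0.
have mg : measurable_fun setT g by case/integrableP : ig => /measurable_EFinP.
pose Ek (k : nat) : set R := `](- k%:R)%R, k%:R]%classic.
pose gk k x := g x * \1_(Ek k) x.
have mgk k : measurable_fun setT (gk k).
  by apply: measurable_funM => //; apply: measurable_indic; exact: measurable_itv.
have gkE k (u : R -> R) : (\int[leb]_x (gk k x * u x))%R = (\int[leb]_(x in Ek k) (g x * u x))%R.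
  rewrite [RHS]Rintegral_mkcond; apply: eq_Rintegral => x _.
  rewrite patchE /gk indicE; case: ifP => _; first by rewrite mulr1.
  by rewrite mulr0 mul0r.
have igk k : leb.-integrable setT (EFin \o gk k).
  apply: (@le_integrable _ _ _ leb setT measurableT _ (EFin \o g)) => //.
    apply/measurable_EFinP; exact: mgk.
  move=> x _; rewrite /= lee_fin /gk normrM indicE.
  by case: (_ \in _); rewrite ?normr1 ?mulr1// normr0 mulr0.
have DC : (fun k => \int[leb]_x `|(gk k x)%:E - (g x)%:E|)%E @ \oo --> 0%E.
  have [] // := @dominated_convergence _ _ _ leb setT measurableT
    (fun k x => (gk k x)%:E) (EFin \o g) (fun x => `|g x|%:E).
  - by move=> k; apply/measurable_EFinP; exact: mgk.
  - by apply/measurable_EFinP; exact: mg.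
  - apply: aeW => x _; apply: cvg_EFin; first exact: nearW.
    apply: cvg_near_cst; exists (Num.truncn `|g x| + (Num.truncn `|x|).+1)%N => // k /= kx.
    have : `|x| < k%:R.
      apply: lt_le_trans (Num.Theory.truncnS_gt _) _; rewrite ler_nat.
      by apply: leq_trans kx; rewrite leq_addl.
    rewrite ltr_norml => /andP[h1 h2]; have xE : Ek k x by rewrite /Ek/= in_itv/= h1 ltW.
    by rewrite /gk indicE mem_set// mulr1.
  - rewrite (_ : (fun x => _) = abse \o (EFin \o g)); last exact/funext.
    exact: integrable_abse.
  - apply: aeW => x k _; rewrite lee_fin /gk normrM indicE.
    by case: (_ \in _); rewrite ?normr1 ?mulr1// normr0 mulr0.
move: DC => /fine_cvgP[_ /(@cvg_dist_le R)] /(_ e e0) [k _ /(_ k (leqnn _))] /= hk.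
exists (gk k); split => //.
  move: hk; rewrite subr0; apply: le_trans; apply: le_trans (ler_norm _).
  by rewrite /Rintegral; under eq_integral do rewrite distrC.
rewrite gkE; under eq_fun do rewrite gkE.
apply: weak_itv => //; exact: (integrableS measurableT).
Qed.

End WeakStar.

(** * The discrete Fokker-Planck equation *)

Section Esum.
Context {R : realType}.
Local Open Scope ereal_scope.

Lemma esumZl (T : choiceType) (c : R) (a : T -> \bar R) : (0 <= c)%R -> (forall i, 0 <= a i) ->
  \esum_(i in [set: T]) (c%:E * a i) = c%:E * \esum_(i in [set: T]) a i.
Proof.
move=> c0 a0; rewrite /esum -ereal_supZl//; last first.
  by apply/set0P; exists 0; exists set0; [exact: fsets_set0|rewrite fsbig_set0].
congr ereal_sup; apply/seteqP; split => [_ [A fA <-]|_ [_ [A fA <-] <-]].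
  by exists (\sum_(i \in A) a i); [exists A|rewrite ge0_mule_fsumr].
by exists A => //; rewrite ge0_mule_fsumr.
Qed.

Lemma esum_delta (T : choiceType) (j : T) (c : \bar R) : 0 <= c ->
  \esum_(i in [set: T]) (if i == j then c else 0) = c.
Proof.
move=> c0; rewrite -[RHS](@esum_set1 R _ j (fun=> c))// [RHS]esum_mkcond.
apply: eq_esum => i _; have [->|ij] := eqVneq i j; first by rewrite mem_set.
by rewrite memNset// => /= ij'; rewrite ij' eqxx in ij.
Qed.

Lemma exchange_esum (T1 T2 : choiceType) (a : T1 -> T2 -> \bar R) : (forall i j, 0 <= a i j) ->
  \esum_(i in [set: T1]) \esum_(j in [set: T2]) a i j =
  \esum_(j in [set: T2]) \esum_(i in [set: T1]) a i j.
Proof.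
move=> a0; rewrite !esum_esum//.
rewrite (@reindex_esum _ _ _ (setT `*`` (fun=> setT)) _ (fun x : T2 * T1 => (x.2, x.1)))//.
split => //; first by move=> [x1 x2] [y1 y2] _ _ /= [-> ->].
by move=> [x1 x2] _; exists (x2, x1).
Qed.

(** Only the two hats of the cell of [x] survive. A sum over target nodes thus becomes an
    interpolation at the transported point, which is the duality between the Fokker-Planck step and
    an averaging operator. *)
Lemma esum_interp (rho : R) (g : int -> R) (x : R) : (0 < rho)%R -> (forall i, 0 <= g i)%R ->
  \esum_(i in [set: int]) (g i * beta rho i x)%:E = (interp rho g x)%:E.
Proof.
move=> r0 g0; set j := Num.floor (x / rho).
have fj := floor_itv (x / rho).
have b0 i : (0 <= beta rho i x)%R by rewrite /beta le_max lexx.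
have bz i : i != j -> i != (j + 1)%R -> beta rho i x = 0%R.
  move=> ij ij1; rewrite /beta max_l// subr_le0.
  move: fj; rewrite -/j intrD => /andP[f1 f2].
  have [lt|gt|e] := ltgtP i j; last by rewrite e eqxx in ij.
    have : (i%:~R + 1 <= j%:~R :> R)%R by rewrite -(intrD _ _ 1) ler_int lezD1.
    move=> h; rewrite ger0_norm; lra.
  have : (j + 1 < i)%R by rewrite lt_neqAle eq_sym ij1/= lezD1.
  rewrite -lezD1 -(ler_int R) !intrD => h; rewrite ler0_norm; lra.
transitivity (\esum_(i in [set: int]) ((if i == j then (g j * beta rho j x)%:E else 0) +
   (if i == (j + 1)%R then (g (j + 1)%R * beta rho (j + 1) x)%:E else 0))).
  apply: eq_esum => i _; have [->|ij] := eqVneq i j.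
    by rewrite -[X in X == _]addr0 (inj_eq (addrI j)) /= adde0.
  have [->|ij1] := eqVneq i (j + 1)%R; first by rewrite add0e.
  by rewrite bz// mulr0 adde0.
rewrite esumD; last 2 first.
- by move=> i _; case: ifP => // _; rewrite lee_fin mulr_ge0.
- by move=> i _; case: ifP => // _; rewrite lee_fin mulr_ge0.
by rewrite !esum_delta ?lee_fin ?mulr_ge0// -EFinD.
Qed.

End Esum.

(** Even numbers enumerate the nonnegative integers, odd ones the negative integers. Sums and unions
    over [int] become series and unions over [nat] through this bijection. *)
Definition int_of (n : nat) : int := if odd n then Negz n./2 else Posz n./2.

Definition of_int (i : int) : nat := match i with Posz m => m.*2 | Negz m => m.*2.+1 end.

Lemma of_intK : cancel of_int int_of.
Proof.
by case=> m; rewrite /int_of /of_int /= ?odd_double /= ?doubleK ?uphalf_double.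
Qed.

Lemma int_ofK : cancel int_of of_int.
Proof.
move=> n; rewrite /int_of /of_int; case: ifPn => on.
  by rewrite -[in RHS](odd_double_half n) on.
by rewrite -[in RHS](odd_double_half n) (negbTE on).
Qed.

Section FloorFun.
Context {R : realType}.
Local Notation leb := (@lebesgue_measure R).

Lemma floor_preimage (i : int) : [set x : R | Num.floor x = i] = `[i%:~R, (i + 1)%:~R[%classic.
Proof.
apply/seteqP; split => x /=; rewrite in_itv/=; first by move=> <-; exact: floor_itv.
by move=> h; apply: floor_def.
Qed.

Lemma measurable_floor_fun d (U : measurableType d) (g : int -> U) :
  measurable_fun [set: R] (fun x => g (Num.floor x)).
Proof.
move=> _ Y mY; rewrite setTI.
have -> : (fun x : R => g (Num.floor x)) @^-1` Y =
    \bigcup_(n in [set n | Y (g (int_of n))]) [set x : R | Num.floor x = int_of n].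
  apply/seteqP; split => [x /= Yx|x [n /= Yn xn]]; last by rewrite xn.
  by exists (of_int (Num.floor x)); rewrite /= of_intK.
by apply: bigcup_measurable => n _; rewrite floor_preimage; exact: measurable_itv.
Qed.

Lemma measurable_floor_fun2 d (U : measurableType d) (g : int -> int -> U) :
  measurable_fun [set: R * R] (fun z => g (Num.floor z.1) (Num.floor z.2)).
Proof.
move=> _ Y mY; rewrite setTI.
have -> : (fun z : R * R => g (Num.floor z.1) (Num.floor z.2)) @^-1` Y =
    \bigcup_n \bigcup_(m in [set m | Y (g (int_of n) (int_of m))])
     ([set x : R | Num.floor x = int_of n] `*` [set x : R | Num.floor x = int_of m]).
  apply/seteqP; split => [[x y] /= Yx|[x y] [n _ [m /= Yn [/= -> ->]]]]//.
  by exists (of_int (Num.floor x)) => //; exists (of_int (Num.floor y)); rewrite /= !of_intK.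
apply: bigcup_measurable => n _; apply: bigcup_measurable => m _.
by apply: measurableX; rewrite floor_preimage; exact: measurable_itv.
Qed.

(** The index that [mdens] reads off [x]: the node whose half-open cell contains [x]. Integrals of
    functions of [nidx] reduce to sums over the nodes. *)
Definition nidx (rho x : R) : int := Num.floor (x / rho + 2^-1).

Variable rho : R.
Hypothesis rho_gt0 : 0 < rho.

Lemma nidx_itv x : xnode rho (nidx rho x) - rho / 2 <= x < xnode rho (nidx rho x) + rho / 2.
Proof.
have := floor_itv (x / rho + 2^-1); rewrite -/(nidx rho x) intrD => /andP[a b].
have xE : x = x / rho * rho by rewrite divfK// gt_eqF.
rewrite /xnode; set i := (nidx rho x)%:~R in a b *.
have a' : i * rho <= (x / rho + 2^-1) * rho by rewrite ler_pM2r.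
have b' : (x / rho + 2^-1) * rho < (i + 1) * rho by rewrite ltr_pM2r.
by move: a' b'; rewrite !mulrDl -xE => ? ?; apply/andP; split; lra.
Qed.

Lemma nidx_preimage (i : int) : [set x : R | nidx rho x = i] =
  `[xnode rho i - rho / 2, xnode rho i + rho / 2[%classic.
Proof.
apply/seteqP; split => x /=; rewrite in_itv/=; first by move=> <-; exact: nidx_itv.
rewrite /xnode => /andP[a b]; apply: floor_def; rewrite intrD.
have xE : x = x / rho * rho by rewrite divfK// gt_eqF.
apply/andP; split.
  by rewrite -(ler_pM2r rho_gt0) mulrDl -xE; lra.
by rewrite -(ltr_pM2r rho_gt0) !mulrDl -xE; lra.
Qed.

Lemma nidx_dist x : `|xnode rho (nidx rho x) - x| <= rho / 2.
Proof. have /andP[a b] := nidx_itv x; rewrite ler_norml; apply/andP; split; lra. Qed.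

Lemma measurable_nidx_fun d (U : measurableType d) (g : int -> U) :
  measurable_fun [set: R] (fun x => g (nidx rho x)).
Proof.
apply: (measurableT_comp (measurable_floor_fun g)).
by apply: measurable_funD => //; apply: measurable_funM.
Qed.

Lemma integral_nidx (g : int -> \bar R) (f : R -> \bar R) : (forall i, 0 <= g i)%E ->
  (forall x, 0 <= f x)%E -> measurable_fun [set: R] f ->
  (\int[leb]_x (g (nidx rho x) * f x) =
   \esum_(i in [set: int]) (g i * \int[leb]_(x in [set x | nidx rho x = i]) f x))%E.
Proof.
move=> g0 f0 mf.
pose F n : set R := [set x | nidx rho x = int_of n].
have mF n : measurable (F n) by rewrite /F nidx_preimage; exact: measurable_itv.
have UF : \bigcup_n F n = setT.
  by apply/seteqP; split => x // _; exists (of_int (nidx rho x)) => //; rewrite /F/= of_intK.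
have tF : trivIset setT F.
  apply/trivIsetP => n m _ _ nm; apply/seteqP; split => x //= []; rewrite /F/= => -> h.
  by move: nm; rewrite -(int_ofK n) h int_ofK eqxx.
have mgf : measurable_fun setT (fun x => g (nidx rho x) * f x)%E.
  by apply: emeasurable_funM => //; exact: measurable_nidx_fun.
have := @ge0_integral_bigcup _ _ _ leb F (fun x => g (nidx rho x) * f x)%E mF.
rewrite /= UF => /(_ mgf) ->//; last by move=> x _; rewrite mule_ge0.
rewrite nneseries_esumT; last by move=> n; apply: integral_ge0 => x _; rewrite mule_ge0.
rewrite [RHS](@reindex_esum _ _ _ setT setT int_of); last first.
  split => //; first by move=> n m _ _ /(can_inj int_ofK).
  by move=> i _; exists (of_int i) => //; rewrite of_intK.
apply: eq_esum => n _; rewrite -/(F n).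
transitivity (\int[leb]_(x in F n) (g (int_of n) * f x))%E.
  by apply: eq_integral => x; rewrite inE /F/= => ->.
have mfn : measurable_fun (F n : set R) f by exact: measurable_funTS.
by rewrite (@ge0_integralZl _ _ _ leb (F n) (mF n) f mfn).
Qed.

Lemma leb_nidx (i : int) : leb [set x | nidx rho x = i] = rho%:E.
Proof.
have lt : xnode rho i - rho / 2 < xnode rho i + rho / 2.
  by rewrite ltrD2l -subr_gt0 opprK -splitr.
by rewrite nidx_preimage lebesgue_measure_itv/= lte_fin lt -EFinB; congr EFin; lra.
Qed.

Lemma integral_nidx_cst (g : int -> \bar R) : (forall i, 0 <= g i)%E ->
  (\int[leb]_x g (nidx rho x) = \esum_(i in [set: int]) (g i * rho%:E))%E.
Proof.
move=> g0; transitivity (\int[leb]_x (g (nidx rho x) * (cst 1%E x)))%E.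
  by apply: eq_integral => x _; rewrite mule1.
rewrite integral_nidx//; apply: eq_esum => i _.
have mi : measurable ([set x | nidx rho x = i] : set R).
  by rewrite nidx_preimage; exact: measurable_itv.
by rewrite integral_cst//; congr (_ * _)%E; rewrite mul1e; exact: leb_nidx.
Qed.

End FloorFun.

(** * Sums of hats over separated points *)

Section HatSums.
Context {R : realType}.

Definition hat (y : R) : R := Num.max 0 (1 - `|y|).

Lemma hat_ge0 y : 0 <= hat y. Proof. by rewrite /hat le_max lexx. Qed.

Lemma hat_le1 y : hat y <= 1.
Proof. by rewrite /hat ge_max ler01/= gerBl. Qed.

Lemma hat_far y s : s <= 1 -> s <= `|y| -> hat y <= 1 - s.
Proof. by move=> s1 sy; rewrite /hat ge_max subr_ge0 s1/= lerD2l lerN2. Qed.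

Lemma hat_pair y y' s : s <= 1 -> y <= 0 -> 0 <= y' -> s <= y' - y -> hat y + hat y' <= 2 - s.
Proof.
move=> s1 y0 y'0 g; rewrite /hat (ler0_norm y0) (ger0_norm y'0).
by case: (leP 0 (1 - - y)) => ?; case: (leP 0 (1 - y')) => ?; lra.
Qed.

(* For [s >= 2/3] at most five consecutive points of an [s]-separated sequence
   meet the support of the hat. *)
Lemma hat5 s (y1 y2 y3 y4 y5 : R) : 0 <= s <= 1 -> s <= y2 - y1 -> s <= y3 - y2 -> s <= y4 - y3 -> s <= y5 - y4 ->
  hat y1 + hat y2 + hat y3 + hat y4 + hat y5 <= 1 + 4 * (1 - s).
Proof.
move=> /andP[s0 s1] g1 g2 g3 g4.
have farp y : s <= y -> hat y <= 1 - s by move=> h; apply: hat_far => //; apply: le_trans h (ler_norm _).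
have farn y : y <= - s -> hat y <= 1 - s.
  by move=> h; apply: hat_far => //; rewrite -normrN; apply: le_trans (ler_norm _); lra.
(* The cases locate [0] among the points. The pair around [0] contributes at most [2 - s] and the
   three others [1 - s] each, in total [1 + 4 (1 - s)]. If all points lie on one side, the nearest
   contributes at most [1] and the four others [1 - s] each. *)
have [h1|h1] := leP y5 0.
  have := hat_le1 y5.
  have := farn y1; have := farn y2; have := farn y3; have := farn y4.
  by do 4!(move=> /(_ ltac:(lra)) ?); lra.
have [h2|h2] := leP y4 0.
  have := hat_pair s1 h2 (ltW h1) g4; have := farn y1; have := farn y2; have := farn y3.
  by do 3!(move=> /(_ ltac:(lra)) ?); lra.
have [h3|h3] := leP y3 0.
  have := hat_pair s1 h3 (ltW h2) g3; have := farn y1; have := farn y2; have := farp y5.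
  by do 3!(move=> /(_ ltac:(lra)) ?); lra.
have [h4|h4] := leP y2 0.
  have := hat_pair s1 h4 (ltW h3) g2; have := farn y1; have := farp y4; have := farp y5.
  by do 3!(move=> /(_ ltac:(lra)) ?); lra.
have [h5|h5] := leP y1 0.
  have := hat_pair s1 h5 (ltW h4) g1; have := farp y3; have := farp y4; have := farp y5.
  by do 3!(move=> /(_ ltac:(lra)) ?); lra.
have := hat_le1 y1.
have := farp y2; have := farp y3; have := farp y4; have := farp y5.
by do 4!(move=> /(_ ltac:(lra)) ?); lra.
Qed.

Lemma esum_hat (y : int -> R) (s : R) : 2 / 3 <= s <= 1 -> (forall j, s <= y (j + 1) - y j) ->
  (\esum_(j in [set: int]) (hat (y j))%:E <= (1 + 4 * (1 - s))%:E)%E.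
Proof.
move=> /andP[s23 s1] gap; have s0 : 0 <= s by lra.
have [[j0 hj0]|allz] := pselect (exists j, hat (y j) != 0); last first.
  rewrite esum1 ?lee_fin; first lra.
  by move=> j _; congr EFin; apply/eqP/negP => /negP h; apply: allz; exists j.
have yj0 : `|y j0| < 1.
  by rewrite ltNge; apply: contra hj0 => h; rewrite /hat max_l// subr_le0.
have up (i : int) (n : nat) : n%:R * s <= y (i + n%:Z) - y i.
  elim: n => [|n IH]; first by rewrite mul0r addr0 subrr.
  have := gap (i + n%:Z); rewrite -addrA -[n%:Z + 1]/(n%:Z + 1%:Z) -PoszD addn1 -natr1 mulrDl mul1r; lra.
(* [3 s >= 2] is the full width of the support of the hat, so points with indices three apart cannot
   both contribute. *)
have up3 (i j : int) : i + 3 <= j -> 2 <= y j - y i.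
  move=> ij; have -> : j = i + (`|j - i|%N : int) by rewrite gez0_abs ?subrKC// subr_ge0; lia.
  apply: le_trans (up i `|j - i|%N).
  have : (3 <= `|j - i|%N)%N by lia.
  rewrite -(ler_nat R) => h; apply: (@le_trans _ _ (3 * s)); first lra.
  by rewrite ler_wpM2r.
have far j : j != j0 -> j != j0 + 1 -> j != j0 - 1 -> j != j0 + 2 -> j != j0 - 2 -> hat (y j) = 0.
  move=> *; have [h|h] : (j0 + 3 <= j \/ j + 3 <= j0)%R by lia.
    have := up3 _ _ h; move: yj0; rewrite ltr_norml => /andP[? ?] ?.
    by rewrite /hat max_l// subr_le0; apply: le_trans (ler_norm _); lra.
  have := up3 _ _ h; move: yj0; rewrite ltr_norml => /andP[? ?] ?.
  by rewrite /hat max_l// subr_le0 -normrN; apply: le_trans (ler_norm _); lra.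
pose D (k : int) (j : int) : \bar R := if j == k then (hat (y k))%:E else 0%E.
have D0 k j : (0 <= D k j)%E by rewrite /D; case: ifP => // _; rewrite lee_fin hat_ge0.
have Ds k : (\esum_(j in [set: int]) D k j = (hat (y k))%:E)%E.
  by rewrite /D esum_delta// lee_fin hat_ge0.
apply: (@le_trans _ _ (\esum_(j in [set: int]) (D (j0 - 2)%R j + D (j0 - 1)%R j + D j0 j + D (j0 + 1)%R j + D (j0 + 2)%R j))%E).
  apply: le_esum => j _.
  have [->|n0] := eqVneq j j0.
    by rewrite {3}/D eqxx -2!addeA addeC -!addeA leeDl// !adde_ge0.
  have [->|n1] := eqVneq j (j0 + 1).
    by rewrite {4}/D eqxx -addeA addeC -addeA leeDl// !adde_ge0.
  have [->|n2] := eqVneq j (j0 - 1).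
    by rewrite {2}/D eqxx -3!addeA addeC -!addeA leeDl// !adde_ge0.
  have [->|n3] := eqVneq j (j0 + 2).
    by rewrite {5}/D eqxx addeC leeDl// !adde_ge0.
  have [->|n4] := eqVneq j (j0 - 2).
    by rewrite {1}/D eqxx -!addeA leeDl// !adde_ge0.
  by rewrite far// !adde_ge0.
rewrite !esumD//; try (by move=> *; rewrite ?adde_ge0).
rewrite !Ds -!EFinD lee_fin; apply: hat5; rewrite ?s0 ?s1//.
- by have := gap (j0 - 2); have -> : j0 - 2 + 1 = j0 - 1 by lia.
- by have := gap (j0 - 1); rewrite subrK.
- by have := gap (j0 + 1); have -> : j0 + 1 + 1 = j0 + 2 by lia.
Qed.

End HatSums.

(** * The Markov chain on the nodes and the bound on its masses *)

Section Chain.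
Context {R : realType}.
Variables (rho : R) (Pp Pm : nat -> int -> R) (mg : nat -> int -> \bar R).
Hypothesis rho_gt0 : 0 < rho.
Hypothesis mg0_ge0 : forall i, (0 <= mg 0%N i)%E.
Hypothesis mg0_sum : (\esum_(i in [set: int]) mg 0%N i = 1)%E.
Hypothesis mgS : forall k i, mg k.+1 i =
  (\esum_(j in [set: int]) ((2^-1 * (beta rho i (Pp k j) + beta rho i (Pm k j)))%:E * mg k j))%E.

Let b0 i x : 0 <= beta rho i x. Proof. by rewrite /beta le_max lexx. Qed.

Lemma mg_ge0 k i : (0 <= mg k i)%E.
Proof.
case: k => [//|k]; rewrite mgS; elim: k i => [|k IH] i; apply: esum_ge0 => j _;
  by rewrite mule_ge0 ?lee_fin ?mulr_ge0 ?addr_ge0//; rewrite mgS.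
Qed.

(** The transition operator acting on functions; the recursion [mgS] is its transpose, acting on
    masses. *)
Definition chain_op k (g : int -> R) (j : int) : R :=
  2^-1 * (interp rho g (Pp k j) + interp rho g (Pm k j)).

Lemma chain_op_ge0 k g : (forall i, 0 <= g i) -> forall j, 0 <= chain_op k g j.
Proof.
move=> g0 j; have h x : 0 <= interp rho g x by rewrite -(interp_cst rho 0 x) interp_le.
by rewrite mulr_ge0// addr_ge0.
Qed.

Let fin_of_sum k : (\esum_(i in [set: int]) mg k i = 1)%E -> forall i, mg k i \is a fin_num.
Proof.
move=> s1 i; rewrite ge0_fin_numE ?mg_ge0//; apply: (@le_lt_trans _ _ 1%E); last exact: ltry.
rewrite -s1 -[leLHS](@esum_set1 R _ i (mg k)) ?mg_ge0//.
rewrite [leLHS]esum_mkcond; apply: le_esum => j _.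
by case: ifP => // _; exact: mg_ge0.
Qed.

Let stepE k (g : int -> R) : (forall i, mg k i \is a fin_num) -> (forall i, 0 <= g i) ->
  (\esum_(i in [set: int]) ((g i)%:E * mg k.+1 i) =
   \esum_(j in [set: int]) ((chain_op k g j)%:E * mg k j))%E.
Proof.
move=> fin g0.
transitivity (\esum_(i in [set: int]) \esum_(j in [set: int])
   (((fine (mg k j) * 2^-1) * (g i * beta rho i (Pp k j) + g i * beta rho i (Pm k j)))%:E))%E.
  apply: eq_esum => i _; rewrite mgS -esumZl//; last first.
    by move=> j; rewrite mule_ge0 ?mg_ge0// lee_fin mulr_ge0 ?addr_ge0.
  apply: eq_esum => j _; rewrite -[in LHS](fineK (fin j)) -!EFinM; congr EFin; ring.
have f0 j : 0 <= fine (mg k j) by rewrite fine_ge0// mg_ge0.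
rewrite exchange_esum; last by move=> i j; rewrite lee_fin !mulr_ge0// addr_ge0// mulr_ge0.
apply: eq_esum => j _; under eq_esum do rewrite EFinM.
rewrite esumZl; [|by rewrite mulr_ge0|by move=> i; rewrite lee_fin addr_ge0// mulr_ge0].
under eq_esum do rewrite EFinD.
rewrite esumD; [|by move=> i _; rewrite lee_fin mulr_ge0|by move=> i _; rewrite lee_fin mulr_ge0].
rewrite !esum_interp// -[in RHS](fineK (fin j)) -EFinD -!EFinM; congr EFin; rewrite /chain_op; ring.
Qed.

(** Duality tested on the constant [1], which interpolation preserves. Duality itself requires
    finite masses at level [k], and these follow from the total mass at that level, so the induction
    carries both. *)
Lemma mg_sum k : (\esum_(i in [set: int]) mg k i = 1)%E.
Proof.
elim: k => // k IH; have := @stepE k (fun=> 1) (fin_of_sum IH) (fun=> ler01).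
under eq_esum do rewrite mul1e.
move=> ->; rewrite -[RHS]IH; apply: eq_esum => j _.
by rewrite /chain_op !interp_cst -[1 + 1]/(2%:R) mulVf ?mul1e// pnatr_eq0.
Qed.

Lemma mg_fin k i : mg k i \is a fin_num. Proof. exact: fin_of_sum (mg_sum k) i. Qed.

Lemma mg_step k (g : int -> R) : (forall i, 0 <= g i) ->
  (\esum_(i in [set: int]) ((g i)%:E * mg k.+1 i) =
   \esum_(j in [set: int]) ((chain_op k g j)%:E * mg k j))%E.
Proof. by move=> g0; apply: stepE => // i; exact: mg_fin. Qed.

(* If the nodes are transported to points [s * rho] apart, the hats
   [beta_i] evaluated at these points add up to at most [1 + 4 (1 - s)]. *)
Lemma mg_bound (B s : R) (N : nat) : 2 / 3 <= s <= 1 -> (forall i, mg 0%N i <= B%:E)%E ->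
  (forall k j, (k < N)%N -> s * rho <= Pp k (j + 1) - Pp k j) ->
  (forall k j, (k < N)%N -> s * rho <= Pm k (j + 1) - Pm k j) ->
  forall k, (k <= N)%N -> forall i, (mg k i <= (B * (1 + 4 * (1 - s)) ^+ k)%:E)%E.
Proof.
move=> ss mB gp gm; elim=> [_ i|k IH kN i]; first by rewrite expr0 mulr1.
have {}IH := IH (ltnW kN); set Bk := B * _ in IH.
have Bk0 : 0 <= Bk by rewrite -lee_fin; apply: le_trans (mg_ge0 k 0) (IH 0).
have hatE (P : int -> R) : (forall j, s * rho <= P (j + 1) - P j) ->
  (\esum_(j in [set: int]) (beta rho i (P j))%:E <= (1 + 4 * (1 - s))%:E)%E.
  move=> gP; apply: (@esum_hat R (fun j => P j / rho - i%:~R)) => // j.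
  by rewrite opprB addrA subrK -mulrBl ler_pdivlMr.
rewrite mgS; apply: (@le_trans _ _ (\esum_(j in [set: int]) ((Bk / 2)%:E * ((beta rho i (Pp k j))%:E + (beta rho i (Pm k j))%:E)))%E).
  apply: le_esum => j _; rewrite -EFinD -EFinM.
  apply: le_trans (lee_pmul _ _ (lexx _) (IH j)) _; rewrite ?mg_ge0 ?lee_fin ?mulr_ge0 ?addr_ge0//.
  by rewrite mulrAC (mulrC 2^-1).
rewrite esumZl; [|by rewrite divr_ge0|by move=> j; rewrite -EFinD lee_fin addr_ge0].
rewrite esumD; [|by move=> j _; rewrite lee_fin|by move=> j _; rewrite lee_fin].
have -> : (B * (1 + 4 * (1 - s)) ^+ k.+1)%:E = ((Bk / 2)%:E * ((1 + 4 * (1 - s))%:E + (1 + 4 * (1 - s))%:E))%E.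
  by rewrite -EFinD -EFinM; congr EFin; rewrite /Bk exprSr; field.
apply: lee_wpmul2l; first by rewrite lee_fin divr_ge0.
by apply: leeD; apply: hatE => j; [exact: gp|exact: gm].
Qed.

End Chain.

(** * Regularity of the discrete value function and of its mollified gradient *)

Section SchemeValue.
Context {R : realType}.
Local Notation leb := (@lebesgue_measure R).

(** Explicit constants replace existential ones: every estimate below is expressed through them and
    is thereby uniform along a sequence of schemes. [K] is a support radius common to [m0] and
    [phi]. *)
Record mfg_data (T : R) (sigma : R -> R) (F G : R -> probability R R -> R) (phi m0 : R -> R)
    (C S K C0 : R) : Prop := MfgData {
  T_gt0 : 0 < T;
  sigma_cont : {within `[0%R, T]%classic, continuous sigma};
  sigma_bnd : forall t, 0 <= t <= T -> `|sigma t| <= S;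
  F_C2 : forall m, P1 m -> C2_bounded (F^~ m) C;
  G_C2 : forall m, P1 m -> C2_bounded (G^~ m) C;
  F_cont : cont_RP1 F;
  G_cont : cont_RP1 G;
  m0_meas : measurable_fun setT m0;
  m0_ge0 : forall x, 0 <= m0 x;
  m0_bnd : {ae leb, forall x, m0 x <= C0};
  m0_supp : forall x, K < `|x| -> m0 x = 0;
  m0_int : (\int[leb]_x (m0 x)%:E = 1)%E;
  phi_smooth : smooth phi;
  phi_supp : forall x, K < `|x| -> phi x = 0;
  phi_ge0 : forall x, 0 <= phi x;
  phi_int : (\int[leb]_x (phi x)%:E = 1)%E;
  C_pos : 0 <= C; K_gt0 : 0 < K; C0_gt0 : 0 < C0 }.

Record mfg_scheme (T : R) (sigma : R -> R) (F G : R -> probability R R -> R) (phi m0 : R -> R)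
    (rho h eps : R) (N : nat) (mu : R -> probability R R) : Prop := MfgScheme {
  rho_gt0 : 0 < rho; h_gt0 : 0 < h; eps_gt0 : 0 < eps;
  NhT : N%:R * h = T;
  mu_P1 : forall t, 0 <= t <= T -> P1 (mu t);
  mu_sol : discrete_mfg_solution T rho h eps N sigma F G phi m0 mu }.

Variables (T : R) (sigma : R -> R) (F G : R -> probability R R -> R) (phi m0 : R -> R)
  (C S K C0 : R) (rho h eps : R) (N : nat) (mu : R -> probability R R).
Hypothesis D : mfg_data T sigma F G phi m0 C S K C0.
Hypothesis P : mfg_scheme T sigma F G phi m0 rho h eps N mu.

Local Notation w := (vgrid rho h N sigma F G mu).

(** One constant serves as bound, Lipschitz constant and semiconcavity constant. The factor [2]
    comes from second differences estimated by two Taylor remainders, the factor [1 + T] from the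
    accumulated running cost. *)
Definition cstL : R := 2 * C * (1 + T).
Local Notation L := cstL.

Let r0 := rho_gt0 P.
Let h0 := h_gt0 P.

Lemma cstL_ge0 : 0 <= L.
Proof. by rewrite /cstL !mulr_ge0 ?(C_pos D)// addr_ge0// ltW// (T_gt0 D). Qed.

Lemma tk_itv k : (k <= N)%N -> 0 <= tk h k <= T.
Proof.
by move=> kN; rewrite /tk -(NhT P) mulr_ge0 ?(ltW h0)//= ler_pM2r ?ler_nat.
Qed.

Let muk k (kN : (k <= N)%N) : P1 (mu (tk h k)) := mu_P1 P (tk_itv kN).

Let C2_le (f : R -> R) : C2_bounded f C ->
  [/\ forall i, `|f (xnode rho i)| <= 2 * C,
      forall i, `|f (xnode rho (i + 1)) - f (xnode rho i)| <= 2 * C * rho &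
      forall i, f (xnode rho (i + 1)) + f (xnode rho (i - 1)) - 2 * f (xnode rho i) <= 2 * C * rho ^+ 2].
Proof.
move=> [d1 [d2 [_ b]]]; have C0' := C_pos D; split=> i.
- by have [? _] := b (xnode rho i); lra.
- apply: (@le_trans _ _ (C * `|xnode rho (i + 1) - xnode rho i|)).
    by apply: derive_le_lip => // x; case: (b x) => _ [].
  rewrite xnodeD1 addrAC subrr add0r gtr0_norm//.
  by have := mulr_ge0 C0' (ltW r0); lra.
- rewrite xnodeD1 xnodeB1; apply: second_diff_le => // x; by case: (b x) => _ [].
Qed.

Lemma wN : w N = fun i => G (xnode rho i) (mu T).
Proof. by rewrite /vgrid subnn /= /tk (NhT P). Qed.

Lemma wS k : (k < N)%N -> w k = hjb_step rho h (sigma (tk h k))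
  (fun i => F (xnode rho i) (mu (tk h k))) (w k.+1).
Proof.
move=> kN; rewrite /vgrid -(subnSK kN) /=.
by have -> : (N - (N - k.+1).+1 = k)%N by lia.
Qed.

Let fC k (kN : (k < N)%N) := C2_le (F_C2 D (muk (ltnW kN))).
Let gC : [/\ forall i, `|w N i| <= 2 * C,
      forall i, `|w N (i + 1) - w N i| <= 2 * C * rho &
      forall i, w N (i + 1) + w N (i - 1) - 2 * w N i <= 2 * C * rho ^+ 2].
Proof.
have PT : P1 (mu T) by apply: (mu_P1 P); rewrite lexx ltW// (T_gt0 D).
by rewrite wN; exact: (C2_le (G_C2 D PT)).
Qed.

Lemma w_bnd k : (k <= N)%N -> forall i, `|w k i| <= L.
Proof.
case: gC => g1 g2 g3; apply: (hjb_iter_bnd r0 h0 (NhT P) wS) => // l /fC[] //.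
Qed.

Lemma w_lip k : (k <= N)%N -> forall i, `|w k (i + 1) - w k i| <= L * rho.
Proof.
case: gC => g1 g2 g3; apply: (hjb_iter_lip r0 h0 (NhT P) wS) => // l /fC[] //.
Qed.

Lemma w_semiconcave k : (k <= N)%N -> forall i, w k (i + 1) + w k (i - 1) - 2 * w k i <= L * rho ^+ 2.
Proof.
case: gC => g1 g2 g3; apply: (hjb_iter_semiconcave r0 h0 (NhT P) wS) => // l /fC[] //.
Qed.

Lemma w_time (A : R) k m i : 0 < A -> (k <= m)%N -> (m <= N)%N ->
  `|w k i - w m i| <= L ^+ 2 / A + (m - k)%:R * (h * (2 * C + L ^+ 2) + A * (h * S ^+ 2 + rho ^+ 2)).
Proof.
case: gC => g1 g2 g3 A0 km mN.
apply: (hjb_iter_time r0 h0 (NhT P) wS) => // l lN; try by case: (fC lN).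
by apply: (sigma_bnd D); apply: tk_itv; exact: ltnW.
Qed.

Local Notation Dv k := (Dveps rho h eps N sigma F G phi mu k).

Let cI k (kN : (k <= N)%N) := interp_continuous r0 (w_lip kN).

Lemma Dveps_bnd k : (k <= N)%N -> forall x, `|Dv k x| <= L.
Proof.
move=> kN x.
exact: (mollify_deriv_bnd (phi_smooth D) (phi_supp D) (phi_ge0 D) (phi_int D) (K_gt0 D) (eps_gt0 P)
  (cI kN) r0 (erefl _) (w_lip kN)).
Qed.

Lemma Dveps_shift k : (k <= N)%N -> forall x, Dv k (x + rho) - Dv k x <= L * rho.
Proof.
move=> kN x.
exact: (mollify_deriv_shift (phi_smooth D) (phi_supp D) (phi_ge0 D) (phi_int D) (K_gt0 D) (eps_gt0 P)
  (cI kN) r0 (erefl _) (w_semiconcave kN)).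
Qed.

Lemma Dveps_secant_right k : (k <= N)%N -> forall x m,
  interp rho (w k) (x + m%:R * rho) - interp rho (w k) x <=
  m%:R * rho * Dv k x + L * (m%:R * rho) ^+ 2 + 2 * L * (K * eps).
Proof.
move=> kN x m.
exact: (mollify_secant_right (phi_smooth D) (phi_supp D) (phi_ge0 D) (phi_int D) (K_gt0 D) (eps_gt0 P)
  (cI kN) r0 cstL_ge0 (erefl _) (w_lip kN) (w_semiconcave kN)).
Qed.

Lemma Dveps_secant_left k : (k <= N)%N -> forall x m,
  m%:R * rho * Dv k x - L * (m%:R * rho) ^+ 2 - 2 * L * (K * eps) <=
  interp rho (w k) x - interp rho (w k) (x - m%:R * rho).
Proof.
move=> kN x m.
exact: (mollify_secant_left (phi_smooth D) (phi_supp D) (phi_ge0 D) (phi_int D) (K_gt0 D) (eps_gt0 P)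
  (cI kN) r0 cstL_ge0 (erefl _) (w_lip kN) (w_semiconcave kN)).
Qed.

End SchemeValue.

Section ProbMean.
Context {R : realType}.
Implicit Types (nu : probability R R) (g : R -> R).

Definition mean nu g : R := (\int[nu]_x g x)%R.

Lemma prob_integrable nu g B : measurable_fun setT g -> (forall x, `|g x| <= B) ->
  nu.-integrable setT (EFin \o g).
Proof.
move=> mg gB; apply: measurable_bounded_integrable => //.
  by rewrite [X in (X < _)%E](_ : _ = 1%E) ?ltry//; exact: probability_setT.
by exists B; split; [exact: num_real|move=> M BM x _; exact: le_trans (gB x) (ltW BM)].
Qed.

Lemma mean_cst nu c : mean nu (fun=> c) = c.
Proof. by rewrite /mean Rintegral_cst// [X in fine X](_ : _ = 1%E) ?mulr1//; exact: probability_setT. Qed.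

Lemma meanZD nu a b g1 g2 B : measurable_fun setT g1 -> measurable_fun setT g2 ->
  (forall x, `|g1 x| <= B) -> (forall x, `|g2 x| <= B) ->
  mean nu (fun x => a * g1 x + b * g2 x) = a * mean nu g1 + b * mean nu g2.
Proof.
move=> m1 m2 b1 b2; have i1 := prob_integrable nu m1 b1; have i2 := prob_integrable nu m2 b2.
have bZ c g : (forall x, `|g x| <= B) -> forall x, `|c * g x| <= `|c| * B.
  by move=> gB x; rewrite normrM ler_wpM2l.
rewrite /mean RintegralD//; last 2 first.
- by apply: (prob_integrable nu _ (bZ a _ b1)); apply: measurable_funM.
- by apply: (prob_integrable nu _ (bZ b _ b2)); apply: measurable_funM.
by rewrite !RintegralZl.
Qed.

Lemma mean_le nu g1 g2 B : measurable_fun setT g1 -> measurable_fun setT g2 ->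
  (forall x, `|g1 x| <= B) -> (forall x, `|g2 x| <= B) -> (forall x, g1 x <= g2 x) ->
  mean nu g1 <= mean nu g2.
Proof.
move=> m1 m2 b1 b2 g12; apply: le_Rintegral => //.
- exact: prob_integrable m1 b1.
- exact: prob_integrable m2 b2.
Qed.

Lemma mean_dist nu g1 g2 B e : measurable_fun setT g1 -> measurable_fun setT g2 ->
  (forall x, `|g1 x| <= B) -> (forall x, `|g2 x| <= B) -> (forall x, `|g1 x - g2 x| <= e) ->
  `|mean nu g1 - mean nu g2| <= e.
Proof.
move=> m1 m2 b1 b2 ge; have -> : mean nu g1 - mean nu g2 = mean nu (fun x => g1 x - g2 x).
  have := meanZD nu 1 (-1) m1 m2 b1 b2; rewrite mul1r mulN1r => <-.
  by congr mean; apply/funext => x; rewrite mul1r mulN1r.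
have md : measurable_fun setT (fun x => g1 x - g2 x) by exact: measurable_funB.
have e0 : 0 <= e by exact: le_trans (ge 0).
have mm c : measurable_fun [set: R] (fun=> c : R) by exact: measurable_cst.
have be c : `|c| <= e -> forall x : R, `|(fun=> c) x| <= e by [].
rewrite ler_norml -(mean_cst nu (- e)) -{2}(mean_cst nu e).
apply/andP; split; apply: (@mean_le _ _ _ e) => // x.
- by rewrite normrN ger0_norm.
- by have := ge x; rewrite ler_norml => /andP[].
- by rewrite ger0_norm.
- by have := ge x; rewrite ler_norml => /andP[].
Qed.

End ProbMean.

(** * The discrete measures: bounded densities and duality at grid times *)

Section SchemeMeasure.
Context {R : realType}.
Local Notation leb := (@lebesgue_measure R).
Variables (T : R) (sigma : R -> R) (F G : R -> probability R R -> R) (phi m0 : R -> R)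
  (C S K C0 : R) (rho h eps : R) (N : nat) (mu : R -> probability R R).
Hypothesis D : mfg_data T sigma F G phi m0 C S K C0.
Hypothesis P : mfg_scheme T sigma F G phi m0 rho h eps N mu.

Local Notation L := (cstL T C).
Local Notation mg := (mgrid rho h eps N sigma F G phi m0 mu).
Local Notation Pp := (fun k j => Phi_plus rho h eps N sigma F G phi mu j k).
Local Notation Pm := (fun k j => Phi_minus rho h eps N sigma F G phi mu j k).
Local Notation dens := (mdens rho h eps N sigma F G phi m0 mu).
Local Notation Dv k := (Dveps rho h eps N sigma F G phi mu k).
Local Notation op := (chain_op rho Pp Pm).

Let r0 := rho_gt0 P.
Let h0 := h_gt0 P.
Let mm0 : measurable_fun [set: R] (fun x => (m0 x)%:E).
Proof. by apply/measurable_EFinP; exact: (m0_meas D). Qed.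
Let m0p x : (0 <= (m0 x)%:E)%E. Proof. by rewrite lee_fin (m0_ge0 D). Qed.

(** The closed cell of the scheme and the half-open one of [nidx] differ by an endpoint, a null
    set. *)
Lemma mg0E i : mg 0%N i = (\int[leb]_(x in [set x | nidx rho x = i]) (m0 x)%:E)%E.
Proof.
have m0oo : measurable_fun (`]xnode rho i - rho / 2, xnode rho i + rho / 2[%classic : set R) (fun x => (m0 x)%:E).
  exact: (measurable_funTS mm0).
transitivity (\int[leb]_(x in cell rho i) (m0 x)%:E)%E; first by [].
by rewrite nidx_preimage// /cell (integral_itv_bndoo true false m0oo) (integral_itv_bndoo true true m0oo).
Qed.

Lemma mgS k i : mg k.+1 i =
  (\esum_(j in [set: int]) ((2^-1 * (beta rho i (Pp k j) + beta rho i (Pm k j)))%:E * mg k j))%E.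
Proof. by []. Qed.

Lemma mg0_ge0 i : (0 <= mg 0%N i)%E.
Proof. by apply: integral_ge0 => x _; exact: m0p. Qed.

Lemma mg0_esum (g : int -> \bar R) : (forall i, 0 <= g i)%E ->
  (\esum_(i in [set: int]) (g i * mg 0%N i) = \int[leb]_x (g (nidx rho x) * (m0 x)%:E))%E.
Proof.
move=> g0; rewrite (integral_nidx r0 g0 m0p mm0); apply: eq_esum => i _; congr (_ * _)%E.
exact: mg0E.
Qed.

Lemma mg0_sum : (\esum_(i in [set: int]) mg 0%N i = 1)%E.
Proof.
have := @mg0_esum (fun=> 1%E) (fun=> lee01); under eq_esum do rewrite mul1e.
by move=> ->; under eq_integral do rewrite mul1e; exact: (m0_int D).
Qed.

Lemma mg0_le i : (mg 0%N i <= (C0 * rho)%:E)%E.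
Proof.
have mi : measurable ([set x | nidx rho x = i] : set R).
  by rewrite nidx_preimage//; exact: measurable_itv.
rewrite mg0E; apply: (@le_trans _ _ (\int[leb]_(x in [set x | nidx rho x = i]) (cst C0%:E) x)%E).
  apply: ae_ge0_le_integral => //.
  - exact: (measurable_funTS mm0).
  - by move=> x _; rewrite lee_fin ltW// (C0_gt0 D).
  - have := m0_bnd D; apply: filterS; first exact: (ae_filter_ringOfSetsType leb).
    by move=> x hx _; rewrite lee_fin.
rewrite integral_cst// EFinM; apply: lee_wpmul2l; first by rewrite lee_fin ltW// (C0_gt0 D).
by rewrite le_eqVlt; apply/orP; left; apply/eqP; exact: leb_nidx.
Qed.

Let mg_ge k i := mg_ge0 mg0_ge0 mgS k i.
Let mg_f k i := mg_fin r0 mg0_ge0 mg0_sum mgS k i.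

(** Makes the separation factor [1 - h L] at least [2 / 3], the threshold in the estimate of the
    sums of hats. *)
Hypothesis hL : h * L <= 3^-1.

Let gap k (j : int) : (k <= N)%N -> (1 - h * L) * rho <= rho - h * (Dv k (xnode rho (j + 1)) - Dv k (xnode rho j)).
Proof.
move=> kN; have := Dveps_shift D P kN (xnode rho j); rewrite xnodeD1 => H.
by rewrite mulrBl mul1r lerD2l lerN2 -mulrA ler_pM2l.
Qed.

Let Phi_diff (x d1 d2 s : R) : rho - h * (d1 - d2) <= x + rho - h * d1 + s - (x - h * d2 + s).
Proof. by rewrite le_eqVlt; apply/orP; left; apply/eqP; ring. Qed.

(** Semiconcavity keeps the images of neighbouring nodes [(1 - h L) rho] apart. The masses then grow
    by a factor at most [1 + 4 h L] per step, and [k] such factors stay below [exp (4 L T)] because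
    [k h <= T]. *)
Lemma mg_le k : (k <= N)%N -> forall i, (mg k i <= (C0 * expR (4 * L * T) * rho)%:E)%E.
Proof.
move=> kN i.
have hL0 : 0 <= h * L by rewrite mulr_ge0 ?(cstL_ge0 D)// ltW.
have ss : 2 / 3 <= 1 - h * L <= 1 by move: hL hL0; set x := h * L => ? ?; apply/andP; split; lra.
have gp l j : (l < N)%N -> (1 - h * L) * rho <= Pp l (j + 1) - Pp l j.
  by move=> lN; apply: le_trans (gap j (ltnW lN)) _; rewrite /Phi_plus xnodeD1; exact: Phi_diff.
have gm l j : (l < N)%N -> (1 - h * L) * rho <= Pm l (j + 1) - Pm l j.
  by move=> lN; apply: le_trans (gap j (ltnW lN)) _; rewrite /Phi_minus xnodeD1; exact: Phi_diff.
apply: le_trans (mg_bound r0 mg0_ge0 mgS ss mg0_le gp gm kN i) _.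
rewrite lee_fin [leRHS]mulrAC ler_wpM2l//; first by rewrite mulr_ge0 ?(ltW r0) ?(ltW (C0_gt0 D)).
have -> : 1 + 4 * (1 - (1 - h * L)) = 1 + 4 * (h * L) by ring.
apply: (@le_trans _ _ (expR (4 * (h * L)) ^+ k)).
  by rewrite lerXn2r ?nnegrE ?expR_ge0 ?expR_ge1Dx// addr_ge0// mulr_ge0.
rewrite -expRM_natl ler_expR.
have -> : k%:R * (4 * (h * L)) = 4 * L * (k%:R * h) by ring.
have L40 : 0 <= 4 * L by apply: mulr_ge0 => //; exact: (cstL_ge0 D).
by rewrite ler_wpM2l//; have /andP[] := tk_itv P kN.
Qed.

Definition cstD : R := C0 * expR (4 * L * T).

Lemma cstD_gt0 : 0 < cstD.
Proof. by rewrite mulr_gt0 ?(C0_gt0 D)// expR_gt0. Qed.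

Lemma floor_step k t : tk h k <= t -> t < tk h k.+1 -> Num.floor (t / h) = k%:Z.
Proof.
rewrite /tk => h1 h2; apply: floor_def.
by rewrite ler_pdivlMr// ltr_pdivrMr// -PoszD addn1 h1 h2.
Qed.

Lemma tk_cover t : 0 <= t <= T -> exists2 k, (k < N)%N & tk h k <= t <= tk h k.+1.
Proof.
move=> /andP[t0 tT].
have N0 : (0 < N)%N.
  by rewrite lt0n; apply/eqP => N0; have := T_gt0 D; rewrite -(NhT P) N0 mul0r ltxx.
have [tT'|tT'] := ltP t T; last first.
  exists N.-1; first by rewrite prednK.
  by rewrite prednK// /tk (NhT P) tT andbT (le_trans _ tT')// -(NhT P) ler_pM2r// ler_nat leq_pred.
have [k /andP[k1 k2]] := @floor_nat R (t / h) (divr_ge0 t0 (ltW h0)).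
have k1' : k%:R * h <= t by rewrite -ler_pdivlMr.
have k2' : t < k.+1%:R * h by rewrite -ltr_pdivrMr// -natr1.
exists k; last by rewrite /tk k1' ltW.
by rewrite -(ltr_nat R) -(ltr_pM2r h0) (NhT P); apply: le_lt_trans tT'.
Qed.

Let theta_itv t : 0 <= t -> 0 <= t / h - (`|Num.floor (t / h)|%N)%:R <= 1.
Proof.
move=> t0; have f0 : 0 <= Num.floor (t / h) by rewrite floor_ge0 divr_ge0// ltW.
have /andP[a b] := floor_itv (t / h).
have e : (`|Num.floor (t / h)|%N%:R : R) = (Num.floor (t / h))%:~R by rewrite -[in RHS](gez0_abs f0).
move: a b; rewrite e intrD subr_ge0 => -> /ltW; rewrite lerBlDl; by rewrite addrC.
Qed.

(** At [t = T] the index is [N] and level [N + 1], which lies beyond the range of the estimates,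
    receives weight zero. *)
Let kle t : 0 <= t <= T -> (`|Num.floor (t / h)|%N <= N)%N /\
  ((`|Num.floor (t / h)|%N < N)%N \/ t / h - (`|Num.floor (t / h)|%N)%:R = 0).
Proof.
move=> /andP[t0]; rewrite le_eqVlt => /orP[/eqP ->|tT].
  have -> : T / h = N%:R by rewrite -(NhT P) mulfK// gt_eqF.
  have -> : `|Num.floor (N%:R : R)|%N = N by rewrite -[N%:R]/(N%:Z%:~R) intrKfloor.
  by split => //; right; rewrite subrr.
have [|k kN] := @tk_cover t; first by rewrite t0 ltW.
move=> /andP[k1]; rewrite le_eqVlt => /orP[/eqP te|k2]; last by rewrite (floor_step k1 k2)/=; split; [exact: ltnW|left].
have e : t / h = k.+1%:R by rewrite te /tk mulfK// gt_eqF.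
rewrite e -[k.+1%:R]/(k.+1%:Z%:~R) intrKfloor /=; split => //; right; by rewrite subrr.
Qed.

Lemma dens_ge0 x t : 0 <= t -> 0 <= dens x t.
Proof.
move=> t0; have /andP[a b] := theta_itv t0.
have f0 l i : 0 <= fine (mg l i) by apply: fine_ge0; exact: mg_ge.
by rewrite /mdens mulr_ge0 ?invr_ge0 ?(ltW r0)// addr_ge0// mulr_ge0// subr_ge0.
Qed.

Lemma dens_le x t : 0 <= t <= T -> dens x t <= cstD.
Proof.
move=> tT; have /andP[t0 _] := tT; have /andP[a b] := theta_itv t0; have [kN kN'] := kle tT.
rewrite /mdens ler_pdivrMl// -/(nidx rho x).
have fle k : (k <= N)%N -> fine (mg k (nidx rho x)) <= cstD * rho.
  by move=> /mg_le/(_ (nidx rho x)); rewrite -{1}(fineK (mg_f _ _)) lee_fin.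
set th := t / h - _ in a b kN' *.
have := fle _ kN; set u := fine _; move=> u1.
have [kN2|->] := kN'; last by rewrite mul0r addr0 subr0 mul1r mulrC.
have := fle _ kN2; set u' := fine _; move=> u2.
have : (1 - th) * u <= (1 - th) * (cstD * rho) by rewrite ler_wpM2l// subr_ge0.
have : th * u' <= th * (cstD * rho) by rewrite ler_wpM2l.
lra.
Qed.

Lemma measurable_dens t : measurable_fun [set: R] (dens^~ t).
Proof.
rewrite /mdens; apply: (@measurable_nidx_fun R rho _ _ (fun i => rho^-1 *
  ((1 - (t / h - `|Num.floor (t / h)|%N%:R)) * fine (mg `|Num.floor (t / h)|%N i) +
   (t / h - `|Num.floor (t / h)|%N%:R) * fine (mg `|Num.floor (t / h)|%N.+1 i)))).
Qed.

Lemma measurable_dens2 : measurable_fun [set: R * R] (fun z => dens z.1 z.2).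
Proof.
pose g1 (i l : int) := fine (mg `|l|%N i).
pose g2 (i l : int) := fine (mg `|l|%N.+1 i).
pose g3 (i l : int) := (`|l|%N%:R : R).
pose Z (z : R * R) : R * R := (z.1 / rho + 2^-1, z.2 / h).
have mZ : measurable_fun setT Z.
  apply: measurable_fun_pair => /=; last by apply: measurable_funM => //; exact: measurable_snd.
  apply: measurable_funD => //; apply: measurable_funM => //; exact: measurable_fst.
have m1 := measurableT_comp (measurable_floor_fun2 g1) mZ.
have m2 := measurableT_comp (measurable_floor_fun2 g2) mZ.
have m3 := measurableT_comp (measurable_floor_fun2 g3) mZ.
have mt : measurable_fun setT (fun z : R * R => z.2 / h).
  by apply: measurable_funM => //; exact: measurable_snd.
have mc (c : R) : measurable_fun [set: R * R] (fun=> c) by exact: measurable_cst.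
exact: (measurable_funM (mc rho^-1) (measurable_funD
  (measurable_funM (measurable_funB (mc 1) (measurable_funB mt m3)) m1)
  (measurable_funM (measurable_funB mt m3) m2))).
Qed.

Lemma mu_int t (g : R -> \bar R) : 0 <= t <= T -> measurable_fun [set: R] g ->
  (forall x, 0 <= g x)%E -> (\int[mu t]_x g x = \int[leb]_x (g x * (dens x t)%:E))%E.
Proof.
move=> tT mg' g0; apply: ge0_integral_density => //.
- exact: measurable_dens.
- by move=> x; apply: dens_ge0; case/andP : tT.
- by move=> A mA; exact: (mu_sol P tT mA).
Qed.

Lemma mu_nidx t (g : int -> \bar R) : 0 <= t <= T -> (forall i, 0 <= g i)%E ->
  let k := `|Num.floor (t / h)|%N in let th := t / h - k%:R in
  (\int[mu t]_x g (nidx rho x) = (1 - th)%:E * (\esum_(i in [set: int]) (g i * mg k i)) +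
     th%:E * (\esum_(i in [set: int]) (g i * mg k.+1 i)))%E.
Proof.
move=> tT g0 k th; have /andP[t0 _] := tT; have /andP[th0 th1] := theta_itv t0.
have f0 l i : 0 <= fine (mg l i) by exact: fine_ge0.
have th1' : 0 <= 1 - th by rewrite subr_ge0.
rewrite mu_int//; last exact: measurable_nidx_fun.
pose g' i := (g i * (rho^-1 * ((1 - th) * fine (mg k i) + th * fine (mg k.+1 i)))%:E)%E.
transitivity (\int[leb]_x g' (nidx rho x))%E; first by [].
rewrite integral_nidx_cst//; last first.
  by move=> i; rewrite mule_ge0// lee_fin mulr_ge0 ?invr_ge0 ?(ltW r0)// addr_ge0// mulr_ge0.
have gm l i : (0 <= g i * mg l i)%E by rewrite mule_ge0.
rewrite -!esumZl// -esumD; last 2 first.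
- by move=> i _; rewrite mule_ge0.
- by move=> i _; rewrite mule_ge0.
apply: eq_esum => i _; rewrite /g' -muleA -EFinM mulrAC mulVf ?gt_eqF// mul1r EFinD.
rewrite ge0_muleDr ?lee_fin ?mulr_ge0// !EFinM !fineK//.
by rewrite muleCA [X in (_ + X)%E]muleCA.
Qed.

Lemma mu_tk k (g : int -> \bar R) : (k <= N)%N -> (forall i, 0 <= g i)%E ->
  (\int[mu (tk h k)]_x g (nidx rho x) = \esum_(i in [set: int]) (g i * mg k i))%E.
Proof.
move=> kN g0; rewrite mu_nidx//; last exact: (tk_itv P kN).
have -> : `|Num.floor (tk h k / h)|%N = k.
  by rewrite (@floor_step k)// /tk ltr_pM2r// ltr_nat.
have -> : tk h k / h - k%:R = 0 by rewrite /tk mulfK ?subrr// gt_eqF.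
by rewrite subr0 mul1e mul0e adde0.
Qed.

Lemma mu_affine k t (g : int -> \bar R) : (k < N)%N -> tk h k <= t <= tk h k.+1 ->
  (forall i, 0 <= g i)%E -> let th := t / h - k%:R in 
  (\int[mu t]_x g (nidx rho x) = (1 - th)%:E * (\int[mu (tk h k)]_x g (nidx rho x)) +
     th%:E * (\int[mu (tk h k.+1)]_x g (nidx rho x)))%E.
Proof.
move=> kN /andP[k1 k2] g0 th.
have := tk_itv P (ltnW kN); have := tk_itv P kN => /andP[_ b] /andP[a _].
move: k2; rewrite le_eqVlt => /orP[/eqP te|k2]; last first.
  rewrite mu_nidx//; last by rewrite (le_trans a)// (le_trans (ltW k2)).
  by rewrite (floor_step k1 k2) !mu_tk// ltnW.
have -> : th = 1 by rewrite /th te /tk mulfK ?gt_eqF// -natr1 addrAC subrr add0r.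
by rewrite te subrr mul0e add0e mul1e.
Qed.

Lemma mu_step k (g : int -> R) : (k < N)%N -> (forall i, 0 <= g i) ->
  (\int[mu (tk h k.+1)]_x (g (nidx rho x))%:E = \int[mu (tk h k)]_x (op k g (nidx rho x))%:E)%E.
Proof.
move=> kN g0; rewrite (@mu_tk k.+1 (fun i => (g i)%:E) kN)//.
rewrite (@mu_tk k (fun i => (op k g i)%:E) (ltnW kN)); last first.
  by move=> i; rewrite lee_fin; exact: chain_op_ge0.
exact: (mg_step r0 mg0_ge0 mg0_sum mgS).
Qed.

Let op_bnd k (g : int -> R) B : (forall i, `|g i| <= B) -> forall j, `|op k g j| <= B.
Proof.
move=> gB j; have := interp_bnd r0 gB (Pp k j); have := interp_bnd r0 gB (Pm k j).
by rewrite /chain_op !ler_norml => /andP[? ?] /andP[? ?]; apply/andP; split; lra.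
Qed.

Lemma mean_ge0_fin (nu : probability R R) (g : int -> R) B : (forall i, 0 <= g i <= B) ->
  (\int[nu]_x (g (nidx rho x))%:E = (mean nu (fun x => g (nidx rho x)))%:E)%E.
Proof.
move=> gB; rewrite /mean /Rintegral fineK//; apply: integrable_fin_num => //.
apply: (@prob_integrable _ _ _ B); first exact: measurable_nidx_fun.
by move=> x; have /andP[a b] := gB (nidx rho x); rewrite ger0_norm.
Qed.

Lemma mean_shift (nu : probability R R) (g : int -> R) B : (forall i, `|g i| <= B) ->
  mean nu (fun x => g (nidx rho x) + B) = mean nu (fun x => g (nidx rho x)) + B.
Proof.
move=> gB; have B0 : 0 <= B by exact: le_trans (gB 0).
have := @meanZD _ nu 1 1 (fun x => g (nidx rho x)) (fun=> B) B.
rewrite !mul1r mean_cst => <-//.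
- by congr mean; apply/funext => x; rewrite !mul1r.
- exact: measurable_nidx_fun.
- by move=> _; rewrite ger0_norm.
Qed.

Let sh (g : int -> R) B : (forall i, `|g i| <= B) -> forall i, 0 <= g i + B <= 2 * B.
Proof. by move=> gB i; have := gB i; rewrite ler_norml => /andP[? ?]; apply/andP; split; lra. Qed.

(** The duality of [mu_step] is an identity between sums of nonnegative terms; adding the bound [B]
    to [g] reduces bounded functions to it. *)
Lemma mean_step k (g : int -> R) B : (k < N)%N -> (forall i, `|g i| <= B) ->
  mean (mu (tk h k.+1)) (fun x => g (nidx rho x)) = mean (mu (tk h k)) (fun x => op k g (nidx rho x)).
Proof.
move=> kN gB; apply: (addIr B); rewrite -!mean_shift//; last exact: op_bnd.
have := @mu_step k (fun i => g i + B) kN (fun i => proj1 (andP (sh gB i))).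
rewrite (mean_ge0_fin _ (sh gB)).
rewrite (@mean_ge0_fin _ (op k (fun i => g i + B)) (2 * B)).
  move=> [->]; congr mean; apply/funext => x.
  by rewrite /chain_op !interpDc//; lra.
move=> i; rewrite (_ : op k _ i = op k g i + B); last by rewrite /chain_op !interpDc//; lra.
by apply: sh; exact: op_bnd.
Qed.

Lemma mean_affine k t (g : int -> R) B : (k < N)%N -> tk h k <= t <= tk h k.+1 ->
  (forall i, `|g i| <= B) -> let th := t / h - k%:R in
  mean (mu t) (fun x => g (nidx rho x)) = (1 - th) * mean (mu (tk h k)) (fun x => g (nidx rho x)) +
     th * mean (mu (tk h k.+1)) (fun x => g (nidx rho x)).
Proof.
move=> kN kt gB th; have := @mu_affine k t (fun i => (g i + B)%:E) kN kt.
rewrite /= !(mean_ge0_fin _ (sh gB)) -!EFinM -EFinD => H.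
have {H}[] := H (fun i => proj1 (andP (sh gB i))).
rewrite !mean_shift// -/th; lra.
Qed.

End SchemeMeasure.

(** * Smooth steps and one-step Taylor expansions *)

Section SmoothStep.
Context {R : realType}.

Let pos (u : R) := Num.max 0 u.

Let pos_taylor a b : `|pos b ^+ 2 - pos a ^+ 2 - 2 * pos a * (b - a)| <= (b - a) ^+ 2.
Proof.
have := sqr_ge0 a; have := sqr_ge0 b; have := sqr_ge0 (b - a).
rewrite /pos ler_norml; case: (leP 0 a) => a0; case: (leP 0 b) => b0 ? ? ?.
- by apply/andP; split; lra.
- have : 0 <= a * - b by rewrite mulr_ge0// oppr_ge0 ltW.
  by move=> ?; apply/andP; split; lra.
- have : 0 <= - a * b by rewrite mulr_ge0// oppr_ge0 ltW.
  by move=> ?; apply/andP; split; lra.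
- by apply/andP; split; lra.
Qed.

(* A step from [0] on [u <= 0] to [1] on [u >= 1] with a Lipschitz derivative,
   so that a second order Taylor bound holds for it everywhere. *)
Definition stepf (u : R) : R := 2 * pos u ^+ 2 - 4 * pos (u - 2^-1) ^+ 2 + 2 * pos (u - 1) ^+ 2.

Definition dstepf (u : R) : R := 4 * pos u - 8 * pos (u - 2^-1) + 4 * pos (u - 1).

Lemma stepf_taylor a b : `|stepf b - stepf a - dstepf a * (b - a)| <= 8 * (b - a) ^+ 2.
Proof.
have := pos_taylor a b; have := pos_taylor (a - 2^-1) (b - 2^-1); have := pos_taylor (a - 1) (b - 1).
have -> : b - 1 - (a - 1) = b - a by ring.
have -> : b - 2^-1 - (a - 2^-1) = b - a by ring.
rewrite !ler_norml /stepf /dstepf => /andP[? ?] /andP[? ?] /andP[? ?]; apply/andP; split; lra.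
Qed.

Lemma dstepf_bnd u : `|dstepf u| <= 2.
Proof.
rewrite /dstepf /pos; case: (leP 0 u) => ?; case: (leP 0 (u - 2^-1)) => ?; case: (leP 0 (u - 1)) => ?;
  rewrite ler_norml; apply/andP; split; lra.
Qed.

Lemma stepf_itv u : 0 <= stepf u <= 1.
Proof.
rewrite /stepf /pos; case: (leP 0 u) => ?; case: (leP 0 (u - 2^-1)) => ?; case: (leP 0 (u - 1)) => ?;
  apply/andP; split; nra.
Qed.

Lemma stepf0 u : u <= 0 -> stepf u = 0.
Proof. by move=> u0; rewrite /stepf /pos !max_l; lra. Qed.

Lemma stepf1 u : 1 <= u -> stepf u = 1.
Proof. by move=> u1; rewrite /stepf /pos !max_r; lra. Qed.

End SmoothStep.

Section TaylorAverages.
Context {R : realType}.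
Variables (rho h : R).
Hypotheses (rho_gt0 : 0 < rho) (h_gt0 : 0 < h) (h_le1 : h <= 1).

(** [f] lies between its tangent plus and minus a parabola. Interpolation is exact on the tangent
    and raises the parabola by at most [rho^2]. *)
Lemma interp_taylor (f : R -> R) x d B : (forall y, `|f y - f x - d * (y - x)| <= B * (y - x) ^+ 2) ->
  `|interp rho (fun i => f (xnode rho i)) x - f x| <= B * rho ^+ 2.
Proof.
move=> fB.
have B0 : 0 <= B by have := le_trans (normr_ge0 _) (fB (x + 1)); rewrite addrAC subrr add0r expr1n mulr1.
have lin c : interp rho (fun i => c * (xnode rho i - x) ^+ 2 + 1 * (d * xnode rho i + (f x - d * x))) x =
    c * interp rho (fun i => (xnode rho i - x) ^+ 2) x + f x.
  rewrite interpZD// mul1r interpDc//.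
  have -> : (fun i => d * xnode rho i) = (fun i => d * xnode rho i + 0 * xnode rho i).
    by apply/funext => i; rewrite mul0r addr0.
  by rewrite interpZD// !interp_xnode// mul0r; ring.
have /andP[s0 s1] := interp_sqr rho_gt0 x x; rewrite subrr expr0n/= add0r in s0 s1.
have up : interp rho (fun i => f (xnode rho i)) x <= interp rho (fun i => B * (xnode rho i - x) ^+ 2 + 1 * (d * xnode rho i + (f x - d * x))) x.
  by apply: interp_le => // i; have := fB (xnode rho i); rewrite ler_norml => /andP[]; lra.
have dn : interp rho (fun i => (- B) * (xnode rho i - x) ^+ 2 + 1 * (d * xnode rho i + (f x - d * x))) x <= interp rho (fun i => f (xnode rho i)) x.
  by apply: interp_le => // i; have := fB (xnode rho i); rewrite ler_norml => /andP[]; lra.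
rewrite !lin in up dn; have : B * interp rho (fun i => (xnode rho i - x) ^+ 2) x <= B * rho ^+ 2.
  by rewrite ler_wpM2l.
by move=> H; rewrite ler_norml; apply/andP; split; lra.
Qed.

(** The first-order contributions of the two noise terms cancel, so the deviation is of order [h]
    although each displacement is of order [sqrt h]. *)
Lemma avg_taylor2 (f f' : R -> R) x D s L S B1 B2 :
  (forall a b, `|f b - f a - f' a * (b - a)| <= B2 * (b - a) ^+ 2) -> `|f' x| <= B1 ->
  `|D| <= L -> `|s| <= S ->
  `|2^-1 * (f (x - h * D + Num.sqrt h * s) + f (x - h * D - Num.sqrt h * s)) - f x|
   <= h * (L * B1 + B2 * (L ^+ 2 + S ^+ 2)).
Proof.
move=> ft f1 DL sS; set q := Num.sqrt h * s.
have q2 : q ^+ 2 = h * s ^+ 2 by rewrite exprMn sqr_sqrtr// ltW.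
have s2 : s ^+ 2 <= S ^+ 2 by rewrite -[s ^+ 2]real_normK ?num_real// lerXn2r ?nnegrE// (le_trans _ sS).
have D2 : D ^+ 2 <= L ^+ 2 by rewrite -[D ^+ 2]real_normK ?num_real// lerXn2r ?nnegrE// (le_trans _ DL).
have B20 : 0 <= B2 by have := le_trans (normr_ge0 _) (ft 0 1); rewrite subr0 expr1n mulr1.
have h2 : h ^+ 2 * D ^+ 2 <= h * L ^+ 2.
  rewrite expr2 -mulrA ler_pM2l// (le_trans _ D2)// ler_piMl ?sqr_ge0//.
have qS : q ^+ 2 <= h * S ^+ 2 by rewrite q2 ler_pM2l.
have Df : `|D * f' x| <= L * B1 by rewrite normrM ler_pM.
have Df' : `|h * (D * f' x)| <= h * (L * B1) by rewrite normrM gtr0_norm// ler_pM2l.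
have Bq : B2 * (h ^+ 2 * D ^+ 2 + q ^+ 2) <= B2 * (h * L ^+ 2 + h * S ^+ 2).
  by rewrite ler_wpM2l// lerD.
have := ft x (x - h * D + q); have := ft x (x - h * D - q).
have -> : x - h * D + q - x = - (h * D) + q by ring.
have -> : x - h * D - q - x = - (h * D) - q by ring.
move: Df'; rewrite !ler_norml => /andP[? ?] /andP[? ?] /andP[? ?]; apply/andP; split; lra.
Qed.

(** Here the second-order term of the noise produces the diffusion part of the generator. The cubic
    remainder is of order [h sqrt h] since, for [h <= 1], the whole displacement is at most
    [sqrt h (L + S)]. *)
Lemma avg_taylor3 (f f' f'' : R -> R) x D s L S B2 B3 :
  (forall a b, `|f b - f a - f' a * (b - a) - 2^-1 * f'' a * (b - a) ^+ 2| <= B3 * `|b - a| ^+ 3) ->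
  `|f'' x| <= B2 -> `|D| <= L -> `|s| <= S ->
  `|2^-1 * (f (x - h * D + Num.sqrt h * s) + f (x - h * D - Num.sqrt h * s)) - f x
    - h * (2^-1 * s ^+ 2 * f'' x - f' x * D)|
   <= h * (B2 * L ^+ 2 * h + B3 * (L + S) ^+ 3 * Num.sqrt h).
Proof.
move=> ft f2 DL sS; set q := Num.sqrt h * s.
have q2 : q ^+ 2 = h * s ^+ 2 by rewrite exprMn sqr_sqrtr// ltW.
have D2 : D ^+ 2 <= L ^+ 2 by rewrite -[D ^+ 2]real_normK ?num_real// lerXn2r ?nnegrE// (le_trans _ DL).
have B30 : 0 <= B3 by have := le_trans (normr_ge0 _) (ft 0 1); rewrite subr0 normr1 expr1n mulr1.
have sh0 : 0 <= Num.sqrt h by exact: sqrtr_ge0.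
have sh1 : Num.sqrt h <= 1 by rewrite -(sqrtr1 R) ler_sqrt.
have hs : h = Num.sqrt h ^+ 2 by rewrite sqr_sqrtr// ltW.
have hsq : h <= Num.sqrt h by rewrite {1}hs expr2 ler_piMl.
have cub (y : R) : `|y| <= h * L + Num.sqrt h * S -> B3 * `|y| ^+ 3 <= h * (B3 * (L + S) ^+ 3 * Num.sqrt h).
  move=> yb; have L0 := le_trans (normr_ge0 _) DL; have S0 := le_trans (normr_ge0 _) sS.
  have y2 : `|y| <= Num.sqrt h * (L + S).
    by apply: le_trans yb _; rewrite mulrDr lerD2r ler_wpM2r.
  have -> : h * (B3 * (L + S) ^+ 3 * Num.sqrt h) = B3 * (Num.sqrt h * (L + S)) ^+ 3 by rewrite {1}hs; ring.
  by rewrite ler_wpM2l// lerXn2r ?nnegrE// mulr_ge0// addr_ge0.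
have hD : `|h * D| <= h * L by rewrite normrM gtr0_norm// ler_pM2l.
have qS : `|q| <= Num.sqrt h * S by rewrite normrM ger0_norm// ler_wpM2l.
have h2 : `|h * D ^+ 2 * f'' x| <= h * L ^+ 2 * B2.
  by rewrite normrM ler_pM//; rewrite ger0_norm ?ler_pM2l// mulr_ge0 ?sqr_ge0 ?(ltW h_gt0).
have h2' : `|h * (h * D ^+ 2 * f'' x)| <= h * (h * L ^+ 2 * B2) by rewrite normrM gtr0_norm// ler_pM2l.
have := ft x (x - h * D + q); have := ft x (x - h * D - q).
have -> : x - h * D + q - x = - (h * D) + q by ring.
have -> : x - h * D - q - x = - (h * D) - q by ring.
have c1 : `|- (h * D) + q| <= h * L + Num.sqrt h * S by rewrite (le_trans (ler_normD _ _))// normrN lerD.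
have c2 : `|- (h * D) - q| <= h * L + Num.sqrt h * S by rewrite (le_trans (ler_normB _ _))// normrN lerD.
have := cub _ c1; have := cub _ c2; set E := h * (B3 * _ * _).
set n1 := B3 * _; set n2 := B3 * _ => e1 e2 t1 t2.
have {t1 e1}t1 := le_trans t1 e1; have {t2 e2}t2 := le_trans t2 e2.
have -> : h * (B2 * L ^+ 2 * h + B3 * (L + S) ^+ 3 * Num.sqrt h) = h * (h * L ^+ 2 * B2) + E by rewrite /E; ring.
have := mulr_ge0 (ltW h_gt0) (le_trans (normr_ge0 _) h2).
have q2f : q ^+ 2 * f'' x = h * (s ^+ 2 * f'' x) by rewrite q2 -mulrA.
move: h2' t1 t2; clearbody E; clear n1 n2 c1 c2 cub.
rewrite !ler_norml => /andP[? ?] /andP[? ?] /andP[? ?] ?; apply/andP; split; lra.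
Qed.

End TaylorAverages.

(** * Second moments and regularity in time *)

Section SchemeEstimates.
Context {R : realType}.
Local Notation leb := (@lebesgue_measure R).
Variables (T : R) (sigma : R -> R) (F G : R -> probability R R -> R) (phi m0 : R -> R)
  (C S K C0 Cr : R) (rho h eps : R) (N : nat) (mu : R -> probability R R).
Hypothesis D : mfg_data T sigma F G phi m0 C S K C0.
Hypothesis P : mfg_scheme T sigma F G phi m0 rho h eps N mu.
Hypotheses (h_le1 : h <= 1) (rho_le1 : rho <= 1) (rho_h : rho <= Cr * h).

Local Notation L := (cstL T C).
Local Notation mg := (mgrid rho h eps N sigma F G phi m0 mu).
Local Notation Pp := (fun k j => Phi_plus rho h eps N sigma F G phi mu j k).
Local Notation Pm := (fun k j => Phi_minus rho h eps N sigma F G phi mu j k).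
Local Notation dens := (mdens rho h eps N sigma F G phi m0 mu).
Local Notation Dv k := (Dveps rho h eps N sigma F G phi mu k).
Local Notation op := (chain_op rho Pp Pm).
Local Notation xn := (fun x => xnode rho (nidx rho x)).

Let r0 := rho_gt0 P.
Let h0 := h_gt0 P.

Let sS k : (k <= N)%N -> `|sigma (tk h k)| <= S.
Proof. by move=> kN; apply: (sigma_bnd D); exact: (tk_itv P kN). Qed.

Let DL k j : (k <= N)%N -> `|Dv k (xnode rho j)| <= L.
Proof. by move=> kN; exact: (Dveps_bnd D P kN). Qed.

(** [rho = O(h)] makes the interpolation error of one step an [O(h)], which remains bounded over the
    [T / h] steps. *)
Let rho2 : rho ^+ 2 <= h * Cr.
Proof. by rewrite mulrC; apply: le_trans rho_h; rewrite expr2 ler_piMl// ltW. Qed.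

Lemma op_taylor2 k j (f f' : R -> R) B1 B2 : (k <= N)%N ->
  (forall a b, `|f b - f a - f' a * (b - a)| <= B2 * (b - a) ^+ 2) -> (forall x, `|f' x| <= B1) ->
  `|op k (fun i => f (xnode rho i)) j - f (xnode rho j)| <= h * (L * B1 + B2 * (L ^+ 2 + S ^+ 2 + Cr)).
Proof.
move=> kN ft f1.
have B20 : 0 <= B2 by have := le_trans (normr_ge0 _) (ft 0 1); rewrite subr0 expr1n mulr1.
have := avg_taylor2 h0 h_le1 ft (f1 (xnode rho j)) (DL j kN) (sS kN).
have := interp_taylor r0 (ft (Pp k j)); have := interp_taylor r0 (ft (Pm k j)).
have : B2 * rho ^+ 2 <= B2 * (h * Cr) by rewrite ler_wpM2l.
rewrite /chain_op /Phi_plus /Phi_minus.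
set a := interp _ _ _; set b := interp _ _ _; set c := f _; set d := f _; set e := f _.
clearbody a b c d e; clear ft f1.
rewrite !ler_norml => ? /andP[? ?] /andP[? ?] /andP[? ?]; apply/andP; split; lra.
Qed.

(** The interpolation error is kept as [h] times [rho]: divided by [h] and summed in time it still
    vanishes with the mesh, unlike the cruder bound of [op_taylor2]. *)
Lemma op_taylor3 k j (f f' f'' : R -> R) B2 B3 : (k <= N)%N ->
  (forall a b, `|f b - f a - f' a * (b - a)| <= B2 * (b - a) ^+ 2) ->
  (forall a b, `|f b - f a - f' a * (b - a) - 2^-1 * f'' a * (b - a) ^+ 2| <= B3 * `|b - a| ^+ 3) ->
  (forall x, `|f'' x| <= B2) ->
  `|op k (fun i => f (xnode rho i)) j - f (xnode rho j) -
    h * (2^-1 * sigma (tk h k) ^+ 2 * f'' (xnode rho j) - f' (xnode rho j) * Dv k (xnode rho j))|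
  <= h * (B2 * L ^+ 2 * h + B3 * (L + S) ^+ 3 * Num.sqrt h + B2 * Cr * rho).
Proof.
move=> kN ft ft3 f2.
have B20 : 0 <= B2 by have := le_trans (normr_ge0 _) (ft 0 1); rewrite subr0 expr1n mulr1.
have := avg_taylor3 h0 h_le1 ft3 (f2 (xnode rho j)) (DL j kN) (sS kN).
have := interp_taylor r0 (ft (Pp k j)); have := interp_taylor r0 (ft (Pm k j)).
have : B2 * rho ^+ 2 <= B2 * (Cr * h * rho) by rewrite ler_wpM2l// expr2 ler_pM2r.
rewrite /chain_op /Phi_plus /Phi_minus.
set a := interp _ _ _; set b := interp _ _ _; set c := f _; set d := f _; set e := f _.
set X := h * (2^-1 * _ * _ - _).
clearbody a b c d e X; clear ft f2 ft3.
rewrite !ler_norml => ? /andP[? ?] /andP[? ?] /andP[? ?]; apply/andP; split; lra.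
Qed.

(** The additive constant of the one-step moment recursion: one [L^2] from the squared drift, one
    from the cross term, [S^2] from the noise and [Cr] from interpolation. *)
Definition cstM : R := 2 * L ^+ 2 + S ^+ 2 + Cr.

Lemma Cr_ge0 : 0 <= Cr.
Proof. by rewrite -(pmulr_lge0 _ h0); apply: le_trans rho_h; exact: ltW. Qed.

Lemma cstM_ge0 : 0 <= cstM.
Proof.
have L2 : 0 <= 2 * L ^+ 2 by apply: mulr_ge0 => //; exact: sqr_ge0.
by rewrite /cstM addr_ge0 ?Cr_ge0// addr_ge0 ?sqr_ge0.
Qed.

Let op_sqr k j : (k <= N)%N ->
  op k (fun i => xnode rho i ^+ 2) j <= (1 + h) * xnode rho j ^+ 2 + h * cstM.
Proof.
move=> kN.
have /andP[_] := interp_sqr r0 (Pp k j) 0; have /andP[_] := interp_sqr r0 (Pm k j) 0.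
under eq_fun do rewrite subr0; rewrite !subr0 => H1 H2.
have q2 : (Num.sqrt h * sigma (tk h k)) ^+ 2 = h * sigma (tk h k) ^+ 2 by rewrite exprMn sqr_sqrtr// ltW.
have s2 : h * sigma (tk h k) ^+ 2 <= h * S ^+ 2.
  by rewrite ler_pM2l// -[sigma _ ^+ 2]real_normK ?num_real// lerXn2r ?nnegrE ?sS// (le_trans _ (sS kN)).
set d := Dv k (xnode rho j); have dL : `|d| <= L by exact: DL.
have D2 : d ^+ 2 <= L ^+ 2 by rewrite -[d ^+ 2]real_normK ?num_real// lerXn2r ?nnegrE// (le_trans _ dL).
have h2 : h ^+ 2 * d ^+ 2 <= h * L ^+ 2.
  by rewrite expr2 -mulrA ler_pM2l// (le_trans _ D2)// ler_piMl ?sqr_ge0.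
have hD : h * d ^+ 2 <= h * L ^+ 2 by rewrite ler_pM2l.
have xd : 0 <= h * (xnode rho j + d) ^+ 2 by rewrite mulr_ge0 ?sqr_ge0// ltW.
move: H1 H2; rewrite /chain_op /Phi_plus /Phi_minus -/d /cstM.
set q := Num.sqrt h * _ in q2 *; set x := xnode rho j in xd *.
set a := interp _ _ _; set b := interp _ _ _; clearbody a b q x d.
by move: rho2 => ? ? ?; lra.
Qed.

Let moment0 : (\int[mu (tk h 0)]_x ((xn x) ^+ 2)%:E <= ((K + 1) ^+ 2)%:E)%E.
Proof.
have K0 := K_gt0 D.
rewrite (@mu_tk _ _ _ _ _ _ _ _ _ _ _ _ _ _ _ _ D P 0 (fun i => (xnode rho i ^+ 2)%:E))//; last first.
  by move=> i; rewrite lee_fin sqr_ge0.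
rewrite (mg0_esum D P (g := fun i => (xnode rho i ^+ 2)%:E)); last by move=> i; rewrite lee_fin sqr_ge0.
have mm0 : measurable_fun [set: R] (fun x => (m0 x)%:E) by apply/measurable_EFinP; exact: (m0_meas D).
have m0p x : (0 <= (m0 x)%:E)%E by rewrite lee_fin (m0_ge0 D).
rewrite -[leRHS]mule1 -(m0_int D) -ge0_integralZl//; last by rewrite lee_fin sqr_ge0.
apply: ge0_le_integral => //.
- by move=> x _; rewrite mule_ge0// lee_fin sqr_ge0.
- apply: emeasurable_funM => //; apply/measurable_EFinP.
  exact: (@measurable_nidx_fun R rho _ _ (fun i => xnode rho i ^+ 2)).
- by apply: emeasurable_funM.
move=> x _; have [xK|xK] := leP `|x| K; last by rewrite (m0_supp D)// !mule0.
apply: lee_wpmul2r => //; rewrite lee_fin -[_ ^+ 2]real_normK ?num_real//.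
rewrite lerXn2r ?nnegrE ?addr_ge0 ?(ltW K0)//.
have := nidx_dist r0 x; have := r0; have := rho_le1.
move: xK; rewrite !ler_norml => /andP[? ?] ? ? /andP[? ?]; apply/andP; split; lra.
Qed.

Definition cst2 : R := expR T * ((K + 1) ^+ 2 + cstM).

(** The right-hand side solves [u (k + 1) = (1 + h) u k + h cstM] exactly, with [u 0 = (K + 1)^2]:
    initially, the nodes that carry mass are within [1] of the support of [m0]. *)
Let moment k : (k <= N)%N ->
  (\int[mu (tk h k)]_x ((xn x) ^+ 2)%:E <= ((1 + h) ^+ k * ((K + 1) ^+ 2 + cstM) - cstM)%:E)%E.
Proof.
elim: k => [_|k IH kN]; first by rewrite expr0 mul1r addrK; exact: moment0.
have {}IH := IH (ltnW kN).
rewrite (@mu_step _ _ _ _ _ _ _ _ _ _ _ _ _ _ _ _ D P k (fun i => xnode rho i ^+ 2) kN); last first.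
  by move=> i; rewrite sqr_ge0.
have msq : measurable_fun [set: R] (fun x => ((xn x) ^+ 2)%:E).
  by apply/measurable_EFinP; exact: (@measurable_nidx_fun R rho _ _ (fun i => xnode rho i ^+ 2)).
have h1 : (0 <= (1 + h)%:E)%E by rewrite lee_fin addr_ge0// ltW.
apply: (@le_trans _ _ (\int[mu (tk h k)]_x ((1 + h)%:E * ((xn x) ^+ 2)%:E + (h * cstM)%:E))%E).
  apply: ge0_le_integral => //.
  - by move=> x _; rewrite lee_fin chain_op_ge0// => i; rewrite sqr_ge0.
  - by apply/measurable_EFinP; exact: (@measurable_nidx_fun R rho _ _ (fun i => op k (fun i => xnode rho i ^+ 2) i)).
  - by apply: emeasurable_funD => //; apply: emeasurable_funM.
  - by move=> x _; rewrite -EFinM -EFinD lee_fin; apply: op_sqr; exact: ltnW.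
have hM : 0 <= h * cstM by rewrite mulr_ge0 ?cstM_ge0// ltW.
rewrite ge0_integralD//; last 2 first.
- by move=> x _; rewrite mule_ge0// lee_fin sqr_ge0.
- by apply: emeasurable_funM.
rewrite ge0_integralZl//; last by move=> x _; rewrite lee_fin sqr_ge0.
rewrite integral_cst// [X in (_ + _ * X)%E](_ : _ = 1%E); last exact: probability_setT.
rewrite mule1; apply: (@le_trans _ _ ((1 + h)%:E * ((1 + h) ^+ k * ((K + 1) ^+ 2 + cstM) - cstM)%:E + (h * cstM)%:E)%E).
  by rewrite leeD2r//; apply: lee_wpmul2l.
rewrite -EFinM -EFinD lee_fin (exprS (1 + h) k); set X := (1 + h) ^+ k; set B := (K + 1) ^+ 2 + cstM; rewrite le_eqVlt; apply/orP; left; apply/eqP; ring.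
Qed.

Let moment2 k : (k <= N)%N -> (\int[mu (tk h k)]_x ((xn x) ^+ 2)%:E <= cst2%:E)%E.
Proof.
move=> kN; apply: le_trans (moment kN) _; rewrite lee_fin.
have B0 : 0 <= (K + 1) ^+ 2 + cstM by rewrite addr_ge0 ?sqr_ge0 ?cstM_ge0.
have : (1 + h) ^+ k * ((K + 1) ^+ 2 + cstM) <= cst2.
  rewrite /cst2 ler_wpM2r//; apply: (@le_trans _ _ (expR h ^+ k)).
    by rewrite lerXn2r ?nnegrE ?expR_ge0 ?expR_ge1Dx// addr_ge0// ltW.
  by rewrite -expRM_natl ler_expR; have /andP[] := tk_itv P kN.
have := cstM_ge0; lra.
Qed.

Lemma moment_bound t : 0 <= t <= T -> (\int[mu t]_x (1 + x ^+ 2)%:E <= (2 * cst2 + 2)%:E)%E.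
Proof.
move=> tT; have [k kN kt] := tk_cover D P tT.
have sq0 i : (0 <= (xnode rho i ^+ 2)%:E)%E by rewrite lee_fin sqr_ge0.
have msq : measurable_fun [set: R] (fun x => ((xn x) ^+ 2)%:E).
  by apply/measurable_EFinP; exact: (@measurable_nidx_fun R rho _ _ (fun i => xnode rho i ^+ 2)).
have H : (\int[mu t]_x ((xn x) ^+ 2)%:E <= cst2%:E)%E.
  rewrite (@mu_affine _ _ _ _ _ _ _ _ _ _ _ _ _ _ _ _ D P k t (fun i => (xnode rho i ^+ 2)%:E))//.
  have /andP[a b] : 0 <= t / h - k%:R <= 1.
    move: kt; rewrite /tk => /andP[k1 k2].
    by rewrite subr_ge0 ler_pdivlMr// k1 lerBlDl natr1 ler_pdivrMr.
  set th := t / h - _ in a b *.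
  have -> : cst2%:E = ((1 - th)%:E * cst2%:E + th%:E * cst2%:E)%E by rewrite -!EFinM -EFinD; congr EFin; ring.
  apply: leeD; apply: lee_wpmul2l.
  - by rewrite lee_fin subr_ge0.
  - by apply: moment2; exact: ltnW.
  - by rewrite lee_fin.
  - exact: moment2.
apply: (@le_trans _ _ (\int[mu t]_x (2%:E * ((xn x) ^+ 2)%:E + 2%:E))%E).
  apply: ge0_le_integral => //.
  - by move=> x _; rewrite lee_fin addr_ge0// sqr_ge0.
  - by apply/measurable_EFinP; apply: measurable_funD => //; exact: measurable_funX.
  - by apply: emeasurable_funD => //; apply: emeasurable_funM.
  move=> x _; rewrite -EFinM -EFinD lee_fin.
  have := nidx_dist r0 x; set y := xnode _ _ => yx.
  have : (y - x) ^+ 2 <= 2^-1 ^+ 2.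
    rewrite -[_ ^+ 2]real_normK ?num_real// lerXn2r ?nnegrE//.
    by apply: le_trans yx _; rewrite ler_piMl.
  have := sqr_ge0 (y + (y - x)); lra.
rewrite ge0_integralD//; last 2 first.
- by move=> x _; rewrite mule_ge0.
- by apply: emeasurable_funM.
rewrite ge0_integralZl//.
rewrite integral_cst// [X in (_ + _ * X)%E](_ : _ = 1%E); last exact: probability_setT.
rewrite mule1 (_ : (2 * cst2 + 2)%:E = 2%:E * cst2%:E + 2%:E)%E; last by rewrite -EFinM -EFinD.
by rewrite leeD2r//; apply: lee_wpmul2l.
Qed.

Section MeanTime.
Variables (f f' : R -> R) (B B1 B2 : R).
Hypothesis fB : forall x, `|f x| <= B.
Hypothesis ft : forall a b, `|f b - f a - f' a * (b - a)| <= B2 * (b - a) ^+ 2.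
Hypothesis f1 : forall x, `|f' x| <= B1.

Definition cstT : R := L * B1 + B2 * (L ^+ 2 + S ^+ 2 + Cr).

Let E t : R := mean (mu t) (fun x => f (xn x)).

Let E_step k : (k < N)%N -> `|E (tk h k.+1) - E (tk h k)| <= h * cstT.
Proof.
move=> kN; rewrite /E.
have fB' i : `|f (xnode rho i)| <= B by [].
rewrite (mean_step D P kN fB').
apply: (@mean_dist _ _ _ _ B).
- exact: (@measurable_nidx_fun R rho _ _ (op k (fun i => f (xnode rho i)))).
- exact: (@measurable_nidx_fun R rho _ _ (fun i => f (xnode rho i))).
- move=> x; have := interp_bnd r0 fB' (Pp k (nidx rho x)); have := interp_bnd r0 fB' (Pm k (nidx rho x)).
  by rewrite /chain_op !ler_norml => /andP[? ?] /andP[? ?]; apply/andP; split; lra.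
- by [].
- by move=> x; apply: op_taylor2 => //; exact: ltnW.
Qed.

Let E_loc k s t : (k < N)%N -> tk h k <= s -> s <= t -> t <= tk h k.+1 -> `|E t - E s| <= cstT * (t - s).
Proof.
move=> kN ks st tk1.
have fB' i : `|f (xnode rho i)| <= B by [].
have ct : tk h k <= t <= tk h k.+1 by rewrite tk1 (le_trans ks).
have cs : tk h k <= s <= tk h k.+1 by rewrite ks (le_trans st).
rewrite /E (mean_affine D P kN ct fB') (mean_affine D P kN cs fB').
have := E_step kN; rewrite /E; set e1 := mean _ _; set e0 := mean _ _ => H.
have -> : (1 - (t / h - k%:R)) * e0 + (t / h - k%:R) * e1 - ((1 - (s / h - k%:R)) * e0 + (s / h - k%:R) * e1)
  = (t - s) / h * (e1 - e0) by ring.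
rewrite normrM ger0_norm ?divr_ge0 ?subr_ge0 ?(ltW h0)//.
apply: (@le_trans _ _ ((t - s) / h * (h * cstT))); first by rewrite ler_wpM2l// divr_ge0 ?subr_ge0 ?(ltW h0).
by rewrite mulrA divfK ?gt_eqF// mulrC.
Qed.

Let E_nodes k d : (k + d <= N)%N -> `|E (tk h (k + d)) - E (tk h k)| <= cstT * (tk h (k + d) - tk h k).
Proof.
elim: d => [_|d IH kd]; first by rewrite addn0 !subrr normr0 mulr0.
rewrite addnS in kd *; have {}IH := IH (ltnW kd).
have := E_step kd; have -> : h * cstT = cstT * (tk h (k + d).+1 - tk h (k + d)).
  by rewrite /tk -natr1; ring.
move: IH; rewrite !ler_norml => /andP[? ?] /andP[? ?]; apply/andP; split; lra.
Qed.

(** One step changes the mean by at most [h cstT], and the curve is affine in time between grid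
    times, so the bound holds for all times. *)
Lemma mean_time s t : 0 <= s <= T -> 0 <= t <= T -> 
  `|mean (mu t) (fun x => f (xn x)) - mean (mu s) (fun x => f (xn x))| <= cstT * `|t - s|.
Proof.
wlog st : s t / s <= t.
  move=> W sT tT; have [/W|/ltW/W] := leP s t; first exact.
  by move=> /(_ tT sT); rewrite distrC (distrC s).
move=> sT tT; rewrite [`|t - s|]ger0_norm ?subr_ge0// -/(E t) -/(E s).
have [k kN /andP[k1 k2]] := tk_cover D P sT; have [l lN /andP[l1 l2]] := tk_cover D P tT.
have [tk1|kt1] := leP t (tk h k.+1); first exact: (E_loc kN).
have kl : (k < l)%N.
  have : tk h k.+1 < tk h l.+1 by apply: lt_le_trans l2.
  by rewrite /tk ltr_pM2r// ltr_nat ltnS.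
have H1 := E_loc kN k1 k2 (lexx _); have H3 := E_loc lN (lexx _) l1 l2.
have := @E_nodes k.+1 (l - k.+1); rewrite subnKC// => /(_ (ltnW lN)) H2.
move: H1 H2 H3; set e1 := E _; set e2 := E _; set e3 := E _; set e4 := E _; clearbody e1 e2 e3 e4.
rewrite !ler_norml => /andP[? ?] /andP[? ?] /andP[? ?]; apply/andP; split; lra.
Qed.

End MeanTime.

End SchemeEstimates.

(** * Tails and equicontinuity of distribution functions *)

Section Tails.
Context {R : realType}.
Local Notation leb := (@lebesgue_measure R).

(** The decay that second moments give through Markov's inequality. Being integrable, it makes the
    tails of the [L^1] distance between distribution functions uniformly small. *)
Definition tail_bnd (c : R) (F : R -> R) := forall x,
  (x <= 0 -> F x <= c / (1 + x ^+ 2)) /\ (0 <= x -> 1 - F x <= c / (1 + x ^+ 2)).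

Let p1 (x : R) : 0 < 1 + x ^+ 2. Proof. by rewrite ltr_pwDl// sqr_ge0. Qed.

Let m1 : measurable_fun [set: R] (fun x : R => (1 + x ^+ 2)%:E).
Proof. by apply/measurable_EFinP; apply: measurable_funD => //; exact: measurable_funX. Qed.

Lemma markov_sqr (nu : probability R R) (c x : R) (A : set R) : measurable A ->
  (\int[nu]_y (1 + y ^+ 2)%:E <= c%:E)%E -> (forall y, A y -> x ^+ 2 <= y ^+ 2) ->
  fine (nu A) <= c / (1 + x ^+ 2).
Proof.
move=> mA nuc Ax; rewrite ler_pdivlMr// mulrC -lee_fin EFinM fineK; last exact: fin_num_measure.
apply: le_trans nuc; rewrite -integral_cst//.
apply: (@le_trans _ _ (\int[nu]_(y in A) (1 + y ^+ 2)%:E)%E).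
  apply: ge0_le_integral => //.
  - by move=> y _; rewrite lee_fin ltW.
  - exact: measurable_funTS.
  - by move=> y Ay; rewrite lee_fin lerD2l Ax.
by apply: ge0_subset_integral => // y _; rewrite lee_fin ltW.
Qed.

Lemma cdf_tail (nu : probability R R) (c : R) : (\int[nu]_y (1 + y ^+ 2)%:E <= c%:E)%E ->
  tail_bnd c (cdfR nu).
Proof.
move=> nuc x; split => x0.
  apply: (@markov_sqr nu c x `]-oo, x]) => // y; rewrite /= in_itv/= => yx.
  by rewrite -(sqrrN x) -(sqrrN y) lerXn2r ?nnegrE ?oppr_ge0 ?lerN2// (le_trans yx).
have -> : 1 - cdfR nu x = fine (nu `]x, +oo[%classic).
  have -> : `]x, +oo[%classic = ~` (`]-oo, x]%classic : set R) by rewrite setCitvl.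
  rewrite probability_setC// fineB ?fin_num_measure//; exact: fin_num_measure.
apply: (@markov_sqr nu c x `]x, +oo[) => // y; rewrite /= in_itv/= andbT => xy.
by rewrite lerXn2r ?nnegrE ?(ltW xy)// (le_trans x0)// ltW.
Qed.

Lemma tail_bnd_dist c F G : tail_bnd c F -> tail_bnd c G -> (forall x, 0 <= F x <= 1) ->
  (forall x, 0 <= G x <= 1) -> forall x, `|F x - G x| <= c / (1 + x ^+ 2).
Proof.
move=> tF tG F01 G01 x; have [f1 f2] := tF x; have [g1 g2] := tG x.
have /andP[? ?] := F01 x; have /andP[? ?] := G01 x.
rewrite ler_norml; have [/[dup] /f1 ? /g1 ?|/ltW x0] := leP x 0.
  by apply/andP; split; lra.
have := f2 x0; have := g2 x0; move=> ? ?; by apply/andP; split; lra.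
Qed.

Lemma integrable_oneDsqr c : leb.-integrable setT (EFin \o (fun x : R => c / (1 + x ^+ 2))).
Proof.
have ii : leb.-integrable setT (EFin \o (fun x : R => (oneDsqr x)^-1)).
  apply/integrableP; split.
    apply/measurable_EFinP; apply: continuous_measurable_fun; exact: continuous_oneDsqrV.
  have v0 (x : R) : 0 <= (oneDsqr x)^-1 by rewrite invr_ge0 ltW// p1.
  under eq_integral do rewrite /= ger0_norm//.
  rewrite ge0_symfun_integralT//.
  - have -> : [set x : R | 0 <= x] = `[0, +oo[%classic.
      by apply/seteqP; split => x /=; rewrite in_itv/= andbT.
    by rewrite integral0y_oneDsqr -EFinM ltry.
  - exact: continuous_oneDsqrV.
  - by move=> x; rewrite /oneDsqr /= sqrrN.
exact: (integrableZl measurableT c ii).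
Qed.

(** A coupling of finite cost exists, and under it [|z.2| <= |z.1 - z.2| + |z.1|]. *)
Lemma W1_P1 (mu nu : probability R R) : P1 mu -> (W1 mu nu < +oo)%E -> P1 nu.
Proof.
move=> P1m W; have /ereal_inf_lt[_ [g [gm gn] <-] gW] := W.
have nn (y : R) : (0 <= `|y|%:E)%E by rewrite lee_fin.
have mnR : measurable_fun [set: R] (fun y : R => `|y|) by exact: normr_measurable.
have mn : measurable_fun [set: R] (fun y : R => `|y|%:E) by apply/measurable_EFinP; exact: mnR.
have mf : measurable_fun setT (fst : R * R -> R) by exact: measurable_fst.
have ms : measurable_fun setT (snd : R * R -> R) by exact: measurable_snd.
have E1 : (\int[mu]_x `|x|%:E = \int[g]_z `|z.1|%:E)%E.
  rewrite -(@ge0_integral_pushforward _ _ _ _ _ _ mf g setT (fun y => `|y|%:E))//.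
  apply: eq_measure_integral => A mA _; rewrite /= /pushforward -gm//; congr (g _).
  by apply/seteqP; split => [[a b]|[a b]] //= [].
have E2 : (\int[nu]_x `|x|%:E = \int[g]_z `|z.2|%:E)%E.
  rewrite -(@ge0_integral_pushforward _ _ _ _ _ _ ms g setT (fun y => `|y|%:E))//.
  apply: eq_measure_integral => A mA _; rewrite /= /pushforward -gn//; congr (g _).
  by apply/seteqP; split => [[a b]|[a b]] //= [].
rewrite /P1 E2; apply: (@le_lt_trans _ _ (\int[g]_z (`|z.1 - z.2|%:E + `|z.1|%:E))%E).
  apply: ge0_le_integral => //.
  - by apply/measurable_EFinP; exact: measurableT_comp.
  - by apply: emeasurable_funD; apply/measurable_EFinP; apply: measurableT_comp => //; exact: measurable_funB.
  - move=> z _; rewrite -EFinD lee_fin -lerBlDr; by rewrite (distrC z.1); exact: lerB_dist.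
rewrite ge0_integralD//.
- by rewrite lte_add_pinfty// -E1.
- by apply/measurable_EFinP; apply: measurableT_comp => //; exact: measurable_funB.
- by apply/measurable_EFinP; apply: measurableT_comp.
Qed.

Lemma mean_indic (nu : probability R R) (A : set R) : measurable A -> mean nu (\1_A) = fine (nu A).
Proof. by move=> mA; rewrite /mean /Rintegral integral_indic// setIT. Qed.

End Tails.

Section CdfEstimates.
Context {R : realType}.
Local Notation leb := (@lebesgue_measure R).
Variables (T : R) (sigma : R -> R) (F G : R -> probability R R -> R) (phi m0 : R -> R)
  (C S K C0 Cr : R) (rho h eps : R) (N : nat) (mu : R -> probability R R).
Hypothesis D : mfg_data T sigma F G phi m0 C S K C0.
Hypothesis P : mfg_scheme T sigma F G phi m0 rho h eps N mu.
Hypotheses (h_le1 : h <= 1) (rho_le1 : rho <= 1) (rho_h : rho <= Cr * h).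
Hypothesis hL : h * cstL T C <= 3^-1.

Local Notation xn := (fun x => xnode rho (nidx rho x)).

Let r0 := rho_gt0 P.

Lemma mu_itv_le t x y : 0 <= t <= T -> x <= y -> cdfR (mu t) y - cdfR (mu t) x <= cstD T C C0 * (y - x).
Proof.
move=> tT xy; rewrite -lee_fin -cdfR_itv// (mu_sol P tT); last exact: measurable_itv.
apply: (@le_trans _ _ (\int[leb]_(z in `]x, y]) (cst (cstD T C C0)%:E) z)%E).
  apply: ge0_le_integral => //.
  - by move=> z _; rewrite lee_fin (dens_ge0 D P)//; case/andP : tT.
  - by apply/measurable_EFinP; apply: measurable_funTS; exact: measurable_dens.
  - by move=> z _; rewrite lee_fin; exact: (dens_le D P hL).
rewrite integral_cst//= lebesgue_measure_itv/= lte_fin.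
by case: ltP => [|yx]; [rewrite -EFinB -EFinM|rewrite mule0 lee_fin mulr_ge0 ?subr_ge0// ltW// (cstD_gt0 D)].
Qed.

(* Test with the step of width [d] to the right of [x]: it differs from the
   indicator of a half-line only on an interval of length [d + rho], whose mass
   is controlled by the density bound. *)
Lemma cdf_time s t x d : 0 <= s <= T -> 0 <= t <= T -> 0 < d ->
  `|cdfR (mu t) x - cdfR (mu s) x| <=
  cstD T C C0 * (d + rho) + cstT T C S Cr (2 / d) (8 / d ^+ 2) * `|t - s|.
Proof.
move=> sT tT d0.
(* The offset covers the distance from a point to its node: the step is [0] at the node of any
   [y <= x], and [1] at the node of any [y > x + d + rho]. *)
pose a := x + rho / 2.
pose f y := stepf ((y - a) / d); pose f' y := dstepf ((y - a) / d) / d.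
have fB y : `|f y| <= 1 by have /andP[u v] := stepf_itv ((y - a) / d); rewrite ger0_norm.
have ft y z : `|f z - f y - f' y * (z - y)| <= 8 / d ^+ 2 * (z - y) ^+ 2.
  have -> : f' y * (z - y) = dstepf ((y - a) / d) * ((z - a) / d - (y - a) / d).
    by rewrite /f' -mulrBl opprB addrA subrK mulrAC mulrA.
  apply: le_trans (stepf_taylor _ _) _.
  by rewrite -mulrBl opprB addrA subrK exprMn exprVn mulrA mulrAC.
have f1 y : `|f' y| <= 2 / d.
  by rewrite normrM (@gtr0_norm _ d^-1) ?invr_gt0// ler_pM2r ?invr_gt0// dstepf_bnd.
have H := mean_time D P h_le1 rho_le1 rho_h fB ft f1 sT tT.
have mf : measurable_fun [set: R] (fun x => f (xn x)) by exact: (@measurable_nidx_fun R rho _ _ (fun i => f (xnode rho i))).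
have indE (nu : probability R R) y : mean nu (\1_(`]y, +oo[)) = 1 - cdfR nu y.
  rewrite mean_indic//; have -> : `]y, +oo[%classic = ~` (`]-oo, y]%classic : set R) by rewrite setCitvl.
  rewrite probability_setC// fineB ?fin_num_measure//; exact: fin_num_measure.
have ib (A : set R) y : `|\1_A y| <= 1 :> R by rewrite indicE; case: (_ \in _); rewrite ?normr1 ?normr0.
have lo (nu : probability R R) : cdfR nu x <= 1 - mean nu (fun x => f (xn x)).
  suff : mean nu (fun x => f (xn x)) <= mean nu (\1_(`]x, +oo[)) by rewrite indE; lra.
  apply: (@mean_le _ _ _ _ 1) => //; move=> y; rewrite indicE mem_setE in_itv/= andbT.
  have := nidx_dist r0 y; rewrite ler_norml => /andP[u v].
  have [xy|yx] := ltP x y; first by have /andP[] := stepf_itv ((xn y - a) / d).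
  rewrite /f stepf0// pmulr_lle0 ?invr_gt0//; rewrite /a; lra.
have hi (nu : probability R R) : 1 - mean nu (fun x => f (xn x)) <= cdfR nu (x + (d + rho)).
  suff : mean nu (\1_(`](x + (d + rho)), +oo[)) <= mean nu (fun x => f (xn x)) by rewrite indE; lra.
  apply: (@mean_le _ _ _ _ 1) => //; move=> y; rewrite indicE mem_setE in_itv/= andbT.
  have := nidx_dist r0 y; rewrite ler_norml => /andP[u v].
  have [xy|yx] := ltP (x + (d + rho)) y; last by have /andP[] := stepf_itv ((xn y - a) / d).
  rewrite /f stepf1// ler_pdivlMr// mul1r /a; lra.
have dr : 0 <= d + rho by rewrite addr_ge0 ?ltW.
have xd : x <= x + (d + rho) by rewrite lerDl.
have := mu_itv_le tT xd; have := mu_itv_le sT xd.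
have := lo (mu t); have := lo (mu s); have := hi (mu t); have := hi (mu s).
have -> : x + (d + rho) - x = d + rho by ring.
move: H; set e1 := mean _ _; set e2 := mean _ _.
set c1 := cdfR _ _; set c2 := cdfR _ _; set c3 := cdfR _ _; set c4 := cdfR _ _.
set X := cstD _ _ _ * _; set Y := cstT _ _ _ _ _ _ * _.
clearbody e1 e2 c1 c2 c3 c4 X Y.
rewrite !ler_norml => /andP[? ?] ? ? ? ? ? ?; apply/andP; split; lra.
Qed.

End CdfEstimates.

(** * Limit points of the measures *)

Section Sequences.
Context {R : realType}.
Local Notation leb := (@lebesgue_measure R).

Lemma tail_small (c e : R) : 0 < e -> exists2 K : R, 0 <= K &
  (\int[leb]_x (if (`|x| <= K)%R then 0%E else (`|c / (1 + x ^+ 2)|)%:E) <= e%:E)%E.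
Proof.
move=> e0; pose f (n : nat) (x : R) : \bar R := if (`|x| <= n%:R)%R then 0%E else (`|c / (1 + x ^+ 2)|)%:E.
have mg : measurable_fun [set: R] (fun x : R => (`|c / (1 + x ^+ 2)|)%:E).
  case/integrableP: (integrable_oneDsqr c) => m _.
  by apply/measurable_EFinP; apply: measurableT_comp => //; apply/measurable_EFinP.
have mf n : measurable_fun [set: R] (f n).
  apply: measurable_fun_if => //.
  - by apply: measurable_fun_ler => //; exact: measurable_normr.
  - exact: measurable_funTS.
have ig : leb.-integrable setT (fun x : R => (`|c / (1 + x ^+ 2)|)%:E).
  by have := integrable_abse (integrable_oneDsqr c).
have [||_ _] := @dominated_convergence _ _ R leb setT measurableT f (cst 0%E) _ mf (measurable_cst _) _ ig.
  apply: nearW => x _; apply: cvg_near_cst; near=> n.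
  rewrite /f ifT//; near: n; exact: nbhs_infty_ger.
  by apply: nearW => x n _; rewrite /f; case: ifP => _; rewrite ?abse0// /= normr_id.
rewrite integral0 => /fine_cvgP[_] /cvgrPdist_lt/(_ _ e0)[n _ /(_ n (leqnn n))].
rewrite /= sub0r normrN => H; exists n%:R => //.
have i0 : (0 <= \int[leb]_x f n x)%E by apply: integral_ge0 => x _; rewrite /f; case: ifP.
have fin : (\int[leb]_x f n x)%E \is a fin_num.
  rewrite ge0_fin_numE//; case/integrableP: ig => _; apply: le_lt_trans.
  apply: ge0_le_integral => //.
  - by move=> x _; rewrite /f; case: ifP.
  - exact: mf.
  - by apply: measurableT_comp => //; exact: mg.
  - by move=> x _; rewrite /f; case: ifP => // _; rewrite /= normr_id.
rewrite -(fineK fin) lee_fin; apply: le_trans (ler_norm _) (ltW H).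
Unshelve. all: by end_near. Qed.

(** Inside [[- K, K]] the integrand is at most [a]; outside, the common tail bound takes over. *)
Lemma W1_le_cdf (mu nu : probability R R) c K e a : tail_bnd c (cdfR mu) -> tail_bnd c (cdfR nu) -> 0 <= K ->
  (\int[leb]_x (if (`|x| <= K)%R then 0%E else (`|c / (1 + x ^+ 2)|)%:E) <= e%:E)%E -> 0 <= a ->
  (forall x, `|x| <= K -> `|cdfR mu x - cdfR nu x| <= a) -> (W1 mu nu <= (2 * K * a + e)%:E)%E.
Proof.
move=> tmu tnu K0 Ke a0 Ha; rewrite W1E /W1cdf.
have mg : measurable_fun [set: R] (fun x : R => if (`|x| <= K)%R then 0%E else (`|c / (1 + x ^+ 2)|)%:E).
  apply: measurable_fun_if => //.
  - by apply: measurable_fun_ler => //; exact: normr_measurable.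
  - apply: measurable_funTS; case/integrableP: (integrable_oneDsqr c) => m _.
    by apply/measurable_EFinP; apply: measurableT_comp => //; apply/measurable_EFinP.
have mi : measurable_fun [set: R] (fun x : R => (a * \1_(`[- K, K]) x)%:E).
  by apply/measurable_EFinP; apply: measurable_funM => //; exact: measurable_indic.
apply: (@le_trans _ _ (\int[leb]_x ((a * \1_(`[- K, K]) x)%:E +
   (if (`|x| <= K)%R then 0%E else (`|c / (1 + x ^+ 2)|)%:E)))%E).
  apply: ge0_le_integral => //.
  - by apply/measurable_EFinP; exact: measurable_cdfRB.
  - exact: emeasurable_funD.
  move=> x _; rewrite indicE mem_setE in_itv/= -ler_norml; case: ifP => xK.
    by rewrite mulr1 adde0 lee_fin Ha.
  rewrite mulr0 add0e lee_fin; apply: le_trans (tail_bnd_dist tmu tnu _ _ x) (ler_norm _);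
    by move=> y; rewrite cdfR_ge0 cdfR_le1.
rewrite ge0_integralD//.
- rewrite EFinD; apply: leeD => //; under eq_integral do rewrite EFinM.
  rewrite ge0_integralZl//; last by apply/measurable_EFinP; exact: measurable_indic.
  have -> : (\int[leb]_x (\1_(`[- K, K]) x)%:E = leb `[(- K)%R, K]%classic)%E.
    by rewrite integral_indic ?setIT//; exact: measurable_itv.
  rewrite lebesgue_measure_itv/= lte_fin.
  case: ifP => _; last by rewrite mule0 lee_fin !mulr_ge0.
  by rewrite -EFinB -EFinM lee_fin; lra.
- by move=> x _; rewrite lee_fin mulr_ge0// indicE.
- by move=> x _; case: ifP.
Qed.

Lemma cdf_of_tails (c L : R) (g : R -> R) : {homo g : x y / x <= y} ->
  (forall x y, `|g x - g y| <= L * `|x - y|) -> (forall x, 0 <= g x <= 1) -> tail_bnd c g ->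
  exists mu : probability R R, forall x, cdfR mu x = g x.
Proof.
move=> gnd gL g01 tg.
have p1 (x : R) : 0 < 1 + x ^+ 2 by rewrite ltr_pwDl// sqr_ge0.
have c0 : 0 <= c.
  have := (tg 0).1 (lexx _); rewrite expr0n/= addr0 divr1; apply: le_trans.
  by case/andP: (g01 0).
have small (e : R) : 0 < e -> forall x, 1 + c / e < `|x| -> c / (1 + x ^+ 2) <= e.
  move=> e0 x Mx; rewrite ler_pdivrMr//.
  have ce : 0 <= c / e by rewrite divr_ge0// ltW.
  have x1 : 1 <= `|x| by apply: le_trans (ltW Mx); rewrite lerDl.
  have : c / e <= `|x| ^+ 2.
    apply: (@le_trans _ _ `|x|); first by apply: le_trans (ltW Mx); rewrite lerDr.
    by rewrite expr2 ler_peMl.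
  by rewrite real_normK ?num_real// ler_pdivrMr// mulrDr mulr1 [e * _]mulrC; lra.
have M0 (e : R) : 0 < e -> 0 <= 1 + c / e by move=> e0; rewrite addr_ge0// divr_ge0// ltW.
apply: probability_of_cdf => //.
- move=> x; apply: cvg_at_right_filter; apply/cvgrPdist_le => e e0.
  have L0 : 0 < `|L| + 1 by rewrite ltr_wpDl.
  near=> y; apply: le_trans (gL _ _) _.
  apply: (@le_trans _ _ ((`|L| + 1) * `|x - y|)).
    by rewrite ler_wpM2r//; apply: le_trans (ler_norm _) _; rewrite lerDl.
  rewrite -ler_pdivlMl// mulrC; near: y; apply: cvgr_dist_le; first exact: cvg_id.
  by rewrite divr_gt0.
- apply/cvgrPdist_le => e e0; exists (1 + c / e); split; first exact: num_real.
  move=> x Mx /=; have x0 : 0 <= x by apply: le_trans (M0 _ e0) (ltW Mx).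
  have /andP[_ g1] := g01 x; rewrite ger0_norm ?subr_ge0//.
  apply: le_trans ((tg x).2 x0) _; apply: small => //; by rewrite ger0_norm.
- apply/cvgrPdist_le => e e0; exists (- (1 + c / e)); split; first exact: num_real.
  move=> x Mx /=; have x0 : x <= 0 by apply: le_trans (ltW Mx) _; rewrite oppr_le0 M0.
  have /andP[g0 _] := g01 x; rewrite sub0r normrN ger0_norm//.
  apply: le_trans ((tg x).1 x0) _; apply: small => //; rewrite ler0_norm// ltrNr//.
Unshelve. all: by end_near. Qed.

(* The last conditions hold for large indices only; the tail of the given
   sequence satisfies them ([mfg_seq_exist]). *)
Record mfg_seq (T : R) (sigma : R -> R) (F G : R -> probability R R -> R) (phi m0 : R -> R) (C Cr : R)
    (rho h eps : nat -> R) (N : nat -> nat) (mn : nat -> R -> probability R R) : Prop := MfgSeq {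
  seq_scheme : forall n, mfg_scheme T sigma F G phi m0 (rho n) (h n) (eps n) (N n) (mn n);
  seq_curve : forall n, is_curve T (mn n);
  seq_rho : rho @ \oo --> 0; seq_h : h @ \oo --> 0; seq_eps : eps @ \oo --> 0;
  seq_h1 : forall n, h n <= 1; seq_rho1 : forall n, rho n <= 1;
  seq_rho_h : forall n, rho n <= Cr * h n;
  seq_hL : forall n, h n * cstL T C <= 3^-1 }.

Variables (T : R) (sigma : R -> R) (F G : R -> probability R R -> R) (phi m0 : R -> R)
  (C S K C0 Cr : R) (rho h eps : nat -> R) (N : nat -> nat) (mn : nat -> R -> probability R R).
Hypothesis D : mfg_data T sigma F G phi m0 C S K C0.

Lemma is_curve_limit (mbar : R -> probability R R) : (forall n, is_curve T (mn n)) ->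
  curve_cvg T mn mbar -> is_curve T mbar.
Proof.
move=> cmn cv; split=> t tT.
  have [n _ /(_ n (leqnn n) t tT) W] := cv 1 ltr01.
  by apply: (W1_P1 ((cmn n).1 t tT)); apply: lt_trans W (ltry _).
move=> e e0; have e30 : 0 < e / 3 by rewrite divr_gt0.
have [n _ /(_ n (leqnn n)) W] := cv _ e30.
have [d d0 Hd] := (cmn n).2 t tT _ e30; exists d => // s sT st.
apply: le_lt_trans (W1_triangle _ (mn n s) _) _.
have -> : e%:E = ((e / 3)%:E + ((e / 3)%:E + (e / 3)%:E))%E by rewrite -!EFinD; congr EFin; lra.
apply: lteD; first by rewrite W1_sym; exact: W.
apply: le_lt_trans (W1_triangle _ (mn n t) _) _; apply: lteD; [exact: Hd|exact: W].
Qed.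

Hypothesis Q : mfg_seq T sigma F G phi m0 C Cr rho h eps N mn.

Definition cstTail : R := 2 * cst2 T C S K Cr + 2.

Lemma seq_tail n t : 0 <= t <= T -> tail_bnd cstTail (cdfR (mn n t)).
Proof.
move=> tT; apply: cdf_tail.
exact: (moment_bound D (seq_scheme Q n) (seq_h1 Q n) (seq_rho1 Q n) (seq_rho_h Q n) tT).
Qed.

Lemma seq_cdf_lip n t x y : 0 <= t <= T -> `|cdfR (mn n t) x - cdfR (mn n t) y| <= cstD T C C0 * `|x - y|.
Proof.
move=> tT; wlog xy : x y / y <= x.
  by move=> W; have [/W//|/ltW/W] := leP y x; rewrite distrC (distrC y).
rewrite !ger0_norm ?subr_ge0//; last exact: cdfR_nd.
exact: (mu_itv_le D (seq_scheme Q n) (seq_hL Q n) tT xy).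
Qed.

Lemma seq_compact : exists2 s : nat -> nat, {homo s : a b / (a < b)%N} &
  exists mbar : R -> probability R R, curve_cvg T (fun k => mn (s k)) mbar.
Proof.
have T0 : 0 <= T by exact: ltW (T_gt0 D).
have Cd0 : 0 < cstD T C C0 by exact: cstD_gt0 D.
set Cd := cstD T C C0 in Cd0.
have [//|n x t tT|e e0|s hs [g hg]] := @arzela_ascoli R T 1 (fun n x t => cdfR (mn n t) x).
- by rewrite ger0_norm ?cdfR_ge0 ?cdfR_le1.
(* The width [d] of the smoothing step is fixed first, so that [Cd (d + rho)] is at most [e / 2]
   once [rho <= d]. The constant of the time estimate, which grows as [d] shrinks, is then absorbed
   by the choice of the time increment. *)
- pose d := e / 4 / Cd; have d0 : 0 < d by rewrite !divr_gt0.
  set ct := `|cstT T C S Cr (2 / d) (8 / d ^+ 2)| + 1.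
  have ct0 : 0 < ct by rewrite ltr_wpDl.
  have /cvgrPdist_le/(_ _ d0)[N0 _ HN0] := seq_rho Q.
  exists (Num.min d (e / 4 / ct)), N0; split; first by rewrite lt_min d0 !divr_gt0.
  move=> n x y s t nN sT tT; rewrite !lt_min => /andP[xd _] /andP[_ sd].
  have h1 := seq_cdf_lip n x y sT.
  have h2 := cdf_time D (seq_scheme Q n) (seq_h1 Q n) (seq_rho1 Q n) (seq_rho_h Q n) (seq_hL Q n) y tT sT d0.
  have := HN0 n nN; rewrite /= sub0r normrN gtr0_norm ?(rho_gt0 (seq_scheme Q n))// => rd.
  rewrite -/Cd in h1 h2.
  have Cdd : Cd * d = e / 4 by rewrite /d mulrC divfK// gt_eqF.
  have k1 : Cd * `|x - y| <= e / 4 by rewrite -Cdd ler_pM2l// ltW.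
  have k2 : Cd * (d + rho n) <= e / 4 + e / 4 by rewrite -Cdd -mulrDr ler_pM2l// lerD2l.
  have k3 : cstT T C S Cr (2 / d) (8 / d ^+ 2) * `|s - t| <= e / 4.
    apply: (@le_trans _ _ (ct * `|s - t|)).
      by rewrite ler_wpM2r// /ct; apply: le_trans (ler_norm _) _; rewrite lerDl.
    by rewrite -ler_pdivlMl// mulrC ltW.
  move: h1 h2 k1 k2 k3.
  set c1 := cdfR _ _; set c2 := cdfR _ _; set c3 := cdfR _ _.
  set X1 := Cd * _; set X2 := Cd * _; set X3 := _ * `|s - t|; clearbody c1 c2 c3 X1 X2 X3.
  by rewrite !ler_norml => /andP[? ?] /andP[? ?] *; apply/andP; split; lra.
exists s => //.
have cv x t : 0 <= t <= T -> cdfR (mn (s n) t) x @[n --> \oo] --> g x t.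
  move=> tT; apply: cvg_eps => e e0; have [n0 H] := hg `|x| e e0.
  by exists n0 => // n /= nn0; apply: H.
have lim_ge t x c : 0 <= t <= T -> (forall n, c <= cdfR (mn n t) x) -> c <= g x t.
  by move=> tT H; apply: (cvg_lb (cv x t tT)); apply: nearW.
have tails t : 0 <= t <= T -> tail_bnd cstTail (g^~ t).
  move=> tT x; split => x0.
    by apply: (cvg_ub (cv x t tT)); apply: nearW => n; apply: (seq_tail _ tT _).1.
  have : 1 - cstTail / (1 + x ^+ 2) <= g x t.
    by apply: lim_ge => // n; have := (seq_tail n tT x).2 x0; lra.
  lra.
have ctail0 : 0 <= cstTail.
  have := (seq_tail 0 (_ : 0 <= 0 <= T) 0).1 (lexx _); rewrite expr0n/= addr0 divr1.
  by move=> H; apply: le_trans (cdfR_ge0 _ _) (H _); rewrite lexx T0.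
have ex t : exists mu : probability R R, 0 <= t <= T -> forall x, cdfR mu x = g x t.
  have [tT|ntT] := pselect (0 <= t <= T); last by exists (mn 0%N t).
  have [|||| mu muE] := @cdf_of_tails cstTail Cd (g^~ t); last by exists mu.
  - move=> x y xy; rewrite -subr_ge0; apply: (cvg_lb (cvgB (cv y t tT) (cv x t tT))).
    by apply: nearW => n; rewrite /= subr_ge0; exact: cdfR_nd.
  - move=> x y; apply: (cvg_ub (cvg_norm (cvgB (cv x t tT) (cv y t tT)))).
    by apply: nearW => n; exact: seq_cdf_lip.
  - move=> x; rewrite lim_ge//= => [|n]; last exact: cdfR_ge0.
    by apply: (cvg_ub (cv x t tT)); apply: nearW => n; exact: cdfR_le1.
  - exact: tails.
have [mbar hmbar] := choice ex.
exists mbar => e e0.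
have e20 : 0 < e / 2 by rewrite divr_gt0.
have e40 : 0 < e / 4 by rewrite divr_gt0.
have [M M0 HM] := tail_small cstTail e40.
have a0 : 0 < e / 4 / (2 * M + 1) by rewrite !divr_gt0// ltr_wpDl// mulr_ge0.
have [n0 Hn0] := hg M _ a0.
exists n0 => // n /= nn0 t tT.
have tb : tail_bnd cstTail (cdfR (mbar t)).
  have -> : cdfR (mbar t) = g^~ t by apply/funext => x; exact: hmbar.
  exact: tails.
apply: le_lt_trans (W1_le_cdf (seq_tail (s n) tT) tb M0 HM (ltW a0) _) _.
  by move=> x xM; rewrite hmbar//; exact: Hn0.
rewrite lte_fin; have : 2 * M * (e / 4 / (2 * M + 1)) <= e / 4.
  rewrite mulrA ler_pdivrMr; last by rewrite ltr_wpDl// mulr_ge0.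
  by rewrite mulrC ler_pM2l// lerDl.
lra.
Qed.

End Sequences.

(** * The density of a limit point *)

Section LimitDensity.
Context {R : realType}.
Local Notation leb := (@lebesgue_measure R).

(** If the functions differ by more than [e] at [x], they differ by at least [e / 2] on an interval
    of length [e / (2 L)] ending at [x]: one is Lipschitz and the other monotone, so the side is
    chosen by the sign of the difference. The area gained is [e^2 / (4 L)]. *)
Lemma cdf_dist_W1 (mu nu : probability R R) (L e : R) : 0 < L -> 0 < e ->
  (forall x y, `|cdfR mu x - cdfR mu y| <= L * `|x - y|) -> (W1 mu nu < (e ^+ 2 / (4 * L))%:E)%E ->
  forall x, `|cdfR mu x - cdfR nu x| <= e.
Proof.
move=> L0 e0 muL; rewrite W1E /W1cdf => W x; rewrite leNgt; apply/negP => ex.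
have md := measurable_cdfRB mu nu.
pose d := e / (2 * L); have d0 : 0 < d by rewrite divr_gt0// mulr_gt0.
have Ld : L * d = e / 2 by rewrite /d; field; rewrite gt_eqF.
have key a : a <= x <= a + d -> (forall y, a <= y <= a + d -> e / 2 <= `|cdfR mu y - cdfR nu y|) -> False.
  move=> _ H; have : ((e ^+ 2 / (4 * L))%:E <= \int[leb]_x `|cdfR mu x - cdfR nu x|%:E)%E.
    apply: (@le_trans _ _ (\int[leb]_(y in `[a, (a + d)%R]) (cst (e / 2)%:E) y)%E).
      rewrite integral_cst//= lebesgue_measure_itv/= lte_fin ltrDl d0.
      rewrite -EFinB -EFinM lee_fin /d le_eqVlt; apply/orP; left; apply/eqP.
      by field; rewrite gt_eqF.
    apply: (@le_trans _ _ (\int[leb]_(y in `[a, (a + d)%R]) `|cdfR mu y - cdfR nu y|%:E)%E).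
      apply: ge0_le_integral; first exact: measurable_itv.
      - by move=> y _; rewrite lee_fin divr_ge0// ltW.
      - exact: measurable_cst.
      - by apply/measurable_EFinP; apply: measurable_funTS; exact: md.
      - by move=> y /=; rewrite in_itv/= lee_fin => /H.
    apply: ge0_subset_integral => //; by apply/measurable_EFinP; exact: md.
  by move=> h; have := le_lt_trans h W; rewrite ltxx.
have muL' y : `|cdfR mu x - cdfR mu y| <= L * `|x - y| by [].
have [lt|ge] := ltP (cdfR mu x) (cdfR nu x).
  apply: (key x); first by rewrite lexx lerDl ltW.
  move=> y /andP[xy yd]; have := cdfR_nd nu xy; have := muL' y.
  have : L * `|x - y| <= e / 2.
    by rewrite -Ld ler_pM2l// ler0_norm ?subr_le0// opprB lerBlDl.
  move: ex lt; set c1 := cdfR _ _; set c2 := cdfR _ _; set c3 := cdfR _ _; set c4 := cdfR _ _.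
  move: (L * _) => X; clearbody c1 c2 c3 c4; rewrite distrC => ex lt H1.
  rewrite ler_norml distrC => /andP[? ?] ?; apply: le_trans (ler_norm _).
  by move: ex; rewrite (ger0_norm (_ : 0 <= c2 - c1)) ?subr_ge0 ?(ltW lt)// => ex; lra.
apply: (key (x - d)); first by rewrite subrK lexx gerBl ltW.
move=> y; rewrite subrK => /andP[xy yd]; have := cdfR_nd nu yd; have := muL' y.
have : L * `|x - y| <= e / 2.
  by rewrite -Ld ler_pM2l// ger0_norm ?subr_ge0// lerBlDl addrC -lerBlDl.
move: ex ge; set c1 := cdfR _ _; set c2 := cdfR _ _; set c3 := cdfR _ _; set c4 := cdfR _ _.
move: (L * _) => X; clearbody c1 c2 c3 c4 => ex lt H1.
rewrite ler_norml => /andP[? ?] ?; apply: le_trans (ler_norm _).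
by move: ex; rewrite ger0_norm ?subr_ge0//; lra.
Qed.

Variables (T : R) (sigma : R -> R) (F G : R -> probability R R -> R) (phi m0 : R -> R)
  (C S K C0 Cr : R) (rho h eps : nat -> R) (N : nat -> nat) (mn : nat -> R -> probability R R).
Hypothesis D : mfg_data T sigma F G phi m0 C S K C0.
Hypothesis Q : mfg_seq T sigma F G phi m0 C Cr rho h eps N mn.
Variable mbar : R -> probability R R.
Hypotheses (mbarC : is_curve T mbar) (cv : curve_cvg T mn mbar).

Local Notation Cd := (cstD T C C0).
Let Cd0 : 0 < Cd. Proof. exact: cstD_gt0 D. Qed.
Let T0 : 0 <= T. Proof. exact: ltW (T_gt0 D). Qed.

Let small e : 0 < e -> 0 < e ^+ 2 / (4 * Cd).
Proof. by move=> e0; rewrite divr_gt0 ?exprn_gt0// mulr_gt0. Qed.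

Lemma cdf_uniform_cvg e : 0 < e -> \forall n \near \oo, forall t x, 0 <= t <= T ->
  `|cdfR (mn n t) x - cdfR (mbar t) x| <= e.
Proof.
move=> e0; have := cv (small e0); apply: filterS => n H t x tT.
by apply: (cdf_dist_W1 Cd0 e0 _ (H t tT)) => y z; exact: (seq_cdf_lip D Q).
Qed.

Lemma cdf_cvg t x : 0 <= t <= T -> cdfR (mn n t) x @[n --> \oo] --> cdfR (mbar t) x.
Proof. by move=> tT; apply: cvg_eps => e /cdf_uniform_cvg; apply: filterS => n; exact. Qed.

Lemma mbar_lip t x y : 0 <= t <= T -> `|cdfR (mbar t) x - cdfR (mbar t) y| <= Cd * `|x - y|.
Proof.
move=> tT; apply: (cvg_ub (cvg_norm (cvgB (@cdf_cvg t x tT) (@cdf_cvg t y tT)))).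
by apply: nearW => n; exact: (seq_cdf_lip D Q).
Qed.

Definition clip (t : R) := Num.min T (Num.max 0 t).

Lemma clip_itv t : 0 <= clip t <= T.
Proof. by rewrite /clip ge_min lexx le_min T0 le_max lexx. Qed.

Lemma clip_id t : 0 <= t <= T -> clip t = t.
Proof. by move=> /andP[t0 tT]; rewrite /clip max_r// min_r. Qed.

Lemma clip_dist s t : `|clip s - clip t| <= `|s - t|.
Proof.
rewrite /clip; case: (leP 0 s) => s0; case: (leP 0 t) => t0;
  (try case: (leP T s) => sT); (try case: (leP T t) => tT); (try case: (leP T 0) => ?);
  rewrite ?subrr ?normr0//; move: (T0) => ?; rewrite ler_norml; apply/andP; split;
  move: (ler_norm (s - t)) (ler_norm (t - s)); rewrite (distrC t s); lra.
Qed.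

(* The clipping makes [fbar] jointly measurable on the whole plane. *)
Definition fbar (x t : R) : R := quot_density Cd (cdfR (mbar (clip t))) x.

Lemma fbar_bnd x t : 0 <= fbar x t <= Cd.
Proof. exact: quot_density_bnd. Qed.

Lemma fbarE t A : 0 <= t <= T -> measurable A -> mbar t A = (\int[leb]_(x in A) (fbar x t)%:E)%E.
Proof.
move=> tT mA; rewrite /fbar clip_id//; apply: (quot_densityE Cd0) => // x y xy.
by apply: le_trans (ler_norm _) _; rewrite -[y - x in leRHS]ger0_norm ?subr_ge0// mbar_lip.
Qed.

Lemma mbar_cdf_cont t e : 0 < e -> exists2 d : R, 0 < d & forall s x, `|s - t| < d ->
  `|cdfR (mbar (clip s)) x - cdfR (mbar (clip t)) x| <= e.
Proof.
move=> e0; have [d d0 Hd] := mbarC.2 (clip t) (clip_itv t) _ (small e0).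
exists d => // s x st; apply: (cdf_dist_W1 Cd0 e0).
  by move=> y z; apply: mbar_lip; exact: clip_itv.
by apply: Hd; [exact: clip_itv|exact: le_lt_trans (clip_dist _ _) st].
Qed.

Let floor_approx (x : R) (k : nat) : `|x - (Num.floor (k.+1%:R * x))%:~R / k.+1%:R| <= k.+1%:R^-1.
Proof.
have /andP[a b] := floor_itv (k.+1%:R * x); rewrite intrD in b.
set fl : R := (Num.floor _)%:~R in a b *.
have k0 : (0 : R) < k.+1%:R by [].
have a' : fl / k.+1%:R <= x by rewrite ler_pdivrMr// mulrC.
by rewrite ger0_norm ?subr_ge0// lerBlDl -{2}[k.+1%:R^-1]mul1r -mulrDl ler_pdivlMr// mulrC ltW.
Qed.

(** The function is continuous in both variables jointly, hence a pointwise limit of functions of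
    two integer parts. *)
Lemma measurable_mbar_cdf c : measurable_fun [set: R * R] (fun z => cdfR (mbar (clip z.2)) (z.1 + c)).
Proof.
pose a (k : nat) (z : R * R) := cdfR (mbar (clip ((Num.floor (k.+1%:R * z.2))%:~R / k.+1%:R)))
  ((Num.floor (k.+1%:R * (z.1 + c)))%:~R / k.+1%:R).
apply: (@measurable_fun_cvg _ _ R setT a) => [k|z _].
  pose Z (z : R * R) : R * R := (k.+1%:R * (z.1 + c), k.+1%:R * z.2).
  have mZ : measurable_fun setT Z.
    apply: measurable_fun_pair => /=; apply: measurable_funM => //.
    by apply: measurable_funD => //; exact: measurable_fst.
  exact: (measurableT_comp (measurable_floor_fun2 (fun i j : int =>
    cdfR (mbar (clip (j%:~R / k.+1%:R))) (i%:~R / k.+1%:R))) mZ).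
apply: cvg_eps => e e0; have e20 : 0 < e / 2 by rewrite divr_gt0.
have [d d0 Hd] := mbar_cdf_cont z.2 e20.
have d'0 : 0 < Num.min d (e / 2 / Cd) by rewrite lt_min d0 divr_gt0.
have := @cvg_harmonic R => /cvgrPdist_lt/(_ _ d'0)[m _ Hm]; exists m => // k /= mk.
have := Hm k mk; rewrite /= sub0r normrN gtr0_norm ?invr_gt0// lt_min => /andP[k1 k2].
have h1 := Hd ((Num.floor (k.+1%:R * z.2))%:~R / k.+1%:R) ((Num.floor (k.+1%:R * (z.1 + c)))%:~R / k.+1%:R).
have {}h1 : `|a k z - cdfR (mbar (clip z.2)) ((Num.floor (k.+1%:R * (z.1 + c)))%:~R / k.+1%:R)| <= e / 2.
  by apply: h1; rewrite distrC; exact: le_lt_trans (floor_approx _ _) k1.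
have h2 := mbar_lip ((Num.floor (k.+1%:R * (z.1 + c)))%:~R / k.+1%:R) (z.1 + c) (clip_itv z.2).
have {}h2 : `|cdfR (mbar (clip z.2)) ((Num.floor (k.+1%:R * (z.1 + c)))%:~R / k.+1%:R) -
    cdfR (mbar (clip z.2)) (z.1 + c)| <= e / 2.
  apply: le_trans h2 _; rewrite -ler_pdivlMl// distrC.
  by apply: le_trans (floor_approx _ _) _; rewrite [leRHS]mulrC ltW.
rewrite (splitr e); apply: le_trans (ler_distD _ _ _) (lerD h1 h2).
Qed.

Lemma measurable_fbar2 : measurable_fun [set: R * R] (fun z => fbar z.1 z.2).
Proof.
exact: (@measurable_quot_density R Cd _ _ (fun z : R * R => cdfR (mbar (clip z.2))) fst measurable_mbar_cdf).
Qed.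

Lemma measurable_fbar t : measurable_fun [set: R] (fbar^~ t).
Proof.
apply: (@measurable_quot_density R Cd _ R (fun _ => cdfR (mbar (clip t))) id) => c.
by apply: measurableT_comp; [exact: measurable_cdfR|exact: measurable_funD].
Qed.

End LimitDensity.

(** * Weak-star convergence on the space-time strip *)

Section ProductWeak.
Context {R : realType}.
Local Notation leb := (@lebesgue_measure R).
Variables (T C : R) (fn : nat -> R * R -> R) (f : R * R -> R).
Hypotheses (mfn : forall n, measurable_fun setT (fn n)) (mf : measurable_fun setT f).
Hypothesis fnC : forall n z, 0 <= z.2 <= T -> 0 <= fn n z <= C.
Hypothesis fC : forall z, 0 <= z.2 <= T -> 0 <= f z <= C.
Hypothesis inner : forall t, 0 <= t <= T -> forall g1 : R -> R, leb.-integrable setT (EFin \o g1) ->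
  (\int[leb]_x (g1 x * fn n (x, t)))%R @[n --> \oo] --> (\int[leb]_x (g1 x * f (x, t)))%R.

(** Weak convergence holds at each fixed time. By Fubini almost every slice of [g] is integrable,
    and dominated convergence in time applies with the majorant [C] times the [L^1] norm of the
    slice. *)
Lemma product_weak (g : R * R -> R) :
  (leb \x leb)%E.-integrable (setT `*` `[0%R, T]%classic) (fun z => (g z)%:E) ->
  (fun k => \int[(leb \x leb)%E]_(z in setT `*` `[0%R, T]%classic) ((fn k z * g z)%:E))%E
      @ \oo --> (\int[(leb \x leb)%E]_(z in setT `*` `[0%R, T]%classic) ((f z * g z)%:E))%E.
Proof.
move=> ig.
pose gD (z : R * R) : R := if 0 <= z.2 <= T then g z else 0.
pose gE (z : measurableTypeR R * measurableTypeR R) : \bar R := (gD z)%:E.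
have gDE : gE = (fun z => (g z)%:E) \_ (setT `*` `[0%R, T]%classic).
  apply/funext => z; rewrite /gE /gD patchE; case: ifPn => h.
    by rewrite mem_set//; split => //=; rewrite in_itv.
  by rewrite memNset//= => -[_]; rewrite in_itv/=; exact/negP.
have igE : (leb \x leb)%E.-integrable setT gE.
  by rewrite gDE; apply/(integrable_mkcond _ _).1 => //; apply: measurableX => //; exact: measurable_itv.
have mgE : measurable_fun setT gE by case/integrableP : igE.
have mgD : measurable_fun [set: R * R] gD by apply/measurable_EFinP.
have main (F : R * R -> R) : measurable_fun setT F -> (forall z, 0 <= z.2 <= T -> 0 <= F z <= C) ->
  (leb \x leb)%E.-integrable setT (fun z : measurableTypeR R * measurableTypeR R => (gD z * F z)%:E) /\
  (\int[(leb \x leb)%E]_(z in setT `*` `[0%R, T]%classic) ((F z * g z)%:E) =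
   \int[leb]_t \int[leb]_x (gD (x, t) * F (x, t))%:E)%E.
  move=> mF FC.
  have iF : (leb \x leb)%E.-integrable setT (fun z : measurableTypeR R * measurableTypeR R => (gD z * F z)%:E).
    apply: (@le_integrable _ _ _ _ _ measurableT _ (fun z => (C%:E * gE z)%E)).
    - by apply/measurable_EFinP; exact: measurable_funM.
    - move=> z _; rewrite /gE -EFinM !abse_EFin lee_fin !normrM mulrC.
      rewrite /gD; case: ifPn => h; last by rewrite normr0 !mulr0.
      by have /andP[F0 FC'] := FC z h; rewrite ler_wpM2r// ger0_norm// (le_trans FC')// ler_norm.
    - exact: integrableZl.
  split => //.
  rewrite [LHS]integral_mkcond.
  transitivity (\int[(leb \x leb)%E]_z (gD z * F z)%:E)%E; last by symmetry; exact: (integral21_prod_meas1 iF).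
  apply: eq_integral => z _; rewrite patchE /gD; case: ifPn.
    by rewrite inE => -[_]; rewrite /= in_itv/= => ->; rewrite mulrC.
  by rewrite notin_setE/= in_itv/=; case: ifP => [h []//|_ _]; rewrite mul0r.
rewrite (main f mf fC).2; under eq_fun do rewrite (main (fn _) (mfn _) (fnC _)).2.
pose H (t : measurableTypeR R) : \bar R := (C%:E * \int[leb]_x `|gE (x, t)|)%E.
have iag : (leb \x leb)%E.-integrable setT (fun z => `|gE z|)%E by exact: integrable_abse.
have mH0 : measurable_fun setT (fun t : measurableTypeR R => \int[leb]_x `|gE (x, t)|)%E.
  exact: (measurable_fubini_G iag).
have iH0 : leb.-integrable setT (fun t : measurableTypeR R => \int[leb]_x `|gE (x, t)|)%E.
  apply/integrableP; split => //.
  have := integral21_prod_meas1 iag; rewrite /fubini_G => E.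
  under eq_integral do rewrite gee0_abs ?integral_ge0//.
  rewrite E; case/integrableP: igE => _; by [].
have iH : leb.-integrable setT H by exact: integrableZl.
have [||_ _] := @dominated_convergence _ _ R leb setT measurableT
   (fun n t => \int[leb]_x (gD (x, t) * fn n (x, t))%:E)%E (fun t => \int[leb]_x (gD (x, t) * f (x, t))%:E)%E H
   (fun n => measurable_fubini_G (main (fn n) (mfn n) (fnC n)).1)
   (measurable_fubini_G (main f mf fC).1) _ iH; last by [].
- have := integrable_ae measurableT iH0; apply: filterS.
  move=> t /(_ I) fint _; have [tT|ntT] := pselect (0 <= t <= T); last first.
    have z0 (F : R * R -> R) : (\int[leb]_x (gD (x, t) * F (x, t))%:E = 0)%E.
      rewrite (_ : (fun x => (gD (x, t) * F (x, t))%:E) = cst 0%E) ?integral0//.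
      by apply/funext => x; rewrite /gD /= ifN ?mul0r//; exact/negP.
    by rewrite z0; under eq_fun do rewrite z0; exact: cvg_cst.
  have ig1 : leb.-integrable setT (EFin \o (fun x => gD (x, t))).
    apply/integrableP; split; last by rewrite ltey_eq fint.
    by apply/measurable_EFinP; exact: (measurable_fun_pair1 t mgD).
  have E (F : R * R -> R) : measurable_fun setT F -> (forall z, 0 <= z.2 <= T -> 0 <= F z <= C) ->
     (\int[leb]_x (gD (x, t) * F (x, t))%:E = (\int[leb]_x (gD (x, t) * F (x, t)))%R%:E)%E.
    move=> mF FC; rewrite /Rintegral fineK//; apply: integrable_fin_num => //.
    apply: (@mul_bdens_integrable R C setT) => //; split; first exact: (measurable_fun_pair1 t mF).
    by move=> x; apply: FC.
  rewrite (E f mf fC).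
  rewrite (_ : (fun n => _) = (fun n => (\int[leb]_x (gD (x, t) * fn n (x, t)))%R%:E)); last first.
    by apply/funext => n; rewrite (E _ (mfn n) (fnC n)).
  apply: cvg_EFin; first exact: nearW.
  exact: (inner tT ig1).
- apply: aeW => t n _; rewrite /H.
  have mk : measurable_fun [set: R] (fun x : R => (gD (x, t) * fn n (x, t))%:E).
    apply/measurable_EFinP; apply: measurable_funM; first exact: (measurable_fun_pair1 t mgD).
    exact: (measurable_fun_pair1 t (mfn n)).
  have mgt : measurable_fun [set: R] (fun x : R => `|gE (x, t)|)%E.
    by apply: measurableT_comp => //; apply/measurable_EFinP; exact: (measurable_fun_pair1 t mgD).
  have [tT|ntT] := pselect (0 <= t <= T); last first.
    have g0 x : gD (x, t) = 0 by rewrite /gD /= ifN//; exact/negP.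
    rewrite (_ : (fun x => `|gE (x, t)|)%E = cst 0%E); last by apply/funext => x; rewrite /gE g0 abse0.
    rewrite integral0 mule0 (_ : (fun x => (gD (x, t) * fn n (x, t))%:E) = cst 0%E); last by apply/funext => x; rewrite g0 mul0r.
    by rewrite integral0 abse0.
  have C0 : 0 <= C by have /andP[a] := @fnC n (0, t) tT; exact: le_trans.
  apply: le_trans (le_abse_integral leb measurableT mk) _.
  rewrite -ge0_integralZl//; apply: ge0_le_integral => //.
  - by apply: measurableT_comp.
  - by apply: emeasurable_funM.
  move=> x _; rewrite /gE -EFinM lee_fin normrM mulrC ler_wpM2r//.
  by have /andP[a b] := @fnC n (x, t) tT; rewrite ger0_norm.
Qed.

End ProductWeak.

Section SeqWeak.
Context {R : realType}.
Local Notation leb := (@lebesgue_measure R).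
Variables (T : R) (sigma : R -> R) (F G : R -> probability R R -> R) (phi m0 : R -> R)
  (C S K C0 Cr : R) (rho h eps : nat -> R) (N : nat -> nat) (mn : nat -> R -> probability R R).
Hypothesis D : mfg_data T sigma F G phi m0 C S K C0.
Hypothesis Q : mfg_seq T sigma F G phi m0 C Cr rho h eps N mn.
Variable mbar : R -> probability R R.
Hypotheses (mbarC : is_curve T mbar) (cv : curve_cvg T mn mbar).

Local Notation Cd := (cstD T C C0).
Local Notation dens n := (mdens (rho n) (h n) (eps n) (N n) sigma F G phi m0 (mn n)).
Local Notation fb := (fbar T C C0 mbar).

Let densB n t : 0 <= t <= T -> bdens Cd ((dens n)^~ t).
Proof.
move=> tT; split; first exact: measurable_dens.
move=> x; rewrite (dens_ge0 D (seq_scheme Q n)) ?(dens_le D (seq_scheme Q n) (seq_hL Q n))//.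
by case/andP: tT.
Qed.

Let fbB t : bdens Cd (fb^~ t).
Proof. split; [exact: measurable_fbar|move=> x; exact: (fbar_bnd D)]. Qed.

Let dens_int n t A : 0 <= t <= T -> measurable A ->
  (\int[leb]_(x in A) dens n x t)%R = fine (mn n t A).
Proof. by move=> tT mA; rewrite (mu_sol (seq_scheme Q n) tT mA). Qed.

Lemma dens_weak t (g : R -> R) : 0 <= t <= T -> leb.-integrable setT (EFin \o g) ->
  (\int[leb]_x (g x * dens n x t))%R @[n --> \oo] --> (\int[leb]_x (g x * fb x t))%R.
Proof.
move=> tT ig; apply: (weak_integrable (fun n => densB n tT) (fbB t)) => // a b ab.
have mI : measurable (`]a, b]%classic : set R) by exact: measurable_itv.
have -> : (\int[leb]_(x in `]a, b]) fb x t)%R = cdfR (mbar t) b - cdfR (mbar t) a.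
  by rewrite /Rintegral -(fbarE D Q cv tT mI) cdfR_itv.
have -> : (fun n => \int[leb]_(x in `]a, b]) dens n x t)%R = (fun n => cdfR (mn n t) b - cdfR (mn n t) a).
  by apply/funext => n; rewrite dens_int// cdfR_itv.
by apply: cvgB; exact: (cdf_cvg D Q cv).
Qed.

Lemma seq_weak_star : weak_star_cvg T (fun n => dens n) mbar.
Proof.
exists fb; split; first exact: (measurable_fbar2 D Q mbarC cv).
split.
  by exists Cd => x t; have /andP[a b] := fbar_bnd D mbar x t; rewrite ger0_norm.
split; first by apply: aeW => t tT A mA; exact: (fbarE D Q cv).
move=> g ig; apply: (@product_weak R T Cd (fun n z => dens n z.1 z.2) (fun z => fb z.1 z.2)) => //.
- by move=> n; exact: measurable_dens2.
- exact: (measurable_fbar2 D Q mbarC cv).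
- by move=> n z zT; case: (densB n zT) => _; exact.
- by move=> z _; exact: (fbar_bnd D).
- by move=> t tT g1 ig1; exact: dens_weak.
Qed.

(** In particular a Lebesgue-null set is null for [mbar t]; the points where the value function is
    not differentiable are discarded in this way. *)
Lemma mbar_le t (A : set R) : 0 <= t <= T -> measurable A -> (mbar t A <= Cd%:E * leb A)%E.
Proof.
move=> tT mA; rewrite (fbarE D Q cv tT mA) -integral_cst//; apply: ge0_le_integral => //.
- by move=> x _; rewrite lee_fin; have /andP[] := fbar_bnd D mbar x t.
- by apply/measurable_EFinP; apply: measurable_funTS; exact: measurable_fbar.
- by move=> x _; rewrite lee_fin; have /andP[] := fbar_bnd D mbar x t.
Qed.

End SeqWeak.

(** * Limit of the value functions *)

Section ValueLimit.
Context {R : realType}.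
Local Notation leb := (@lebesgue_measure R).

Section one.
Variables (T : R) (sigma : R -> R) (F G : R -> probability R R -> R) (phi m0 : R -> R)
  (C S K C0 Cr : R) (rho h eps : R) (N : nat) (mu : R -> probability R R).
Hypothesis D : mfg_data T sigma F G phi m0 C S K C0.
Hypothesis P : mfg_scheme T sigma F G phi m0 rho h eps N mu.
Hypotheses (rho_le1 : rho <= 1) (rho_h : rho <= Cr * h).
Local Notation L := (cstL T C).
Local Notation w := (vgrid rho h N sigma F G mu).
Let r0 := rho_gt0 P.
Let h0 := h_gt0 P.

Definition tidx (t : R) : nat := `|Num.floor (t / h)|%N.

Definition vsch (x t : R) : R := interp rho (w (tidx t)) x.

Lemma tidx_itv t : 0 <= t -> (tidx t)%:R * h <= t < ((tidx t)%:R + 1) * h.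
Proof.
move=> t0; have f0 : 0 <= Num.floor (t / h) by rewrite floor_ge0 divr_ge0// ltW.
have /andP[a b] := floor_itv (t / h).
have e : ((tidx t)%:R : R) = (Num.floor (t / h))%:~R by rewrite /tidx -[in RHS](gez0_abs f0).
by rewrite e -ler_pdivlMr// a/= -ltr_pdivrMr// -[1]/(1%:~R) -intrD.
Qed.

Lemma tidx_le t : 0 <= t <= T -> (tidx t <= N)%N.
Proof.
move=> /andP[t0 tT]; have /andP[a _] := tidx_itv t0.
by rewrite -(ler_nat R) -(ler_pM2r h0) (NhT P) (le_trans a).
Qed.

Lemma tidx_tk k : tidx (tk h k) = k.
Proof. by rewrite /tidx /tk mulfK ?gt_eqF// -[k%:R]/(k%:Z%:~R) intrKfloor. Qed.

Lemma vsch_node k i : vsch (xnode rho i) (tk h k) = w k i.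
Proof. by rewrite /vsch tidx_tk interp_node. Qed.

Lemma vsch_bnd x t : 0 <= t <= T -> `|vsch x t| <= L.
Proof. by move=> tT; apply: interp_bnd => // i; apply: (w_bnd D P); exact: tidx_le. Qed.

Lemma vsch_lip x y t : 0 <= t <= T -> `|vsch y t - vsch x t| <= L * `|y - x|.
Proof. by move=> tT; apply: interp_lip => // i; apply: (w_lip D P); exact: tidx_le. Qed.

Definition cstV (A : R) : R := 2 * C + L ^+ 2 + A * (S ^+ 2 + Cr).

(** The parameter [A] is free: a large value makes the first term small, after which [|s - t| + h]
    is taken small. The summand [h] reflects the jumps of [vsch] at grid times. *)
Lemma vsch_time A x s t : 0 < A -> 0 <= s <= T -> 0 <= t <= T ->
  `|vsch x s - vsch x t| <= L ^+ 2 / A + cstV A * (`|s - t| + h).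
Proof.
move=> A0; wlog st : s t / s <= t.
  move=> W sT tT; have [/W|/ltW/W] := leP s t; first exact.
  by move=> /(_ tT sT); rewrite distrC (distrC s).
move=> sT tT; have kl : (tidx s <= tidx t)%N.
  rewrite leqNgt; apply/negP => lk; have /andP[s0 _] := sT; have /andP[t0 _] := tT.
  have /andP[a _] := tidx_itv s0; have /andP[_ b] := tidx_itv t0.
  have : ((tidx t)%:R + 1) * h <= (tidx s)%:R * h by rewrite ler_pM2r// natr1 ler_nat.
  lra.
rewrite /vsch; set k := tidx s in kl *; set l := tidx t in kl *.
have lN : (l <= N)%N by exact: tidx_le.
have -> : interp rho (w k) x - interp rho (w l) x = interp rho (fun i => 1 * w k i + (-1) * w l i) x.
  by rewrite interpZD//; ring.
apply: interp_bnd => // i; rewrite mul1r mulN1r.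
apply: le_trans (w_time D P i A0 kl lN) _; rewrite lerD2l.
have Cr0 : 0 <= Cr by rewrite -(pmulr_lge0 _ h0); apply: le_trans rho_h; exact: ltW.
have cV0 : 0 <= cstV A.
  have := C_pos D; have := sqr_ge0 L; have : 0 <= A * (S ^+ 2 + Cr) by rewrite mulr_ge0 ?(ltW A0)// addr_ge0 ?sqr_ge0.
  rewrite /cstV; lra.
have rho2 : rho ^+ 2 <= h * Cr by rewrite mulrC; apply: le_trans rho_h; rewrite expr2 ler_piMl// ltW.
apply: (@le_trans _ _ ((l - k)%:R * h * cstV A)).
  have Ar : A * rho ^+ 2 <= A * (h * Cr) by rewrite ler_wpM2l// ltW.
  by rewrite -mulrA ler_wpM2l// /cstV; lra.
rewrite mulrC ler_wpM2l// natrB// mulrBl (distrC s) ger0_norm ?subr_ge0//.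
have /andP[s0 _] := sT; have /andP[t0 _] := tT.
have /andP[_ a] := tidx_itv s0; have /andP[b _] := tidx_itv t0.
move: a b; rewrite -/k -/l; lra.
Qed.

Lemma vsch_secants x (m : nat) t : 0 <= t <= T ->
  vsch (x + m%:R * rho) t - vsch x t <=
    m%:R * rho * Dveps rho h eps N sigma F G phi mu (tidx t) x + L * (m%:R * rho) ^+ 2 + 2 * L * (K * eps) /\
  m%:R * rho * Dveps rho h eps N sigma F G phi mu (tidx t) x - L * (m%:R * rho) ^+ 2 - 2 * L * (K * eps) <=
    vsch x t - vsch (x - m%:R * rho) t.
Proof.
move=> tT; have kN := tidx_le tT.
by split; [exact: (Dveps_secant_right D P kN)|exact: (Dveps_secant_left D P kN)].
Qed.

End one.

Variables (T : R) (sigma : R -> R) (F G : R -> probability R R -> R) (phi m0 : R -> R)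
  (C S K C0 Cr : R) (rho h eps : nat -> R) (N : nat -> nat) (mn : nat -> R -> probability R R).
Hypothesis D : mfg_data T sigma F G phi m0 C S K C0.
Hypothesis Q : mfg_seq T sigma F G phi m0 C Cr rho h eps N mn.
Local Notation L := (cstL T C).
Local Notation vn n := (vsch sigma F G (rho n) (h n) (N n) (mn n)).

(* [v] is only known to be a limit along a subsequence: no comparison principle
   is used, since any bounded Lipschitz viscosity solution is a [value_fun]. *)
Definition value_cvg (v : R -> R -> R) := forall M e : R, 0 < e -> exists n0 : nat,
  forall n (x t : R), (n0 <= n)%N -> `|x| <= M -> 0 <= t <= T -> `|vn n x t - v x t| <= e.

Let T0 : 0 <= T. Proof. exact: ltW (T_gt0 D). Qed.
Let Cr0 : 0 <= Cr.
Proof.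
rewrite -(pmulr_lge0 _ (h_gt0 (seq_scheme Q 0))); apply: le_trans (seq_rho_h Q 0).
exact: ltW (rho_gt0 (seq_scheme Q 0)).
Qed.

Let cV0 A : 0 <= A -> 0 <= cstV T C S Cr A.
Proof.
move=> A0; have := C_pos D; have := sqr_ge0 L.
have : 0 <= A * (S ^+ 2 + Cr) by rewrite mulr_ge0// addr_ge0 ?sqr_ge0.
rewrite /cstV; lra.
Qed.

Lemma value_compact : exists2 s : nat -> nat, {homo s : a b / (a < b)%N} & exists v : R -> R -> R,
  forall M e : R, 0 < e -> exists n0 : nat,
  forall n (x t : R), (n0 <= n)%N -> `|x| <= M -> 0 <= t <= T -> `|vn (s n) x t - v x t| <= e.
Proof.
apply: (@arzela_ascoli R T L (fun n => vn n)) => //.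
  by move=> n x t tT; exact: (vsch_bnd D (seq_scheme Q n)).
move=> e e0; have e40 : 0 < e / 4 by rewrite divr_gt0.
have L0 : 0 <= L by exact: cstL_ge0 D.
(* Chosen before the time increment, so that [L^2 / A <= e / 4]; the [1] keeps [A] positive when
   [L = 0]. *)
pose A := (L ^+ 2 + 1) / (e / 4).
have A0 : 0 < A by rewrite divr_gt0// ltr_wpDl ?sqr_ge0.
have LA : L ^+ 2 / A <= e / 4.
  rewrite /A invf_div mulrA mulrC ler_pdivrMl ?ltr_wpDl ?sqr_ge0//.
  by rewrite mulrDl mul1r lerDl ltW.
pose c := cstV T C S Cr A + 1; have c0 : 0 < c by rewrite ltr_wpDl// cV0// ltW.
have d0 : 0 < e / 4 / c by rewrite divr_gt0.
have /cvgrPdist_le/(_ _ d0)[n0 _ Hn0] := seq_h Q.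
have L1 : 0 < L + 1 by rewrite ltr_wpDl.
exists (Num.min (e / 4 / c) (e / 4 / (L + 1))), n0; split; first by rewrite lt_min d0 divr_gt0.
move=> n x y s t nn0 sT tT; rewrite !lt_min => /andP[_ xy] /andP[st _].
have := Hn0 n nn0; rewrite /= sub0r normrN gtr0_norm ?(h_gt0 (seq_scheme Q n))// => hn.
have h1 := vsch_lip D (seq_scheme Q n) y x sT.
have h2 := vsch_time D (seq_scheme Q n) (seq_rho1 Q n) (seq_rho_h Q n) y A0 sT tT.
have k1 : L * `|x - y| <= e / 4.
  apply: (@le_trans _ _ ((L + 1) * `|x - y|)); first by rewrite ler_wpM2r// lerDl.
  by rewrite -ler_pdivlMl// mulrC ltW.
have k2 : cstV T C S Cr A * (`|s - t| + h n) <= e / 4 + e / 4.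
  have hn0 := h_gt0 (seq_scheme Q n).
  apply: (@le_trans _ _ (c * (`|s - t| + h n))).
    by rewrite ler_wpM2r ?lerDl// addr_ge0// ltW.
  rewrite mulrDr lerD// -ler_pdivlMl// mulrC//; exact: ltW.
move: h1 h2 k1 k2 LA; set u1 := vsch _ _ _ _ _ _ _ _ _; set u2 := vsch _ _ _ _ _ _ _ _ _; set u3 := vsch _ _ _ _ _ _ _ _ _.
set X1 := L * _; set X2 := L ^+ 2 / A; set X3 := cstV _ _ _ _ _ * _; clearbody u1 u2 u3 X1 X2 X3.
by rewrite !ler_norml => /andP[? ?] /andP[? ?] *; apply/andP; split; lra.
Qed.

Variable v : R -> R -> R.
Hypothesis vcv : value_cvg v.

Lemma value_cvg_pt x t : 0 <= t <= T -> vn n x t @[n --> \oo] --> v x t.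
Proof.
move=> tT; apply: cvg_eps => e e0; have [n0 H] := vcv `|x| e0.
by exists n0 => // n /= nn0; exact: H.
Qed.

Lemma value_bnd x t : 0 <= t <= T -> `|v x t| <= L.
Proof.
move=> tT; apply: (cvg_ub (cvg_norm (@value_cvg_pt x t tT))); apply: nearW => n.
exact: (vsch_bnd D (seq_scheme Q n)).
Qed.

Lemma value_lip x y t : 0 <= t <= T -> `|v x t - v y t| <= L * `|x - y|.
Proof.
move=> tT; apply: (cvg_ub (cvg_norm (cvgB (@value_cvg_pt x t tT) (@value_cvg_pt y t tT)))).
by apply: nearW => n; exact: (vsch_lip D (seq_scheme Q n)).
Qed.

Lemma value_time A x s t : 0 < A -> 0 <= s <= T -> 0 <= t <= T ->
  `|v x s - v x t| <= L ^+ 2 / A + cstV T C S Cr A * `|s - t|.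
Proof.
move=> A0 sT tT.
have q : (fun n => `|vn n x s - vn n x t| - cstV T C S Cr A * h n) @ \oo --> `|v x s - v x t| - cstV T C S Cr A * 0.
  apply: cvgB; first by apply: cvg_norm; apply: cvgB; exact: value_cvg_pt.
  by apply: cvgM; [exact: cvg_cst|exact: (seq_h Q)].
rewrite mulr0 subr0 in q; apply: (cvg_ub q); apply: nearW => n.
have := vsch_time D (seq_scheme Q n) (seq_rho1 Q n) (seq_rho_h Q n) x A0 sT tT.
by rewrite /= lerBlDr mulrDr addrA.
Qed.

Lemma value_cont x t e : 0 < e -> 0 <= t <= T -> exists2 d : R, 0 < d &
  forall y s, 0 <= s <= T -> `|y - x| < d -> `|s - t| < d -> `|v y s - v x t| < e.
Proof.
move=> e0 tT; have e40 : 0 < e / 4 by rewrite divr_gt0.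
have L0 : 0 <= L by exact: cstL_ge0 D.
pose A := (L ^+ 2 + 1) / (e / 4).
have A0 : 0 < A by rewrite divr_gt0// ltr_wpDl ?sqr_ge0.
have LA : L ^+ 2 / A <= e / 4.
  rewrite /A invf_div mulrA mulrC ler_pdivrMl ?ltr_wpDl ?sqr_ge0//.
  by rewrite mulrDl mul1r lerDl ltW.
pose c := cstV T C S Cr A + 1; have c0 : 0 < c by rewrite ltr_wpDl// cV0// ltW.
have L1 : 0 < L + 1 by rewrite ltr_wpDl.
exists (Num.min (e / 4 / c) (e / 4 / (L + 1))); first by rewrite lt_min !divr_gt0.
move=> y s sT; rewrite !lt_min => /andP[_ xy] /andP[st _].
have h1 := value_lip y x sT; have h2 := value_time x A0 sT tT.
have k1 : L * `|y - x| <= e / 4.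
  apply: (@le_trans _ _ ((L + 1) * `|y - x|)); first by rewrite ler_wpM2r// lerDl.
  by rewrite -ler_pdivlMl// mulrC ltW.
have k2 : cstV T C S Cr A * `|s - t| <= e / 4.
  apply: (@le_trans _ _ (c * `|s - t|)); first by rewrite ler_wpM2r ?lerDl.
  by rewrite -ler_pdivlMl// mulrC ltW.
move: h1 h2 k1 k2 LA; set u1 := v _ _; set u2 := v _ _; set u3 := v _ _.
set X1 := L * _; set X2 := L ^+ 2 / A; set X3 := cstV _ _ _ _ _ * _; clearbody u1 u2 u3 X1 X2 X3.
by rewrite !ler_norml ltr_norml => /andP[? ?] /andP[? ?] *; apply/andP; split; lra.
Qed.

Variable mbar : R -> probability R R.
Hypotheses (mbarC : is_curve T mbar) (cv : curve_cvg T mn mbar).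

(** Three errors vanish together: the convergence of the value functions, the interpolation of the
    terminal datum over one mesh, and the continuity of [G] in the measure. *)
Lemma value_terminal x : v x T = G x (mbar T).
Proof.
have TT : 0 <= T <= T by rewrite T0 lexx.
apply/eqP; rewrite -subr_eq0 -normr_le0; apply/ler_addgt0Pl => e e0; rewrite addr0.
have e30 : 0 < e / 3 by rewrite divr_gt0.
have [d d0 Hd] := G_cont D x (mbarC.1 T TT) e30.
have C10 : 0 < C + 1 by rewrite ltr_wpDl// (C_pos D).
have c0 : 0 < e / 3 / (C + 1) by rewrite divr_gt0.
have [n0 H1] := vcv `|x| e30.
have /cvgrPdist_le/(_ _ c0)[n1 _ H2] := seq_rho Q.
have [n2 _ H3] := cv d0.
pose n := maxn n0 (maxn n1 n2).
have := H1 n x T; rewrite leq_maxl lexx => /(_ isT isT TT) k1.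
have := H2 n; rewrite /= !leq_max leqnn/= orbT sub0r normrN gtr0_norm ?(rho_gt0 (seq_scheme Q n))// => /(_ isT) k2.
have := H3 n; rewrite /= !leq_max leqnn !orbT => /(_ isT T TT) k3.
have {k3}k3 := Hd x (mn n T) (mu_P1 (seq_scheme Q n) TT) (_ : `|x - x| < d) k3.
have {}k3 : `|G x (mn n T) - G x (mbar T)| < e / 3 by apply: k3; rewrite subrr normr0.
have k4 : `|vn n x T - G x (mn n T)| <= C * rho n.
  have TN : tidx (h n) T = N n by rewrite -(NhT (seq_scheme Q n)) -/(tk (h n) (N n)) (tidx_tk (seq_scheme Q n)).
  rewrite /vsch TN (wN (seq_scheme Q n)).
  have [dG [_ [_ bG]]] := G_C2 D (mu_P1 (seq_scheme Q n) TT).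
  have r0 := rho_gt0 (seq_scheme Q n).
  have lG y : `|G y (mn n T) - G x (mn n T)| <= C * `|y - x|.
    by apply: (derive_le_lip dG) => z; case: (bG z) => _ [].
  rewrite ler_norml lerBrDr lerBlDr; apply/andP; split.
    rewrite -(interp_cst (rho n) (- (C * rho n) + G x (mn n T)) x); apply: interp_le_local => // i xi.
    have := lG (xnode (rho n) i); have : C * `|xnode (rho n) i - x| <= C * rho n by rewrite ler_wpM2l// (C_pos D).
    by rewrite (ler_norml (_ - G x _)) => ? /andP[? ?]; lra.
  rewrite -(interp_cst (rho n) (C * rho n + G x (mn n T)) x); apply: interp_le_local => // i xi.
  have := lG (xnode (rho n) i); have : C * `|xnode (rho n) i - x| <= C * rho n by rewrite ler_wpM2l// (C_pos D).
  by rewrite (ler_norml (_ - G x _)) => ? /andP[? ?]; lra.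
have k5 : C * rho n <= e / 3.
  apply: (@le_trans _ _ ((C + 1) * rho n)); first by rewrite ler_wpM2r ?lerDl// ltW// (rho_gt0 (seq_scheme Q n)).
  by rewrite -ler_pdivlMl// mulrC.
move: k1 k3 k4 k5; set u1 := vsch _ _ _ _ _ _ _ _ _; set u2 := v _ _; set u3 := G _ _; set u4 := G _ _.
set X := C * _; clearbody u1 u2 u3 u4 X.
by rewrite !ler_norml ltr_norml => /andP[? ?] /andP[? ?] /andP[? ?] ?; apply/andP; split; lra.
Qed.

End ValueLimit.

(** * Quadratic test functions in the scheme *)

Section Quadratic.
Context {R : realType}.

(** Affine in time and quadratic in space around [(x0, t0)]. Test functions are replaced by such
    polynomials, on which the average over one step is explicit up to the interpolation error. *)
Definition quad (v0 A b X x0 t0 y s : R) : R :=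
  v0 + A * (s - t0) + b * (y - x0) + 2^-1 * X * (y - x0) ^+ 2.

Section scheme.
Variables (rho h : R).
Hypotheses (rho_gt0 : 0 < rho) (h_gt0 : 0 < h).

Lemma interp_quad v0 A b X x0 t0 s z :
  `|interp rho (fun j => quad v0 A b X x0 t0 (xnode rho j) s) z - quad v0 A b X x0 t0 z s| <= 2^-1 * `|X| * rho ^+ 2.
Proof.
apply: (@interp_taylor R rho rho_gt0 (fun y => quad v0 A b X x0 t0 y s) z (b + X * (z - x0))) => y.
have -> : quad v0 A b X x0 t0 y s - quad v0 A b X x0 t0 z s - (b + X * (z - x0)) * (y - z) = 2^-1 * X * (y - z) ^+ 2.
  by rewrite /quad; field.
by rewrite normrM (ger0_norm (sqr_ge0 _)) normrM ger0_norm.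
Qed.

Lemma havg_quad v0 A b X x0 t0 s sg z :
  `|havg rho h sg (fun j => quad v0 A b X x0 t0 (xnode rho j) s) z -
    (quad v0 A b X x0 t0 z s + 2^-1 * X * (h * sg ^+ 2))| <= 2^-1 * `|X| * rho ^+ 2.
Proof.
have := interp_quad v0 A b X x0 t0 s (z + Num.sqrt h * sg).
have := interp_quad v0 A b X x0 t0 s (z - Num.sqrt h * sg).
have q2 : h * sg ^+ 2 = (Num.sqrt h * sg) ^+ 2 by rewrite exprMn sqr_sqrtr// ltW.
rewrite /havg q2; set q := Num.sqrt h * sg; set i1 := interp _ _ _; set i2 := interp _ _ _.
rewrite /quad !ler_norml => /andP[? ?] /andP[? ?]; apply/andP; split; lra.
Qed.

(** One step sees only the nodes within [sqrt h S + rho] of the foot point, so a comparison near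
    [x0] suffices. *)
Lemma havg_le_near s (w w' : int -> R) x S r x0 : `|s| <= S -> (forall i, `|xnode rho i - x0| <= r -> w i <= w' i) ->
  `|x - x0| + Num.sqrt h * S + rho <= r -> havg rho h s w x <= havg rho h s w' x.
Proof.
move=> sS ww xr; have sh : `|Num.sqrt h * s| <= Num.sqrt h * S by rewrite normrM ger0_norm ?sqrtr_ge0// ler_wpM2l ?sqrtr_ge0.
have loc y : `|y - x| <= Num.sqrt h * S -> interp rho w y <= interp rho w' y.
  move=> yx; apply: interp_le_local => // i iy; apply: ww.
  have := ler_distD x (xnode rho i) x0; have := ler_distD y (xnode rho i) x; lra.
rewrite /havg ler_pM2l//; apply: lerD; apply: loc; first by rewrite addrAC subrr add0r.
by rewrite addrAC subrr add0r normrN.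
Qed.

End scheme.
End Quadratic.

Section SchemeContact.
Context {R : realType}.
Variables (T : R) (sigma : R -> R) (F G : R -> probability R R -> R) (phi m0 : R -> R)
  (C S K C0 Cr : R) (rho h eps : R) (N : nat) (mu : R -> probability R R).
Hypothesis D : mfg_data T sigma F G phi m0 C S K C0.
Hypothesis P : mfg_scheme T sigma F G phi m0 rho h eps N mu.
Hypotheses (rho_h : rho <= Cr * h).
Local Notation L := (cstL T C).
Local Notation w := (vgrid rho h N sigma F G mu).
Let r0 := rho_gt0 P.
Let h0 := h_gt0 P.

Variables (v0 A b X x0 t0 r M : R) (k : nat) (i : int).
Local Notation q := (quad v0 A b X x0 t0).
Hypothesis kN : (k < N)%N.
Hypothesis wki : w k i = q (xnode rho i) (tk h k) + M.

Let sS : `|sigma (tk h k)| <= S.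
Proof. by apply: (sigma_bnd D); apply: (tk_itv P); exact: ltnW. Qed.

Let quadM c y s : quad (v0 + c) A b X x0 t0 y s = q y s + c.
Proof. by rewrite /quad; ring. Qed.

Let rho2 : 2^-1 * `|X| * rho ^+ 2 <= h * (`|X| * (2^-1 * Cr * rho)).
Proof.
have -> : h * (`|X| * (2^-1 * Cr * rho)) = 2^-1 * `|X| * (Cr * h * rho) by ring.
by rewrite ler_wpM2l ?mulr_ge0// expr2 ler_wpM2r// ltW.
Qed.

(** The gradient [b] of the quadratic is a competitor among the controls. Inserting the upper bound
    at level [k + 1] into its cost and dividing by [h] leaves the equation, up to the displayed
    error. *)
Lemma scheme_sub :
  (forall j, `|xnode rho j - x0| <= r -> w k.+1 j <= q (xnode rho j) (tk h k.+1) + M) ->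
  `|xnode rho i - x0| + h * `|b| + Num.sqrt h * S + rho <= r ->
  0 <= A - 2^-1 * b ^+ 2 + 2^-1 * X * sigma (tk h k) ^+ 2 + F (xnode rho i) (mu (tk h k)) +
    `|X| * (`|b| * `|xnode rho i - x0| + 2^-1 * h * b ^+ 2 + 2^-1 * Cr * rho).
Proof.
move=> wq near; rewrite -(pmulr_rge0 _ h0).
set d := xnode rho i - x0 in near *.
have := hjb_le r0 h0 (sigma (tk h k)) (w_bnd D P kN) (fun i => F (xnode rho i) (mu (tk h k))) i b.
rewrite -(wS P kN) wki /hcost.
have near' : `|xnode rho i - h * b - x0| + Num.sqrt h * S + rho <= r.
  apply: le_trans near; rewrite !lerD2r; have -> : xnode rho i - h * b - x0 = d - h * b by rewrite /d; ring.
  by apply: le_trans (ler_normB _ _) _; rewrite normrM gtr0_norm.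
have wq' j : `|xnode rho j - x0| <= r -> w k.+1 j <= quad (v0 + M) A b X x0 t0 (xnode rho j) (tk h k.+1).
  by rewrite quadM; exact: wq.
have H := havg_le_near r0 sS wq' near'.
have := havg_quad r0 h0 (v0 + M) A b X x0 t0 (tk h k.+1) (sigma (tk h k)) (xnode rho i - h * b).
move: H; set a1 := havg _ _ _ _ _; set a2 := havg _ _ _ _ _; rewrite quadM /quad.
have -> : xnode rho i - h * b - x0 = d - h * b by rewrite /d; ring.
have -> : tk h k.+1 - t0 = tk h k - t0 + h by rewrite /tk -natr1; ring.
rewrite -/d; move: (F _ _) => Fi; move: (sigma _) => sg; clearbody a1 a2 d.
have Xbd : - (X * b * d) <= `|X| * (`|b| * `|d|).
  by rewrite mulrA -!normrM; apply: le_trans (ler_norm _) _; rewrite normrN.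
have Xb : X * (h * b ^+ 2) <= `|X| * (h * b ^+ 2).
  by rewrite ler_wpM2r ?ler_norm// mulr_ge0 ?sqr_ge0// ltW.
have hXbd : h * - (X * b * d) <= h * (`|X| * (`|b| * `|d|)) by rewrite ler_pM2l.
have hXb : h * (X * (h * b ^+ 2)) <= h * (`|X| * (h * b ^+ 2)) by rewrite ler_pM2l.
move: rho2 hXbd hXb; clear near near' wq Xbd Xb.
move: (`|b| * `|d|) => bd; rewrite !ler_norml => ? ? ? ? /andP[? ?]; lra.
Qed.

(** Here the control is imposed: it is near-optimal and at most [2 L]. Whatever its value,
    [a^2 / 2 - a b >= - b^2 / 2] gives the Hamiltonian. *)
Lemma scheme_super e : 0 < e ->
  (forall j, `|xnode rho j - x0| <= r -> q (xnode rho j) (tk h k.+1) + M <= w k.+1 j) ->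
  `|xnode rho i - x0| + h * (2 * L) + Num.sqrt h * S + rho <= r ->
  A - 2^-1 * b ^+ 2 + 2^-1 * X * sigma (tk h k) ^+ 2 + F (xnode rho i) (mu (tk h k)) <=
    e + `|X| * (2 * L * `|xnode rho i - x0| + 2^-1 * h * (2 * L) ^+ 2 + 2^-1 * Cr * rho).
Proof.
move=> e0 wq near; rewrite -(ler_pM2l h0).
set d := xnode rho i - x0 in near *.
have he : 0 < h * e by rewrite mulr_gt0.
have [a aL] := hjb_approx_bnd r0 h0 (sigma (tk h k)) (w_bnd D P kN) (w_lip D P kN) (fun i => F (xnode rho i) (mu (tk h k))) i he.
rewrite -(wS P kN) wki /hcost => /ltW.
have L0 := cstL_ge0 D.
have near' : `|xnode rho i - h * a - x0| + Num.sqrt h * S + rho <= r.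
  apply: le_trans near; rewrite !lerD2r; have -> : xnode rho i - h * a - x0 = d - h * a by rewrite /d; ring.
  by apply: le_trans (ler_normB _ _) _; rewrite normrM gtr0_norm// lerD2l ler_pM2l.
have wq' j : `|xnode rho j - x0| <= r -> quad (v0 + M) A b X x0 t0 (xnode rho j) (tk h k.+1) <= w k.+1 j.
  by rewrite quadM; exact: wq.
have H := havg_le_near r0 sS wq' near'.
have := havg_quad r0 h0 (v0 + M) A b X x0 t0 (tk h k.+1) (sigma (tk h k)) (xnode rho i - h * a).
move: H; set a1 := havg _ _ _ _ _; set a2 := havg _ _ _ _ _; rewrite quadM /quad.
have -> : xnode rho i - h * a - x0 = d - h * a by rewrite /d; ring.
have -> : tk h k.+1 - t0 = tk h k - t0 + h by rewrite /tk -natr1; ring.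
rewrite -/d; move: (F _ _) => Fi; move: (sigma _) => sg; clearbody a1 a2 d.
have Xad : X * a * d <= `|X| * (2 * L * `|d|).
  apply: le_trans (ler_norm _) _; rewrite !normrM -mulrA ler_wpM2l// ler_wpM2r//.
have a2L : a ^+ 2 <= (2 * L) ^+ 2.
  by rewrite -[a ^+ 2]real_normK ?num_real// lerXn2r ?nnegrE// (le_trans _ aL).
have Xa : - (X * a ^+ 2) <= `|X| * (2 * L) ^+ 2.
  apply: (@le_trans _ _ (`|X| * a ^+ 2)); last by rewrite ler_wpM2l.
  by rewrite -mulNr ler_wpM2r ?sqr_ge0// -normrN ler_norm.
have hXad : h * (X * a * d) <= h * (`|X| * (2 * L * `|d|)) by rewrite ler_pM2l.
have hXa : h * (h * - (X * a ^+ 2)) <= h * (h * (`|X| * (2 * L) ^+ 2)) by rewrite !ler_pM2l.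
have hab : 0 <= h * (a - b) ^+ 2 by rewrite mulr_ge0 ?sqr_ge0// ltW.
move: rho2 hXad hXa hab; clear near near' wq Xad Xa a2L aL.
move: (2 * L * `|d|) ((2 * L) ^+ 2) => y1 y2; rewrite !ler_norml => ? ? ? ? ? /andP[? ?] ?; lra.
Qed.

End SchemeContact.

Section C21Taylor.
Context {R : realType}.
Implicit Types p : R -> R -> R.

Lemma cont2_near (f : R -> R -> R) x0 t0 e : continuous (fun z : R * R => f z.1 z.2) -> 0 < e ->
  exists2 d : R, 0 < d & forall y s, `|y - x0| < d -> `|s - t0| < d -> `|f y s - f x0 t0| <= e.
Proof.
move=> cf e0; have /cvgrPdist_le/(_ _ e0) := cf (x0, t0).
rewrite nearE => /nbhs_ballP[d /= d0 Hd]; exists d => // y s yx st.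
by rewrite distrC; apply: (Hd (y, s)); split; rewrite /= /ball/= distrC.
Qed.

(** Time is expanded at fixed [y] and space at fixed time [t0], so continuity of [dt p] and [dxx p]
    at the base point is enough. *)
Lemma C21_taylor p x0 t0 eta : C21 p -> 0 < eta -> exists2 d : R, 0 < d &
  forall y s, `|y - x0| < d -> `|s - t0| < d ->
  `|p y s - p x0 t0 - (dt p x0 t0 * (s - t0) + dx p x0 t0 * (y - x0) + 2^-1 * dxx p x0 t0 * (y - x0) ^+ 2)|
  <= eta * `|s - t0| + eta * (y - x0) ^+ 2.
Proof.
move=> [dtp [dxp [dxxp [_ [ct [_ cxx]]]]]] e0.
have [d1 d10 H1] := cont2_near x0 t0 ct e0; have [d2 d20 H2] := cont2_near x0 t0 cxx e0.
exists (Num.min d1 d2); first by rewrite lt_min d10.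
move=> y s; rewrite !lt_min => /andP[y1 y2] /andP[s1 s2].
have t00 : `|t0 - t0| < d2 by rewrite subrr normr0.
pose g (x : R) := p x t0 - dx p x0 t0 * (x - x0) - 2^-1 * dxx p x0 t0 * (x - x0) ^+ 2.
have dg (x : R) : is_derive x 1 g (dx p x t0 - dx p x0 t0 - dxx p x0 t0 * (x - x0)).
  have := dxp x t0 => /derivableP dfx.
  apply: is_derive_eq; by rewrite /dx !derive1E /GRing.scale/=; field.
have [c ca E] := @mean_value R g x0 y (fun x => @ex_derive _ _ _ _ _ _ _ (dg x)).
have [c' c'a E'] := @mean_value R (fun x => dx p x t0) x0 c (fun x => dxxp x t0).
have [u ua Eu] := @mean_value R (p y) t0 s (fun t => dtp y t).
have -> : p y s - p x0 t0 - (dt p x0 t0 * (s - t0) + dx p x0 t0 * (y - x0) + 2^-1 * dxx p x0 t0 * (y - x0) ^+ 2) =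
    (p y s - p y t0 - dt p x0 t0 * (s - t0)) + (g y - g x0).
  by rewrite /g !subrr; ring.
apply: le_trans (ler_normD _ _) _; apply: lerD.
  rewrite Eu -mulrBl normrM ler_wpM2r//; apply: H1 => //; exact: le_lt_trans ua s1.
rewrite E derive1E (@derive_val _ _ _ _ _ _ _ (dg c)) E'.
have -> : derive1 (fun x => dx p x t0) c' * (c - x0) - dxx p x0 t0 * (c - x0) = (dxx p c' t0 - dxx p x0 t0) * (c - x0).
  by rewrite mulrBl.
have := H2 c' t0 (le_lt_trans (le_trans c'a ca) y2) t00.
rewrite !normrM -mulrA -[(y - x0) ^+ 2]real_normK ?num_real// expr2 => k.
by apply: ler_pM => //; apply: ler_wpM2r.
Qed.

Lemma quad_near v0 A b X x0 t0 e : 0 < e -> exists2 d : R, 0 < d &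
  forall y s : R, `|y - x0| < d -> `|s - t0| < d -> `|quad v0 A b X x0 t0 y s - v0| <= e.
Proof.
move=> e0; pose B : R := `|A| + `|b| + `|X| + 1.
have B0 : 0 < B by rewrite ltr_wpDl// !addr_ge0.
exists (Num.min 1 (e / B)); first by rewrite lt_min ltr01 divr_gt0.
move=> y s; rewrite !lt_min => /andP[y1 y2] /andP[s1 s2].
have -> : quad v0 A b X x0 t0 y s - v0 = A * (s - t0) + b * (y - x0) + 2^-1 * X * (y - x0) ^+ 2 by rewrite /quad; ring.
set d := e / B in y2 s2.
have yd : `|y - x0| ^+ 2 <= d by rewrite expr2 (le_trans _ (ltW y2))// ler_piMl// ltW.
have k1 : `|A * (s - t0)| <= `|A| * d by rewrite normrM ler_wpM2l// ltW.
have k2 : `|b * (y - x0)| <= `|b| * d by rewrite normrM ler_wpM2l// ltW.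
have k3 : `|2^-1 * X * (y - x0) ^+ 2| <= `|X| * d.
  rewrite !normrM (@ger0_norm _ 2^-1)// -normrM -expr2 normrX.
  by apply: ler_pM => //; rewrite ler_piMl//; lra.
have d0 : 0 < d by rewrite divr_gt0.
have -> : e = `|A| * d + `|b| * d + `|X| * d + d.
  by rewrite -[X in _ = _ + _ + _ + X]mul1r -!mulrDl -/B mulrC divfK// gt_eqF.
move: k1 k2 k3 (normr_ge0 A); move: (`|A| * d) (`|b| * d) (`|X| * d) => a1 a2 a3.
by rewrite !ler_norml => /andP[? ?] /andP[? ?] /andP[? ?] ?; apply/andP; split; lra.
Qed.

End C21Taylor.

Lemma centered_ord (i : int) (B : nat) : (`|i|%N <= B)%N ->
  exists j : 'I_(2 * B).+1, (j : nat)%:Z - B%:Z = i :> int.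
Proof.
move=> iB; have jB : (`|(i + B%:Z)%R|%N < (2 * B).+1)%N by lia.
exists (Ordinal jB); rewrite /=; lia.
Qed.

(** * From a strict contact of the limit to a contact on the grid *)

Section GridContact.
Context {R : realType}.
Variables (T : R) (rho h : nat -> R) (N : nat -> nat) (W : nat -> nat -> int -> R) (V q : R -> R -> R).
Variables (x0 t0 r eta : R).
Hypotheses (r0 : 0 < r) (eta0 : 0 < eta) (t00 : 0 < t0) (t0T : t0 + r < T).
Hypotheses (rho_gt0 : forall n, 0 < rho n) (h_gt0 : forall n, 0 < h n).
Hypotheses (rho_cvg : rho @ \oo --> 0) (h_cvg : h @ \oo --> 0).
Hypothesis NhT : forall n, (N n)%:R * h n = T.
Hypothesis Wcv : forall e, 0 < e -> exists n0, forall n k i, (n0 <= n)%N -> (k <= N n)%N ->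
  `|xnode (rho n) i - x0| <= r -> `|W n k i - V (xnode (rho n) i) (tk (h n) k)| <= e.
Hypothesis Vcont : forall e, 0 < e -> exists2 d : R, 0 < d & forall y s, 0 <= s <= T ->
  `|y - x0| < d -> `|s - t0| < d -> `|V y s - V x0 t0| <= e.
Hypothesis qcont : forall e, 0 < e -> exists2 d : R, 0 < d & forall y s,
  `|y - x0| < d -> `|s - t0| < d -> `|q y s - V x0 t0| <= e.
Hypothesis Vq : forall y s, `|y - x0| <= r -> t0 <= s <= t0 + r -> 
  V y s <= q y s - eta * (s - t0) - eta * (y - x0) ^+ 2.

Let int_bnd (n : nat) : exists B : nat, forall i, `|xnode (rho n) i - x0| <= r -> (`|i|%N <= B)%N.
Proof.
exists (Num.truncn ((`|x0| + r) / rho n)).+1 => i; rewrite /xnode => H.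
rewrite -(ler_nat R); apply: le_trans (ltW (Num.Theory.truncnS_gt _)).
rewrite ler_pdivlMr// natr_absz intr_norm -{1}(gtr0_norm (rho_gt0 n)) -normrM.
by rewrite -lerBlDl; apply: le_trans H; exact: lerB_dist.
Qed.

Let contact_arith (a b u v e : R) : - (3 * e) <= b -> a <= e - u - v -> b <= a -> u + v <= 4 * e.
Proof. move=> *; lra. Qed.

(* The maximum is taken over the times [s >= t0] only: the scheme is implicit
   backward in time, so a contact compares time [k] with time [k + 1] alone. *)
Lemma grid_contact del : 0 < del -> exists n0, forall n, (n0 <= n)%N -> exists k i,
  [/\ (k < N n)%N, t0 <= tk (h n) k <= t0 + del, `|xnode (rho n) i - x0| <= del &
   forall j, `|xnode (rho n) j - x0| <= r -> 
     W n k.+1 j - q (xnode (rho n) j) (tk (h n) k.+1) <= W n k i - q (xnode (rho n) i) (tk (h n) k)].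
Proof.
move=> del0; move: (t0T) (t00) (r0) => t0T' t00' r0'; pose d := Num.min (Num.min del 1) (r / 2).
have d0 : 0 < d by rewrite !lt_min del0 ltr01 divr_gt0.
have d_del : d <= del by rewrite !ge_min lexx.
have d1 : d <= 1 by rewrite !ge_min lexx !orbT.
have dr : d <= r / 2 by rewrite !ge_min lexx !orbT.
(* The maximum is at least [- 3 e], by a grid point near [(x0, t0)], and at most [e] minus the
   penalty of [Vq]. So the penalty is at most [4 e = eta d^2], which puts the maximiser within [d]
   in space and, as [d <= 1], also in time. *)
pose e := eta * d ^+ 2 / 4; have e0 : 0 < e by rewrite divr_gt0// mulr_gt0// exprn_gt0.
have [n1 H1] := Wcv e0; have [d2 d20 H2] := Vcont e0; have [d3 d30 H3] := qcont e0.
pose d4 := Num.min (Num.min d2 d3) (r / 2); have d40 : 0 < d4 by rewrite !lt_min d20 d30 divr_gt0.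
have /cvgrPdist_lt/(_ _ d40)[n2 _ H4] := rho_cvg; have /cvgrPdist_lt/(_ _ d40)[n3 _ H5] := h_cvg.
exists (maxn n1 (maxn n2 n3)) => n; rewrite !geq_max => /and3P[nn1 nn2 nn3].
have := H4 n nn2; rewrite /= sub0r normrN gtr0_norm// => rd.
have := H5 n nn3; rewrite /= sub0r normrN gtr0_norm// => hd.
have r0n := rho_gt0 n; have h0n := h_gt0 n.
have d4r : d4 <= r / 2 by rewrite !ge_min lexx !orbT.
have [B HB] := int_bnd n.
pose nd (z : 'I_(N n).+1 * 'I_(2 * B).+1) : int := (z.2 : nat)%:Z - B%:Z.
pose Pz (z : 'I_(N n).+1 * 'I_(2 * B).+1) :=
  (t0 <= tk (h n) z.1 <= t0 + r) && (`|xnode (rho n) (nd z) - x0| <= r).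
pose f (z : 'I_(N n).+1 * 'I_(2 * B).+1) := W n z.1 (nd z) - q (xnode (rho n) (nd z)) (tk (h n) z.1).
have tkN k : tk (h n) k <= T -> (k < (N n).+1)%N.
  by rewrite /tk -(NhT n) ler_pM2r// ler_nat ltnS.
have mkz (k : nat) i : t0 <= tk (h n) k <= t0 + r -> `|xnode (rho n) i - x0| <= r ->
   exists2 z, Pz z & (z.1 : nat) = k /\ nd z = i.
  move=> kt ix; have kN : (k < (N n).+1)%N by apply: tkN; case/andP: kt => _ /le_trans; apply; exact: ltW.
  have [j jE] := centered_ord (HB i ix).
  have ndE : nd (Ordinal kN, j) = i by [].
  by exists (Ordinal kN, j); rewrite ?/Pz ndE //= kt.
have [k0 /andP[k01 k02]] : exists k0 : nat, t0 < tk (h n) k0 <= t0 + h n.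
  have [k /andP[a b]] := @floor_nat R (t0 / h n) (divr_ge0 (ltW t00) (ltW h0n)).
  exists k.+1; rewrite /tk -natr1; move: a b; rewrite ler_pdivlMr// ltr_pdivrMr// mulrDl mul1r => a ->/=.
  by rewrite lerD2r.
pose i0 := nidx (rho n) x0.
have i0x : `|xnode (rho n) i0 - x0| <= rho n / 2 by exact: nidx_dist.
have [z0 Pz0 [z01 z02]] : exists2 z, Pz z & (z.1 : nat) = k0 /\ nd z = i0.
  apply: mkz; first by rewrite ltW//=; apply: le_trans k02 _; rewrite lerD2l; lra.
  by apply: le_trans i0x _; lra.
case: (@arg_maxP _ _ _ z0 Pz f Pz0) => z Pzz zmax.
have /andP[/andP[tz1 tz2] xz] := Pzz.
have T0 : 0 <= tk (h n) z.1 <= T by rewrite (le_trans (ltW t00) tz1)/= (le_trans tz2)// ltW.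
have zN : (z.1 <= N n)%N by rewrite -ltnS.
have fz0 : - (3 * e) <= f z0.
  rewrite /f z01 z02.
  have k0N : (k0 <= N n)%N by rewrite -ltnS; apply: tkN; apply: le_trans k02 _; apply: ltW; apply: le_lt_trans t0T; rewrite lerD2l; lra.
  have := H1 n k0 i0 nn1 k0N (le_trans i0x _).
  have rr : rho n / 2 <= r by lra.
  move=> /(_ rr).
  have xd : `|xnode (rho n) i0 - x0| < d4 by apply: le_lt_trans i0x _; lra.
  have td : `|tk (h n) k0 - t0| < d4 by rewrite ger0_norm ?subr_ge0 ?(ltW k01)//; apply: le_lt_trans hd; rewrite lerBlDl.
  have := H2 (xnode (rho n) i0) (tk (h n) k0) _ (lt_le_trans xd _) (lt_le_trans td _).
  have dd2 : d4 <= d2 by rewrite !ge_min lexx.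
  have dd3 : d4 <= d3 by rewrite !ge_min lexx !orbT.
  have tT : 0 <= tk (h n) k0 <= T by apply/andP; split; lra.
  move=> /(_ tT dd2 dd2).
  have := H3 (xnode (rho n) i0) (tk (h n) k0) (lt_le_trans xd dd3) (lt_le_trans td dd3).
  set u1 := q _ _; set u2 := V _ _; set u3 := V _ _; set u4 := W _ _ _.
  rewrite !ler_norml => /andP[? ?] /andP[? ?] /andP[? ?]; lra.
have fz : f z <= e - eta * (tk (h n) z.1 - t0) - eta * (xnode (rho n) (nd z) - x0) ^+ 2.
  have := H1 n z.1 (nd z) nn1 zN xz; have := Vq xz (_ : t0 <= tk (h n) z.1 <= t0 + r).
  rewrite tz1 tz2 => /(_ isT); rewrite /f ler_norml => ? /andP[? ?]; lra.
have mz : f z0 <= f z := zmax z0 Pz0.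
have sum4 : eta * (tk (h n) z.1 - t0) + eta * (xnode (rho n) (nd z) - x0) ^+ 2 <= eta * d ^+ 2.
  have -> : eta * d ^+ 2 = 4 * e by rewrite /e [4 * _]mulrC divfK.
  exact: contact_arith fz0 fz mz.
have t_d : tk (h n) z.1 <= t0 + d.
  have : eta * (tk (h n) z.1 - t0) <= eta * d ^+ 2.
    by apply: le_trans sum4; rewrite lerDl mulr_ge0 ?sqr_ge0// ltW.
  rewrite ler_pM2l// => H; have : d ^+ 2 <= d by rewrite expr2 ler_piMl// ltW.
  lra.
have x_d : `|xnode (rho n) (nd z) - x0| <= d.
  have : eta * (xnode (rho n) (nd z) - x0) ^+ 2 <= eta * d ^+ 2.
    by apply: le_trans sum4; rewrite lerDr mulr_ge0 ?subr_ge0// ltW.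
  by rewrite ler_pM2l// -[(xnode _ _ - _) ^+ 2]real_normK ?num_real// ler_pXn2r ?nnegrE// ltW.
have kN : (z.1 < N n)%N.
  by rewrite -(ltr_nat R) -(ltr_pM2r h0n) NhT -/(tk (h n) z.1); lra.
exists z.1, (nd z); split => //.
- by rewrite tz1; lra.
- exact: le_trans x_d d_del.
(* Level [k + 1] still lies in the window of the maximisation, because [d] and [h n] are at most
   [r / 2]. *)
- move=> j jx; have [|z' Pz' [z'1 z'2]] := mkz z.1.+1 j _ jx.
    by rewrite /tk -natr1 mulrDl mul1r -/(tk (h n) z.1); apply/andP; split; lra.
  by have := zmax z' Pz'; rewrite /f z'1 z'2.
Qed.

End GridContact.

(** * The limit value function is a viscosity solution *)

Section Viscosity.
Context {R : realType}.
Variables (T : R) (sigma : R -> R) (F G : R -> probability R R -> R) (phi m0 : R -> R)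
  (C S K C0 Cr : R) (rho h eps : nat -> R) (N : nat -> nat) (mn : nat -> R -> probability R R).
Hypothesis D : mfg_data T sigma F G phi m0 C S K C0.
Hypothesis Q : mfg_seq T sigma F G phi m0 C Cr rho h eps N mn.
Variable mbar : R -> probability R R.
Hypotheses (mbarC : is_curve T mbar) (cv : curve_cvg T mn mbar).
Local Notation L := (cstL T C).
Local Notation w n := (vgrid (rho n) (h n) (N n) sigma F G (mn n)).
Variable v : R -> R -> R.
Hypothesis vcv : value_cvg T sigma F G rho h N mn v.

Let rpos n : 0 < rho n := rho_gt0 (seq_scheme Q n).
Let hpos n : 0 < h n := h_gt0 (seq_scheme Q n).
Let NhTn n := NhT (seq_scheme Q n).
Let T0 : 0 < T := T_gt0 D.

Let Cr0 : 0 <= Cr.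
Proof. by rewrite -(pmulr_lge0 _ (hpos 0)); apply: le_trans (seq_rho_h Q 0); exact: ltW. Qed.

Lemma sigma_cont_at t0 : 0 < t0 < T -> {for t0, continuous sigma}.
Proof.
move=> t0T; have [H _ _] := (continuous_within_itvP sigma T0).1 (sigma_cont D).
by apply: H; rewrite in_itv.
Qed.

Lemma F_curve_cvg x0 t0 e : 0 <= t0 <= T -> 0 < e -> exists2 d : R, 0 < d &
  \forall n \near \oo, forall x t, 0 <= t <= T -> `|x - x0| < d -> `|t - t0| < d ->
   `|F x (mn n t) - F x0 (mbar t0)| <= e.
Proof.
move=> tT e0; have [d d0 Hd] := F_cont D x0 (mbarC.1 t0 tT) e0.
have d20 : 0 < d / 2 by rewrite divr_gt0.
have [d1 d10 H1] := mbarC.2 t0 tT _ d20.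
exists (Num.min d d1); first by rewrite lt_min d0.
have := cv d20; apply: filterS => n Hn x t tT'; rewrite !lt_min => /andP[xd _] /andP[_ td].
apply: ltW; apply: Hd => //; first exact: (mu_P1 (seq_scheme Q n)).
apply: le_lt_trans (W1_triangle _ (mbar t) _) _.
by rewrite (splitr d) EFinD; apply: lteD; [exact: Hn|exact: H1].
Qed.

Section contact.
Variables (x0 t0 : R).
Hypothesis t0T : 0 < t0 < T.

Let t0T' : 0 <= t0 <= T. Proof. by case/andP: t0T => /ltW-> /ltW->. Qed.

(** Collects the smallness conditions at a contact for both tests: [B] bounds the controls, by [|b|]
    in the subsolution test and by [2 L] in the supersolution test. *)
Lemma contact_small (X B r eta : R) : 0 <= B -> 0 < r -> 0 < eta -> exists2 del : R, 0 < del &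
  exists n1, forall n, (n1 <= n)%N -> forall k i, (k <= N n)%N -> t0 <= tk (h n) k <= t0 + del ->
  `|xnode (rho n) i - x0| <= del ->
  [/\ `|F (xnode (rho n) i) (mn n (tk (h n) k)) - F x0 (mbar t0)| <= eta,
      `|2^-1 * X * sigma (tk (h n) k) ^+ 2 - 2^-1 * X * sigma t0 ^+ 2| <= eta,
      `|X| * (B * `|xnode (rho n) i - x0| + 2^-1 * h n * B ^+ 2 + 2^-1 * Cr * rho n) <= eta &
      `|xnode (rho n) i - x0| + h n * B + Num.sqrt (h n) * S + rho n <= r].
Proof.
move=> B0 r0 e0; have [d1 d10 HF] := F_curve_cvg x0 t0T' e0.
have cs : {for t0, continuous (fun t => 2^-1 * X * sigma t ^+ 2)}.
  have ss := sigma_cont_at t0T.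
  apply: cvgM; first exact: cvg_cst.
  by rewrite /= expr2; apply: cvgM.
have /cvgrPdist_le/(_ _ e0) := cs; rewrite nearE => /nbhs_ballP[d2 /= d20 Hs].
have XB : 0 < `|X| * B + 1 by rewrite ltr_wpDl// mulr_ge0.
pose del := Num.min (Num.min d1 d2) (Num.min (r / 2) (eta / 2 / (`|X| * B + 1))) / 2.
have del0 : 0 < del by rewrite divr_gt0// !lt_min d10 d20 !divr_gt0.
have deld : del < del * 2 by rewrite ltr_pMr// ltrDl.
have del2 : del * 2 = Num.min (Num.min d1 d2) (Num.min (r / 2) (eta / 2 / (`|X| * B + 1))) by rewrite /del divfK.
have de1 : del < d1 by apply: lt_le_trans deld _; rewrite del2 !ge_min lexx.
have de2 : del < d2 by apply: lt_le_trans deld _; rewrite del2 !ge_min lexx !orbT.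
have de3 : del <= r / 2 by apply: le_trans (ltW deld) _; rewrite del2 !ge_min lexx !orbT.
have de4 : del <= eta / 2 / (`|X| * B + 1) by apply: le_trans (ltW deld) _; rewrite del2 !ge_min lexx !orbT.
have e20 : 0 < eta / 2 by rewrite divr_gt0.
have r20 : 0 < r / 2 by rewrite divr_gt0.
have c1 : (fun n => `|X| * (2^-1 * h n * B ^+ 2 + 2^-1 * Cr * rho n)) @ \oo --> `|X| * (2^-1 * 0 * B ^+ 2 + 2^-1 * Cr * 0).
  apply: cvgM; first exact: cvg_cst.
  apply: cvgD; first by apply: cvgM; [apply: cvgM; [exact: cvg_cst|exact: (seq_h Q)]|exact: cvg_cst].
  by apply: cvgM; [exact: cvg_cst|exact: (seq_rho Q)].
have c2 : (fun n => h n * B + Num.sqrt (h n) * S + rho n) @ \oo --> 0 * B + Num.sqrt 0 * S + 0.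
  apply: cvgD; last exact: (seq_rho Q).
  apply: cvgD; first by apply: cvgM; [exact: (seq_h Q)|exact: cvg_cst].
  apply: cvgM; last exact: cvg_cst.
  by apply: (@continuous_cvg _ _ _ _ _ _ Num.sqrt); [exact: sqrt_continuous|exact: (seq_h Q)].
rewrite !(mulr0, mul0r, addr0) in c1; rewrite sqrtr0 !(mulr0, mul0r, addr0) in c2.
have /cvgrPdist_le/(_ _ e20) := c1 => k1; have /cvgrPdist_le/(_ _ r20) := c2 => k2.
have [n1 _ Hn1] : \forall n \near \oo, [/\ (forall x t, 0 <= t <= T -> `|x - x0| < d1 -> `|t - t0| < d1 ->
   `|F x (mn n t) - F x0 (mbar t0)| <= eta), 
   `|0 - `|X| * (2^-1 * h n * B ^+ 2 + 2^-1 * Cr * rho n)| <= eta / 2 &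
   `|0 - (h n * B + Num.sqrt (h n) * S + rho n)| <= r / 2].
  by near=> n; split; near: n.
exists del => //; exists n1 => n nn1 k i kN /andP[t1 t2] xi.
have [H1 H2 H3] := Hn1 n nn1; move: H2 H3; rewrite !sub0r !normrN => H2 H3.
have tkT := tk_itv (seq_scheme Q n) kN.
have tdel : `|tk (h n) k - t0| <= del by rewrite ger0_norm ?subr_ge0// lerBlDl.
split.
- by apply: H1 => //; [exact: le_lt_trans xi de1|exact: le_lt_trans tdel de1].
- by rewrite distrC; apply: Hs; rewrite /ball/= distrC; exact: le_lt_trans tdel de2.
- have a1 := le_trans (ler_norm _) H2.
  have : `|X| * (B * `|xnode (rho n) i - x0|) <= eta / 2.
    apply: (@le_trans _ _ ((`|X| * B + 1) * del)).
      by rewrite mulrA; apply: ler_pM => //; [rewrite mulr_ge0|rewrite lerDl].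
    by rewrite -ler_pdivlMl// mulrC.
  by move=> a2; rewrite -addrA mulrDr (splitr eta) lerD.
- have a1 := le_trans (ler_norm _) H3.
  by rewrite -!addrA (splitr r) lerD ?(le_trans xi)// addrA.
Unshelve. all: by end_near. Qed.

(** The total [5 + 2 s0] is made of [2] from the perturbed time slope, [2 s0] from the perturbed
    second-order coefficient, and [1] from each of the three errors. The supersolution variant has
    one more unit, from near-optimality of the control. *)
Lemma contact_arith (A eta a b X s0 s1 Fk Fb err : R) :
  0 <= eta -> A = a + 2 * eta -> 
  0 <= A - 2^-1 * b ^+ 2 + 2^-1 * (X + 4 * eta) * s1 + Fk + err -> 
  `|Fk - Fb| <= eta -> `|2^-1 * (X + 4 * eta) * s1 - 2^-1 * (X + 4 * eta) * s0| <= eta -> err <= eta ->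
  - a - 2^-1 * s0 * X + 2^-1 * b ^+ 2 <= Fb + eta * (5 + 2 * s0).
Proof.
move=> e0 -> H; move: H; set u := 2^-1 * (X + 4 * eta) * s1; clearbody u.
by move=> H; rewrite !ler_norml => /andP[? ?] /andP[? ?] ?; lra.
Qed.

Lemma contact_arith2 (A eta a b X s0 s1 Fk Fb err : R) :
  0 <= eta -> A = a - 2 * eta -> 
  A - 2^-1 * b ^+ 2 + 2^-1 * (X - 4 * eta) * s1 + Fk <= eta + err -> 
  `|Fk - Fb| <= eta -> `|2^-1 * (X - 4 * eta) * s1 - 2^-1 * (X - 4 * eta) * s0| <= eta -> err <= eta ->
  Fb <= - a - 2^-1 * s0 * X + 2^-1 * b ^+ 2 + eta * (6 + 2 * s0).
Proof.
move=> e0 -> H; move: H; set u := 2^-1 * (X - 4 * eta) * s1; clearbody u.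
by move=> H; rewrite !ler_norml => /andP[? ?] /andP[? ?] ?; lra.
Qed.

Variable p : R -> R -> R.
Hypothesis Cp : C21 p.

Let choose_r (Pd : R -> R -> Prop) : (exists2 d : R, 0 < d & forall y s, `|y - x0| < d -> `|s - t0| < d -> Pd y s) ->
  forall eta, 0 < eta -> exists2 r : R, 0 < r & t0 + r < T /\ forall y s, `|y - x0| <= r -> t0 <= s <= t0 + r ->
    Pd y s /\ `|p y s - p x0 t0 - (dt p x0 t0 * (s - t0) + dx p x0 t0 * (y - x0) + 2^-1 * dxx p x0 t0 * (y - x0) ^+ 2)|
  <= eta * (s - t0) + eta * (y - x0) ^+ 2.
Proof.
move=> [d d0 Hd] eta e0; have [d' d'0 Hd'] := C21_taylor x0 t0 Cp e0.
case/andP: (t0T) => _ t0T2.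
pose m := Num.min (Num.min d d') (T - t0).
have mp : 0 < m by rewrite !lt_min d0 d'0 subr_gt0.
have mm : m / 2 < m by rewrite ltr_pdivrMr// ltr_pMr// ltrDl.
have md : m / 2 < d by apply: lt_le_trans mm _; rewrite !ge_min lexx.
have md' : m / 2 < d' by apply: lt_le_trans mm _; rewrite !ge_min lexx !orbT.
have mT : m / 2 < T - t0 by apply: lt_le_trans mm _; rewrite !ge_min lexx !orbT.
exists (m / 2); first by rewrite divr_gt0.
split; first by rewrite addrC -ltrBrDr.
move=> y s yx /andP[s1 s2]; have st : `|s - t0| <= m / 2 by rewrite ger0_norm ?subr_ge0// lerBlDl.
split; first by apply: Hd; [exact: le_lt_trans yx md|exact: le_lt_trans st md].
rewrite -[X in _ <= eta * X + _]ger0_norm ?subr_ge0//.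
by apply: Hd'; [exact: le_lt_trans yx md'|exact: le_lt_trans st md'].
Qed.

Let Wcv r e : 0 < e -> exists n0, forall n k i, (n0 <= n)%N -> (k <= N n)%N ->
  `|xnode (rho n) i - x0| <= r -> `|w n k i - v (xnode (rho n) i) (tk (h n) k)| <= e.
Proof.
move=> e0; have [n0 H] := vcv (`|x0| + r) e0; exists n0 => n k i nn0 kN xi.
rewrite -(vsch_node (seq_scheme Q n)); apply: H => //; last exact: (tk_itv (seq_scheme Q n)).
by rewrite -lerBlDl; apply: le_trans xi; exact: lerB_dist.
Qed.

Let Vcont e : 0 < e -> exists2 d : R, 0 < d & forall y s, 0 <= s <= T ->
  `|y - x0| < d -> `|s - t0| < d -> `|v y s - v x0 t0| <= e.
Proof.
move=> e0; have [d d0 H] := value_cont D Q vcv x0 e0 t0T'; exists d => // y s sT yx st.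
by apply: ltW; exact: H.
Qed.

Lemma viscosity_sub :
  (exists2 d : R, 0 < d & forall y s, `|y - x0| < d -> `|s - t0| < d -> v y s - p y s <= v x0 t0 - p x0 t0) ->
  - dt p x0 t0 - 2^-1 * sigma t0 ^+ 2 * dxx p x0 t0 + 2^-1 * dx p x0 t0 ^+ 2 <= F x0 (mbar t0).
Proof.
move=> Hmax; apply/ler_addgt0Pl => e e0.
have s0 : 0 < 5 + 2 * sigma t0 ^+ 2 by rewrite ltr_pwDl// mulr_ge0// sqr_ge0.
pose eta := e / (5 + 2 * sigma t0 ^+ 2); have eta0 : 0 < eta by rewrite divr_gt0.
have -> : e + F x0 (mbar t0) = F x0 (mbar t0) + eta * (5 + 2 * sigma t0 ^+ 2) by rewrite /eta divfK ?gt_eqF// addrC.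
have [r r0 [rT Hr]] := choose_r Hmax eta0.
set a := dt p x0 t0 in Hr *; set b := dx p x0 t0 in Hr *; set X := dxx p x0 t0 in Hr *.
have [del del0 [n1 Hsmall]] := contact_small (X + 4 * eta) (normr_ge0 b) r0 eta0.
case/andP: (t0T) => t00 _.
(* Of the added [2 eta (s - t0)] and [2 eta (y - x0)^2], one half absorbs the Taylor error of [p],
   the other half is the strict margin. The first is nonnegative because only times [s >= t0]
   occur. *)
have Vq y s : `|y - x0| <= r -> t0 <= s <= t0 + r ->
   v y s <= quad (v x0 t0) (a + 2 * eta) b (X + 4 * eta) x0 t0 y s - eta * (s - t0) - eta * (y - x0) ^+ 2.
  move=> yx st; have [h1 h2] := Hr y s yx st.
  by move: h1 h2; rewrite /quad ler_norml => ? /andP[? ?]; lra.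
have [n0 Hc] := grid_contact r0 eta0 t00 rT rpos hpos (seq_rho Q) (seq_h Q) NhTn (@Wcv r) Vcont
  (@quad_near R (v x0 t0) (a + 2 * eta) b (X + 4 * eta) x0 t0) Vq del0.
pose n := maxn n0 n1.
have [k [i [kN tki xi Hj]]] := Hc n (leq_maxl _ _).
have [k1 k2 k3 k4] := Hsmall n (leq_maxr _ _) k i (ltnW kN) tki xi.
pose q := quad (v x0 t0) (a + 2 * eta) b (X + 4 * eta) x0 t0.
have wki : w n k i = q (xnode (rho n) i) (tk (h n) k) + (w n k i - q (xnode (rho n) i) (tk (h n) k)) by ring.
have := scheme_sub D (seq_scheme Q n) (seq_rho_h Q n) kN wki _ k4.
rewrite real_normK ?num_real// in k3.
move=> HH; apply: (@contact_arith _ eta a b X _ _ _ _ _ (ltW eta0) (erefl _) (HH _) k1 k2 k3).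
by move=> j /Hj; rewrite -/q; lra.
Qed.

Lemma viscosity_super :
  (exists2 d : R, 0 < d & forall y s, `|y - x0| < d -> `|s - t0| < d -> v x0 t0 - p x0 t0 <= v y s - p y s) ->
  F x0 (mbar t0) <= - dt p x0 t0 - 2^-1 * sigma t0 ^+ 2 * dxx p x0 t0 + 2^-1 * dx p x0 t0 ^+ 2.
Proof.
move=> Hmin; apply/ler_addgt0Pr => e e0.
have s0 : 0 < 6 + 2 * sigma t0 ^+ 2 by rewrite ltr_pwDl// mulr_ge0// sqr_ge0.
pose eta := e / (6 + 2 * sigma t0 ^+ 2); have eta0 : 0 < eta by rewrite divr_gt0.
have -> : e = eta * (6 + 2 * sigma t0 ^+ 2) by rewrite /eta divfK ?gt_eqF.
have [r r0 [rT Hr]] := choose_r Hmin eta0.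
set a := dt p x0 t0 in Hr *; set b := dx p x0 t0 in Hr *; set X := dxx p x0 t0 in Hr *.
have L0 : 0 <= 2 * L by apply: mulr_ge0 => //; exact: cstL_ge0 D.
have [del del0 [n1 Hsmall]] := contact_small (X - 4 * eta) L0 r0 eta0.
case/andP: (t0T) => t00 _.
pose q := quad (v x0 t0) (a - 2 * eta) b (X - 4 * eta) x0 t0.
have Vq y s : `|y - x0| <= r -> t0 <= s <= t0 + r ->
   - v y s <= - q y s - eta * (s - t0) - eta * (y - x0) ^+ 2.
  move=> yx st; have [h1 h2] := Hr y s yx st.
  by move: h1 h2; rewrite /q /quad ler_norml => ? /andP[? ?]; lra.
have Wcv' e' : 0 < e' -> exists n0, forall n k i, (n0 <= n)%N -> (k <= N n)%N ->
  `|xnode (rho n) i - x0| <= r -> `|(- w n k i) - (- v (xnode (rho n) i) (tk (h n) k))| <= e'.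
  move=> /(@Wcv r)[n0 H]; exists n0 => n k i nn0 kN xi.
  by rewrite -opprD normrN; exact: H.
have Vcont' e' : 0 < e' -> exists2 d : R, 0 < d & forall y s, 0 <= s <= T ->
  `|y - x0| < d -> `|s - t0| < d -> `|(- v y s) - (- v x0 t0)| <= e'.
  move=> /Vcont[d d0 H]; exists d => // y s sT yx st; rewrite -opprD normrN; exact: H.
have qcont' e' : 0 < e' -> exists2 d : R, 0 < d & forall y s,
  `|y - x0| < d -> `|s - t0| < d -> `|(- q y s) - (- v x0 t0)| <= e'.
  move=> e'0; have [d d0 H] := @quad_near R (v x0 t0) (a - 2 * eta) b (X - 4 * eta) x0 t0 e' e'0.
  by exists d => // y s yx st; rewrite -opprD normrN; exact: H.
(* The contact argument speaks of maxima; negating the grid values, the limit and the polynomial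
   covers minima. *)
have [n0 Hc] := @grid_contact R T rho h N (fun n k i => - w n k i) (fun y s => - v y s) (fun y s => - q y s)
  x0 t0 r eta r0 eta0 t00 rT rpos hpos (seq_rho Q) (seq_h Q) NhTn Wcv' Vcont' qcont' Vq del del0.
pose n := maxn n0 n1.
have [k [i [kN tki xi Hj]]] := Hc n (leq_maxl _ _).
have [k1 k2 k3 k4] := Hsmall n (leq_maxr _ _) k i (ltnW kN) tki xi.
have wki : w n k i = q (xnode (rho n) i) (tk (h n) k) + (w n k i - q (xnode (rho n) i) (tk (h n) k)) by ring.
have := scheme_super D (seq_scheme Q n) (seq_rho_h Q n) kN wki eta0 _ k4.
move=> HH; apply: (@contact_arith2 _ eta a b X _ _ _ _ _ (ltW eta0) (erefl _) (HH _) k1 k2 k3).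
by move=> j /Hj; rewrite -/q; lra.
Qed.

End contact.

Lemma seq_value_fun : value_fun T sigma F G mbar v.
Proof.
split; last first.
  split; first by exists L => x t; exact: (value_bnd D Q vcv).
  by exists L => x y t; exact: (value_lip D Q vcv).
split; first by move=> x; exact: (value_terminal D Q vcv mbarC cv).
split; first by move=> x t tT e e0; exact: (value_cont D Q vcv).
split; first by move=> p x0 t0 t0T Cp; exact: viscosity_sub.
by move=> p x0 t0 t0T Cp; exact: viscosity_super.
Qed.

End Viscosity.

(** * Limit of the gradients and of the Fokker-Planck equation *)

Section NullModification.
Context d (T : measurableType d) (R : realType) (mu : {measure set T -> \bar R}).
Import HBNNSimple.
Local Open Scope ereal_scope.

(* No measurability of [f] is needed: simple functions below [f] can be set
   to zero on the null set without changing their integrals. *)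
Lemma ge0_integral_null_modification (f g : T -> \bar R) (A : set T) : measurable A -> mu A = 0 ->
  (forall x, 0 <= f x) -> (forall x, 0 <= g x) -> (forall x, ~ A x -> f x = g x) ->
  \int[mu]_x f x <= \int[mu]_x g x.
Proof.
move=> mA A0 f0 g0 fg; rewrite !ge0_integralTE//.
apply: ge_ereal_sup => _ [h hf <-].
have mAc : measurable (~` A) by exact: measurableC.
apply: ereal_sup_ubound; exists (proj_nnsfun h mAc).
  move=> x; rewrite /= /mindic indicE; have [xA|xA] := pselect (A x).
    by rewrite memNset ?mulr0//; exact.
  by rewrite mem_set// mulr1 -fg.
rewrite -!integralT_nnsfun; apply: ae_eq_integral => //.
- by apply/measurable_EFinP.
- by apply/measurable_EFinP.
exists A; split => // x /=; apply: contra_notP => xA _.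
by rewrite /= /mindic indicE mem_set// mulr1.
Qed.

Lemma integral_null_modification (f g : T -> \bar R) (A : set T) : measurable A -> mu A = 0 ->
  (forall x, ~ A x -> f x = g x) -> \int[mu]_x f x = \int[mu]_x g x.
Proof.
move=> mA A0 fg; rewrite [LHS]integralE [RHS]integralE.
have pos0 (k : T -> \bar R) x : 0 <= k^\+ x by exact: funepos_ge0.
have neg0 (k : T -> \bar R) x : 0 <= k^\- x by exact: funeneg_ge0.
have fgp x : ~ A x -> f^\+ x = g^\+ x by move=> xA; rewrite 2!funeposE fg.
have fgn x : ~ A x -> f^\- x = g^\- x by move=> xA; rewrite 2!funenegE fg.
have gfp x : ~ A x -> g^\+ x = f^\+ x by move=> xA; rewrite fgp.
have gfn x : ~ A x -> g^\- x = f^\- x by move=> xA; rewrite fgn.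
have le k l := @ge0_integral_null_modification k l A mA A0.
by congr (_ - _); apply/eqP; rewrite eq_le; apply/andP; split; exact: le.
Qed.

End NullModification.

(** * Almost everywhere differentiability of Lipschitz functions *)

Section LipschitzDerivable.
Context {R : realType}.
Local Notation leb := (@lebesgue_measure R).

Let clamp (M x : R) := Num.max (- M) (Num.min M x).

Let clamp_homo M : {homo clamp M : x y / x <= y}.
Proof. by move=> x y xy; rewrite /clamp; apply: le_max2 => //; exact: le_min2. Qed.

Let clamp_le M x y : 0 <= M -> x <= y -> clamp M y - clamp M x <= y - x.
Proof.
move=> M0 xy; rewrite /clamp; case: (leP M x) => ?; case: (leP M y) => ?;
  rewrite ?(max_r (_ : - M <= M)); try (by lra); try (case: (leP (- M) x) => ?); try (case: (leP (- M) y) => ?); lra.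
Qed.

Let affine_derivable (F : R -> R) (a b c x : R) : derivable F x 1 ->
  derivable (fun y => F y * a + b - c * y) x 1.
Proof.
move=> /derivableP dF.
have H : is_derive x 1 (fun y => F y * a + b - c * y) ('D_1 F x * a - c).
  by apply: is_derive_eq; rewrite /GRing.scale/=; ring.
exact: (@ex_derive _ _ _ _ _ _ _ H).
Qed.

(* Locally, [f + (L + 1) id] is an affine image of a Lipschitz distribution
   function, which is differentiable almost everywhere. *)
Lemma lip_ae_derivable (f : R -> R) (L : R) : (forall x y, `|f x - f y| <= L * `|x - y|) ->
  {ae leb, forall x, derivable f x 1}.
Proof.
move=> fL.
have L0 : 0 <= L by have := le_trans (normr_ge0 _) (fL 1 0); rewrite subr0 normr1 mulr1.
have loc (n : nat) : {ae leb, forall x, - n.+1%:R < x < n.+1%:R -> derivable f x 1}.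
  pose M : R := n.+1%:R; have M0 : 0 < M by [].
  (* The summand with [L + 1] makes [g] increase with slope at least [1] on [[- M, M]]; its total
     increment is then positive, and [g] can be normalised to a distribution function. *)
  pose g x := f (clamp M x) + (L + 1) * clamp M x.
  have g_homo x y : x <= y -> clamp M y - clamp M x <= g y - g x.
    move=> xy; have := fL (clamp M y) (clamp M x); have cxy := clamp_homo M xy.
    by rewrite (@ger0_norm _ (clamp M y - _)) ?subr_ge0// ler_norml /g => /andP[? ?]; lra.
  have g_lip x y : x <= y -> g y - g x <= (2 * L + 1) * (y - x).
    move=> xy; have := fL (clamp M y) (clamp M x); have cxy := clamp_homo M xy.
    rewrite (@ger0_norm _ (clamp M y - _)) ?subr_ge0// ler_norml /g => /andP[? ?].
    apply: (@le_trans _ _ ((2 * L + 1) * (clamp M y - clamp M x))); first lra.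
    by rewrite ler_wpM2l ?clamp_le ?(ltW M0)// addr_ge0// mulr_ge0.
  have cM x : M <= x -> clamp M x = M by move=> ?; rewrite /clamp min_l// max_r//; lra.
  have cmM x : x <= - M -> clamp M x = - M by move=> ?; rewrite /clamp max_l// ge_min; apply/orP; right.
  pose k := (g M - g (- M))^-1.
  have k0 : 0 < k.
    rewrite invr_gt0; apply: lt_le_trans (g_homo (- M) M _); last lra.
    by rewrite cM// cmM//; lra.
  have kN0 : g M - g (- M) != 0 by rewrite -invr_eq0 gt_eqF.
  pose F x := (g x - g (- M)) * k.
  have Fnd : {homo F : x y / x <= y}.
    move=> x y xy; rewrite /F ler_pM2r// lerD2r -subr_ge0.
    by apply: le_trans (g_homo _ _ xy); rewrite subr_ge0; exact: clamp_homo.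
  have Flip x y : x <= y -> F y - F x <= (2 * L + 1) * k * (y - x).
    move=> xy; rewrite /F -mulrBl opprB addrA subrK mulrAC ler_pM2r//; exact: g_lip.
  have FM x : M <= x -> F x = 1.
    move=> Mx; have -> : F x = (g M - g (- M)) * k by rewrite /F /g (cM x Mx) (cM M (lexx M)).
    by rewrite /k divff.
  have FmM x : x <= - M -> F x = 0.
    by move=> xM; rewrite /F /g (cmM x xM) (cmM (- M) (lexx _)) subrr mul0r.
  have F01 x : 0 <= F x <= 1.
    apply/andP; split.
      by have [/Fnd|/ltW/FmM->//] := leP (- M) x; rewrite FmM.
    by have [xM|/ltW Mx] := leP x M; [rewrite -(FM M (lexx _)); exact: Fnd|rewrite FM].
  have p1 (x : R) : 0 < 1 + x ^+ 2 by rewrite ltr_pwDl// sqr_ge0.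
  (* Beyond [M] the function is exactly [0] or [1]; the constant is chosen so that the bound is at
     least [1] inside. *)
  have Ft : tail_bnd (1 + M ^+ 2) F.
    move=> x; have [xM|Mx] := leP (`|x|) M.
      have h : 1 <= (1 + M ^+ 2) / (1 + x ^+ 2).
        rewrite ler_pdivlMr// mul1r lerD2l -[x ^+ 2]real_normK ?num_real//.
        by apply: lerXn2r => //; rewrite nnegrE ltW.
      by have /andP[? ?] := F01 x; split => _; apply: le_trans h; lra.
    have h : 0 <= (1 + M ^+ 2) / (1 + x ^+ 2) by rewrite divr_ge0// ltW.
    split => x0; move: Mx; first by rewrite ler0_norm// ltrNr => /ltW/FmM->.
    by rewrite ger0_norm// => /ltW/FM->; rewrite subrr.
  have FL x y : `|F x - F y| <= (2 * L + 1) * k * `|x - y|.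
    wlog xy : x y / y <= x.
      by move=> W; have [/W//|/ltW/W] := leP y x; rewrite distrC (distrC y).
    by rewrite !ger0_norm ?subr_ge0 ?Fnd ?Flip.
  have [mu muE] := cdf_of_tails Fnd FL F01 Ft.
  have c0 : 0 < (2 * L + 1) * k by rewrite mulr_gt0// ltr_wpDl// mulr_ge0.
  have [|g' [_ _ H]] := @lip_cdf_density R mu _ c0; first by move=> x y xy; rewrite !muE Flip.
  move: H; apply: filterS; first exact: (ae_filter_ringOfSetsType leb).
  move=> x [dF _] xM; have [x1 x2] := andP xM.
  have dG : derivable (fun y => cdfR mu y * k^-1 + g (- M) - (L + 1) * y) x 1.
    exact: affine_derivable.
  apply: near_eq_derivable dG; near=> y.
  have y1 : - M <= y by apply: ltW; near: y; exact: (lt_nbhsr x1).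
  have y2 : y <= M by apply: ltW; near: y; exact: (lt_nbhsl x2).
  rewrite muE /F mulfK ?gt_eqF// subrK /g /clamp min_r// max_r//; ring.
have := ae_foralln loc; apply: filterS.
move=> x H; apply: (H (Num.truncn `|x|)).
by rewrite -ltr_norml; exact: Num.Theory.truncnS_gt.
Unshelve. all: by end_near. Qed.

(* [x |-> derive1 f x] has junk values where [f] is not derivable; [dquot] is
   everywhere measurable and agrees with it almost everywhere. *)
Definition dquot (L : R) (f : R -> R) (x : R) : R := quot_density (2 * L + 1) (fun y => f y + L * y) x - L.

Lemma measurable_dquot L f : continuous f -> measurable_fun [set: R] (dquot L f).
Proof.
move=> cf; apply: measurable_funB => //.
apply: (@measurable_quot_density R _ _ R (fun _ y => f y + L * y) id) => c.
apply: measurable_funD; last by apply: measurable_funM => //; exact: measurable_funD.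
apply: (measurableT_comp (continuous_measurable_fun cf)); exact: measurable_funD.
Qed.

Lemma dquot_bnd L f x : 0 <= L -> `|dquot L f x| <= L + 1.
Proof.
move=> L0; have L1 : 0 < 2 * L + 1 by rewrite ltr_wpDl// mulr_ge0.
have /andP[a b] := quot_density_bnd L1 (fun y => f y + L * y) x.
by rewrite /dquot ler_norml; apply/andP; split; lra.
Qed.

Lemma dquotE (L : R) (f : R -> R) (x : R) : (forall x y, `|f x - f y| <= L * `|x - y|) -> derivable f x 1 -> dquot L f x = derive1 f x.
Proof.
move=> fL df; have L0 : 0 <= L by have := le_trans (normr_ge0 _) (fL 1 0); rewrite subr0 normr1 mulr1.
have L1 : 0 < 2 * L + 1 by rewrite ltr_wpDl// mulr_ge0.
have idg : is_derive x 1 (fun y => f y + L * y) (derive1 f x + L).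
  by have /derivableP dfx := df; apply: is_derive_eq; rewrite -derive1E /GRing.scale/=; ring.
have dg := @ex_derive _ _ _ _ _ _ _ idg.
have dE : derive1 (fun y => f y + L * y) x = derive1 f x + L by rewrite [LHS]derive1E; exact: derive_val.
rewrite /dquot (quot_density_derive dg) ?dE ?addrK// -dE.
apply: lip_derive_bnd => // y z yz; have := fL z y; rewrite (@ger0_norm _ (z - y)) ?subr_ge0//.
  by rewrite ler_norml => /andP[? ?]; lra.
by rewrite ler_norml => /andP[? ?]; lra.
Qed.

End LipschitzDerivable.

Section GradientLimit.
Context {R : realType}.
Local Notation leb := (@lebesgue_measure R).
Variables (T : R) (sigma : R -> R) (F G : R -> probability R R -> R) (phi m0 : R -> R)
  (C S K C0 Cr : R) (rho h eps : nat -> R) (N : nat -> nat) (mn : nat -> R -> probability R R).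
Hypothesis D : mfg_data T sigma F G phi m0 C S K C0.
Hypothesis Q : mfg_seq T sigma F G phi m0 C Cr rho h eps N mn.
Local Notation L := (cstL T C).
Local Notation vn n := (vsch sigma F G (rho n) (h n) (N n) (mn n)).
Local Notation Dn n t x := (Dveps (rho n) (h n) (eps n) (N n) sigma F G phi (mn n) (tidx (h n) t) x).
Variable v : R -> R -> R.
Hypothesis vcv : value_cvg T sigma F G rho h N mn v.

Let rpos n : 0 < rho n := rho_gt0 (seq_scheme Q n).

Lemma value_cvg_seq (y : nat -> R) (x t : R) : 0 <= t <= T -> y @ \oo --> x ->
  vn n (y n) t @[n --> \oo] --> v x t.
Proof.
move=> tT yx.
have c1 : (fun n => L * `|y n - x|) @ \oo --> L * `|x - x|.
  apply: cvgM; first exact: cvg_cst.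
  by apply: cvg_norm; apply: cvgB => //; exact: cvg_cst.
rewrite subrr normr0 mulr0 in c1.
apply: cvg_eps => e e0; have e20 : 0 < e / 2 by rewrite divr_gt0.
have /cvgrPdist_le/(_ _ e20) := c1.
have /cvg_dist_le/(_ e20) := @value_cvg_pt _ _ _ _ _ _ _ _ _ _ vcv x t tT.
apply: filterS2 => n k1; rewrite sub0r normrN => k2.
have k3 := vsch_lip D (seq_scheme Q n) x (y n) tT.
have k4 := le_trans k3 (le_trans (ler_norm _) k2).
by rewrite (splitr e); apply: le_trans (ler_distD _ _ _) (lerD k4 k1).
Qed.

(* Semiconcavity bounds the mollified derivative, from both sides, by secants of
   the discrete value function of length [m rho]; these tend to secants of [v],
   whose length is then sent to [0]. *)
Lemma gradient_cvg (y : nat -> R) (x t : R) : 0 <= t <= T -> y @ \oo --> x -> derivable (v^~ t) x 1 ->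
  Dn n t (y n) @[n --> \oo] --> derive1 (v^~ t) x.
Proof.
move=> tT yx dv; set d := derive1 _ x.
have L0 : 0 <= L := cstL_ge0 D.
apply: cvg_eps => e e0; have e40 : 0 < e / 4 by rewrite divr_gt0.
pose s (n : nat) : R := n.+1%:R^-1.
have sp n : 0 < s n by rewrite invr_gt0.
have s0 : s @ \oo --> 0 by exact: cvg_harmonic.
have sN0 : (fun n => - s n) @ \oo --> 0 by rewrite -oppr0; apply: cvgN.
have snz n : s n != 0 by rewrite gt_eqF.
have sNz n : - s n != 0 by rewrite oppr_eq0.
have q1 := derivable_quot dv snz s0; have q2 := derivable_quot dv sNz sN0.
have L1 : 0 < e / 4 / (L + 1) by rewrite divr_gt0// ltr_wpDl.
have /cvg_dist_le/(_ e40) := q1; have /cvg_dist_le/(_ e40) := q2; have /cvg_dist_le/(_ L1) := s0.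
move=> k1 k2 k3.
have [del del0 [k4 k5 k6]] : exists2 del : R, 0 < del & [/\ L * del <= e / 4,
   `|(v (x + del) t - v x t) / del - d| <= e / 4 & `|(v (x - del) t - v x t) / (- del) - d| <= e / 4].
  have [n _ Hn] : \forall n \near \oo, [/\ `|s n - 0| <= e / 4 / (L + 1),
     `|(v (x + s n) t - v x t) / s n - d| <= e / 4 & `|(v (x + - s n) t - v x t) / (- s n) - d| <= e / 4].
    by near=> n; split; near: n.
  have [h1 h2 h3] := Hn n (leqnn n); exists (s n) => //; split => //.
  apply: (@le_trans _ _ ((L + 1) * s n)); first by rewrite ler_wpM2r ?lerDl// ltW.
  by rewrite -ler_pdivlMl// ?ltr_wpDl// mulrC; move: h1; rewrite subr0 gtr0_norm.
(* Discrete secants have lengths that are multiples of the mesh; [m n] meshes come within [rho n] of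
   [del]. *)
pose m n := Num.truncn (del / rho n).
pose r n := (m n)%:R * rho n.
have r_bnd n : `|r n - del| <= rho n.
  have /andP[a b] := Num.Theory.truncn_itv (divr_ge0 (ltW del0) (ltW (rpos n))).
  move: a b; rewrite ler_pdivlMr// ltr_pdivrMr// -/(m n) -/(r n) -natr1 mulrDl mul1r -/(r n) => a b.
  by rewrite ler0_norm ?subr_le0// opprB lerBlDr addrC ltW.
have r0 n : 0 <= r n by rewrite mulr_ge0// ltW.
have rc : r @ \oo --> del.
  apply: cvg_eps => e' e'0; have /cvg_dist_le/(_ e'0) := seq_rho Q; apply: filterS => n.
  by rewrite subr0 gtr0_norm//; apply: le_trans.
have yr : (fun n => y n + r n) @ \oo --> x + del by exact: cvgD.
have yrN : (fun n => y n - r n) @ \oo --> x - del by exact: cvgB.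
pose err n := L * r n ^+ 2 + 2 * L * (K * eps n) + L * rho n.
have errc : err @ \oo --> L * del ^+ 2 + 2 * L * (K * 0) + L * 0.
  apply: cvgD; last by apply: cvgM; [exact: cvg_cst|exact: (seq_rho Q)].
  apply: cvgD.
    by apply: cvgM; [exact: cvg_cst|under eq_fun do rewrite expr2; rewrite expr2; exact: cvgM].
  by apply: cvgM; [exact: cvg_cst|apply: cvgM; [exact: cvg_cst|exact: (seq_eps Q)]].
rewrite !mulr0 !addr0 in errc.
have lowc : (fun n => vn n (y n + r n) t - vn n (y n) t - err n) @ \oo --> v (x + del) t - v x t - L * del ^+ 2.
  by apply: cvgB => //; apply: cvgB; exact: value_cvg_seq.
have highc : (fun n => vn n (y n) t - vn n (y n - r n) t + err n) @ \oo --> v x t - v (x - del) t + L * del ^+ 2.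
  by apply: cvgD => //; apply: cvgB; exact: value_cvg_seq.
have ed : 0 < del * (e / 4) by rewrite mulr_gt0.
have /cvg_dist_le/(_ ed) := lowc; have /cvg_dist_le/(_ ed) := highc.
apply: filterS2 => n hi lo.
have [sr sl] := vsch_secants D (seq_scheme Q n) (y n) (m n) tT.
have DB := Dveps_bnd D (seq_scheme Q n) (tidx_le (seq_scheme Q n) tT) (y n).
rewrite -/(r n) in sr sl; set Dv := Dveps _ _ _ _ _ _ _ _ _ _ _ in sr sl DB *.
have rD : `|r n * Dv - del * Dv| <= L * rho n.
  by rewrite -mulrBl normrM mulrC; apply: ler_pM.
have Ld : L * del ^+ 2 <= del * (e / 4) by rewrite expr2 mulrA mulrC ler_pM2l.
have e1 : `|v (x + del) t - v x t - del * d| <= del * (e / 4).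
  have -> : v (x + del) t - v x t - del * d = del * ((v (x + del) t - v x t) / del - d).
    by rewrite mulrBr mulrCA divff ?mulr1// gt_eqF.
  by rewrite normrM gtr0_norm// ler_pM2l.
have e2 : `|v x t - v (x - del) t - del * d| <= del * (e / 4).
  have -> : v x t - v (x - del) t - del * d = del * ((v (x - del) t - v x t) / (- del) - d).
    by rewrite invrN mulrBr mulrN -mulNr mulrCA divff ?gt_eqF// mulr1 opprB.
  by rewrite normrM gtr0_norm// ler_pM2l.
have : `|del * (Dv - d)| <= del * e.
  have -> : del * e = del * (e / 4) + del * (e / 4) + del * (e / 4) + del * (e / 4) by field.
  have -> : del * (Dv - d) = del * Dv - del * d by ring.
  move: sr sl rD Ld e1 e2 hi lo; rewrite /err.
  move: (del * Dv) (r n * Dv) (del * (e / 4)) (del * d) => a b E c.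
  move: (L * r n ^+ 2) (L * del ^+ 2) (2 * L * (K * eps n)) (L * rho n) => u1 u2 u3 u4.
  move: (vn n _ t) (vn n (y n) t) (vn n (y n - _) t) (v _ _) (v x t) (v (x - del) t) => w1 w2 w3 w4 w5 w6.
  by rewrite !ler_norml => ? ? /andP[? ?] ? /andP[? ?] /andP[? ?] /andP[? ?] /andP[? ?]; apply/andP; split; lra.
by rewrite normrM gtr0_norm// ler_pM2l.
Unshelve. all: by end_near. Qed.

Lemma nidx_cvg (x : R) : (fun n => xnode (rho n) (nidx (rho n) x)) @ \oo --> x.
Proof.
apply: cvg_eps => e e0; have /cvg_dist_le/(_ e0) := seq_rho Q; apply: filterS => n.
rewrite subr0 gtr0_norm// => re; apply: le_trans (nidx_dist (rpos n) x) _.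
by apply: le_trans re; have := rpos n; lra.
Qed.

Lemma value_cont_x t : 0 <= t <= T -> continuous (v^~ t).
Proof.
move=> tT x; apply/cvgrPdist_lt => e e0; have [d d0 H] := value_cont D Q vcv x e0 tT.
apply: filterS (nbhsx_ballx x d d0) => y; rewrite /ball/= => xy; rewrite distrC.
by apply: H => //; [rewrite distrC|rewrite subrr normr0].
Qed.

End GradientLimit.

Section DensityMean.
Context {R : realType}.
Local Notation leb := (@lebesgue_measure R).

Lemma bounded_mul_integrable (D : set R) (g f : R -> R) B : measurable D -> measurable_fun setT g ->
  (forall x, `|g x| <= B) -> leb.-integrable D (EFin \o f) -> leb.-integrable D (EFin \o (fun x => g x * f x)).
Proof.
move=> mD mg gB fi; have -> : (fun x => g x * f x) = (fun x => f x * g x) by apply/funext => x; rewrite mulrC.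
apply: (@integrableMl _ _ _ leb D mD (EFin \o f) g) => //; first exact: measurable_funTS.
by exists B; split; [exact: num_real|move=> M BM x _; exact: le_trans (gB x) (ltW BM)].
Qed.

Lemma mean_density (mu : probability R R) (f g : R -> R) B : measurable_fun setT f -> (forall x, 0 <= f x) ->
  (forall A : set R, measurable A -> mu A = (\int[leb]_(x in A) (f x)%:E)%E) ->
  measurable_fun setT g -> (forall x, `|g x| <= B) ->
  leb.-integrable setT (EFin \o f) /\ mean mu g = (\int[leb]_x (g x * f x))%R.
Proof.
move=> mf f0 muE mg gB.
have f1 : (\int[leb]_x (f x)%:E = 1)%E by rewrite -(muE setT measurableT); exact: probability_setT.
have fi : leb.-integrable setT (EFin \o f).
  apply/integrableP; split; first by apply/measurable_EFinP; exact: mf.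
  by under eq_integral do rewrite /= ger0_norm//; rewrite f1 ltry.
split => //; have B0 : 0 <= B := le_trans (normr_ge0 _) (gB 0).
have mB : measurable_fun [set: R] (fun=> B) by exact: measurable_cst.
have gfi : leb.-integrable setT (EFin \o (fun x => g x * f x)) by exact: bounded_mul_integrable fi.
have Bfi : leb.-integrable setT (EFin \o (fun x => B * f x)).
  by apply: bounded_mul_integrable fi => // x; rewrite ger0_norm.
have gp x : 0 <= g x + B by have := gB x; rewrite ler_norml => /andP[]; lra.
have E1 : mean mu (fun x => g x + B) = mean mu g + B.
  have := meanZD mu 1 1 mg mB gB (fun _ => eq_ind_r (fun z => z <= B) (lexx B) (ger0_norm B0)).
  rewrite mean_cst !mul1r => <-; congr mean; apply/funext => x; by rewrite !mul1r.
have E2 : mean mu (fun x => g x + B) = (\int[leb]_x ((g x + B) * f x))%R.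
  rewrite /mean /Rintegral; congr fine.
  apply: (ge0_integral_density mf f0 muE); last by move=> x; rewrite lee_fin.
  by apply/measurable_EFinP; exact: measurable_funD.
apply: (addIr B); rewrite -E1 E2.
transitivity (\int[leb]_x (g x * f x + B * f x))%R; first by apply: eq_Rintegral => x _; rewrite mulrDl.
rewrite RintegralD//; congr (_ + _).
have fi' : leb.-integrable setT (fun x => (f x)%:E) by exact: fi.
by rewrite RintegralZl// /Rintegral f1 mulr1.
Qed.

End DensityMean.

(** * The discrete Fokker-Planck equation in integrated form *)

Section SchemeFP.
Context {R : realType}.
Local Notation leb := (@lebesgue_measure R).
Variables (T : R) (sigma : R -> R) (F G : R -> probability R R -> R) (phi m0 : R -> R)
  (C S K C0 Cr : R) (rho h eps : R) (N : nat) (mu : R -> probability R R).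
Hypothesis D : mfg_data T sigma F G phi m0 C S K C0.
Hypothesis P : mfg_scheme T sigma F G phi m0 rho h eps N mu.
Hypotheses (h_le1 : h <= 1) (rho_le1 : rho <= 1) (rho_h : rho <= Cr * h).

Local Notation L := (cstL T C).
Local Notation Dv k := (Dveps rho h eps N sigma F G phi mu k).
Local Notation xn := (fun x => xnode rho (nidx rho x)).
Let r0 := rho_gt0 P.
Let h0 := h_gt0 P.

Variables (p p1 p2 : R -> R) (B : R).
Hypotheses (pB : forall x, `|p x| <= B) (p1B : forall x, `|p1 x| <= B) (p2B : forall x, `|p2 x| <= B).
Hypothesis pt : forall a b, `|p b - p a - p1 a * (b - a)| <= B * (b - a) ^+ 2.
Hypothesis pt3 : forall a b, `|p b - p a - p1 a * (b - a) - 2^-1 * p2 a * (b - a) ^+ 2| <= B * `|b - a| ^+ 3.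

Definition fpgen k x : R := 2^-1 * sigma (tk h k) ^+ 2 * p2 x - p1 x * Dv k x.
Definition fpJ k : R := mean (mu (tk h k)) (fun x => fpgen k (xn x)).
Definition cstJ : R := 2^-1 * S ^+ 2 * B + B * L.
(** Consistency error per unit of time: squared drift, cubic Taylor remainder and interpolation. It
    vanishes with [h] and [rho]. *)
Definition fperr : R := B * L ^+ 2 * h + B * (L + S) ^+ 3 * Num.sqrt h + B * Cr * rho.

Let B0 : 0 <= B. Proof. exact: le_trans (normr_ge0 _) (pB 0). Qed.

Lemma fpgen_bnd k x : (k <= N)%N -> `|fpgen k x| <= cstJ.
Proof.
move=> kN; have sS : `|sigma (tk h k)| <= S by apply: (sigma_bnd D); exact: (tk_itv P kN).
apply: le_trans (ler_normB _ _) _; apply: lerD.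
  rewrite normrM; apply: ler_pM => //.
  rewrite normrM (@ger0_norm _ 2^-1)// ler_pM2l// normrX lerXn2r ?nnegrE//; exact: le_trans sS.
by rewrite normrM; apply: ler_pM => //; exact: (Dveps_bnd D P kN).
Qed.

Lemma fpJ_bnd k : (k <= N)%N -> `|fpJ k| <= cstJ.
Proof.
move=> kN; rewrite -[fpJ k]subr0 -(mean_cst (mu (tk h k)) 0).
have J0 : 0 <= cstJ := le_trans (normr_ge0 _) (fpgen_bnd 0 kN).
apply: (@mean_dist _ _ _ _ cstJ).
- exact: (@measurable_nidx_fun R rho _ _ (fun i => fpgen k (xnode rho i))).
- exact: measurable_cst.
- by move=> x; exact: fpgen_bnd.
- by move=> x; rewrite normr0.
- by move=> x; rewrite subr0; exact: fpgen_bnd.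
Qed.

Let E k : R := mean (mu (tk h k)) (fun x => p (xn x)).

Lemma fp_step k : (k < N)%N -> `|E k.+1 - E k - h * fpJ k| <= h * fperr.
Proof.
move=> kN; have kN' := ltnW kN; rewrite /E.
have pB' i : `|p (xnode rho i)| <= B by [].
rewrite (mean_step D P kN pB'); set nu := mu (tk h k).
have mp : measurable_fun [set: R] (fun x => p (xn x)) by exact: (@measurable_nidx_fun R rho _ _ (fun i => p (xnode rho i))).
have mg : measurable_fun [set: R] (fun x => fpgen k (xn x)) by exact: (@measurable_nidx_fun R rho _ _ (fun i => fpgen k (xnode rho i))).
pose M := Num.max B cstJ.
have bp x : `|p (xn x)| <= M by rewrite le_max pB.
have bg x : `|fpgen k (xn x)| <= M by rewrite le_max fpgen_bnd// orbT.
have := meanZD nu 1 h mp mg bp bg; rewrite mul1r => E1.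
rewrite -addrA -opprD -/(fpJ k) -E1; apply: (@mean_dist _ _ _ _ (B + h * M)).
- exact: (@measurable_nidx_fun R rho _ _ (chain_op rho _ _ k (fun i => p (xnode rho i)))).
- by apply: measurable_funD; apply: measurable_funM.
- have M0 : 0 <= h * M by rewrite mulr_ge0 ?(ltW h0)// le_max B0.
  move=> x; apply: (@le_trans _ _ B); last by rewrite lerDl.
  have := interp_bnd r0 pB' (Phi_plus rho h eps N sigma F G phi mu (nidx rho x) k).
  have := interp_bnd r0 pB' (Phi_minus rho h eps N sigma F G phi mu (nidx rho x) k).
  by rewrite /chain_op !ler_norml => /andP[? ?] /andP[? ?]; apply/andP; split; lra.
- move=> x; apply: le_trans (ler_normD _ _) _; rewrite mul1r; apply: lerD => //.
  by rewrite normrM gtr0_norm// ler_pM2l.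
- move=> x; have := op_taylor3 D P h_le1 rho_h (nidx rho x) kN' pt pt3 p2B.
  by rewrite mul1r opprD addrA.
Qed.

Let Js (s : R) : R := fpJ (tidx h s).

Lemma measurable_fpJ : measurable_fun [set: R] (fun s => fpJ (tidx h s)).
Proof.
have H := @measurable_floor_fun R _ _ (fun i : int => fpJ `|i|%N).
have mZ : measurable_fun [set: R] (fun s => s / h) by exact: measurable_funM.
exact: (measurableT_comp H mZ).
Qed.

Lemma fpJ_bnd_s s : 0 <= s <= T -> `|fpJ (tidx h s)| <= cstJ.
Proof. by move=> sT; apply: fpJ_bnd; exact: (tidx_le P). Qed.

Lemma fpJ_integrable a b : 0 <= a -> b <= T -> leb.-integrable `]a, b] (EFin \o (fun s => fpJ (tidx h s))).
Proof.
move=> a0 bT; apply: measurable_bounded_integrable => //.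
- by rewrite /= lebesgue_measure_itv/=; case: ifP => _; rewrite ?ltry// -EFinB ltry.
- by apply: measurable_funTS; exact: measurable_fpJ.
- exists cstJ; split; [exact: num_real|move=> M BM s /=; rewrite in_itv/= => /andP[s1 s2]].
  by apply: le_trans (ltW BM); apply: fpJ_bnd_s; rewrite (le_trans a0 (ltW s1)) (le_trans s2).
Qed.

Let Js_cell k : (k < N)%N -> (\int[leb]_(s in `]tk h k, tk h k.+1]) Js s)%R = h * fpJ k.
Proof.
move=> kN; have /andP[_ tT] := tk_itv P kN; have /andP[t0 _] := tk_itv P (ltnW kN).
have mJ := measurable_fpJ.
have tt : tk h k < tk h k.+1 by rewrite /tk ltr_pM2r// ltr_nat.
have io : leb.-integrable `]tk h k, tk h k.+1] (EFin \o Js) by exact: fpJ_integrable.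
have ico : leb.-integrable `[tk h k, tk h k.+1[ (EFin \o Js).
  apply: measurable_bounded_integrable => //.
  - by rewrite /= lebesgue_measure_itv/=; case: ifP => _; rewrite ?ltry// -EFinB ltry.
  - by apply: measurable_funTS; exact: mJ.
  - exists cstJ; split; [exact: num_real|move=> M BM s /=; rewrite in_itv/= => /andP[s1 s2]].
    by apply: le_trans (ltW BM); apply: fpJ_bnd_s; rewrite (le_trans t0 s1) (le_trans (ltW s2)).
(* The integer part is constant on the cell closed at the left, while the integrals are split over
   cells closed at the right; the endpoints do not matter. *)
rewrite Rintegral_itv_obnd_cbnd// -Rintegral_itv_bndo_bndc//.
transitivity (\int[leb]_(s in `[tk h k, tk h k.+1[) (fpJ k))%R.
  apply: eq_Rintegral => s; rewrite inE/= in_itv/= => /andP[s1 s2].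
  by rewrite /Js /tidx (floor_step P s1 s2).
rewrite Rintegral_cst//= lebesgue_measure_itv/= lte_fin tt -EFinB /= mulrC; congr (_ * _).
by rewrite /tk -natr1; ring.
Qed.

Let Js_split a b c : 0 <= a -> a <= b -> b <= c -> c <= T ->
  (\int[leb]_(s in `]a, c]) Js s)%R = (\int[leb]_(s in `]a, b]) Js s)%R + (\int[leb]_(s in `]b, c]) Js s)%R.
Proof.
move=> a0 ab bc cT; have := @Rintegral_itvB R Js (BRight a) (BRight c) b (fpJ_integrable a0 cT).
rewrite !bnd_simp => /(_ ab bc) <-; by rewrite addrC subrK.
Qed.

(** [h] times the mean of the generator is exactly the integral of a step function over one time
    cell, so only the consistency errors accumulate. *)
Lemma fp_nodes m : (m <= N)%N ->
  `|E m - E 0 - (\int[leb]_(s in `]0, tk h m]) Js s)%R| <= tk h m * fperr.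
Proof.
elim: m => [_|m IH mN].
  by rewrite subrr sub0r /tk mul0r set_itv_ge ?bnd_simp ?ltxx// Rintegral_set0 oppr0 normr0 mul0r.
have {}IH := IH (ltnW mN); have := fp_step mN.
have /andP[_ tT] := tk_itv P mN; have /andP[t0 _] := tk_itv P (ltnW mN).
have tt : tk h m <= tk h m.+1 by rewrite /tk ler_pM2r// ler_nat.
rewrite (Js_split _ t0 tt tT)// (Js_cell mN).
have -> : tk h m.+1 * fperr = tk h m * fperr + h * fperr by rewrite /tk -natr1; ring.
move: IH; move: (\int[leb]_(s in _) _)%R (tk h m * fperr) (h * fperr) (h * fpJ m) => I X Y Z.
by rewrite !ler_norml => /andP[? ?] /andP[? ?]; apply/andP; split; lra.
Qed.

(** The last, incomplete time cell contributes at most [cstJ h]. *)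
Lemma fp_time t : 0 <= t <= T ->
  `|E (tidx h t) - E 0 - (\int[leb]_(s in `]0, t]) fpJ (tidx h s))%R| <= T * fperr + cstJ * h.
Proof.
move=> tT; have /andP[t0 tT'] := tT.
have mN : (tidx h t <= N)%N by exact: (tidx_le P).
have H := fp_nodes mN; have /andP[a b] := tidx_itv P t0; have /andP[s0 s1] := tk_itv P mN.
rewrite -/(tk h (tidx h t)) mulrDl mul1r -/(tk h _) in a b.
rewrite (Js_split _ s0 a tT')//.
have err0 : 0 <= fperr.
  have := le_trans (normr_ge0 _) (@fp_step 0 _).
  have N0 : (0 < N)%N by have [k kN _] := tk_cover D P tT; apply: leq_ltn_trans kN.
  by move=> /(_ N0); rewrite pmulr_rge0.
have J0 : 0 <= cstJ := le_trans (normr_ge0 _) (fpgen_bnd 0 mN).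
have le1 : tk h (tidx h t) * fperr <= T * fperr by rewrite ler_wpM2r.
have le2 : `|(\int[leb]_(s in `]tk h (tidx h t), t]) Js s)%R| <= cstJ * h.
  have lebE : leb `]tk h (tidx h t), t] = (t - tk h (tidx h t))%:E.
    rewrite lebesgue_measure_itv/= lte_fin; case: ltP => ta; first by rewrite -EFinB.
    by congr EFin; apply/esym/eqP; rewrite subr_eq0 eq_le ta a.
  apply: (@le_trans _ _ (cstJ * fine (leb `]tk h (tidx h t), t]))).
    apply: Rintegral_norm_le => //; first by rewrite lebE ltry.
      exact: fpJ_integrable.
    move=> s /=; rewrite in_itv/= => /andP[s1' s2']; apply: fpJ_bnd_s.
    by rewrite (le_trans s0 (ltW s1')) (le_trans s2').
  by rewrite lebE /= ler_wpM2l// lerBlDl ltW.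
move: H le1 le2; move: (tk h _ * fperr) (T * fperr) (cstJ * h) => X Y Z.
move: (\int[leb]_(s in _) _)%R (\int[leb]_(s in `]_, t]) _)%R => I1 I2.
by rewrite !ler_norml => /andP[? ?] ? /andP[? ?]; apply/andP; split; lra.
Qed.

End SchemeFP.

(** * Products of a strongly and a weakly convergent sequence *)

Section WeakStrong.
Context {R : realType}.
Local Notation leb := (@lebesgue_measure R).

Lemma Rintegral_dominated (D : set R) (bn : nat -> R -> R) (b g : R -> R) : measurable D ->
  (forall n, measurable_fun D (bn n)) -> measurable_fun D b ->
  {ae leb, forall x, D x -> bn n x @[n --> \oo] --> b x} ->
  leb.-integrable D (EFin \o g) -> (forall n x, D x -> `|bn n x| <= g x) ->
  [/\ leb.-integrable D (EFin \o b), (\int[leb]_(x in D) `|bn n x - b x|)%R @[n --> \oo] --> 0 &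
   (\int[leb]_(x in D) bn n x)%R @[n --> \oo] --> (\int[leb]_(x in D) b x)%R].
Proof.
move=> mD mbn mb cb ig bg.
have [||ib c0 c1] := @dominated_convergence _ _ R leb D mD (fun n x => (bn n x)%:E) (EFin \o b) (EFin \o g)
  (fun n => (measurable_EFinP D (bn n)).2 (mbn n)) ((measurable_EFinP D b).2 mb) _ ig.
- apply: filterS cb; first exact: (ae_filter_ringOfSetsType leb).
  move=> x H Dx; apply: cvg_EFin; first exact: nearW.
  exact: H.
- by apply: aeW => x n Dx; rewrite lee_fin bg.
split => //.
- by move: c0 => /fine_cvgP[_]; apply: cvg_trans; apply: near_eq_cvg; exact: nearW.
- by move: c1; rewrite -[X in _ --> X -> _]fineK ?integrable_fin_num// => /fine_cvgP[_].
Qed.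

Variables (C : R) (fn : nat -> R -> R) (f : R -> R).
Hypotheses (bfn : forall n, bdens C (fn n)) (bf : bdens C f).
Hypothesis fn_f : forall a b : R, a <= b ->
  (\int[leb]_(x in `]a, b]) fn n x)%R @[n --> \oo] --> (\int[leb]_(x in `]a, b]) f x)%R.

(** Write the difference as the integral of [(bn - b) fn] plus that of [b (fn - f)]. The first tends
    to [0] since [bn] converges in [L^1] by domination and [fn] is bounded; the second is weak
    convergence tested on [b]. *)
Lemma weak_strong (bn : nat -> R -> R) (b g : R -> R) :
  (forall n, measurable_fun setT (bn n)) -> measurable_fun setT b ->
  {ae leb, forall x, bn n x @[n --> \oo] --> b x} ->
  leb.-integrable setT (EFin \o g) -> (forall n x, `|bn n x| <= g x) ->
  (\int[leb]_x (bn n x * fn n x))%R @[n --> \oo] --> (\int[leb]_x (b x * f x))%R.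
Proof.
move=> mbn mb cb ig bg.
have cb' : {ae leb, forall x, [set: R] x -> bn n x @[n --> \oo] --> b x} by apply: filterS cb; first exact: (ae_filter_ringOfSetsType leb).
have [ib c0 _] := Rintegral_dominated measurableT mbn mb cb' ig (fun n x _ => bg n x).
have cw := weak_integrable bfn bf fn_f ib.
have ibn n : leb.-integrable setT (EFin \o bn n).
  apply: (@le_integrable _ _ R leb setT measurableT (EFin \o bn n) (EFin \o g)) => //.
    by apply/measurable_EFinP; exact: mbn.
  by move=> x _; rewrite !abse_EFin lee_fin (le_trans (bg n x))// ler_norm.
have idn n : leb.-integrable setT (EFin \o (fun x => bn n x - b x)).
  have i1 : leb.-integrable setT (fun x => (bn n x)%:E) by exact: ibn.
  have i2 : leb.-integrable setT (fun x => (b x)%:E) by exact: ib.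
  have := integrableB measurableT i1 i2; congr (leb.-integrable _ _).
have iad n : leb.-integrable setT (EFin \o (fun x => `|bn n x - b x|)).
  by rewrite (_ : EFin \o _ = abse \o (EFin \o (fun x => bn n x - b x))) ?funeqE//; exact: integrable_abse.
have C0 : 0 <= C by have [_ /(_ 0) /andP[]] := bf; exact: le_trans.
have le n : `|(\int[leb]_x (bn n x * fn n x))%R - (\int[leb]_x (b x * fn n x))%R| <=
   C * (\int[leb]_x `|bn n x - b x|)%R.
  have j1 := mul_bdens_integrable measurableT (bfn n) (ibn n).
  have j2 := mul_bdens_integrable measurableT (bfn n) ib.
  have j3 := mul_bdens_integrable measurableT (bfn n) (idn n).
  have -> : (\int[leb]_x (bn n x * fn n x))%R - (\int[leb]_x (b x * fn n x))%R =
     (\int[leb]_x ((bn n x - b x) * fn n x))%R.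
    have j1' : leb.-integrable setT (fun x => (bn n x * fn n x)%:E) by exact: j1.
    have j2' : leb.-integrable setT (fun x => (b x * fn n x)%:E) by exact: j2.
    by rewrite -RintegralB//; apply: eq_Rintegral => x _; rewrite mulrBl.
  apply: (le_trans (@le_normr_Rintegral _ _ _ leb setT _ measurableT j3)).
  have iad' : leb.-integrable setT (fun x => (`|bn n x - b x|)%:E) by exact: iad.
  rewrite -RintegralZl//; apply: le_Rintegral => //.
  - rewrite (_ : EFin \o _ = abse \o (EFin \o (fun x => (bn n x - b x) * fn n x))) ?funeqE//.
    exact: integrable_abse.
  - have := integrableZl measurableT C (iad n); by congr (leb.-integrable _ _).
  - move=> x _; have [_ /(_ x) /andP[f0 fC]] := bfn n.
    by rewrite normrM mulrC (ger0_norm f0) ler_wpM2r.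
apply: cvg_eps => e e0; have e20 : 0 < e / 2 by rewrite divr_gt0.
have c2 : (fun n => C * (\int[leb]_x `|bn n x - b x|)%R) @ \oo --> 0.
  by rewrite -[X in _ --> X](mulr0 C); apply: cvgM => //; exact: cvg_cst.
have := cvg_dist_le c2 e20; have := cvg_dist_le cw e20; apply: filterS2 => n h1.
rewrite subr0 => h2; have h3 := le_trans (ler_norm _) h2; have := le_trans (le n) h3.
move: h1; move: (\int[leb]_x _)%R (\int[leb]_x _)%R (\int[leb]_x _)%R => x y z.
by rewrite !ler_norml => /andP[? ?] /andP[? ?]; apply/andP; split; lra.
Qed.

End WeakStrong.

Section MeanLimit.
Context {R : realType}.
Local Notation leb := (@lebesgue_measure R).
Variables (T : R) (sigma : R -> R) (F G : R -> probability R R -> R) (phi m0 : R -> R)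
  (C S K C0 Cr : R) (rho h eps : nat -> R) (N : nat -> nat) (mn : nat -> R -> probability R R).
Hypothesis D : mfg_data T sigma F G phi m0 C S K C0.
Hypothesis Q : mfg_seq T sigma F G phi m0 C Cr rho h eps N mn.
Variable mbar : R -> probability R R.
Hypotheses (mbarC : is_curve T mbar) (cv : curve_cvg T mn mbar).

Local Notation Cd := (cstD T C C0).
Local Notation dens n := (mdens (rho n) (h n) (eps n) (N n) sigma F G phi m0 (mn n)).
Local Notation fb := (fbar T C C0 mbar).

Lemma cdf_cvg_seq (tn : nat -> R) t x : (forall n, 0 <= tn n <= T) -> 0 <= t <= T -> tn @ \oo --> t ->
  cdfR (mn n (tn n)) x @[n --> \oo] --> cdfR (mbar t) x.
Proof.
move=> tnT tT ct; apply: cvg_eps => e e0; have e20 : 0 < e / 2 by rewrite divr_gt0.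
have [d d0 Hd] := mbar_cdf_cont D Q mbarC cv t e20.
have /cvgrPdist_lt/(_ d d0) := ct.
have := cdf_uniform_cvg D Q cv e20; apply: filterS2 => n h1 h2.
have := h1 (tn n) x (tnT n); rewrite distrC in h2; have := Hd _ x h2.
rewrite !clip_id// !ler_norml => /andP[? ?] /andP[? ?]; apply/andP; split; lra.
Qed.

(** The times may vary with [n], because the scheme evaluates its measures at grid times; uniform
    convergence of the distribution functions in time absorbs this. *)
Lemma mean_cvg_seq (tn : nat -> R) t (bn : nat -> R -> R) (b g : R -> R) M :
  (forall n, 0 <= tn n <= T) -> 0 <= t <= T -> tn @ \oo --> t ->
  (forall n, measurable_fun setT (bn n)) -> measurable_fun setT b ->
  {ae leb, forall x, bn n x @[n --> \oo] --> b x} ->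
  leb.-integrable setT (EFin \o g) -> (forall n x, `|bn n x| <= g x) ->
  (forall n x, `|bn n x| <= M) -> (forall x, `|b x| <= M) ->
  mean (mn n (tn n)) (bn n) @[n --> \oo] --> mean (mbar t) b.
Proof.
move=> tnT tT ct mbn mb cb ig bg bnM bM.
have d0 n x : 0 <= dens n x (tn n).
  by apply: (dens_ge0 D (seq_scheme Q n)); case/andP: (tnT n).
have bfn n : bdens Cd ((dens n)^~ (tn n)).
  split; first exact: measurable_dens.
  by move=> x; rewrite d0 (dens_le D (seq_scheme Q n) (seq_hL Q n)).
have bf : bdens Cd (fb^~ t).
  by split; [exact: measurable_fbar|move=> x; exact: (fbar_bnd D)].
have f0 x : 0 <= fb x t by have [_ /(_ x) /andP[]] := bf.
rewrite (mean_density bf.1 f0 (fun A => fbarE D Q cv tT) mb bM).2.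
rewrite (_ : (fun n => _) = fun n => (\int[leb]_x (bn n x * dens n x (tn n)))%R); last first.
  apply/funext => n.
  by rewrite (mean_density (bfn n).1 (d0 n) (mu_sol (seq_scheme Q n) (tnT n)) (mbn n) (bnM n)).2.
apply: (weak_strong bfn bf _ mbn mb cb ig bg) => a c ac.
have mI : measurable (`]a, c]%classic : set R) by exact: measurable_itv.
have -> : (\int[leb]_(x in `]a, c]) fb x t)%R = cdfR (mbar t) c - cdfR (mbar t) a.
  by rewrite /Rintegral -(fbarE D Q cv tT mI) cdfR_itv.
rewrite (_ : (fun n => _) = (fun n => cdfR (mn n (tn n)) c - cdfR (mn n (tn n)) a)); last first.
  by apply/funext => n; rewrite /Rintegral -(mu_sol (seq_scheme Q n) (tnT n) mI) cdfR_itv.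
by apply: cvgB; exact: cdf_cvg_seq.
Qed.

End MeanLimit.

Section InitialMean.
Context {R : realType}.
Local Notation leb := (@lebesgue_measure R).
Variables (T : R) (sigma : R -> R) (F G : R -> probability R R -> R) (phi m0 : R -> R)
  (C S K C0 : R) (rho h eps : R) (N : nat) (mu : R -> probability R R).
Hypothesis D : mfg_data T sigma F G phi m0 C S K C0.
Hypothesis P : mfg_scheme T sigma F G phi m0 rho h eps N mu.

Lemma m0_integrable : leb.-integrable setT (EFin \o m0).
Proof.
apply/integrableP; split; first by apply/measurable_EFinP; exact: m0_meas D.
by under eq_integral do rewrite /= (ger0_norm (m0_ge0 D _)); rewrite (m0_int D) ltry.
Qed.

Lemma mean_init (g : int -> R) B : (forall i, `|g i| <= B) ->
  mean (mu (tk h 0)) (fun x => g (nidx rho x)) = (\int[leb]_x (g (nidx rho x) * m0 x))%R.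
Proof.
move=> gB; have B0 : 0 <= B := le_trans (normr_ge0 _) (gB 0).
have sh i : 0 <= g i + B <= 2 * B.
  by have := gB i; rewrite ler_norml => /andP[? ?]; apply/andP; split; lra.
have mg : measurable_fun [set: R] (fun x => g (nidx rho x)) by exact: (@measurable_nidx_fun R rho _ _ g).
apply: (addIr B); rewrite -(mean_shift rho _ gB).
have H : (\int[mu (tk h 0)]_x (g (nidx rho x) + B)%:E = \int[leb]_x ((g (nidx rho x) + B)%:E * (m0 x)%:E))%E.
  have g0 i : (0 <= (g i + B)%:E)%E by rewrite lee_fin; case/andP: (sh i).
  by rewrite -(mg0_esum D P g0); exact: (mu_tk D P (leq0n _) g0).
have -> : mean (mu (tk h 0)) (fun x => g (nidx rho x) + B) = (\int[leb]_x ((g (nidx rho x) + B) * m0 x))%R.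
  by rewrite /mean /Rintegral H.
transitivity (\int[leb]_x (g (nidx rho x) * m0 x + B * m0 x))%R; first by apply: eq_Rintegral => x _; rewrite mulrDl.
have i1 : leb.-integrable setT (fun x => (g (nidx rho x) * m0 x)%:E).
  exact: (bounded_mul_integrable measurableT mg (fun x => gB _) m0_integrable).
have i0 : leb.-integrable setT (fun x => (m0 x)%:E) by exact: m0_integrable.
have i2 : leb.-integrable setT (fun x => (B * m0 x)%:E).
  by apply: (@bounded_mul_integrable _ _ (fun=> B) m0 B) => // x; rewrite ger0_norm.
rewrite RintegralD// RintegralZl//; congr (_ + _).
by rewrite /Rintegral (m0_int D) mulr1.
Qed.

End InitialMean.

(** * Passage to the limit in the Fokker-Planck equation *)

Section FPLimit.
Context {R : realType}.
Local Notation leb := (@lebesgue_measure R).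
Variables (T : R) (sigma : R -> R) (F G : R -> probability R R -> R) (phi m0 : R -> R)
  (C S K C0 Cr : R) (rho h eps : nat -> R) (N : nat -> nat) (mn : nat -> R -> probability R R).
Hypothesis D : mfg_data T sigma F G phi m0 C S K C0.
Hypothesis Q : mfg_seq T sigma F G phi m0 C Cr rho h eps N mn.
Variable mbar : R -> probability R R.
Hypotheses (mbarC : is_curve T mbar) (cv : curve_cvg T mn mbar).
Variable v : R -> R -> R.
Hypothesis vcv : value_cvg T sigma F G rho h N mn v.

Local Notation L := (cstL T C).
Local Notation xn n := (fun x => xnode (rho n) (nidx (rho n) x)).
Local Notation Sc n := (seq_scheme Q n).

Let T0 : 0 <= T. Proof. exact: ltW (T_gt0 D). Qed.
Let L0 : 0 <= L. Proof. exact: cstL_ge0 D. Qed.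

Let tn (s : R) (n : nat) : R := tk (h n) (tidx (h n) s).

Let tn_itv s n : 0 <= s <= T -> 0 <= tn s n <= T.
Proof. by move=> sT; apply: (tk_itv (Sc n)); exact: (tidx_le (Sc n)). Qed.

Let tn_cvg s : 0 <= s <= T -> tn s @ \oo --> s.
Proof.
move=> /andP[s0 _]; apply: cvg_eps => e e0; have /cvg_dist_le/(_ e0) := seq_h Q.
apply: filterS => n; rewrite subr0 gtr0_norm ?(h_gt0 (Sc n))// => he.
have /andP[a b] := tidx_itv (Sc n) s0; rewrite /tn /tk distrC ger0_norm ?subr_ge0//.
apply: le_trans he; rewrite lerBlDr; apply: le_trans (ltW b) _.
by rewrite mulrDl mul1r addrC.
Qed.

Let sigma_cvg s : 0 <= s <= T -> sigma (tn s n) @[n --> \oo] --> sigma s.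
Proof.
move=> sT; have sA : `[0%R, T]%classic s by rewrite /= in_itv.
have /cvgrPdist_le H := (subspace_continuousP _ _).1 (sigma_cont D) s sA.
apply: cvg_eps => e e0; have := H e e0; rewrite near_withinE => /nbhs_ballP[d /= d0 Hd].
have /cvgrPdist_lt/(_ d d0) := @tn_cvg s sT; apply: filterS => n sd.
by rewrite distrC; apply: Hd => //=; rewrite in_itv/=; exact: tn_itv.
Qed.

Variables (p p1 p2 : R -> R) (B Kp : R).
Hypotheses (pB : forall x, `|p x| <= B) (p1B : forall x, `|p1 x| <= B) (p2B : forall x, `|p2 x| <= B).
Hypothesis pt : forall a b, `|p b - p a - p1 a * (b - a)| <= B * (b - a) ^+ 2.
Hypothesis pt3 : forall a b, `|p b - p a - p1 a * (b - a) - 2^-1 * p2 a * (b - a) ^+ 2| <= B * `|b - a| ^+ 3.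
Hypotheses (cp : continuous p) (cp1 : continuous p1) (cp2 : continuous p2).
Hypotheses (pK : forall x, Kp < `|x| -> p x = 0) (p1K : forall x, Kp < `|x| -> p1 x = 0)
  (p2K : forall x, Kp < `|x| -> p2 x = 0).

Let B0 : 0 <= B. Proof. exact: le_trans (normr_ge0 _) (pB 0). Qed.

(** The support of the test function enlarged by [1], which exceeds the distance from a point to its
    node; one compact set then dominates for all [n]. *)
Let supp : set R := `[(- (Kp + 1))%R, (Kp + 1)%R]%classic.
Let dom (M x : R) : R := M * \1_supp x.

Let dom_integrable M : leb.-integrable setT (EFin \o dom M).
Proof.
have H : leb.-integrable setT (EFin \o (\1_supp : R -> R)).
  exact: integrable_indic_itv.
have := integrableZl measurableT M H; by congr (leb.-integrable _ _).
Qed.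

Let dom_le (q M x : R) : (Kp + 1 < `|x| -> q = 0) -> `|q| <= M -> `|q| <= dom M x.
Proof.
move=> qK qM; rewrite /dom indicE; have [xs|xs] := boolP (x \in supp); first by rewrite mulr1.
rewrite qK ?normr0 ?mulr0// ltNge; apply: contra xs; rewrite inE /supp/= in_itv/=.
by rewrite ler_norml.
Qed.

Let xn_far n x : Kp + 1 < `|x| -> Kp < `|xnode (rho n) (nidx (rho n) x)|.
Proof.
move=> Kx; have := nidx_dist (rho_gt0 (Sc n)) x; have := seq_rho1 Q n.
have := ler_normD (xnode (rho n) (nidx (rho n) x)) (x - xnode (rho n) (nidx (rho n) x)).
rewrite subrKC distrC; move: Kx; set a := `|_ - _|; set b := `|x|; set c := `|xnode _ _|; move: a b c (rho n) => a b c d; lra.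
Qed.

Let cvg_node (q : R -> R) x : continuous q -> q (xnode (rho n) (nidx (rho n) x)) @[n --> \oo] --> q x.
Proof. by move=> cq; apply: (cvg_comp _ _ (@nidx_cvg _ _ _ _ _ _ _ _ _ _ _ _ _ _ Q x)); exact: cq. Qed.

Let mgen n k : measurable_fun setT (fun x => fpgen sigma F G phi (rho n) (h n) (eps n) (N n) (mn n) p1 p2 k
   (xnode (rho n) (nidx (rho n) x))).
Proof.
exact: (@measurable_nidx_fun R (rho n) _ _ (fun i => fpgen sigma F G phi (rho n) (h n) (eps n) (N n) (mn n) p1 p2 k
   (xnode (rho n) i))).
Qed.

(** [dquot] stands for the derivative of [v]: it is measurable and bounded everywhere, and differs
    from the derivative only on a null set. *)
Definition gen_limit (s x : R) : R := 2^-1 * sigma s ^+ 2 * p2 x - p1 x * dquot L (v^~ s) x.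

Lemma measurable_gen_limit s : 0 <= s <= T -> measurable_fun [set: R] (gen_limit s).
Proof.
move=> sT; apply: measurable_funB.
  by apply: measurable_funM => //; exact: continuous_measurable_fun.
apply: measurable_funM; first exact: continuous_measurable_fun.
by apply: measurable_dquot; exact: (value_cont_x D Q vcv).
Qed.

Let cstG := cstJ T C S B + B.

Lemma gen_limit_bnd s x : 0 <= s <= T -> `|gen_limit s x| <= cstJ T C S B + B.
Proof.
rewrite -/cstG.
move=> sT; have sS : `|sigma s| <= S by exact: (sigma_bnd D).
rewrite /cstG /cstJ -addrA -[X in _ + X]/(B * L + B).
apply: le_trans (ler_normB _ _) _; apply: lerD.
  rewrite normrM; apply: ler_pM => //.
  rewrite normrM (@ger0_norm _ 2^-1)// ler_pM2l// normrX lerXn2r ?nnegrE//; exact: le_trans sS.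
have -> : B * L + B = B * (L + 1) by ring.
by rewrite normrM; apply: ler_pM => //; exact: dquot_bnd.
Qed.

(** For almost every [x] the mollified gradient at the node of [x] converges, as does [sigma] at the
    grid time before [s]. So the integrands converge almost everywhere with a common majorant, while
    the densities converge weakly. *)
Lemma fpJ_cvg s : 0 <= s <= T ->
  fpJ sigma F G phi (rho n) (h n) (eps n) (N n) (mn n) p1 p2 (tidx (h n) s) @[n --> \oo] -->
  mean (mbar s) (gen_limit s).
Proof.
move=> sT; rewrite /fpJ.
have gB n x : `|fpgen sigma F G phi (rho n) (h n) (eps n) (N n) (mn n) p1 p2 (tidx (h n) s)
   (xnode (rho n) (nidx (rho n) x))| <= cstG.
  apply: le_trans (fpgen_bnd D (Sc n) p1B p2B _ _) _; first exact: (tidx_le (Sc n)).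
  by rewrite /cstG lerDl.
have vL x y : `|v x s - v y s| <= L * `|x - y| by exact: (value_lip D Q vcv).
apply: (@mean_cvg_seq _ _ _ _ _ _ _ _ _ _ _ _ _ _ _ _ _ D Q _ mbarC cv (tn s) s
   (fun n x => fpgen sigma F G phi (rho n) (h n) (eps n) (N n) (mn n) p1 p2 (tidx (h n) s)
   (xnode (rho n) (nidx (rho n) x))) (gen_limit s) (dom cstG) cstG) => //.
- by move=> n; exact: tn_itv.
- exact: tn_cvg.
- exact: measurable_gen_limit.
- apply: filterS (lip_ae_derivable vL); first exact: (ae_filter_ringOfSetsType leb).
  move=> x dv.
  rewrite /fpgen /gen_limit (dquotE vL dv); apply: cvgB.
    apply: cvgM; last exact: cvg_node.
    apply: cvgM; first exact: cvg_cst.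
    by rewrite expr2; under eq_fun do rewrite expr2; apply: cvgM; exact: sigma_cvg.
  apply: cvgM; first exact: cvg_node.
  by apply: (gradient_cvg D Q vcv sT _ dv); exact: (nidx_cvg Q).
- move=> n x; apply: dom_le => // Kx.
  by rewrite /fpgen p1K ?p2K ?mulr0 ?mul0r ?subrr//; exact: xn_far.
- by move=> x; exact: gen_limit_bnd.
Qed.

Lemma fp_limit t : 0 <= t <= T -> leb.-integrable `]0, t] (EFin \o (fun s => mean (mbar s) (gen_limit s))) /\
  mean (mbar t) p = (\int[leb]_x (p x * m0 x))%R + (\int[leb]_(s in `]0, t]) mean (mbar s) (gen_limit s))%R.
Proof.
move=> tT; have /andP[t0 tT'] := tT.
pose J n s := fpJ sigma F G phi (rho n) (h n) (eps n) (N n) (mn n) p1 p2 (tidx (h n) s).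
have sub s : `]0, t]%classic s -> 0 <= s <= T.
  by rewrite /= in_itv/= => /andP[s0 st]; rewrite (ltW s0) (le_trans st).
have mJ n : measurable_fun `]0, t] (J n) by apply: measurable_funTS; exact: measurable_fpJ.
have cJ s : `]0, t]%classic s -> J n s @[n --> \oo] --> mean (mbar s) (gen_limit s).
  by move=> /sub; exact: fpJ_cvg.
have mI : measurable (`]0, t]%classic : set R) by exact: measurable_itv.
have cJ' : {ae leb, forall s, `]0, t]%classic s -> J n s @[n --> \oo] --> mean (mbar s) (gen_limit s)}.
  by apply: aeW => s; exact: cJ.
have [iJ _ cIJ] := @Rintegral_dominated R `]0, t]%classic J (fun s => mean (mbar s) (gen_limit s)) (fun=> cstJ T C S B)
  mI mJ (measurable_fun_cvg mJ cJ) cJ' (itv_integrable _ _ (fun x => cvg_cst _))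
  (fun n s sI => fpJ_bnd_s D (Sc n) p1B p2B (sub s sI)).
split => //.
have cE : mean (mn n (tk (h n) (tidx (h n) t))) (fun x => p (xnode (rho n) (nidx (rho n) x))) @[n --> \oo] --> mean (mbar t) p.
  apply: (@mean_cvg_seq _ _ _ _ _ _ _ _ _ _ _ _ _ _ _ _ _ D Q _ mbarC cv (tn t) t
    (fun n x => p (xnode (rho n) (nidx (rho n) x))) p (dom B) B) => //.
  - by move=> n; exact: tn_itv.
  - exact: tn_cvg.
  - by move=> n; exact: (@measurable_nidx_fun R (rho n) _ _ (fun i => p (xnode (rho n) i))).
  - exact: continuous_measurable_fun.
  - by apply: aeW => x; exact: cvg_node.
  - by move=> n x; apply: dom_le => // Kx; rewrite pK//; exact: xn_far.
have cE0 : mean (mn n (tk (h n) 0)) (fun x => p (xnode (rho n) (nidx (rho n) x))) @[n --> \oo] --> (\int[leb]_x (p x * m0 x))%R.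
  rewrite (_ : (fun n => _) = fun n => (\int[leb]_x (p (xnode (rho n) (nidx (rho n) x)) * m0 x))%R); last first.
    apply/funext => n.
    exact: (@mean_init _ _ _ _ _ _ _ _ _ _ _ _ _ _ _ _ D (Sc n) (fun i => p (xnode (rho n) i)) B (fun i => pB _)).
  have im0 := m0_integrable D.
  have ig : leb.-integrable setT (EFin \o (fun x => B * m0 x)).
    by apply: (@bounded_mul_integrable _ _ (fun=> B) m0 B) => // x; rewrite ger0_norm.
  have [] // := @Rintegral_dominated R setT (fun n x => p (xnode (rho n) (nidx (rho n) x)) * m0 x) (fun x => p x * m0 x)
    (fun x => B * m0 x) measurableT _ _ _ ig.
  - move=> n; apply: measurable_funM; last exact: m0_meas D.
    exact: (@measurable_nidx_fun R (rho n) _ _ (fun i => p (xnode (rho n) i))).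
  - by apply: measurable_funM; [exact: continuous_measurable_fun|exact: m0_meas D].
  - by apply: aeW => x _; apply: cvgM; [exact: cvg_node|exact: cvg_cst].
  - by move=> n x _; rewrite normrM (ger0_norm (m0_ge0 D x)) ler_wpM2r// (m0_ge0 D).
have cerr : T * fperr T C S Cr (rho n) (h n) B + cstJ T C S B * h n @[n --> \oo] --> T * (B * L ^+ 2 * 0 + B * (L + S) ^+ 3 * Num.sqrt 0 + B * Cr * 0) + cstJ T C S B * 0.
  have ch := seq_h Q; have cr := seq_rho Q.
  have cs : Num.sqrt (h n) @[n --> \oo] --> Num.sqrt (0 : R).
    by apply: (cvg_comp _ _ ch); exact: sqrt_continuous.
  apply: cvgD; apply: cvgM => //; try exact: cvg_cst.
  apply: cvgD; last by apply: cvgM => //; exact: cvg_cst.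
  by apply: cvgD; apply: cvgM => //; exact: cvg_cst.
rewrite sqrtr0 !mulr0 !addr0 mulr0 in cerr.
have : `|mean (mbar t) p - (\int[leb]_x (p x * m0 x))%R - (\int[leb]_(s in `]0, t]) mean (mbar s) (gen_limit s))%R| <= 0.
  rewrite -[leLHS]subr0.
  apply: (cvg_ub (@cvgB _ _ _ _ _ _ _ _ _ (@cvg_norm _ _ _ _ _ _ _ (@cvgB _ _ _ _ _ _ _ _ _ (@cvgB _ _ _ _ _ _ _ _ _ cE cE0) cIJ)) cerr)).
  apply: nearW => n /=.
  rewrite subr_le0.
  exact: (fp_time D (Sc n) (seq_h1 Q n) (seq_rho_h Q n) pB p1B p2B pt pt3 tT).
by rewrite normr_le0 -addrA -opprD subr_eq0 => /eqP.
Qed.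

End FPLimit.

Section SeqSolution.
Context {R : realType}.
Local Notation leb := (@lebesgue_measure R).
Variables (T : R) (sigma : R -> R) (F G : R -> probability R R -> R) (phi m0 : R -> R) (C S K C0 Cr : R).
Hypothesis D : mfg_data T sigma F G phi m0 C S K C0.

Local Notation L := (cstL T C).
Local Notation Cd := (cstD T C C0).

Let solution_of_value (rho h eps : nat -> R) (N : nat -> nat) (mn : nat -> R -> probability R R)
  (mbar : R -> probability R R) (v : R -> R -> R) :
  mfg_seq T sigma F G phi m0 C Cr rho h eps N mn -> is_curve T mbar -> curve_cvg T mn mbar ->
  value_cvg T sigma F G rho h N mn v -> mfg_solution T sigma F G m0 mbar.
Proof.
move=> Q mbarC cv vcv; split => //; exists v; split; first exact: (seq_value_fun D Q mbarC cv vcv).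
move=> p tp t tT; have [sp [Kp pK]] := tp.
have [b0 pB0] := test_fun_bounded 0 tp; have [b1 pB1] := test_fun_bounded 1 tp.
have [b2 pB2] := test_fun_bounded 2 tp; have [b3 pB3] := test_fun_bounded 3 tp.
pose B := Num.max (Num.max b0 b1) (Num.max b2 b3).
have pB x : `|p x| <= B by rewrite !le_max pB0.
have p1B x : `|derive1 p x| <= B by rewrite !le_max pB1 orbT.
have p2B x : `|derive1 (derive1 p) x| <= B by rewrite !le_max pB2 !orbT.
have p3B x : `|derive1 (derive1 (derive1 p)) x| <= B by rewrite !le_max pB3 !orbT.
have d0 x : derivable p x 1 by exact: (sp 0%N).
have d1 x : derivable (derive1 p) x 1 by exact: (sp 1%N).
have d2 x : derivable (derive1 (derive1 p)) x 1 by exact: (sp 2%N).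
have c0 : continuous p by move=> x; exact: derivable_cont.
have c1 : continuous (derive1 p) by move=> x; exact: derivable_cont.
have c2 : continuous (derive1 (derive1 p)) by move=> x; exact: derivable_cont.
have [iJ E] := fp_limit D Q mbarC cv vcv pB p1B p2B (taylor2 d0 d1 p2B) (taylor3 d0 d1 d2 p3B) c0 c1 c2 pK
  (nderiv_support 1 pK) (nderiv_support 2 pK) tT.
set J := (fun s => mean (mbar s) _) in iJ E.
have inner s : 0 <= s <= T -> (\int[mbar s]_x ((2^-1 * sigma s ^+ 2 * nderiv 2 p x
                              - derive1 p x * dx v x s)%:E) = (J s)%:E)%E.
  move=> sT; have vL x y : `|v x s - v y s| <= L * `|x - y| by exact: (value_lip D Q vcv).
  (* [A] contains the points where [v] is not differentiable. It is null for Lebesgue measure, hence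
     for [mbar s] because of the density bound, so the arbitrary values of [dx v] there do not
     affect the integral. *)
  have [A [mA A0 subA]] := lip_ae_derivable vL.
  have mA0 : mbar s A = 0%E.
    by apply/eqP; rewrite eq_le measure_ge0 andbT; apply: le_trans (mbar_le D Q cv sT mA) _; rewrite A0 mule0.
  rewrite (@integral_null_modification _ _ _ (mbar s) _
    (fun x => (gen_limit T sigma C v (derive1 p) (derive1 (derive1 p)) s x)%:E) A mA mA0).
    rewrite /J /mean /Rintegral fineK//; apply: integrable_fin_num => //.
    apply: (@prob_integrable _ _ _ (cstJ T C S B + B)).
      exact: (measurable_gen_limit D Q vcv c1 c2 sT).
    by move=> x; exact: (gen_limit_bnd D v p1B p2B x sT).
  move=> x xA; have dv : derivable (v^~ s) x 1 by apply: contrapT => nd; exact/xA/subA.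
  by rewrite /gen_limit (dquotE vL dv).
have -> : (\int[mbar t]_x (p x)%:E)%E = (mean (mbar t) p)%:E.
  rewrite /mean /Rintegral fineK//; apply: integrable_fin_num => //.
  by apply: (@prob_integrable _ _ _ B) => //; exact: continuous_measurable_fun.
have ipm : leb.-integrable setT (EFin \o (fun x => p x * m0 x)).
  by apply: (@bounded_mul_integrable _ _ p m0 B) => //; [exact: continuous_measurable_fun|exact: m0_integrable D].
rewrite E EFinD; congr (_ + _)%E; first by rewrite /Rintegral fineK//; exact: integrable_fin_num.
have /andP[t0 tT'] := tT.
rewrite /Rintegral fineK; last exact: integrable_fin_num.
rewrite integral_itv_obnd_cbnd; last by case/integrableP: iJ.
apply: eq_integral => s; rewrite inE/= in_itv/= => /andP[s0 st]; rewrite inner//.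
by rewrite s0 (le_trans st).
Qed.

Lemma homo_cvg_infty (s : nat -> nat) : {homo s : a b / (a < b)%N} -> s @ \oo --> \oo.
Proof.
move=> hs A [n _ nA]; exists n => // k nk; apply: nA => /=; exact: leq_trans nk (homo_ltn_id hs k).
Qed.

Lemma curve_cvg_sub (mn : nat -> R -> probability R R) mbar (s : nat -> nat) :
  s @ \oo --> \oo -> curve_cvg T mn mbar -> curve_cvg T (mn \o s) mbar.
Proof. by move=> cs cv e /cv H; exact: cs H. Qed.

Lemma mfg_seq_sub (rho h eps : nat -> R) (N : nat -> nat) (mn : nat -> R -> probability R R) (s : nat -> nat) :
  s @ \oo --> \oo -> mfg_seq T sigma F G phi m0 C Cr rho h eps N mn ->
  mfg_seq T sigma F G phi m0 C Cr (rho \o s) (h \o s) (eps \o s) (N \o s) (mn \o s).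
Proof.
move=> cs [q1 q2 q3 q4 q5 q6 q7 q8 q9]; split => [n|n||||n|n|n|n] /=.
- exact: q1.
- exact: q2.
- exact: (cvg_comp _ _ cs q3).
- exact: (cvg_comp _ _ cs q4).
- exact: (cvg_comp _ _ cs q5).
- exact: q6.
- exact: q7.
- exact: q8.
- exact: q9.
Qed.

(** A further subsequence is extracted to obtain a limit value function. The conclusion mentions
    only [mbar], so nothing is lost. *)
Lemma seq_solution (rho h eps : nat -> R) (N : nat -> nat) (mn : nat -> R -> probability R R)
  (mbar : R -> probability R R) :
  mfg_seq T sigma F G phi m0 C Cr rho h eps N mn -> is_curve T mbar -> curve_cvg T mn mbar ->
  mfg_solution T sigma F G m0 mbar.
Proof.
move=> Q mbarC cv; have [s /homo_cvg_infty hs [v Hv]] := value_compact D Q.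
exact: (solution_of_value (mfg_seq_sub hs Q) mbarC (curve_cvg_sub hs cv) Hv).
Qed.

End SeqSolution.

(** * From the stated assumptions to the working hypotheses *)

Section Assumptions.
Context {R : realType}.
Local Notation leb := (@lebesgue_measure R).

Lemma C2_bounded_le (f : R -> R) (a b : R) : a <= b -> C2_bounded f a -> C2_bounded f b.
Proof.
move=> ab [d1 [d2 [c2 fb]]]; split => //; split => //; split => // x; have [f0 [f1 f2]] := fb x.
by rewrite !(le_trans _ ab).
Qed.

Lemma segment_bounded (f : R -> R) (a b : R) : {within `[a, b]%classic, continuous f} ->
  exists M, forall x, a <= x <= b -> `|f x| <= M.
Proof.
move=> cf; have [M [_ HM]] : bounded_set (f @` `[a, b]).
  by apply: compact_bounded; apply: continuous_compact => //; exact: segment_compact.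
exists (M + 1) => x xab; apply: HM; first by rewrite ltrDl.
by exists x => //=; rewrite in_itv.
Qed.

Lemma mfg_data_exist (T : R) (sigma : R -> R) (F G : R -> probability R R -> R) (m0 phi : R -> R) :
  0 < T -> {within `[0%R, T]%classic, continuous sigma} ->
  (exists C : R, forall m, P1 m -> C2_bounded (F^~ m) C /\ C2_bounded (G^~ m) C) ->
  cont_RP1 F -> cont_RP1 G -> measurable_fun setT m0 -> (forall x, 0 <= m0 x) ->
  (exists C : R, {ae leb, forall x, m0 x <= C}) -> compact_support m0 ->
  (\int[leb]_x (m0 x)%:E = 1)%E -> test_fun phi -> (forall x, 0 <= phi x) ->
  (\int[leb]_x (phi x)%:E = 1)%E ->
  exists C S K C0 : R, mfg_data T sigma F G phi m0 C S K C0.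
Proof.
move=> T0 cs [C HC] cF cG mm0 m00 [C0 HC0] [K1 HK1] m01 [sphi [K2 HK2]] phi0 phi1.
have [S HS] := segment_bounded cs.
exists (Num.max C 0), S, (Num.max (Num.max K1 K2) 1), (Num.max C0 1).
split => //.
- by move=> m /HC[fC _]; apply: C2_bounded_le fC; rewrite le_max lexx.
- by move=> m /HC[_ gC]; apply: C2_bounded_le gC; rewrite le_max lexx.
- apply: filterS HC0; first exact: (ae_filter_ringOfSetsType leb).
  by move=> x; rewrite le_max => ->.
- by move=> x Kx; apply: HK1; apply: le_lt_trans Kx; rewrite !le_max lexx.
- by move=> x Kx; apply: HK2; apply: le_lt_trans Kx; rewrite !le_max lexx orbT.
- by rewrite le_max lexx orbT.
- by rewrite lt_max ltr01 orbT.
- by rewrite lt_max ltr01 orbT.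
Qed.

(** The smallness conditions on [rho] and [h] hold from a rank [n0] on. The claim is made for every
    index sequence beyond [n0], so that one rank serves all subsequences considered later. *)
Lemma mfg_seq_exist (T : R) (sigma : R -> R) (F G : R -> probability R R -> R) (m0 phi : R -> R)
    (C : R) (rho h eps : nat -> R) (N : nat -> nat) (mn : nat -> R -> probability R R) :
  (forall n, 0 < rho n) -> (forall n, 0 < h n) -> (forall n, 0 < eps n) ->
  rho @ \oo --> 0 -> h @ \oo --> 0 -> eps @ \oo --> 0 ->
  (forall n, (N n)%:R * h n = T) -> (exists Cr : R, \forall n \near \oo, rho n <= Cr * h n) ->
  (forall n, is_curve T (mn n)) ->
  (forall n, discrete_mfg_solution T (rho n) (h n) (eps n) (N n) sigma F G phi m0 (mn n)) ->
  exists (Cr : R) (n0 : nat), forall s : nat -> nat, s @ \oo --> \oo -> (forall k, (n0 <= s k)%N) ->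
   mfg_seq T sigma F G phi m0 C Cr (rho \o s) (h \o s) (eps \o s) (N \o s) (mn \o s).
Proof.
move=> r0 h0 e0 cr ch ce NT [Cr HCr] cmn sol; exists Cr.
have nr : \forall n \near \oo, rho n <= 1.
  by have := cvg_dist_le cr ltr01; apply: filterS => n; rewrite subr0 gtr0_norm.
have nh : \forall n \near \oo, h n <= 1.
  by have := cvg_dist_le ch ltr01; apply: filterS => n; rewrite subr0 gtr0_norm.
have nL : \forall n \near \oo, h n * cstL T C <= 3^-1.
  have c3 : (fun n => h n * cstL T C) @ \oo --> 0 * cstL T C by apply: cvgM => //; exact: cvg_cst.
  have t0 : 0 < 3^-1 :> R by [].
  have := cvg_dist_le c3 t0; rewrite mul0r; apply: filterS => n; rewrite subr0.
  by apply: le_trans; exact: ler_norm.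
have [n0 _ H] : \forall n \near \oo, [/\ rho n <= 1, h n <= 1, h n * cstL T C <= 3^-1 & rho n <= Cr * h n].
  by near=> n; split; near: n.
exists n0 => s cs sn; split => [n|n||||n|n|n|n] /=.
- by split => //; exact: (cmn _).1.
- exact: cmn.
- exact: (cvg_comp _ _ cs cr).
- exact: (cvg_comp _ _ cs ch).
- exact: (cvg_comp _ _ cs ce).
- by have [] := H _ (sn n).
- by have [] := H _ (sn n).
- by have [] := H _ (sn n).
- by have [] := H _ (sn n).
Unshelve. all: by end_near. Qed.

Lemma strict_subsequence (P : nat -> Prop) : (forall n, exists2 k, (n <= k)%N & P k) ->
  exists2 s : nat -> nat, {homo s : a b / (a < b)%N} & forall k, P (s k).
Proof.
move=> H; have /choice[f Hf] n : exists k, (n <= k)%N /\ P k by have [k] := H n; exists k.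
pose s := fix s k := if k is k'.+1 then f (s k').+1 else f 0%N.
exists s; last by case=> [|k]; [case: (Hf 0%N)|case: (Hf (s k).+1)].
apply: homo_ltn => [? ? ?|k]; first exact: ltn_trans.
by case: (Hf (s k).+1).
Qed.

Lemma same_curve_W1 T (mu nu : R -> probability R R) (la : probability R R) t :
  same_curve T mu nu -> 0 <= t <= T -> W1 la (mu t) = W1 la (nu t).
Proof.
move=> mn tT; rewrite !W1E /W1cdf; apply: eq_integral => x _.
by rewrite /cdfR (mn t tT _ (measurable_itv _)).
Qed.

Lemma weak_star_shift T (fn : nat -> R -> R -> R) (mbar : R -> probability R R) n0 :
  weak_star_cvg T (fun k => fn (k + n0)%N) mbar -> weak_star_cvg T fn mbar.
Proof.
move=> [fb [mfb [fbb [fbE fbw]]]]; exists fb; split; first exact: mfb.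
split; first exact: fbb.
split; first exact: fbE.
move=> g /fbw H; set u := (X in X @ \oo --> _); rewrite -(cvg_shiftn n0 u); exact: H.
Qed.

End Assumptions.
Theorem theorem5p2 (R : realType) (T : R) (sigma : R -> R)
    (F G : R -> probability R R -> R) (m0 : R -> R) (phi : R -> R)
    (rho h eps : nat -> R) (N : nat -> nat)
    (mn : nat -> R -> probability R R) :
  (* time horizon *)
  0 < T ->
  (* (A1)(ii): sigma continuous on [0,T] *)
  {within `[0%R, T]%classic, continuous sigma} ->
  (* (A1)(i): F, G uniformly bounded on R x P_1 ... *)
  (exists C : R, forall x m, P1 m -> `|F x m| <= C /\ `|G x m| <= C) ->
  (* ... and C^2 in x, with C^2 norms bounded uniformly in m *)
  (exists C : R, forall m, P1 m -> C2_bounded (F^~ m) C /\ C2_bounded (G^~ m) C) ->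
  (* F, G continuous on R x P_1(R) *)
  cont_RP1 F -> cont_RP1 G ->
  (* (A1)(iii): m_0 has an essentially bounded, compactly supported density *)
  measurable_fun setT m0 ->
  (forall x, 0 <= m0 x) ->
  (exists C : R, {ae @lebesgue_measure R, forall x, m0 x <= C}) ->
  compact_support m0 ->
  (\int[@lebesgue_measure R]_x (m0 x)%:E = 1)%E ->
  (* the mollifier phi in C_c^infinity, phi >= 0, \int phi = 1 *)
  test_fun phi ->
  (forall x, 0 <= phi x) ->
  (\int[@lebesgue_measure R]_x (phi x)%:E = 1)%E ->
  (* the parameters *)
  (forall n, 0 < rho n) -> (forall n, 0 < h n) -> (forall n, 0 < eps n) ->
  rho @ \oo --> 0 -> h @ \oo --> 0 -> eps @ \oo --> 0 ->
  (forall n, (N n)%:R * h n = T) ->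
  (* rho_n = O(h_n) *)
  (exists C : R, \forall n \near \oo, rho n <= C * h n) ->
  (* h_n = o(eps_n^2) *)
  (fun n => h n / eps n ^+ 2) @ \oo --> 0 ->
  (* m^n in C([0,T]; P_1) solves (MFG)^{eps_n}_{rho_n,h_n} *)
  (forall n, is_curve T (mn n)) ->
  (forall n, discrete_mfg_solution T (rho n) (h n) (eps n) (N n) sigma F G
                                   phi m0 (mn n)) ->
  let dens := fun n => mdens (rho n) (h n) (eps n) (N n) sigma F G phi m0 (mn n) in
  (* (1) (m^n) has a limit point in C([0,T]; P_1) *)
  (exists (s : nat -> nat) (mbar : R -> probability R R),
      {homo s : a b / (a < b)%N} /\ is_curve T mbar /\
      curve_cvg T (fun k => mn (s k)) mbar) /\
  (* (2) every limit point solves (MFG), and along the converging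
     subsequence the densities converge weakly-* in L^infty(R x [0,T]) *)
  (forall (s : nat -> nat) (mbar : R -> probability R R),
      {homo s : a b / (a < b)%N} -> is_curve T mbar ->
      curve_cvg T (fun k => mn (s k)) mbar ->
      mfg_solution T sigma F G m0 mbar /\
      weak_star_cvg T (fun k => dens (s k)) mbar) /\
  (* (3) if (MFG) has a unique solution m, the whole sequence converges *)
  (forall m : R -> probability R R,
      mfg_solution T sigma F G m0 m ->
      (forall m', mfg_solution T sigma F G m0 m' -> same_curve T m' m) ->
      curve_cvg T mn m /\ weak_star_cvg T dens m).

Proof.
move=> T0 cs _ HC cF cG mm0 m00 HC0 HK m01 tphi phi0 phi1 r0 h0 e0 cr ch ce NT HCr _ cmn sol dens.
have [C [S [K [C0 D]]]] := mfg_data_exist T0 cs HC cF cG mm0 m00 HC0 HK m01 tphi phi0 phi1.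
have [Cr [n0 HQ]] := mfg_seq_exist C r0 h0 e0 cr ch ce NT HCr cmn sol.
(* Shifting a subsequence by [n0] makes all its indices at least [n0], since a strictly increasing
   [s] satisfies [n <= s n]. Convergence is not affected by a shift, and the weak-star limit is
   transferred back at the end. *)
have shift (s : nat -> nat) : {homo s : a b / (a < b)%N} ->
    (fun k => s (k + n0)%N) @ \oo --> \oo /\ (forall k, (n0 <= s (k + n0))%N).
  move=> hs; split.
    by apply: homo_cvg_infty => a b ab; apply: hs; rewrite ltn_add2r.
  by move=> k; apply: leq_trans (homo_ltn_id hs _); exact: leq_addl.
have part1 (s : nat -> nat) : {homo s : a b / (a < b)%N} ->
    exists (s1 : nat -> nat) (mbar : R -> probability R R),
      {homo s1 : a b / (a < b)%N} /\ is_curve T mbar /\ curve_cvg T (fun k => mn (s (s1 k))) mbar.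
  move=> hs; have [cs1 sn] := shift s hs; have Q := HQ _ cs1 sn.
  have [s1 hs1 [mbar cv]] := seq_compact D Q.
  exists (fun k => s1 k + n0)%N, mbar; split; first by move=> a b ab; rewrite ltn_add2r; exact: hs1.
  split => //; apply: (is_curve_limit _ cv) => n; exact: cmn.
have part2 (s : nat -> nat) (mbar : R -> probability R R) :
    {homo s : a b / (a < b)%N} -> is_curve T mbar -> curve_cvg T (fun k => mn (s k)) mbar ->
    mfg_solution T sigma F G m0 mbar /\ weak_star_cvg T (fun k => dens (s k)) mbar.
  move=> hs mbarC cv; have [cs1 sn] := shift s hs; have Q := HQ _ cs1 sn.
  have cv1 : curve_cvg T (mn \o (fun k => s (k + n0)%N)) mbar.
    have /homo_cvg_infty ca : {homo (fun k => k + n0)%N : a b / (a < b)%N} by move=> a b; rewrite ltn_add2r.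
    exact: (curve_cvg_sub ca cv).
  split; first exact: (seq_solution D Q mbarC cv1).
  exact: (@weak_star_shift _ _ (fun k => dens (s k)) _ n0 (seq_weak_star D Q mbarC cv1)).
split; first by have [s1 [mbar H]] := part1 id (fun a b ab => ab); exists s1, mbar.
split; first exact: part2.
move=> m solm uniq.
have cvm : curve_cvg T mn m.
  (* Otherwise some subsequence stays at distance at least [e] from [m]. By compactness it has a
     limit point, which solves the system and therefore coincides with [m]: a contradiction. *)
  apply: contrapT => ncv.
  have [e e_gt0 bad] : exists2 e : R, 0 < e & forall n, exists2 k, (n <= k)%N &
      exists2 t, 0 <= t <= T & ~ (W1 (mn k t) (m t) < e%:E)%E.
    apply: contrapT => H; apply: ncv => e e_gt0; apply: contrapT => He; apply: H.
    exists e => // n; apply: contrapT => Hn; apply: He; exists n => // k /= nk t tT.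
    by apply: contrapT => Ht; apply: Hn; exists k => //; exists t.
  have [s hs Hs] := strict_subsequence bad.
  have [s1 [mbar [hs1 [mbarC cv]]]] := part1 s hs.
  have hss : {homo (s \o s1) : a b / (a < b)%N} by move=> a b /hs1/hs.
  have [/uniq same _] := part2 _ _ hss mbarC cv.
  have [k _ /(_ k (leqnn _)) Hk] := cv e e_gt0.
  have [t tT] := Hs (s1 k); rewrite -(same_curve_W1 _ same tT); apply; exact: Hk.
by split => //; case: (part2 id m (fun a b ab => ab) solm.1 cvm).
Qed.
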